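(* Let $-\pi<a<b<\pi$, $E=[-\pi,a]\cup[b,\pi]$ and $E^g=[-\pi+b,\;a+\pi]$. Let $\Lambda\subset\mathbb{C}$ be a complete interpolating sequence for $PW_E$. Then (1) $\Lambda\cup\{\tilde\lambda\}$ is a uniqueness set for $PW_{E^g}$ for any $\tilde\lambda\in\mathbb{C}\setminus\Lambda$; (2) $\Lambda\setminus\{\lambda_0\}$ is minimal for $PW_{E^g}$ for any $\lambda_0\in\Lambda$.
   Context: For a compact set $S\subset\mathbb{R}$, the Paley-Wiener space $PW_S$ is the space of entire functions $f(z)=\int_S \varphi(t)e^{izt}\,dt$ with $\varphi\in L^2(S)$, with inner product $(f,g)=\frac1{2\pi}\int_{\mathbb{R}} f(x)\overline{g(x)}\,dx$. It is a reproducing kernel Hilbert space with reproducing kernel $\kappa^S_\lambda(z)=\int_S e^{i(z-\bar\lambda)t}\,dt$. A set $\Lambda\subset\mathbb{C}$ is a complete interpolating sequence for $PW_S$ if for every $\{a_\lambda\}\in\ell^2(\Lambda)$ there is a unique $f\in PW_S$ with $f(\lambda)/\|\kappa^S_\lambda\|=a_\lambda$ for all $\lambda\in\Lambda$; equivalently, the normalized kernels $\{\kappa^S_\lambda/\|\kappa^S_\lambda\|\}_{\lambda\in\Lambda}$ form a Riesz basis of $PW_S$. A set $M\subset\mathbb{C}$ is a uniqueness set for $PW_S$ if the only $f\in PW_S$ vanishing on $M$ is $f=0$ (equivalently $\{\kappa^S_\mu\}_{\mu\in M}$ is complete in $PW_S$). $M$ is minimal for $PW_S$ if the system $\{\kappa^S_\mu\}_{\mu\in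 M}$ is minimal in $PW_S$, i.e. no element belongs to the closed linear span of the others. *)

(* Defs.v *)
From mathcomp Require Import all_boot all_order all_algebra.
From mathcomp Require Import all_classical all_reals all_analysis.
From mathcomp Require Import complex.

Set Implicit Arguments.
Unset Strict Implicit.
Unset Printing Implicit Defensive.

Import Order.TTheory GRing.Theory Num.Theory.

Local Open Scope classical_set_scope.
Local Open Scope ring_scope.

Definition cexp (R : realType) (z : R[i]) : R[i] :=
  Complex (expR (complex.Re z) * cos (complex.Im z))
          (expR (complex.Re z) * sin (complex.Im z)).

(* Lebesgue integral over D of a complex-valued function, componentwise; as with
   Rintegral, the value is meaningful when both components are integrable. *)
Definition cintegral (R : realType) (D : set R) (f : R -> R[i]) : R[i] :=
  Complex (\int[@lebesgue_measure R]_(t in D) complex.Re (f t))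
          (\int[@lebesgue_measure R]_(t in D) complex.Im (f t)).

(* Square-integrable functions on S (representatives, not classes). *)
Definition L2 (R : realType) (S : set R) : set (R -> R[i]) :=
  [set phi : R -> R[i] |
    [/\ @measurable_fun _ _ (measurableTypeR R) R S (fun t => complex.Re (phi t)),
        @measurable_fun _ _ (measurableTypeR R) R S (fun t => complex.Im (phi t)) &
        (\int[@lebesgue_measure R]_(t in S)
           ((Normc.normc (phi t)) ^+ 2)%:E < +oo)%E]].

(* For bounded S every such f is automatically entire. *)
Definition PW (R : realType) (S : set R) : set (R[i] -> R[i]) :=
  [set f : R[i] -> R[i] | exists2 phi : R -> R[i], L2 S phi &
     forall z, f z = cintegral S (fun t => phi t * cexp ('i%C * z * t%:C%C))].

(* Only the restrictions of f and g to the real line matter. *)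
Definition PWdot (R : realType) (f g : R[i] -> R[i]) : R[i] :=
  ((2 * pi)^-1)%:C%C * cintegral setT (fun x : R => f x%:C%C * (g x%:C%C)^*%C).

Definition PWnorm (R : realType) (f : R[i] -> R[i]) : R :=
  Num.sqrt (complex.Re (PWdot f f)).

Definition kappa (R : realType) (S : set R) (lam z : R[i]) : R[i] :=
  cintegral S (fun t => cexp ('i%C * (z - lam^*%C) * t%:C%C)).

(* Only the values of a on Lam matter. *)
Definition ell2 (R : realType) (Lam : set R[i]) : set (R[i] -> R[i]) :=
  [set a : R[i] -> R[i] | (\esum_(l in Lam) ((Normc.normc (a l)) ^+ 2)%:E < +oo)%E].

Definition complete_interpolating (R : realType) (S : set R)
    (Lam : set R[i]) : Prop :=
  forall a, ell2 Lam a ->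
    exists! f, PW S f /\
      forall l, Lam l -> f l / (PWnorm (kappa S l))%:C%C = a l.

Definition uniqueness_set (R : realType) (S : set R) (M : set R[i]) : Prop :=
  forall f, PW S f -> (forall m, M m -> f m = 0) -> forall z, f z = 0.

(* Closed linear span in PW S of the kernels kappa S m, for m in M. *)
Definition closed_span_kappa (R : realType) (S : set R) (M : set R[i]) :
    set (R[i] -> R[i]) :=
  [set f : R[i] -> R[i] | PW S f /\ forall e : R, 0 < e ->
     exists (n : nat) (m : 'I_n -> R[i]) (c : 'I_n -> R[i]),
       (forall j, M (m j)) /\
       PWnorm (fun z => f z - \sum_(j < n) c j * kappa S (m j) z) < e].

Definition minimal (R : realType) (S : set R) (M : set R[i]) : Prop :=
  forall m, M m -> ~ closed_span_kappa S (M `\ m) (kappa S m).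

Definition gapped (R : realType) (a b : R) : set R :=
  `[- pi, a] `|` `[b, pi].

(* The two pieces of gapped a b, translated by pi and - pi and glued at 0. *)
Definition swapped (R : realType) (a b : R) : set R :=
  `[- pi + b, a + pi].

(* Main.v *)
(** Split the transform [F] of a function on the two intervals into [F = F+ + F-], with [F+] coming
    from [[b, pi]] and [F-] from [[-pi, a]].  For two such transforms [F] and [G] the determinant
    [F+ G- - F- G+] has its spectrum in [[b - pi, a + pi]] and vanishes wherever both [F] and [G] do;
    this transfers information on the sequence from the gapped set to the interval.

    Minimality: if [g] vanishes on the sequence except at [l], and if [G = (z - l) k + h] vanishes on
    all of it with [h+ (l) = - h- (l) <> 0], then [det (g, G) / (z - l0)] vanishes on the sequence
    without [l] and [l0], but not at [l].  It grows too fast to be in the Paley-Wiener space, but it still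
    acts as a bounded functional on exponential sums.

    Uniqueness: choose [F = (z - l1) k1 + (P, 0)] and [G = (z - l1) k2 + (0, Q)] vanishing on the
    sequence, and put [D = det (F, G)].  If [f] vanishes on the sequence and at [l1], then for all rows
    [h], [k] with enough decay [f det (h, k) = D W] with [W] in the same space as [f]; this comes from
    expanding [h] and [k] in the dual basis.  Take for [h] and [k] bumps of width [eps], once at the left ends
    of the two intervals and once at the right ends.  Comparing both choices, the spectrum of [W] has
    length [O(eps)], while its norm is [O(eps^(-5/4))], so that [W] tends to its value [0] at [l1], whereas
    [det (h, k)] does not tend to [0].  Hence [f = 0]. *)
Require Import Defs.
From mathcomp Require Import all_boot all_order all_algebra.
From mathcomp Require Import all_classical all_reals all_analysis.
From mathcomp Require Import measurable_realfun.
From mathcomp Require Import complex.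
From mathcomp Require Import ring lra.

Set Implicit Arguments.
Unset Strict Implicit.
Unset Printing Implicit Defensive.

Import Order.TTheory GRing.Theory Num.Theory.
Import numFieldNormedType.Exports.

Local Open Scope classical_set_scope.
Local Open Scope ring_scope.

(** The determinant vanishes on the sequence because there [F+ = - F-] and [G+ = - G-], so that both
    rows are multiples of [(1, -1)].

    The exponents: separation gives convergence of the sum of [(1 + |Im z|) / (1 + |z|)^p] over the
    sequence for [p > 1]. With this weight the two bumps cost [eps^-(2 + p)], and two divisions,
    estimated on a line at height of order [1 / eps] and away from the zeros, gain [eps^2]; so [W]
    has norm [O(eps^-p)]. On a spectrum of length [O(eps)] the values at two fixed points differ by
    [O(eps^(3/2))] times the norm. Any [p] between 1 and 3/2 would do, and [p = 5/4] can be written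
    with square roots.

    Two obstacles shape the rest. Nothing is known about the zeros of [D] off the sequence except
    that [D] is 1 at [l1]; therefore the two choices of bumps are compared near [l1] only, and an
    identity theorem spreads the result. And the hypothesis yields interpolation without any norm
    control; the bounds on dual functions, the separation and the sparseness all come from a
    sampling inequality, which has to be extracted by a gliding hump. *)

Notation Re := complex.Re.
Notation Im := complex.Im.
Notation nc := Normc.normc.

(** * Complex numbers *)

Section ComplexNumbers.
Variable R : realType.
Implicit Types (z w : R[i]) (x y : R).

Lemma ReD z w : Re (z + w) = Re z + Re w. Proof. by case: z w => a b []. Qed.
Lemma ImD z w : Im (z + w) = Im z + Im w. Proof. by case: z w => a b []. Qed.
Lemma ReN z : Re (- z) = - Re z. Proof. by case: z. Qed.
Lemma ImN z : Im (- z) = - Im z. Proof. by case: z. Qed.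
Lemma ReM z w : Re (z * w) = Re z * Re w - Im z * Im w.
Proof. by case: z w => a b []. Qed.
Lemma ImM z w : Im (z * w) = Re z * Im w + Im z * Re w.
Proof. by case: z w => a b []. Qed.
Lemma ReJ z : Re (z^*)%C = Re z. Proof. by case: z. Qed.
Lemma ImJ z : Im (z^*)%C = - Im z. Proof. by case: z. Qed.
Lemma ReC x : Re x%:C%C = x. Proof. by []. Qed.
Lemma ImC x : Im x%:C%C = 0. Proof. by []. Qed.
Lemma Rei : Re ('i%C : R[i]) = 0. Proof. by []. Qed.
Lemma Imi : Im ('i%C : R[i]) = 1. Proof. by []. Qed.
Lemma Re0 : Re (0 : R[i]) = 0. Proof. by []. Qed.
Lemma Im0 : Im (0 : R[i]) = 0. Proof. by []. Qed.
Lemma Re1 : Re (1 : R[i]) = 1. Proof. by []. Qed.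
Lemma Im1 : Im (1 : R[i]) = 0. Proof. by []. Qed.
Lemma Re_cexp z : Re (cexp z) = expR (Re z) * cos (Im z). Proof. by []. Qed.
Lemma Im_cexp z : Im (cexp z) = expR (Re z) * sin (Im z). Proof. by []. Qed.
Lemma Re_Complex x y : Re (Complex x y) = x. Proof. by []. Qed.
Lemma Im_Complex x y : Im (Complex x y) = y. Proof. by []. Qed.
Definition cE := (Re_cexp, Im_cexp, Re_Complex, Im_Complex, ReD, ImD, ReN, ImN, ReM, ImM, ReJ, ImJ, ReC, ImC, Rei, Imi,
  Re0, Im0, Re1, Im1).

Lemma ceq z w : Re z = Re w -> Im z = Im w -> z = w.
Proof. by case: z w => a b [c d] /= -> ->. Qed.

Lemma nc_ge0 z : 0 <= nc z. Proof. by case: z => a b; exact: sqrtr_ge0. Qed.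
Lemma nc_sq z : nc z ^+ 2 = Re z ^+ 2 + Im z ^+ 2.
Proof. by case: z => a b /=; rewrite sqr_sqrtr// addr_ge0 ?sqr_ge0. Qed.
Lemma ncM z w : nc (z * w) = nc z * nc w. Proof. exact: Normc.normcM. Qed.
Lemma nc0 : nc (0 : R[i]) = 0. Proof. exact: Normc.normc0. Qed.
Lemma nc1 : nc (1 : R[i]) = 1. Proof. exact: Normc.normc1. Qed.
Lemma ncV z : nc z^-1 = (nc z)^-1. Proof. exact: Normc.normcV. Qed.
Lemma ncN z : nc (- z) = nc z.
Proof. by case: z => a b /=; rewrite !sqrrN. Qed.
Lemma ncJ z : nc (z^*)%C = nc z.
Proof. by case: z => a b /=; rewrite sqrrN. Qed.
Lemma ncB z w : nc (z - w) = nc (w - z).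
Proof. by rewrite -ncN opprB. Qed.
Lemma ncD z w : nc (z + w) <= nc z + nc w.
Proof. by have := ler_normD z w; rewrite /Num.norm/= lecE/= => /andP[]. Qed.
Lemma nc_real x : nc x%:C%C = `|x|.
Proof. by rewrite /= expr0n/= addr0 sqrtr_sqr. Qed.
Lemma nci : nc ('i%C : R[i]) = 1.
Proof. by rewrite /= expr0n expr1n/= add0r sqrtr1. Qed.
Lemma ncX z n : nc (z ^+ n) = nc z ^+ n.
Proof. by elim: n => [|n IH]; rewrite ?expr0 ?nc1// !exprS ncM IH. Qed.
Lemma nc_eq0 z : (nc z == 0) = (z == 0).
Proof. by apply/eqP/eqP => [/Normc.eq0_normc//|->]; exact: nc0. Qed.
Lemma nc_gt0 z : (0 < nc z) = (z != 0).
Proof. by rewrite lt_def nc_eq0 nc_ge0 andbT. Qed.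

Lemma nc_sum (I : Type) (s : seq I) (P : pred I) (F : I -> R[i]) :
  nc (\sum_(i <- s | P i) F i) <= \sum_(i <- s | P i) nc (F i).
Proof.
elim/big_ind2: _ => [|x1 x2 y1 y2 h1 h2|//]; first by rewrite nc0.
by apply: le_trans (ncD _ _) _; exact: lerD.
Qed.

Lemma ncB_ge z w : nc z - nc w <= nc (z - w).
Proof. by rewrite lerBlDr; apply: le_trans (ncD _ _); rewrite subrK. Qed.

Lemma le_of_sqr x y : 0 <= y -> x ^+ 2 <= y ^+ 2 -> x <= y.
Proof.
move=> y0 h; rewrite leNgt; apply/negP => yx.
by move: h; rewrite leNgt ltrXn2r ?nnegrE// ?(le_trans y0 (ltW yx))// ltW.
Qed.

Lemma sqr_absr x : `|x| ^+ 2 = x ^+ 2.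
Proof. by rewrite real_normK ?num_real. Qed.

Lemma Re_le_nc z : `|Re z| <= nc z.
Proof.
by apply: le_of_sqr (nc_ge0 z) _; rewrite sqr_absr nc_sq lerDl sqr_ge0.
Qed.
Lemma Im_le_nc z : `|Im z| <= nc z.
Proof.
by apply: le_of_sqr (nc_ge0 z) _; rewrite sqr_absr nc_sq lerDr sqr_ge0.
Qed.
Lemma nc_le z : nc z <= `|Re z| + `|Im z|.
Proof.
apply: le_of_sqr; first by rewrite addr_ge0.
rewrite nc_sq sqrrD !sqr_absr.
by rewrite addrAC lerDl mulrn_wge0// mulr_ge0.
Qed.

Lemma mulJc z : z * (z^*)%C = (nc z ^+ 2)%:C%C.
Proof. by apply: ceq; rewrite ?cE ?nc_sq; ring. Qed.

Lemma cexpD z w : cexp (z + w) = cexp z * cexp w.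
Proof.
apply: ceq; rewrite ?cE expRD; [rewrite cosD|rewrite sinD]; ring.
Qed.
Lemma cexp0 : cexp (0 : R[i]) = 1.
Proof. by apply: ceq; rewrite ?cE expR0 ?cos0 ?sin0 ?mulr1 ?mulr0. Qed.
Lemma nc_cexp z : nc (cexp z) = expR (Re z).
Proof.
rewrite /cexp /= !exprMn -mulrDr cos2Dsin2 mulr1 sqrtr_sqr ger0_norm//.
Qed.
Lemma cexp_neq0 z : cexp z != 0.
Proof. by rewrite -nc_gt0 nc_cexp expR_gt0. Qed.
Lemma cexpN z : cexp (- z) = (cexp z)^-1.
Proof.
by apply: (mulfI (cexp_neq0 z)); rewrite -cexpD subrr cexp0 mulfV ?cexp_neq0.
Qed.

Lemma abs_sin_le x : `|sin x| <= `|x|.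
Proof.
have main (y : R) : 0 <= y -> `|sin y| <= y.
  move=> y0; have [->|y1] := eqVneq y 0; first by rewrite sin0 normr0.
  have y2 : 0 < y by rewrite lt_def y1.
  have [|c cy] := @MVT R sin cos 0 y y2 (fun t _ => is_derive_sin t).
    exact/continuous_subspaceT/continuous_sin.
  rewrite sin0 !subr0 => ->.
  rewrite normrM (ger0_norm y0) ler_piMl// ler_norml.
  by rewrite cos_geN1 cos_le1.
case: (leP 0 x) => x0; first by rewrite (ger0_norm x0) main.
have x1 : 0 <= - x by lra.
by rewrite -normrN -sinN -(normrN x) (ger0_norm x1) main.
Qed.

Lemma one_sub_cos x : 1 - cos x = 2 * sin (x / 2) ^+ 2.
Proof.
have -> : cos x = cos (x / 2 + x / 2) by congr cos; field.
rewrite cosD -!expr2 cos2sin2; ring.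
Qed.

Lemma one_sub_cos_le x : 1 - cos x <= x ^+ 2 / 2.
Proof.
rewrite one_sub_cos.
have : sin (x / 2) ^+ 2 <= (x / 2) ^+ 2.
  by rewrite -(sqr_absr (sin _)) -(sqr_absr (x / 2)) lerXn2r ?nnegrE// abs_sin_le.
rewrite exprMn; lra.
Qed.

Lemma expR_sub1_ge x : x <= expR x - 1.
Proof. by have := expR_ge1Dx x; lra. Qed.

Lemma expR_sub1_le x : expR x - 1 <= x * expR x.
Proof.
have := expR_ge1Dx (- x); rewrite expRN => h.
have e0 := expR_gt0 x.
have : (1 - x) * expR x <= (expR x)^-1 * expR x by rewrite ler_wpM2r// ltW.
by rewrite mulVf ?gt_eqF//; lra.
Qed.

Lemma abs_expR_sub1 x : `|expR x - 1| <= `|x| * Num.max 1 (expR x).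
Proof.
have := expR_sub1_ge x; have := expR_sub1_le x => h1 h2.
have [x0|x0] := leP 0 x.
  rewrite (ger0_norm x0) ger0_norm ?(le_trans x0)//.
  by apply: le_trans h1 _; rewrite ler_wpM2l// le_max lexx orbT.
rewrite (ltr0_norm x0) ler0_norm; last first.
  by rewrite subr_le0 -expR0 ler_expR ltW.
apply: (@le_trans _ _ (- x * 1)); first by lra.
by rewrite ler_wpM2l ?le_max ?lexx//; lra.
Qed.

(** The phase and the modulus of [cexp w] each contribute [nc w] times the maximum, hence the factor
    2; the maximum with 1 covers both signs of [Re w]. *)
Lemma nc_cexp_sub1 w : nc (cexp w - 1) <= 2 * nc w * Num.max 1 (expR (Re w)).
Proof.
set M := Num.max _ _.
have M1 : 1 <= M by rewrite le_max lexx.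
have Me : expR (Re w) <= M by rewrite le_max lexx orbT.
have -> : cexp w - 1 = cexp (Complex 0 (Im w)) * (expR (Re w))%:C%C - 1 :> R[i].
  congr (_ - _); apply: ceq; rewrite ?cE ?mulr0 ?mulr1 expR0; ring.
set u := cexp _.
have -> : u * (expR (Re w))%:C%C - 1 =
    (u - 1) * (expR (Re w))%:C%C + ((expR (Re w) - 1)%:C)%C.
  apply: ceq; rewrite ?cE; ring.
apply: le_trans (ncD _ _) _; rewrite ncM !nc_real (ger0_norm (expR_ge0 _)).
have hu : nc (u - 1) <= `|Im w|.
  apply: le_of_sqr => //; rewrite sqr_absr nc_sq /u ?cE expR0 !mul1r subr0.
  have := one_sub_cos_le (Im w); have := cos2Dsin2 (Im w); lra.
have h1 := abs_expR_sub1 (Re w).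
have h2 : nc (u - 1) * expR (Re w) <= nc w * M.
  by rewrite ler_pM ?nc_ge0 ?expR_ge0// (le_trans hu)// Im_le_nc.
have h3 : `|Re w| * M <= nc w * M.
  by rewrite ler_wpM2r ?Re_le_nc// (le_trans _ M1).
rewrite -/M in h1; lra.
Qed.

End ComplexNumbers.

(** * Lebesgue integrals on the line *)

Section Integrals.
Variable R : realType.
Local Notation mu := (@lebesgue_measure R).
Local Notation T := (measurableTypeR R).
Implicit Types (c d : R) (f g h : R -> R) (phi psi : R -> R[i]).

(** Measurability and integrability always refer to the whole line. Functions on a smaller set are
    extended by 0, so that sums, shifts and Fubini carry no domains. *)
Definition mf f := @measurable_fun _ _ T R setT f.
Definition ri f := mu.-integrable setT (EFin \o f).
Definition RI f : R := \int[mu]_x f x.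

Lemma ri_mf f : ri f -> mf f.
Proof. by move=> /measurable_int/measurable_EFinP. Qed.

Lemma ri_dom f g : mf f -> ri g -> (forall t, `|f t| <= g t) -> ri f.
Proof.
move=> mf_ gi fg; apply: le_integrable gi => //; first exact/measurable_EFinP.
by move=> t _ /=; rewrite lee_fin (le_trans (fg t))// ler_norm.
Qed.

Lemma ri_lty f : mf f -> (\int[mu]_x (`|f x|%:E) < +oo)%E -> ri f.
Proof. by move=> m h; apply/integrableP; split => //; exact/measurable_EFinP. Qed.

Lemma riD f g : ri f -> ri g -> ri (fun t => f t + g t).
Proof. by move=> fi gi; exact: (integrableD _ fi gi). Qed.
Lemma riB f g : ri f -> ri g -> ri (fun t => f t - g t).
Proof. by move=> fi gi; exact: (integrableB _ fi gi). Qed.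
Lemma riN f : ri f -> ri (fun t => - f t).
Proof. by move=> fi; exact: (integrableN fi). Qed.
Lemma riZ c f : ri f -> ri (fun t => c * f t).
Proof. by move=> fi; exact: (integrableZl _ c fi). Qed.
Lemma ri_norm f : ri f -> ri (fun t => `|f t|).
Proof. by move=> fi; exact: (integrable_norm fi). Qed.
Lemma ri0 : ri (fun _ => 0). Proof. exact: integrable0. Qed.

Lemma RID f g : ri f -> ri g -> RI (fun t => f t + g t) = RI f + RI g.
Proof. by move=> *; exact: RintegralD. Qed.
Lemma RIB f g : ri f -> ri g -> RI (fun t => f t - g t) = RI f - RI g.
Proof. by move=> *; exact: RintegralB. Qed.
Lemma RIZ c f : ri f -> RI (fun t => c * f t) = c * RI f.
Proof. by move=> *; exact: RintegralZl. Qed.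
Lemma RI0 : RI (fun _ => 0) = 0.
Proof. by rewrite /RI /Rintegral integral0. Qed.
Lemma RI_ge0 f : (forall t, 0 <= f t) -> 0 <= RI f.
Proof. by move=> f0; apply: Rintegral_ge0. Qed.
Lemma RI_le f g : ri f -> ri g -> (forall t, f t <= g t) -> RI f <= RI g.
Proof. by move=> fi gi fg; apply: le_Rintegral. Qed.
Lemma RI_EFin f : ri f -> (RI f)%:E = (\int[mu]_x (f x)%:E)%E.
Proof. by move=> fi; rewrite /RI /Rintegral fineK// integrable_fin_num. Qed.

Lemma mfD f g : mf f -> mf g -> mf (fun t => f t + g t).
Proof. exact: measurable_funD. Qed.
Lemma mfB f g : mf f -> mf g -> mf (fun t => f t - g t).
Proof. exact: measurable_funB. Qed.
Lemma mfM f g : mf f -> mf g -> mf (fun t => f t * g t).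
Proof. exact: measurable_funM. Qed.
Lemma mf_cst c : mf (fun _ => c). Proof. exact: measurable_cst. Qed.
Lemma mf_cont f : continuous f -> mf f.
Proof. exact: continuous_measurable_fun. Qed.
Lemma mfN f : mf f -> mf (fun t => - f t).
Proof.
move=> h; have := mfB (mf_cst 0) h.
by under eq_fun do rewrite sub0r.
Qed.
Lemma mf_norm f : mf f -> mf (fun t => `|f t|).
Proof. by move=> h; exact: measurableT_comp. Qed.
Lemma mf_expR f : mf f -> mf (fun t => expR (f t)).
Proof. by move=> h; apply: measurableT_comp h; exact: measurable_expR. Qed.
Lemma mf_cos f : mf f -> mf (fun t => cos (f t)).
Proof.
move=> h; apply: (measurableT_comp (f := cos)) h.
by apply: continuous_measurable_fun; exact: continuous_cos.
Qed.
Lemma mf_sin f : mf f -> mf (fun t => sin (f t)).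
Proof.
move=> h; apply: (measurableT_comp (f := sin)) h.
by apply: continuous_measurable_fun; exact: continuous_sin.
Qed.
Lemma mf_id : mf (fun t => t). Proof. exact: measurable_id. Qed.

Definition ind (c d t : R) : R := (c <= t <= d)%R%:R.

Lemma indE c d : ind c d = \1_(`[c, d]%classic).
Proof. by apply/funext => t; rewrite indicE /ind mem_setE in_itv. Qed.

Lemma mf_ind c d : mf (ind c d).
Proof.
rewrite indE.
exact: measurable_indic.
Qed.
Lemma ind_ge0 c d t : 0 <= ind c d t. Proof. by rewrite /ind ler0n. Qed.
Lemma ri_ind c d : ri (ind c d).
Proof.
rewrite indE.
exact: integrable_indic_itv.
Qed.
Lemma RI_ind c d : c <= d -> RI (ind c d) = d - c.
Proof.
move=> cd; rewrite indE.
rewrite /RI /Rintegral integral_indic// setIT.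
have /= := lebesgue_measure_itv `[c, d] => ->.
rewrite lte_fin; case: ltP => //= dc.
by rewrite (le_anti (introT andP (conj cd dc))) subrr.
Qed.

(** * Complex-valued integrands *)

Definition mcf phi := mf (fun t => Re (phi t)) /\ mf (fun t => Im (phi t)).
Definition ci phi := ri (fun t => Re (phi t)) /\ ri (fun t => Im (phi t)).
Definition CI phi : R[i] := cintegral setT phi.

Lemma mcfD phi psi : mcf phi -> mcf psi -> mcf (fun t => phi t + psi t).
Proof.
by move=> [a b] [c d]; split; under eq_fun do rewrite ?cE; exact: mfD.
Qed.
Lemma mcfN phi : mcf phi -> mcf (fun t => - phi t).
Proof.
by move=> [a b]; split; under eq_fun do rewrite ?cE; exact: mfN.
Qed.
Lemma mcfB phi psi : mcf phi -> mcf psi -> mcf (fun t => phi t - psi t).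
Proof. by move=> a b; apply: mcfD => //; exact: mcfN. Qed.
Lemma mcfM phi psi : mcf phi -> mcf psi -> mcf (fun t => phi t * psi t).
Proof.
move=> [a b] [c d]; split; under eq_fun do rewrite ?cE.
  by apply: mfB; exact: mfM.
by apply: mfD; exact: mfM.
Qed.
Lemma mcf_cst (c : R[i]) : mcf (fun _ => c). Proof. by split; exact: mf_cst. Qed.
Lemma mcf_real f : mf f -> mcf (fun t => (f t)%:C%C).
Proof. by move=> h; split => //=; exact: mf_cst. Qed.
Lemma mcfJ phi : mcf phi -> mcf (fun t => (phi t)^*%C).
Proof.
move=> [a b]; split; under eq_fun do rewrite ?cE; [exact: a|exact: mfN].
Qed.
Lemma mcf_sum (I : Type) (s : seq I) (F : I -> R -> R[i]) :
  (forall i, mcf (F i)) -> mcf (fun t => \sum_(i <- s) F i t).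
Proof.
move=> h; elim: s => [|i s IH].
  by under eq_fun do rewrite big_nil; exact: mcf_cst.
by under eq_fun do rewrite big_cons; exact: mcfD.
Qed.
Lemma mcf_cexp phi : mcf phi -> mcf (fun t => cexp (phi t)).
Proof.
move=> [a b]; split.
  exact: (mfM (mf_expR a) (mf_cos b)).
exact: (mfM (mf_expR a) (mf_sin b)).
Qed.
Lemma mcf_exp (w : R[i]) : mcf (fun t => cexp (w * t%:C%C)).
Proof. by apply/mcf_cexp/mcfM; [exact: mcf_cst|exact: (mcf_real mf_id)]. Qed.
Lemma mcf_ind c d : mcf (fun t => (ind c d t)%:C%C).
Proof. exact: (mcf_real (mf_ind _ _)). Qed.

Lemma mf_nc2 phi : mcf phi -> mf (fun t => nc (phi t) ^+ 2).
Proof.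
by move=> [a b]; under eq_fun do rewrite nc_sq !expr2; apply: mfD; exact: mfM.
Qed.
Lemma mf_nc phi : mcf phi -> mf (fun t => nc (phi t)).
Proof.
move=> h; have h2 := mf_nc2 h.
have -> : (fun t => nc (phi t)) = (fun t => Num.sqrt (nc (phi t) ^+ 2)).
  by apply/funext => t; rewrite sqrtr_sqr ger0_norm// nc_ge0.
apply: measurableT_comp h2.
by apply: continuous_measurable_fun; exact: sqrt_continuous.
Qed.

Lemma ci_mcf phi : ci phi -> mcf phi.
Proof. by move=> [/ri_mf a /ri_mf b]. Qed.

Lemma ci_dom phi g : mcf phi -> ri g -> (forall t, nc (phi t) <= g t) -> ci phi.
Proof.
move=> [a b] gi h; split.
  by apply: ri_dom gi _ => // t; exact: le_trans (Re_le_nc _) _.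
by apply: ri_dom gi _ => // t; exact: le_trans (Im_le_nc _) _.
Qed.

Lemma ci_nc phi : ci phi -> ri (fun t => nc (phi t)).
Proof.
move=> h; have [a b] := h; have m := ci_mcf h.
apply: ri_dom (mf_nc m) (riD (ri_norm a) (ri_norm b)) _ => t.
by rewrite ger0_norm ?nc_ge0// nc_le.
Qed.

Lemma ciD phi psi : ci phi -> ci psi -> ci (fun t => phi t + psi t).
Proof.
by move=> [a b] [c d]; split; under [X in ri X]funext do rewrite ?cE; exact: riD.
Qed.
Lemma ciZ (c : R[i]) phi : ci phi -> ci (fun t => c * phi t).
Proof.
move=> [a b]; split; under [X in ri X]funext do rewrite ?cE.
  by apply: riB; exact: riZ.
by apply: riD; exact: riZ.
Qed.
Lemma ciN phi : ci phi -> ci (fun t => - phi t).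
Proof.
by move=> [a b]; split; under [X in ri X]funext do rewrite ?cE; exact: riN.
Qed.
Lemma ciB phi psi : ci phi -> ci psi -> ci (fun t => phi t - psi t).
Proof. by move=> a b; apply: ciD => //; exact: ciN. Qed.
Lemma ci0 : ci (fun _ => 0). Proof. by split; exact: ri0. Qed.
Lemma ci_sum (I : Type) (s : seq I) (F : I -> R -> R[i]) :
  (forall i, ci (F i)) -> ci (fun t => \sum_(i <- s) F i t).
Proof.
move=> h; elim: s => [|i s IH].
  by under [X in ci X]funext do rewrite big_nil; exact: ci0.
by under [X in ci X]funext do rewrite big_cons; exact: ciD.
Qed.

Lemma Re_CI phi : Re (CI phi) = RI (fun t => Re (phi t)). Proof. by []. Qed.
Lemma Im_CI phi : Im (CI phi) = RI (fun t => Im (phi t)). Proof. by []. Qed.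

Lemma CID phi psi : ci phi -> ci psi ->
  CI (fun t => phi t + psi t) = CI phi + CI psi.
Proof.
move=> [a b] [c d]; apply: ceq; rewrite ?cE ?Re_CI ?Im_CI -RID//;
  by congr RI; apply/funext => t; rewrite ?cE.
Qed.
Lemma CIZ (c : R[i]) phi : ci phi -> CI (fun t => c * phi t) = c * CI phi.
Proof.
move=> [a b]; apply: ceq; rewrite ?cE ?Re_CI ?Im_CI -!RIZ//.
  rewrite -RIB; [|exact: riZ|exact: riZ].
  by congr RI; apply/funext => t; rewrite ?cE.
rewrite -RID; [|exact: riZ|exact: riZ].
by congr RI; apply/funext => t; rewrite ?cE.
Qed.
Lemma CIN phi : ci phi -> CI (fun t => - phi t) = - CI phi.
Proof.
move=> h; rewrite -mulN1r -CIZ//; congr CI; apply/funext => t.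
by rewrite mulN1r.
Qed.
Lemma CIB phi psi : ci phi -> ci psi ->
  CI (fun t => phi t - psi t) = CI phi - CI psi.
Proof. by move=> a b; rewrite CID ?CIN//; exact: ciN. Qed.
Lemma CI0 : CI (fun _ => 0) = 0.
Proof. by apply: ceq; rewrite ?Re_CI ?Im_CI ?cE RI0. Qed.
Lemma CI_sum (I : Type) (s : seq I) (F : I -> R -> R[i]) :
  (forall i, ci (F i)) -> CI (fun t => \sum_(i <- s) F i t) = \sum_(i <- s) CI (F i).
Proof.
move=> h; elim: s => [|i s IH].
  by under [X in CI X]funext do rewrite big_nil; rewrite CI0 big_nil.
under [X in CI X]funext do rewrite big_cons.
by rewrite CID ?IH ?big_cons//; exact: ci_sum.
Qed.

(* Rotate the integral to the positive real axis. *)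
Lemma nc_CI_le phi : ci phi -> nc (CI phi) <= RI (fun t => nc (phi t)).
Proof.
move=> h; set z := CI phi.
have [->|z0] := eqVneq z 0; first by rewrite nc0; apply: RI_ge0 => t; exact: nc_ge0.
have zp : 0 < nc z by rewrite nc_gt0.
rewrite -(ler_pM2l zp) -expr2.
have -> : nc z ^+ 2 = Re (CI (fun t => (z^*)%C * phi t)).
  by rewrite CIZ// -/z mulrC mulJc ?cE.
rewrite Re_CI -RIZ; last exact: ci_nc.
apply: RI_le; [by have [] := ciZ (z^*)%C h|exact/riZ/ci_nc|].
move=> t; apply: le_trans (ler_norm _) _; apply: le_trans (Re_le_nc _) _.
by rewrite ncM ncJ.
Qed.

End Integrals.

(** * Changes of variable and Fubini *)

Section Fubini.
Variable R : realType.
Local Notation mu := (@lebesgue_measure R).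
Local Notation T := (measurableTypeR R).
Implicit Types (f g h : R -> R) (phi psi : R -> R[i]).

Lemma mf_EFin f : mf f -> measurable_fun [set: T] (fun t => (f t)%:E).
Proof.
move=> h; have : measurable_fun [set: T] (EFin \o f) by exact/measurable_EFinP.
exact.
Qed.

(** Both sides are measures in [A] that agree on half-open intervals, and this characterises
    Lebesgue measure. *)
Lemma affine_measure (c a : R) (A : set R) : c != 0 ->
  measurable (A : set T) ->
  mu A = (`|c|%:E * mu ((fun t : T => (c * t + a)%R : T) @^-1` A))%E.
Proof.
move=> c0 mA.
have mphi : measurable_fun [set: T] (fun t : T => c * t + a : T).
  exact: (mfD (mfM (mf_cst c) (@mf_id R)) (mf_cst a)).
pose pf := measure_function_pushforward__canonical__measure_function_Measure
  (@lebesgue_measure R) mphi.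
pose m := mscale (NngNum (normr_ge0 c)) pf.
have H : forall X : set T, ocitv X -> mu X = m X.
  move=> _ [[x y] _ <-]; rewrite /m /mscale /= /pf /pushforward /=.
  have [cp|cn] := ltP 0 c.
    have -> : (fun t : T => c * t + a : T) @^-1` `]x, y]%classic =
              `](x - a) / c, (y - a) / c]%classic.
      apply/seteqP; split => t /=; rewrite !in_itv/= ltr_pdivrMr// ler_pdivlMr//;
        rewrite [t * c]mulrC => /andP[h1 h2]; apply/andP; split; lra.
    rewrite !lebesgue_measure_itv/= !lte_fin ltr_pM2r ?invr_gt0// ltrD2r.
    case: ifP => _; last by rewrite mule0.
    by rewrite -!EFinB -EFinM (gtr0_norm cp); congr EFin; field.
  have {cn}cn : c < 0 by rewrite lt_neqAle c0.
  have -> : (fun t : T => c * t + a : T) @^-1` `]x, y]%classic =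
            `[(y - a) / c, (x - a) / c[%classic.
    apply/seteqP; split => t /=; rewrite !in_itv/= ltr_ndivlMr// ler_ndivrMr//;
      rewrite [t * c]mulrC => /andP[h1 h2]; apply/andP; split; lra.
  rewrite !lebesgue_measure_itv/= !lte_fin ltr_nM2r ?invr_lt0// ltrD2r.
  case: ifP => _; last by rewrite mule0.
  by rewrite -!EFinB -EFinM (ltr0_norm cn); congr EFin; field.
exact: (lebesgue_measure_unique H).
Qed.

Lemma ge0_affine_integral (c a : R) f : c != 0 -> mf f -> (forall t, 0 <= f t) ->
  (\int[mu]_t (f t)%:E = `|c|%:E * \int[mu]_t (f (c * t + a)%R)%:E)%E.
Proof.
move=> c0 mf_ f0.
have mphi : measurable_fun [set: T] (fun t : T => c * t + a : T).
  exact: (mfD (mfM (mf_cst c) (@mf_id R)) (mf_cst a)).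
pose pf := measure_function_pushforward__canonical__measure_function_Measure
  (@lebesgue_measure R) mphi.
pose m := mscale (NngNum (normr_ge0 c)) pf.
transitivity (\int[m]_t (f t)%:E)%E.
  by apply: eq_measure_integral => A mA _; exact: affine_measure.
rewrite ge0_integral_mscale//; [|exact: mf_EFin|by move=> t _; rewrite lee_fin].
congr (_ * _)%E.
rewrite /pf ge0_integral_pushforward//; first exact: mf_EFin.
by move=> t _; rewrite lee_fin.
Qed.

Lemma affine_integral (c a : R) f : c != 0 -> ri f ->
  ri (fun t => f (c * t + a)) /\ RI f = `|c| * RI (fun t => f (c * t + a)).
Proof.
move=> c0 fi.
have mphi : measurable_fun [set: T] (fun t : T => c * t + a : T).
  exact: (mfD (mfM (mf_cst c) (@mf_id R)) (mf_cst a)).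
have mcomp g : mf g -> mf (fun t => g (c * t + a)).
  by move=> mg; exact: (measurableT_comp mg mphi).
have pos g : ri g -> (forall t, 0 <= g t) -> ri (fun t => g (c * t + a)) /\
    RI g = `|c| * RI (fun t => g (c * t + a)).
  move=> gi g0; have E := ge0_affine_integral a c0 (ri_mf gi) g0.
  have gi' : ri (fun t => g (c * t + a)).
    apply: ri_lty; first exact: (mcomp _ (ri_mf gi)).
    under eq_integral do rewrite ger0_norm//.
    rewrite ltNge leye_eq; apply/negP => /eqP E'.
    move: E; rewrite E' gt0_muley ?lte_fin ?normr_gt0// -RI_EFin//.
  by split => //; apply: EFin_inj; rewrite EFinM !RI_EFin.
(* [f] is the difference of [|f| + f] and [|f|], both nonnegative and integrable. *)
have h1 t : 0 <= `|f t| + f t.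
  by have := lerNnormlW (lexx `|f t|); lra.
have [p1 p2] := pos _ (riD (ri_norm fi) fi) h1.
have [n1 n2] := pos _ (ri_norm fi) (fun t => normr_ge0 _).
have E : f = (fun t => (`|f t| + f t) - `|f t|) by apply/funext => t; ring.
split.
  rewrite E; exact: riB.
rewrite {1}E RIB ?p2 ?n2 -?mulrBr; last 2 first.
- exact: riD (ri_norm fi) fi.
- exact: ri_norm.
by congr (_ * _); rewrite -RIB//; congr RI; apply/funext => t; ring.
Qed.

Lemma RI_shift a f : ri f -> RI (fun t => f (t + a)) = RI f.
Proof.
move=> fi; have [_ ->] := affine_integral a (oner_neq0 _) fi.
by rewrite normr1 mul1r; under [in RHS]eq_fun do rewrite mul1r.
Qed.

Lemma ri_shift a f : ri f -> ri (fun t => f (t + a)).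
Proof.
move=> fi; have [+ _] := affine_integral a (oner_neq0 _) fi.
by under eq_fun do rewrite mul1r.
Qed.

Lemma RI_odd f : ri f -> (forall t, f (- t) = - f t) -> RI f = 0.
Proof.
move=> fi fo; have c0 : (-1 : R) != 0 by rewrite oppr_eq0 oner_neq0.
have [_] := affine_integral 0 c0 fi.
have -> : (fun t => f (-1 * t + 0)) = (fun t => -1 * f t).
  by apply/funext => t; rewrite addr0 mulN1r fo mulN1r.
rewrite RIZ// normrN normr1; lra.
Qed.

Lemma ci_shift a phi : ci phi -> ci (fun t => phi (t + a)).
Proof. by move=> [h1 h2]; split; [exact: (ri_shift a h1)|exact: (ri_shift a h2)]. Qed.

Lemma CI_shift a phi : ci phi -> CI (fun t => phi (t + a)) = CI phi.
Proof.
move=> [h1 h2]; apply: ceq; rewrite ?Re_CI ?Im_CI.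
  exact: (RI_shift a h1).
exact: (RI_shift a h2).
Qed.

Lemma mf_shift a f : mf f -> mf (fun t => f (t + a)).
Proof.
move=> m; apply: (measurableT_comp (f := f : T -> R)) => //.
exact: (mfD (@mf_id R) (mf_cst a)).
Qed.

(** Domination by a product [g x * h y] gives integrability over the plane at once; all later
    interchanges of integrals have such a bound. *)
Lemma Fubini_dom (F : R -> R -> R) g h :
  measurable_fun [set: T * T] (fun p : T * T => F p.1 p.2) -> ri g -> ri h ->
  (forall x y, `|F x y| <= g x * h y) ->
  [/\ (forall x, ri (F x)), ri (fun x => RI (F x)) &
     RI (fun x => RI (F x)) = RI (fun y => RI (fun x => F x y))].
Proof.
move=> mF gi hi Fgh.
have m1 x : mf (F x) by exact: (measurableT_comp mF (measurable_pair1 x)).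
have m2 y : mf (F^~ y) by exact: (measurableT_comp mF (measurable_pair2 y)).
have i1 x : ri (F x) by apply: ri_dom (m1 x) (riZ (g x) hi) _ => y; exact: Fgh.
have i2 y : ri (F^~ y).
  by apply: ri_dom (m2 y) (riZ (h y) gi) _ => x; rewrite mulrC; exact: Fgh.
pose G := fun p : T * T => (F p.1 p.2)%:E.
have mG : measurable_fun [set: T * T] G by exact/measurable_EFinP.
have iG : (mu \x mu)%E.-integrable setT G.
  apply/(integrable12ltyP _ _ mG).
  apply: (@le_lt_trans _ _ (\int[mu]_x (`|g x| * RI (fun y => `|h y|))%:E)%E).
    apply: ge0_le_integral => //.
    - by move=> x _; exact: integral_ge0.
    - by apply: (@measurable_fun_fubini_tonelli_F _ _ _ _ _ mu (fun p => `|G p|)%E) => //;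
        exact: measurableT_comp.
    - exact: (mf_EFin (mfM (mf_norm (ri_mf gi)) (mf_cst _))).
    move=> x _.
    have -> : (\int[mu]_y `|G (x, y)| = (RI (fun y => `|F x y|))%:E)%E.
      by rewrite RI_EFin//; exact: ri_norm.
    rewrite lee_fin -RIZ; last exact: ri_norm.
    apply: RI_le; [exact: ri_norm|exact: (riZ _ (ri_norm _))|].
    by move=> y; rewrite -normrM (le_trans (Fgh x y))// ler_norm.
  have := riZ (RI (fun y => `|h y|)) (ri_norm gi).
  under eq_fun do rewrite mulrC.
  move=> /integrable_lty; exact.
have E1 x : (\int[mu]_y G (x, y) = (RI (F x))%:E)%E by rewrite RI_EFin.
have E2 y : (\int[mu]_x G (x, y) = (RI (F^~ y))%:E)%E by rewrite RI_EFin.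
split; first exact: i1.
  have := integrable_fubini_F iG; congr (_.-integrable _ _).
  exact/funext.
have := Fubini iG.
under eq_integral do rewrite E1.
under [in RHS]eq_integral do rewrite E2.
by move=> h'; rewrite /RI /Rintegral h'.
Qed.

Definition mcf2 (F : R -> R -> R[i]) :=
  measurable_fun [set: T * T] (fun p : T * T => Re (F p.1 p.2)) /\
  measurable_fun [set: T * T] (fun p : T * T => Im (F p.1 p.2)).

Lemma mcf2M F G : mcf2 F -> mcf2 G -> mcf2 (fun x y => F x y * G x y).
Proof.
move=> [a b] [c d]; split; under eq_fun do rewrite ?cE.
  by apply: measurable_funB; exact: measurable_funM.
by apply: measurable_funD; exact: measurable_funM.
Qed.

Lemma mcf2_fst phi : mcf phi -> mcf2 (fun x _ => phi x).
Proof.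
by move=> [a b]; split; [apply: (measurableT_comp a)|apply: (measurableT_comp b)];
  exact: measurable_fst.
Qed.

Lemma mcf2_snd phi : mcf phi -> mcf2 (fun _ y => phi y).
Proof.
by move=> [a b]; split; [apply: (measurableT_comp a)|apply: (measurableT_comp b)];
  exact: measurable_snd.
Qed.

Lemma mcf2_sub phi : mcf phi -> mcf2 (fun x y => phi (x - y)).
Proof.
by move=> [a b]; split; [apply: (measurableT_comp a)|apply: (measurableT_comp b)];
  apply: measurable_funB; [exact: measurable_fst|exact: measurable_snd|
  exact: measurable_fst|exact: measurable_snd].
Qed.

Lemma CFubini_dom (F : R -> R -> R[i]) g h : mcf2 F -> ri g -> ri h ->
  (forall x y, nc (F x y) <= g x * h y) ->
  [/\ (forall x, ci (F x)), ci (fun x => CI (F x)) &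
     CI (fun x => CI (F x)) = CI (fun y => CI (fun x => F x y))].
Proof.
move=> [mr mi] gi hi FF.
have [a1 a2 a3] := Fubini_dom mr gi hi (fun x y => le_trans (Re_le_nc _) (FF x y)).
have [b1 b2 b3] := Fubini_dom mi gi hi (fun x y => le_trans (Im_le_nc _) (FF x y)).
split; [by move=> x; split; [exact: a1|exact: b1]|by split|].
by apply: ceq.
Qed.

End Fubini.

(** * Square-integrable functions *)

Section L2theory.
Variable R : realType.
Local Notation mu := (@lebesgue_measure R).
Local Notation T := (measurableTypeR R).
Implicit Types (f g h : R -> R) (phi psi : R -> R[i]).

Definition sq phi := mcf phi /\ ri (fun t => nc (phi t) ^+ 2).
Definition nL phi : R := Num.sqrt (RI (fun t => nc (phi t) ^+ 2)).

Lemma nL_ge0 phi : 0 <= nL phi. Proof. exact: sqrtr_ge0. Qed.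
Lemma nL_sq phi : nL phi ^+ 2 = RI (fun t => nc (phi t) ^+ 2).
Proof. by rewrite sqr_sqrtr// RI_ge0// => t; exact: sqr_ge0. Qed.
Lemma nL_eq phi psi : (forall t, nc (phi t) = nc (psi t)) -> nL phi = nL psi.
Proof. by move=> h; congr (Num.sqrt (RI _)); apply/funext => t; rewrite h. Qed.
Lemma sq_mcf phi : sq phi -> mcf phi. Proof. by case. Qed.
Lemma sq_ri phi : sq phi -> ri (fun t => nc (phi t) ^+ 2). Proof. by case. Qed.

Lemma sq_dom phi g : mcf phi -> ri g -> (forall t, nc (phi t) ^+ 2 <= g t) -> sq phi.
Proof.
move=> m gi h; split=> //; apply: ri_dom (mf_nc2 m) gi _ => t.
by rewrite ger0_norm ?sqr_ge0.
Qed.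

Lemma sq_le phi psi : mcf phi -> sq psi -> (forall t, nc (phi t) <= nc (psi t)) ->
  sq phi.
Proof.
move=> m [_ h] le_; apply: sq_dom m h _ => t.
by rewrite lerXn2r ?nnegrE ?nc_ge0.
Qed.

Lemma nL_le phi psi : mcf phi -> sq psi -> (forall t, nc (phi t) <= nc (psi t)) ->
  nL phi <= nL psi.
Proof.
move=> m h le_; apply: ler_wsqrtr; apply: RI_le.
- exact: sq_ri (sq_le m h le_).
- exact: sq_ri h.
- by move=> t; rewrite lerXn2r ?nnegrE ?nc_ge0.
Qed.

Lemma sqZ (c : R[i]) phi : sq phi -> sq (fun t => c * phi t).
Proof.
move=> [m h]; apply: (sq_dom (mcfM (mcf_cst c) m) (riZ (nc c ^+ 2) h)) => t.
by rewrite ncM exprMn.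
Qed.
Lemma nLZ (c : R[i]) phi : sq phi -> nL (fun t => c * phi t) = nc c * nL phi.
Proof.
move=> [m h]; rewrite /nL; under [X in RI X]eq_fun do rewrite ncM exprMn.
by rewrite RIZ// sqrtrM ?sqr_ge0// sqrtr_sqr ger0_norm ?nc_ge0.
Qed.
Lemma sqJ phi : sq phi -> sq (fun t => (phi t)^*%C).
Proof. by move=> [m h]; apply: (sq_dom (mcfJ m) h) => t; rewrite ncJ. Qed.
Lemma nLJ phi : nL (fun t => (phi t)^*%C) = nL phi.
Proof. by apply: nL_eq => t; rewrite ncJ. Qed.
Lemma sqN phi : sq phi -> sq (fun t => - phi t).
Proof. by move=> [m h]; apply: (sq_dom (mcfN m) h) => t; rewrite ncN. Qed.
Lemma nLN phi : nL (fun t => - phi t) = nL phi.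
Proof. by apply: nL_eq => t; rewrite ncN. Qed.
Lemma sqD phi psi : sq phi -> sq psi -> sq (fun t => phi t + psi t).
Proof.
move=> [m1 h1] [m2 h2]; apply: (sq_dom (mcfD m1 m2) (riZ 2 (riD h1 h2))) => t.
have := ncD (phi t) (psi t); have := nc_ge0 (phi t + psi t).
have := sqr_ge0 (nc (phi t) - nc (psi t)).
set x := nc (phi t); set y := nc (psi t); set z := nc _ => h z0 zxy.
have : z ^+ 2 <= (x + y) ^+ 2 by rewrite lerXn2r ?nnegrE// (le_trans z0).
nra.
Qed.
Lemma sqB phi psi : sq phi -> sq psi -> sq (fun t => phi t - psi t).
Proof. by move=> h1 h2; apply: sqD => //; exact: sqN. Qed.
Lemma sq0 : sq (fun _ => 0).
Proof. by split; [exact: mcf_cst|under eq_fun do rewrite nc0 expr0n/=; exact: ri0]. Qed.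
Lemma nL0 : nL (fun _ => 0) = 0.
Proof. by rewrite /nL; under [X in RI X]eq_fun do rewrite nc0 expr0n/=; rewrite RI0 sqrtr0. Qed.
Lemma sq_sum (I : Type) (s : seq I) (F : I -> R -> R[i]) :
  (forall i, sq (F i)) -> sq (fun t => \sum_(i <- s) F i t).
Proof.
move=> h; elim: s => [|i s IH].
  by under [X in sq X]funext do rewrite big_nil; exact: sq0.
by under [X in sq X]funext do rewrite big_cons; exact: sqD.
Qed.

Lemma sqM_ci phi psi : sq phi -> sq psi -> ci (fun t => phi t * psi t).
Proof.
move=> [m1 h1] [m2 h2]; apply: (ci_dom (mcfM m1 m2) (riD h1 h2)) => t.
rewrite ncM; have := sqr_ge0 (nc (phi t) - nc (psi t)).
have := sqr_ge0 (nc (phi t)); have := sqr_ge0 (nc (psi t)).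
nra.
Qed.

(** The common core of Cauchy-Schwarz for integrals, for finite sums and in Schur's test: a weighted
    arithmetic-geometric inequality holds termwise for every [s], and [s = X / A] is the optimal
    weight. *)
Lemma le_of_amgm (X A B : R) : 0 <= A -> 0 <= B -> 0 <= X ->
  (forall s, 0 < s -> 2 * X <= s * A + s^-1 * B) -> X ^+ 2 <= A * B.
Proof.
move=> A0 B0 X0 h.
have [A1|A1] := eqVneq A 0.
  rewrite A1 mul0r; have [->|X1] := eqVneq X 0; first by rewrite expr0n.
  have Xp : 0 < X by rewrite lt_def X1.
  have Bp : 0 < B + 1 by rewrite ltr_wpDl.
  (* For [A = 0] the weight [s = (B + 1) / X] makes the right side smaller than [X]. *)
  have := h _ (divr_gt0 Bp Xp); rewrite A1 mulr0 add0r invf_div => h'.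
  have : X / (B + 1) * B < X.
    by rewrite mulrAC ltr_pdivrMr// ltr_pM2l//; lra.
  lra.
have Ap : 0 < A by rewrite lt_def A1.
have [X1|X1] := eqVneq X 0; first by rewrite X1 expr0n/= mulr_ge0.
have Xp : 0 < X by rewrite lt_def X1.
have := h _ (divr_gt0 Xp Ap); rewrite invf_div mulfVK// => h'.
have : X <= A / X * B by lra.
rewrite -(ler_pM2r Xp) -expr2 => /le_trans; apply.
by rewrite mulrAC mulfVK.
Qed.

Lemma CS_nc phi psi : sq phi -> sq psi ->
  RI (fun t => nc (phi t * psi t)) <= nL phi * nL psi.
Proof.
move=> h1 h2; apply: le_of_sqr; first by rewrite mulr_ge0 ?nL_ge0.
rewrite exprMn !nL_sq; apply: le_of_amgm.
- by apply: RI_ge0 => t; exact: sqr_ge0.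
- by apply: RI_ge0 => t; exact: sqr_ge0.
- by apply: RI_ge0 => t; exact: nc_ge0.
move=> s s0; have s1 := sqM_ci h1 h2.
rewrite -!RIZ ?(sq_ri h1) ?(sq_ri h2)//; last exact: ci_nc.
rewrite -RID; [|exact/riZ/sq_ri|exact/riZ/sq_ri].
apply: RI_le.
- exact/riZ/ci_nc.
- by apply: riD; apply: riZ; exact: sq_ri.
move=> t; rewrite ncM.
have := sqr_ge0 (s * nc (phi t) - nc (psi t)).
have sv : s * s^-1 = 1 by rewrite mulfV// gt_eqF.
have sv0 : 0 < s^-1 by rewrite invr_gt0.
set x := nc _; set y := nc _ => hh.
have : 0 <= s^-1 * (s * x - y) ^+ 2 by rewrite mulr_ge0// ltW.
have -> : s^-1 * (s * x - y) ^+ 2 =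
  s * (s * s^-1) * x ^+ 2 - 2 * (s * s^-1) * (x * y) + s^-1 * y ^+ 2 by ring.
rewrite sv; lra.
Qed.

Lemma CS phi psi : sq phi -> sq psi ->
  nc (CI (fun t => phi t * psi t)) <= nL phi * nL psi.
Proof.
move=> h1 h2; apply: le_trans (nc_CI_le (sqM_ci h1 h2)) _; exact: CS_nc.
Qed.

Lemma nLD phi psi : sq phi -> sq psi ->
  nL (fun t => phi t + psi t) <= nL phi + nL psi.
Proof.
move=> h1 h2; apply: le_of_sqr; first by rewrite addr_ge0 ?nL_ge0.
rewrite sqrrD !nL_sq.
have h3 := ci_nc (sqM_ci h1 h2).
apply: (@le_trans _ _ (RI (fun t => nc (phi t) ^+ 2 + (2 * nc (phi t * psi t)) + nc (psi t) ^+ 2))).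
  apply: RI_le; [exact: sq_ri (sqD h1 h2)|apply: riD; [apply: riD|]|].
  - exact: sq_ri h1.
  - exact: riZ.
  - exact: sq_ri h2.
  move=> t; rewrite ncM.
  have := ncD (phi t) (psi t); have := nc_ge0 (phi t + psi t).
  set x := nc (phi t); set y := nc (psi t); set z := nc _ => z0 zxy.
  have : z ^+ 2 <= (x + y) ^+ 2 by rewrite lerXn2r ?nnegrE// (le_trans z0).
  rewrite sqrrD -mulr_natl; lra.
rewrite RID; [|by apply: riD; [exact: sq_ri|exact: riZ]|exact: sq_ri].
rewrite RID; [|exact: sq_ri|exact: riZ].
rewrite lerD2r lerD2l RIZ// -[in leRHS]mulr_natl ler_wpM2l//.
exact: CS_nc.
Qed.
Lemma nLB phi psi : sq phi -> sq psi ->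
  nL (fun t => phi t - psi t) <= nL phi + nL psi.
Proof. by move=> h1 h2; rewrite -(nLN psi); apply: nLD => //; exact: sqN. Qed.
Lemma nL_sum (I : Type) (s : seq I) (F : I -> R -> R[i]) :
  (forall i, sq (F i)) -> nL (fun t => \sum_(i <- s) F i t) <= \sum_(i <- s) nL (F i).
Proof.
move=> h; elim: s => [|i s IH].
  by under [X in nL X]funext do rewrite big_nil; rewrite nL0 big_nil.
under [X in nL X]funext do rewrite big_cons; rewrite big_cons.
apply: le_trans (nLD _ _) _ => //; first exact: sq_sum.
by rewrite lerD2l.
Qed.

Lemma sq_bnd (M c d : R) phi : mcf phi -> (forall t, c <= t <= d -> nc (phi t) <= M) ->
  (forall t, ~~ (c <= t <= d) -> phi t = 0) -> sq phi.
Proof.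
move=> m hM h0; apply: (sq_dom m (riZ (M ^+ 2) (ri_ind c d))) => t.
rewrite /ind; have [tcd|tcd] := boolP (c <= t <= d).
  by rewrite mulr1 lerXn2r ?nnegrE ?nc_ge0 ?hM// (le_trans (nc_ge0 _) (hM _ tcd)).
by rewrite h0// nc0 mulr0 expr0n.
Qed.

Lemma nL_bnd (M c d : R) phi : c <= d -> mcf phi ->
  (forall t, c <= t <= d -> nc (phi t) <= M) ->
  (forall t, ~~ (c <= t <= d) -> phi t = 0) -> nL phi ^+ 2 <= M ^+ 2 * (d - c).
Proof.
move=> cd m hM h0; rewrite nL_sq -(RI_ind cd) -RIZ; last exact: ri_ind.
apply: RI_le; [exact: sq_ri (sq_bnd m hM h0)|exact/riZ/ri_ind|] => t.
rewrite /ind; have [tcd|tcd] := boolP (c <= t <= d).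
  by rewrite mulr1 lerXn2r ?nnegrE ?nc_ge0 ?hM// (le_trans (nc_ge0 _) (hM _ tcd)).
by rewrite h0// nc0 mulr0 expr0n.
Qed.

Lemma sq_ci (c d : R) phi : sq phi -> (forall t, ~~ (c <= t <= d) -> phi t = 0) ->
  ci phi.
Proof.
move=> [m h] h0; apply: (ci_dom m (riD h (ri_ind c d))) => t.
rewrite /ind; have [tcd|tcd] := boolP (c <= t <= d).
  by rewrite mulr1n; have := sqr_ge0 (nc (phi t) - 1/2); nra.
by rewrite h0// nc0 expr0n/= add0r.
Qed.

Lemma sqM_bnd (M : R) phi psi : sq phi -> mcf psi -> (forall t, phi t != 0 -> nc (psi t) <= M) ->
  sq (fun t => psi t * phi t).
Proof.
move=> [m h] mp hM; apply: (sq_dom (mcfM mp m) (riZ (M ^+ 2) h)) => t.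
rewrite ncM exprMn; have [->|p0] := eqVneq (phi t) 0.
  by rewrite nc0 expr0n/= !mulr0.
rewrite ler_wpM2r ?sqr_ge0// lerXn2r ?nnegrE ?nc_ge0 ?hM//.
by rewrite (le_trans (nc_ge0 _) (hM _ p0)).
Qed.
Lemma nLM_bnd (M : R) phi psi : 0 <= M -> sq phi -> mcf psi ->
  (forall t, phi t != 0 -> nc (psi t) <= M) ->
  nL (fun t => psi t * phi t) <= M * nL phi.
Proof.
move=> M0 h mp hM.
have -> : M * nL phi = nL (fun t => M%:C%C * phi t).
  by rewrite nLZ// nc_real ger0_norm.
apply: nL_le (mcfM mp (sq_mcf h)) (sqZ _ h) _ => t.
rewrite !ncM nc_real (ger0_norm M0); have [->|p0] := eqVneq (phi t) 0.
  by rewrite nc0 !mulr0.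
by rewrite ler_wpM2r ?nc_ge0 ?hM.
Qed.

End L2theory.

(** * Limit theorems and completeness *)

Section Limits.
Variable R : realType.
Local Notation mu := (@lebesgue_measure R).
Local Notation T := (measurableTypeR R).
Implicit Types (f g h : R -> R) (phi psi : R -> R[i]).

Lemma cvgn_ge_const (u : nat -> R) (l B : R) : u n @[n --> \oo] --> l ->
  (forall n, B <= u n) -> B <= l.
Proof. by move=> h hB; apply: (cvgr_to_ge h); exact: nearW. Qed.
Lemma cvgn_le_const (u : nat -> R) (l B : R) : u n @[n --> \oo] --> l ->
  (forall n, u n <= B) -> l <= B.
Proof. by move=> h hB; apply: (cvgr_to_le h); exact: nearW. Qed.

Lemma RI_ae f g : mf f -> mf g -> {ae mu, forall t, f t = g t} -> RI f = RI g.
Proof.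
move=> m1 m2 h; congr fine; apply: ae_eq_integral => //.
- exact: mf_EFin.
- exact: mf_EFin.
case: h => N [mN N0 sub]; exists N; split => // t nt; apply: sub => ft; apply: nt.
by move=> _; rewrite /= ft.
Qed.

Lemma DCT (F : nat -> R -> R) f g : (forall n, mf (F n)) -> ri g ->
  (forall n t, `|F n t| <= g t) -> (forall t, F n t @[n --> \oo] --> f t) ->
  ri f /\ RI (F n) @[n --> \oo] --> RI f.
Proof.
move=> mF gi hg hl.
have mf_ : mf f.
  by apply: (@measurable_fun_cvg _ _ _ setT F) => // t _; exact: hl.
have [] := @dominated_convergence _ T R mu setT measurableT
  (fun n t => (F n t)%:E) (EFin \o f) (EFin \o g).
- by move=> n; exact: mf_EFin.
- exact: mf_EFin.
- by apply: aeW => t _; apply: cvg_EFin; [exact: nearW|exact: hl].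
- exact: gi.
- by apply: aeW => t n _; rewrite /= lee_fin.
move=> fi _ hc; split => //.
have Fi n : ri (F n) by apply: ri_dom gi _.
apply: (@fine_cvg R nat \oo _ (fun n => \int[mu]_x (F n x)%:E)%E).
by rewrite RI_EFin.
Qed.

Lemma Fatou_bound (F : nat -> R -> R) f B : (forall n, ri (F n)) ->
  (forall n t, 0 <= F n t) -> (forall t, F n t @[n --> \oo] --> f t) ->
  (forall n, RI (F n) <= B) -> ri f /\ RI f <= B.
Proof.
move=> Fi F0 hl hB.
have mF n : mf (F n) by exact: ri_mf.
have mf_ : mf f.
  by apply: (@measurable_fun_cvg _ _ _ setT F) => // t _; exact: hl.
have f0 t : 0 <= f t by apply: cvgn_ge_const (hl t) _.
have E t : limn_einf (fun n => (F n t)%:E) = (f t)%:E.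
  have h : (F n t)%:E @[n --> \oo] --> (f t)%:E.
    by apply: cvg_EFin; [exact: nearW|exact: hl].
  by have [-> _] := cvg_limn_einf_sup h.
have h : (\int[mu]_t (f t)%:E <= B%:E)%E.
  under eq_integral do rewrite -E.
  apply: (le_trans (fatou _ _ _ _)) => //.
  - by move=> n; exact: mf_EFin.
  - by move=> n t _; rewrite lee_fin.
  rewrite limn_einf_lim; apply: lime_le; first exact: is_cvg_einfs.
  apply: nearW => n; apply: (@le_trans _ _ (\int[mu]_t (F n t)%:E)%E).
    by apply: ereal_inf_lbound; exists n => /=.
  by rewrite -RI_EFin// lee_fin.
have fi : ri f.
  apply: ri_lty => //; under eq_integral do rewrite ger0_norm//.
  by apply: le_lt_trans h _; rewrite ltry.
by split => //; rewrite -lee_fin RI_EFin.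
Qed.

Lemma half_pow_sum n : \sum_(j < n) (1 / 2) ^+ j <= 2 :> R.
Proof.
suff -> : \sum_(j < n) (1 / 2) ^+ j = 2 - 2 * (1 / 2) ^+ n :> R.
  by rewrite gerBl mulr_ge0// exprn_ge0//; lra.
elim: n => [|n IH]; first by rewrite big_ord0 expr0; lra.
by rewrite big_ord_recr/= IH exprS; lra.
Qed.

Lemma nL_cvg (phin : nat -> R -> R[i]) (phi : R -> R[i]) (g : R -> R) :
  (forall n, mcf (phin n)) -> ri g -> (forall n t, nc (phin n t) ^+ 2 <= g t) ->
  mcf phi -> (forall t, nc (phin n t) ^+ 2 @[n --> \oo] --> nc (phi t) ^+ 2) ->
  sq phi /\ forall B, 0 <= B -> (forall n, nL (phin n) <= B) -> nL phi <= B.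
Proof.
move=> mF gi hg m hl.
have hg' n t : `|nc (phin n t) ^+ 2| <= g t by rewrite ger0_norm ?sqr_ge0.
have [h1 h2] := DCT (fun n => mf_nc2 (mF n)) gi hg' hl.
split=> // B B0 hB; apply: le_of_sqr => //; rewrite nL_sq.
apply: cvgn_le_const h2 _ => n; rewrite -nL_sq lerXn2r ?nnegrE ?nL_ge0//.
Qed.

Lemma cvg_nc2 (u : nat -> R[i]) (x y : R) :
  Re (u n) @[n --> \oo] --> x -> Im (u n) @[n --> \oo] --> y ->
  nc (u n) ^+ 2 @[n --> \oo] --> nc (Complex x y) ^+ 2.
Proof.
move=> h1 h2; rewrite nc_sq ?cE; under eq_fun do rewrite nc_sq.
by apply: cvgD; rewrite !expr2; [under eq_fun do rewrite expr2; exact: cvgM|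
  under eq_fun do rewrite expr2; exact: cvgM].
Qed.

(* The sum of the [|phi_(j+1) - phi_j|] is square-integrable, hence finite almost everywhere, and it
   dominates the differences. *)
Lemma L2_complete (phi : nat -> R -> R[i]) (C : R) : 0 <= C ->
  (forall n, sq (phi n)) ->
  (forall n, nL (fun t => phi n.+1 t - phi n t) <= C * (1 / 2) ^+ n) ->
  exists psi, [/\ sq psi,
    (forall n, nL (fun t => psi t - phi n t) <= 2 * C * (1 / 2) ^+ n) &
    (forall t, (forall n, phi n t = 0) -> psi t = 0)].
Proof.
move=> C0 sphi hphi.
pose d j t := nc (phi j.+1 t - phi j t).
pose g n t := \sum_(j < n) d j t.
have sd j : sq (fun t => (d j t)%:C%C).
  apply: (sq_le (mcf_real (mf_nc (mcfB (sq_mcf (sphi _)) (sq_mcf (sphi _)))))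
    (sqB (sphi j.+1) (sphi j))) => t.
  by rewrite nc_real ger0_norm ?nc_ge0.
have g0 n t : 0 <= g n t by apply: sumr_ge0 => j _; exact: nc_ge0.
have gC n t : (g n t)%:C%C = \sum_(j < n) (d j t)%:C%C by rewrite rmorph_sum.
have sg n : sq (fun t => (g n t)%:C%C).
  by under eq_fun do rewrite gC; exact: sq_sum.
have gnd t : {homo g^~ t : m n / (m <= n)%N >-> m <= n}.
  move=> m n mn; rewrite /g -!(big_mkord xpredT (fun j => d j t)).
  rewrite (big_cat_nat (n := m) _ mn)//= lerDl.
  by apply: sumr_ge0 => j _; exact: nc_ge0.
have dist m n t : (m <= n)%N -> nc (phi n t - phi m t) <= g n t - g m t.
  move=> mn; rewrite -(subnKC mn); elim: (n - m)%N => [|k IH].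
    by rewrite addn0 !subrr nc0.
  rewrite addnS.
  have -> : phi (m + k).+1 t - phi m t =
     (phi (m + k).+1 t - phi (m + k)%N t) + (phi (m + k)%N t - phi m t) by ring.
  apply: le_trans (ncD _ _) _.
  by rewrite /g big_ord_recr/= -/(d (m + k)%N t) -/(g _ _); move: IH; rewrite /g; lra.
have nLg n : nL (fun t => (g n t)%:C%C) <= 2 * C.
  under [X in nL X]eq_fun do rewrite gC.
  apply: le_trans (nL_sum _ (fun j : 'I_n => sd j)) _.
  apply: (@le_trans _ _ (\sum_(j < n) C * (1 / 2) ^+ j)).
    apply: ler_sum => j _; apply: le_trans (hphi j).
    by rewrite (@nL_eq _ _ (fun t => phi j.+1 t - phi j t))// => t; rewrite nc_real ger0_norm ?nc_ge0.
  by rewrite -mulr_sumr mulrC ler_wpM2r// half_pow_sum.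
have gri n : ri (fun t => g n t ^+ 2).
  have := sq_ri (sg n).
  by under eq_fun do rewrite nc_real sqr_absr.
have Ig n : (\int[mu]_t (g n t ^+ 2)%:E <= ((2 * C) ^+ 2)%:E)%E.
  rewrite -RI_EFin// lee_fin.
  have -> : RI (fun t => g n t ^+ 2) = nL (fun t => (g n t)%:C%C) ^+ 2.
    by rewrite nL_sq; congr RI; apply/funext => t; rewrite nc_real sqr_absr.
  by rewrite lerXn2r ?nnegrE ?nL_ge0// mulr_ge0.
pose F n t := (g n t ^+ 2)%:E.
have Fnd t : {homo F^~ t : m n / (m <= n)%N >-> (m <= n)%E}.
  by move=> m n mn; rewrite lee_fin lerXn2r ?nnegrE ?gnd.
have mF n : measurable_fun [set: T] (F n) by exact: (mf_EFin (ri_mf (gri n))).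
pose G t := limn (F^~ t).
have cF t : F n t @[n --> \oo] --> G t by exact: ereal_nondecreasing_is_cvgn.
have mG : measurable_fun [set: T] G.
  by apply: (@emeasurable_fun_cvg _ T R setT F G) => // t _; exact: cF.
have F0 n t : (0 <= F n t)%E by rewrite lee_fin sqr_ge0.
have G0 t : (0 <= G t)%E.
  by apply: lime_ge; [exact: cF|exact: nearW].
have FG n t : (F n t <= G t)%E.
  apply: lime_ge; first exact: cF.
  by exists n => // m /= nm; exact: Fnd.
have IG : (\int[mu]_t G t <= ((2 * C) ^+ 2)%:E)%E.
  rewrite /G monotone_convergence//.
  apply: lime_le; last by apply: nearW => n; exact: Ig.
  apply: ereal_nondecreasing_is_cvgn => m n mn.
  by apply: ge0_le_integral => // t _; exact: Fnd.
have iG : mu.-integrable setT G.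
  apply/integrableP; split => //.
  under eq_integral do rewrite gee0_abs//.
  by apply: le_lt_trans IG _; rewrite ltry.
(* On [A] the partial sums [g n t] are bounded, so the differences of the [phi n t] are absolutely
   summable. *)
pose A : set T := [set t | G t \is a fin_num].
have mA : measurable A.
  by rewrite -[A]setTI; exact: emeasurable_fin_num.
have bA t n : A t -> g n t ^+ 2 <= fine (G t).
  by move=> At; rewrite -lee_fin fineK//; exact: FG.
have cA (P : R[i] -> R) t : A t -> (forall z w, P (z - w) = P z - P w) ->
    (forall z, `|P z| <= nc z) -> cvgn (fun n => P (phi n t)).
  move=> At PB Pnc.
  pose u k := P (phi k.+1 t) - P (phi k t).
  have cu : cvgn (series u : nat -> R^o).
    apply: normed_cvg; rewrite /normed_series_of seriesEnat/=.
    apply: nondecreasing_is_cvgn.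
      move=> m n mn; rewrite (big_cat_nat (n := m) _ mn)//= lerDl.
      exact: sumr_ge0.
    exists (Num.sqrt (fine (G t))) => _ [n _ <-].
    apply: (@le_trans _ _ (g n t)).
      rewrite /g -(big_mkord xpredT (fun j => d j t)).
      by apply: ler_sum => k _; rewrite /u -PB.
    by rewrite -[g n t]ger0_norm// -sqrtr_sqr ler_wsqrtr ?bA.
  have -> : (fun n => P (phi n t)) = (fun n => P (phi 0 t) + series u n).
    apply/funext => n; rewrite !seriesEnat/= /u telescope_sumr//; ring.
  by apply: is_cvgD; [exact: is_cvg_cst|exact: cu].
(* Outside [A] the value is 0 and not an arbitrary limit: common zeros of the [phi n] must be zeros
   of [psi] at every point. *)
pose psi t : R[i] := if G t \is a fin_num then
  Complex (limn (fun n => Re (phi n t))) (limn (fun n => Im (phi n t))) else 0.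
have cRe t : A t -> Re (phi n t) @[n --> \oo] --> Re (psi t).
  move=> At; rewrite /psi (At : G t \is a fin_num) ?cE.
  by apply: cA => // [z w|z]; [rewrite ?cE|exact: Re_le_nc].
have cIm t : A t -> Im (phi n t) @[n --> \oo] --> Im (psi t).
  move=> At; rewrite /psi (At : G t \is a fin_num) ?cE.
  by apply: cA => // [z w|z]; [rewrite ?cE|exact: Im_le_nc].
pose chi : R -> R := \1_A.
have mchi : mf chi by exact: measurable_indic.
have chi1 t : A t -> chi t = 1 by move=> At; rewrite /chi indicE mem_set.
have chi0 t : ~ A t -> chi t = 0 by move=> At; rewrite /chi indicE memNset.
have psi0 t : ~ A t -> psi t = 0.
  by move=> At; rewrite /psi; case: ifP => // h; case: At.
have mpsi : mcf psi.
  split.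
    apply: (@measurable_fun_cvg _ T R setT (fun n t => chi t * Re (phi n t))).
      by move=> n; apply: mfM => //; have [] := sq_mcf (sphi n).
    move=> t _; have [At|At] := pselect (A t).
      by rewrite chi1//; under eq_fun do rewrite mul1r; exact: cRe.
    by rewrite chi0// psi0//; under eq_fun do rewrite mul0r; exact: cvg_cst.
  apply: (@measurable_fun_cvg _ T R setT (fun n t => chi t * Im (phi n t))).
    by move=> n; apply: mfM => //; have [] := sq_mcf (sphi n).
  move=> t _; have [At|At] := pselect (A t).
    by rewrite chi1//; under eq_fun do rewrite mul1r; exact: cIm.
  by rewrite chi0// psi0//; under eq_fun do rewrite mul0r; exact: cvg_cst.
have iGr : ri (fun t => chi t * fine (G t)).
  have iGA : mu.-integrable A G by exact: (integrableS measurableT mA (@subsetT _ A) iG).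
  have := (@integrable_mkcond _ T R mu A G mA).1 iGA.
  apply: eq_integrable => // t _; rewrite /patch /=; case: ifPn => [|/negP]; rewrite inE => At.
    by rewrite chi1// mul1r fineK.
  by rewrite chi0// mul0r.
have aeA : {ae mu, forall t, A t}.
  by have := integrable_ae measurableT iG; case=> N [mN N0 sub]; exists N; split => // t nt;
    apply: sub => h; apply: nt; exact: h.
(* After multiplication by the indicator of [A] the differences converge everywhere and their
   squares are dominated by [fine (G t)], so norm bounds pass to the limit. *)
have key n : sq (fun t => (chi t)%:C%C * (psi t - phi n t)) /\
    forall B, 0 <= B -> (forall m, (n <= m)%N -> nL (fun t => phi m t - phi n t) <= B) ->
      nL (fun t => (chi t)%:C%C * (psi t - phi n t)) <= B.
  have := @nL_cvg (fun m t => (chi t)%:C%C * (phi (n + m)%N t - phi n t))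
    (fun t => (chi t)%:C%C * (psi t - phi n t)) (fun t => chi t * fine (G t)).
  case.
  - by move=> m; apply: mcfM; [exact: mcf_real|apply: mcfB; exact: sq_mcf].
  - exact: iGr.
  - move=> m t; have [At|At] := pselect (A t).
      rewrite chi1// ncM nc1 mul1r mul1r (le_trans _ (bA t (n + m)%N At))//.
      rewrite lerXn2r ?nnegrE ?nc_ge0// (le_trans (dist n _ t (leq_addr _ _)))//.
      by rewrite gerBl.
    by rewrite chi0// ncM nc0 !mul0r expr0n.
  - by apply: mcfM; [exact: mcf_real|apply: mcfB; [exact: mpsi|exact: sq_mcf]].
  - move=> t; have [At|At] := pselect (A t); last first.
      by rewrite chi0//; under eq_fun do rewrite !mul0r; rewrite mul0r; exact: cvg_cst.
    rewrite chi1//; under eq_fun do rewrite mul1r; rewrite mul1r.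
    have -> : psi t - phi n t = Complex (Re (psi t) - Re (phi n t)) (Im (psi t) - Im (phi n t)).
      by apply: ceq; rewrite ?cE.
    apply: cvg_nc2; under eq_fun do rewrite ?cE; apply: cvgB; try exact: cvg_cst.
      by have := cRe t At; rewrite -(cvg_shiftn n); under eq_fun do rewrite addnC.
    by have := cIm t At; rewrite -(cvg_shiftn n); under eq_fun do rewrite addnC.
  move=> h1 h2; split => // B B0 hB; apply: h2 => // m.
  apply: le_trans (hB (n + m)%N (leq_addr _ _)); apply: nL_le.
  - by apply: mcfM; [exact: mcf_real|apply: mcfB; exact: sq_mcf].
  - exact: sqB.
  move=> t; rewrite ncM; have [At|At] := pselect (A t).
    by rewrite chi1// nc1 mul1r.
  by rewrite chi0// nc0 mul0r nc_ge0.
have spsi : sq psi.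
  have -> : psi = (fun t => (chi t)%:C%C * (psi t - phi 0%N t) + (chi t)%:C%C * phi 0%N t).
    apply/funext => t; rewrite -mulrDr subrK; have [At|At] := pselect (A t).
      by rewrite chi1// mul1r.
    by rewrite chi0// psi0// mulr0.
  apply: sqD; first by have [] := key 0%N.
  apply: (@sqM_bnd _ 1) => //; first exact: mcf_real.
  by move=> t _; rewrite nc_real /chi indicE; case: (_ \in _); rewrite ?normr1 ?normr0.
exists psi; split => //.
  move=> n; have [_ h] := key n.
  have -> : nL (fun t => psi t - phi n t) = nL (fun t => (chi t)%:C%C * (psi t - phi n t)).
    congr Num.sqrt; apply: RI_ae.
    - exact: (ri_mf (sq_ri (sqB spsi (sphi n)))).
    - by have [/sq_ri/ri_mf] := key n.
    case: aeA => N [mN N0 sub]; exists N; split => // t nt; apply: sub => At; apply: nt.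
    by rewrite /= chi1// mul1r.
  apply: h; first by rewrite !mulr_ge0// exprn_ge0.
  move=> m nm; rewrite -(subnKC nm).
  suff : nL (fun t => phi (n + (m - n))%N t - phi n t) <=
      2 * C * ((1 / 2) ^+ n - (1 / 2) ^+ (n + (m - n))).
    move=> /le_trans; apply; rewrite ler_wpM2l ?mulr_ge0//.
    by rewrite gerBl exprn_ge0.
  elim: (m - n)%N => [|k IH].
    by rewrite addn0 subrr mulr0; under [X in nL X]eq_fun do rewrite subrr; rewrite nL0.
  rewrite addnS.
  have -> : (fun t => phi (n + k).+1 t - phi n t) =
    (fun t => (phi (n + k).+1 t - phi (n + k)%N t) + (phi (n + k)%N t - phi n t)).
    by apply/funext => t; ring.
  apply: le_trans (nLD _ _) _; [exact: sqB|exact: sqB|].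
  have := hphi (n + k)%N; rewrite exprS; lra.
move=> t ht; rewrite /psi; case: ifP => // _.
by apply: ceq; rewrite ?cE; apply/cvg_lim => //; under eq_fun do rewrite ht; exact: cvg_cst.
Qed.
End Limits.

(** * Fourier transforms of compactly supported functions *)

Section FourierTransform.
Variable R : realType.
Local Notation mu := (@lebesgue_measure R).
Local Notation T := (measurableTypeR R).
Implicit Types (f g h : R -> R) (phi psi : R -> R[i]) (z w : R[i]).

Definition ee z (t : R) : R[i] := cexp ('i%C * z * t%:C%C).
Definition FT phi z : R[i] := CI (fun t => phi t * ee z t).
(** Vanishing is required at every point and not almost everywhere, so that functions can be
    identified pointwise. *)
Definition supp (c d : R) phi := forall t, ~~ (c <= t <= d) -> phi t = 0.
Definition en (c d : R) z (t : R) : R[i] := (ind c d t)%:C%C * ee z t.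

Lemma Re_iz z (t : R) : Re ('i%C * z * t%:C%C) = - Im z * t.
Proof. rewrite ?cE; ring. Qed.
Lemma nc_ee z t : nc (ee z t) = expR (- Im z * t).
Proof. by rewrite nc_cexp Re_iz. Qed.
Lemma mcf_ee z : mcf (ee z). Proof. exact: mcf_exp. Qed.
Lemma ee_neq0 z t : ee z t != 0. Proof. exact: cexp_neq0. Qed.
Lemma eeD z w t : ee (z + w) t = ee z t * ee w t.
Proof. by rewrite /ee -cexpD; congr cexp; ring. Qed.
Lemma eeDt z t s : ee z (t + s) = ee z t * ee z s.
Proof. by rewrite /ee -cexpD rmorphD; congr cexp; ring. Qed.
Lemma eeNt z t : ee z (- t) = (ee z t)^-1.
Proof. by rewrite /ee -cexpN rmorphN; congr cexp; ring. Qed.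
Lemma ee0 t : ee 0 t = 1. Proof. by rewrite /ee mulr0 mul0r cexp0. Qed.
Lemma ee00 z : ee z 0 = 1. Proof. by rewrite /ee mulr0 cexp0. Qed.

Lemma ind1 c d (t : R) : c <= t <= d -> ind c d t = 1.
Proof. by rewrite /ind => ->. Qed.
Lemma ind_0 c d (t : R) : ~~ (c <= t <= d) -> ind c d t = 0.
Proof. by rewrite /ind => /negbTE ->. Qed.
Lemma suppP c d phi t : supp c d phi -> phi t != 0 -> c <= t <= d.
Proof. by move=> h; apply: contraNT => /h ->. Qed.
Lemma supp_ind c d phi : supp c d phi -> phi = (fun t => (ind c d t)%:C%C * phi t).
Proof.
move=> h; apply/funext => t; have [tcd|tcd] := boolP (c <= t <= d).
  by rewrite ind1// mul1r.
by rewrite h// mulr0.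
Qed.
Lemma supp_sub c d c' d' phi : c' <= c -> d <= d' -> supp c d phi -> supp c' d' phi.
Proof.
move=> h1 h2 h t; have [tcd|tcd] := boolP (c <= t <= d); last by rewrite h.
by case/andP: tcd => h3 h4; rewrite (le_trans h1 h3) (le_trans h4 h2).
Qed.
Lemma suppD c d phi psi : supp c d phi -> supp c d psi ->
  supp c d (fun t => phi t + psi t).
Proof. by move=> h1 h2 t ht; rewrite h1// h2// addr0. Qed.
Lemma suppB c d phi psi : supp c d phi -> supp c d psi ->
  supp c d (fun t => phi t - psi t).
Proof. by move=> h1 h2 t ht; rewrite h1// h2// subr0. Qed.
Lemma suppZ c d (k : R[i]) phi : supp c d phi -> supp c d (fun t => k * phi t).
Proof. by move=> h1 t ht; rewrite h1// mulr0. Qed.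
Lemma supp_sum c d (I : Type) (s : seq I) (F : I -> R -> R[i]) :
  (forall i, supp c d (F i)) -> supp c d (fun t => \sum_(i <- s) F i t).
Proof. by move=> h t ht; rewrite big1// => i _; rewrite h. Qed.

Lemma expR_bnd (c d k t : R) : c <= t <= d -> expR (k * t) <= expR (`|k| * (`|c| + `|d|)).
Proof.
move=> /andP[h1 h2]; rewrite ler_expR; apply: le_trans (ler_norm _) _.
rewrite normrM ler_wpM2l// ler_norml.
have := lerNnormlW (lexx `|c|); have := ler_norm d.
have := normr_ge0 c; have := normr_ge0 d => *; apply/andP; split; lra.
Qed.

Lemma sq_ee c d phi z : sq phi -> supp c d phi -> sq (fun t => ee z t * phi t).
Proof.
move=> h s; apply: (@sqM_bnd _ (expR (`|- Im z| * (`|c| + `|d|)))) => //.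
  exact: mcf_ee.
by move=> t /(suppP s) ?; rewrite nc_ee expR_bnd.
Qed.
Lemma FT_ci c d phi z : sq phi -> supp c d phi -> ci (fun t => phi t * ee z t).
Proof.
move=> h s; apply: (@sq_ci _ c d).
  by under eq_fun do rewrite mulrC; exact: sq_ee s.
by move=> t /s ->; rewrite mul0r.
Qed.

Lemma sq_en c d z : sq (en c d z).
Proof.
apply: (@sq_bnd _ (expR (`|- Im z| * (`|c| + `|d|))) c d).
- by apply: mcfM; [exact: mcf_ind|exact: mcf_ee].
- by move=> t tcd; rewrite /en ind1// mul1r nc_ee expR_bnd.
- by move=> t tcd; rewrite /en ind_0// mul0r.
Qed.
Lemma supp_en c d z : supp c d (en c d z).
Proof. by move=> t ht; rewrite /en ind_0// mul0r. Qed.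

Lemma FTD c d phi psi z : sq phi -> supp c d phi -> sq psi -> supp c d psi ->
  FT (fun t => phi t + psi t) z = FT phi z + FT psi z.
Proof.
move=> h1 s1 h2 s2; rewrite /FT -CID; [|exact: FT_ci s1|exact: FT_ci s2].
by congr CI; apply/funext => t; rewrite mulrDl.
Qed.
Lemma FTZ c d (k : R[i]) phi z : sq phi -> supp c d phi ->
  FT (fun t => k * phi t) z = k * FT phi z.
Proof.
move=> h1 s1; rewrite /FT -CIZ; last exact: FT_ci s1.
by congr CI; apply/funext => t; rewrite mulrA.
Qed.
Lemma FTB c d phi psi z : sq phi -> supp c d phi -> sq psi -> supp c d psi ->
  FT (fun t => phi t - psi t) z = FT phi z - FT psi z.
Proof.
move=> h1 s1 h2 s2; rewrite /FT -CIB; [|exact: FT_ci s1|exact: FT_ci s2].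
by congr CI; apply/funext => t; rewrite mulrBl.
Qed.
Lemma FT0 z : FT (fun _ => 0) z = 0.
Proof. by rewrite /FT; under [X in CI X]eq_fun do rewrite mul0r; rewrite CI0. Qed.
Lemma FT_sum c d (I : Type) (s : seq I) (F : I -> R -> R[i]) z :
  (forall i, sq (F i)) -> (forall i, supp c d (F i)) ->
  FT (fun t => \sum_(i <- s) F i t) z = \sum_(i <- s) FT (F i) z.
Proof.
move=> h1 h2; rewrite /FT -CI_sum; last by move=> i; exact: FT_ci (h1 i) (h2 i).
by congr CI; apply/funext => t; rewrite mulr_suml.
Qed.

Lemma FT_mulee phi z w : FT (fun t => ee w t * phi t) z = FT phi (z + w).
Proof.
by congr CI; apply/funext => t; rewrite eeD; ring.
Qed.

Lemma FT_bound c d phi z : sq phi -> supp c d phi ->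
  nc (FT phi z) <= nL phi * nL (en c d z).
Proof.
move=> h s; have -> : FT phi z = CI (fun t => phi t * en c d z t).
  by congr CI; rewrite {1}(supp_ind s); apply/funext => t; rewrite /en; ring.
by apply: CS h _; exact: sq_en.
Qed.

Lemma FT_diff c d phi z w M : c <= d -> 0 <= M -> sq phi -> supp c d phi ->
  (forall t, c <= t <= d -> nc (ee w t - ee z t) <= M) ->
  nc (FT phi w - FT phi z) <= M * Num.sqrt (d - c) * nL phi.
Proof.
move=> cd M0 h s hM.
pose u t := (ind c d t)%:C%C * (ee w t - ee z t).
have mu_ : mcf u by apply: mcfM; [exact: mcf_ind|apply: mcfB; exact: mcf_ee].
have u1 t : c <= t <= d -> nc (u t) <= M.
  by move=> tcd; rewrite /u ind1// mul1r hM.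
have u0 : supp c d u by move=> t tcd; rewrite /u ind_0// mul0r.
have -> : FT phi w - FT phi z = CI (fun t => phi t * u t).
  rewrite /FT -CIB; [|exact: FT_ci s|exact: FT_ci s].
  congr CI; rewrite {1 2}(supp_ind s); apply/funext => t; rewrite /u; ring.
apply: le_trans (CS h (sq_bnd mu_ u1 u0)) _.
rewrite mulrC ler_wpM2r ?nL_ge0//.
apply: le_of_sqr; first by rewrite mulr_ge0// sqrtr_ge0.
rewrite exprMn [X in _ <= _ * X]sqr_sqrtr ?subr_ge0//.
exact: (nL_bnd cd mu_ u1 u0).
Qed.

Lemma FT_shift c d phi z (a : R) : sq phi -> supp c d phi ->
  FT (fun t => phi (t + a)) z = ee z (- a) * FT phi z.
Proof.
move=> h s; rewrite /FT -CIZ; last exact: FT_ci s.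
have := CI_shift a (ciZ (ee z (- a)) (FT_ci z h s)) => <-.
congr CI; apply/funext => t; rewrite eeDt eeNt mulrCA; congr (_ * _).
by rewrite mulrC mulfK ?ee_neq0.
Qed.
Lemma sq_shift phi (a : R) : sq phi -> sq (fun t => phi (t + a)).
Proof.
move=> [[m1 m2] h]; split; last exact: (ri_shift a h).
by split; [exact: (mf_shift a m1)|exact: (mf_shift a m2)].
Qed.
Lemma nL_shift phi (a : R) : sq phi -> nL (fun t => phi (t + a)) = nL phi.
Proof.
by move=> [_ h]; congr Num.sqrt; exact: (RI_shift a h).
Qed.

Lemma is_derive_exp_cos (k l : R) (x : R) :
  is_derive x 1 (fun t => expR (k * t) * cos (l * t))
    (k * (expR (k * x) * cos (l * x)) - l * (expR (k * x) * sin (l * x))).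
Proof.
apply: is_derive_eq.
rewrite /GRing.scale/= ?mulr0 ?addr0 ?mulr1; ring.
Qed.
Lemma is_derive_exp_sin (k l : R) (x : R) :
  is_derive x 1 (fun t => expR (k * t) * sin (l * t))
    (k * (expR (k * x) * sin (l * x)) + l * (expR (k * x) * cos (l * x))).
Proof.
apply: is_derive_eq.
rewrite /GRing.scale/= ?mulr0 ?addr0 ?mulr1; ring.
Qed.

Lemma FTC_RI (F f : R -> R) (c d : R) : c <= d -> (forall x : R, is_derive x (1 : R) F (f x)) ->
  continuous f -> RI (fun t => ind c d t * f t) = F d - F c.
Proof.
move=> cd; have [-> _ _|cd' dF cf] := eqVneq c d.
  rewrite subrr; have -> : (fun t => ind d d t * f t) = (fun t => f d * ind d d t).
    apply/funext => t; rewrite /ind; case: (boolP (d <= t <= d)) => h.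
      by rewrite mulr1 mul1r; congr f; apply/le_anti; case/andP: h => -> ->.
    by rewrite mulr0 mul0r.
  by rewrite RIZ ?RI_ind// ?subrr ?mulr0//; exact: ri_ind.
have {cd cd'}cd : c < d by rewrite lt_neqAle cd'.
have cF x : {for x, continuous F}.
  by apply: differentiable_continuous; apply/derivable1_diffP; have [] := dF x.
have H := @continuous_FTC2 R f F c d cd.
have -> : RI (fun t => ind c d t * f t) = fine (\int[mu]_(t in `[c, d]) (f t)%:E)%E.
  rewrite /RI Rintegral_mkcond /Rintegral integral_mkcond; congr fine.
  rewrite [RHS]integral_mkcond.
  apply: eq_integral => t _; rewrite /patch/= !in_setT mem_setE in_itv/= /ind.
  by case: (_ <= _ <= _); rewrite ?mul1r ?mul0r.
rewrite H//.
- exact: continuous_subspaceT.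
- split; [by move=> x _; have [] := dF x| | ].
  + by apply: cvg_at_right_filter; exact: cF.
  + by apply: cvg_at_left_filter; exact: cF.
- by move=> x _; rewrite derive1E; have [_ ->] := dF x.
Qed.

(** Stated as a product so that [z = 0] is included. *)
Lemma FT_box c d z : c <= d ->
  'i%C * z * FT (fun t => (ind c d t)%:C%C) z = ee z d - ee z c.
Proof.
move=> cd; set k := - Im z; set l := Re z.
have eeE t : ee z t = Complex (expR (k * t) * cos (l * t)) (expR (k * t) * sin (l * t)).
  rewrite /ee /cexp; have -> : 'i%C * z * t%:C%C = Complex (k * t) (l * t).
    by apply: ceq; rewrite ?cE /k /l; ring.
  by [].
have ccos : continuous (fun t : R => expR (k * t) * cos (l * t)).
  move=> x; apply: differentiable_continuous; apply/derivable1_diffP.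
  by have [] := is_derive_exp_cos k l x.
have csin : continuous (fun t : R => expR (k * t) * sin (l * t)).
  move=> x; apply: differentiable_continuous; apply/derivable1_diffP.
  by have [] := is_derive_exp_sin k l x.
have hci : ci (fun t => (ind c d t)%:C%C * ee z t).
  by apply: (@sq_ci _ c d); [exact: sq_en|exact: supp_en].
rewrite /FT -CIZ//; apply: ceq; rewrite ?Re_CI ?Im_CI !eeE ?cE.
  rewrite -(FTC_RI cd (is_derive_exp_cos k l)).
    by congr RI; apply/funext => t; rewrite eeE ?cE /k /l; ring.
  move=> x; apply: cvgB; apply: cvgM; try exact: cvg_cst; [exact: ccos|exact: csin].
rewrite -(FTC_RI cd (is_derive_exp_sin k l)).
  by congr RI; apply/funext => t; rewrite eeE ?cE /k /l; ring.
move=> x; apply: cvgD; apply: cvgM; try exact: cvg_cst; [exact: csin|exact: ccos].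
Qed.

End FourierTransform.

(** * Division by a zero *)

Opaque RI CI.

Section Division.
Variable R : realType.
Local Notation mu := (@lebesgue_measure R).
Local Notation T := (measurableTypeR R).
Implicit Types (f g h : R -> R) (phi psi : R -> R[i]) (z w : R[i]).

Lemma le_k_sq (k y : R) : 0 <= k -> k * y <= k + k * y ^+ 2.
Proof. by move=> k0; have := sqr_ge0 (y - 1/2); nra. Qed.
Lemma amgm_weight (e k y : R) : 0 < e -> 0 <= k -> 2 * (k * y) <= e * k + e^-1 * (k * y ^+ 2).
Proof.
move=> e0 k0; have sv : e * e^-1 = 1 by rewrite mulfV// gt_eqF.
have sv0 : 0 <= e^-1 by rewrite invr_ge0 ltW.
have := mulr_ge0 (mulr_ge0 sv0 (sqr_ge0 (e * 1 - y))) k0.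
have -> : e^-1 * (e * 1 - y) ^+ 2 * k =
    e * (e * e^-1) * k - 2 * (e * e^-1) * (y * k) + e^-1 * (k * y ^+ 2) by ring.
rewrite sv; lra.
Qed.

Definition heaviside (u : R) : R := (0 <= u)%R%:R.

Lemma mf_heaviside : mf heaviside.
Proof.
have -> : heaviside = \1_(`[0%R, +oo[%classic).
  by apply/funext => t; rewrite indicE /heaviside mem_setE in_itv/= andbT.
exact: measurable_indic.
Qed.
Lemma heaviside_ge0 u : 0 <= heaviside u. Proof. exact: ler0n. Qed.
Lemma heaviside_le1 u : heaviside u <= 1. Proof. by rewrite /heaviside; case: (0 <= u). Qed.
Lemma ind_le1 c d (t : R) : ind c d t <= 1. Proof. by rewrite /ind; case: (_ <= _ <= _). Qed.

(* The transform of [quot c d lam phi] is [FT phi z / (z - lam)] when [FT phi lam = 0]. *)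
Definition quot (c d : R) (lam : R[i]) phi (t : R) : R[i] :=
  (ind c d t)%:C%C * (- 'i%C * ee (- lam) t *
    CI (fun s => (heaviside (t - s))%:C%C * (phi s * ee lam s))).

Section quot.
Variables (c d : R) (lam : R[i]) (phi : R -> R[i]).
Hypotheses (hphi : sq phi) (sphi : supp c d phi).

(** One interchange for two uses: [u = ee (- lam)] yields measurability of the quotient,
    [u = ee (z - lam)] its transform. *)
Lemma quot_Fubini (u : R -> R[i]) (M : R) : mcf u -> (forall t, c <= t <= d -> nc (u t) <= M) ->
  ci (fun t => CI (fun s => (ind c d t)%:C%C * u t * ((heaviside (t - s))%:C%C * (phi s * ee lam s)))) /\
  CI (fun t => CI (fun s => (ind c d t)%:C%C * u t * ((heaviside (t - s))%:C%C * (phi s * ee lam s)))) =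
  CI (fun s => CI (fun t => (ind c d t)%:C%C * u t * ((heaviside (t - s))%:C%C * (phi s * ee lam s)))).
Proof.
move=> mu_ hM.
pose F t s := (ind c d t)%:C%C * u t * ((heaviside (t - s))%:C%C * (phi s * ee lam s)).
suff [_ h1 h2] : [/\ (forall x, ci (F x)), ci (fun x => CI (F x)) &
     CI (fun x => CI (F x)) = CI (fun y => CI (fun x => F x y))] by split.
apply: (@CFubini_dom _ F (fun t => M * ind c d t)
    (fun s => nc (phi s * ee lam s))).
- apply: mcf2M.
    by apply: (mcf2_fst (phi := fun t => (ind c d t)%:C%C * u t)); apply: mcfM => //; exact: mcf_ind.
  apply: mcf2M; last first.
    by apply: (mcf2_snd (phi := fun s => phi s * ee lam s)); exact: (ci_mcf (FT_ci lam hphi sphi)).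
  by apply: (mcf2_sub (phi := fun s => (heaviside s)%:C%C)); exact: (mcf_real mf_heaviside).
- exact/riZ/ri_ind.
- exact: (ci_nc (FT_ci lam hphi sphi)).
- move=> t s; rewrite /F ncM (ncM _ (phi s * ee lam s)) (ncM _ (u t)) !nc_real.
  rewrite !ger0_norm ?ind_ge0 ?heaviside_ge0//.
  apply: ler_pM; rewrite ?mulr_ge0 ?ind_ge0 ?nc_ge0 ?heaviside_ge0//; last first.
    by rewrite ler_piMl ?nc_ge0 ?heaviside_le1.
  rewrite /ind; case: (boolP (c <= t <= d)) => tcd; last by rewrite mul0r mulr0.
  by rewrite mul1r mulr1 hM.
Qed.

Lemma ci_heaviside (t : R) : ci (fun s => (heaviside (t - s))%:C%C * (phi s * ee lam s)).
Proof.
apply: (ci_dom _ (ci_nc (FT_ci lam hphi sphi))).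
  apply: mcfM; last exact: (ci_mcf (FT_ci lam hphi sphi)).
  apply: mcf_real; apply: (measurableT_comp mf_heaviside).
  by apply: mfB; [exact: mf_cst|exact: mf_id].
move=> s; rewrite ncM nc_real ger0_norm ?heaviside_ge0// ler_piMl ?nc_ge0//.
exact: heaviside_le1.
Qed.

Lemma quotE (z : R[i]) t : quot c d lam phi t * ee z t =
  - 'i%C * CI (fun s => (ind c d t)%:C%C * ee (z - lam) t *
    ((heaviside (t - s))%:C%C * (phi s * ee lam s))).
Proof.
by rewrite (CIZ _ (ci_heaviside t)) /quot addrC eeD; ring.
Qed.

Lemma mcf_quot : mcf (quot c d lam phi).
Proof.
have [h _] := @quot_Fubini (ee (0 - lam)) (expR (`|- Im (0 - lam)| * (`|c| + `|d|)))
  (mcf_ee _) ltac:(by move=> t tcd; rewrite nc_ee expR_bnd).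
have -> : quot c d lam phi = (fun t => - 'i%C * CI (fun s => (ind c d t)%:C%C * ee (0 - lam) t *
    ((heaviside (t - s))%:C%C * (phi s * ee lam s)))).
  by apply/funext => t; rewrite -quotE ee0 mulr1.
exact: (ci_mcf (ciZ _ h)).
Qed.

Lemma supp_quot : supp c d (quot c d lam phi).
Proof. by move=> t h; rewrite /quot ind_0// mul0r. Qed.

Lemma sq_quot : sq (quot c d lam phi).
Proof.
pose M := expR (`|- Im (- lam)| * (`|c| + `|d|)) * RI (fun s => nc (phi s * ee lam s)).
apply: (@sq_bnd _ M c d); [exact: mcf_quot| |exact: supp_quot].
move=> t tcd; rewrite /quot ind1// mul1r ncM ncM ncN nci mul1r nc_ee.
apply: ler_pM; rewrite ?expR_ge0 ?nc_ge0 ?expR_bnd//.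
apply: le_trans (nc_CI_le (ci_heaviside t)) _; apply: RI_le.
- exact: (ci_nc (ci_heaviside t)).
- exact: (ci_nc (FT_ci lam hphi sphi)).
move=> s; rewrite ncM nc_real ger0_norm ?heaviside_ge0// ler_piMl ?nc_ge0//.
exact: heaviside_le1.
Qed.

(** Integrating in [t] first leaves the transform of an interval [[s, d]], which has one term at
    each end. The term at [d] carries the factor [FT phi lam = 0], and the term at [s] reproduces
    [FT phi z / (z - lam)]. *)
Lemma FT_quot z : FT phi lam = 0 -> (z - lam) * FT (quot c d lam phi) z = FT phi z.
Proof.
move=> h0; set w := z - lam.
have [hc E] := @quot_Fubini (ee w) (expR (`|- Im w| * (`|c| + `|d|)))
  (mcf_ee _) ltac:(by move=> t tcd; rewrite nc_ee expR_bnd).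
have -> : FT (quot c d lam phi) z = - 'i%C * CI (fun t => CI (fun s =>
    (ind c d t)%:C%C * ee w t * ((heaviside (t - s))%:C%C * (phi s * ee lam s)))).
  by rewrite -(CIZ _ hc); congr CI; apply/funext => t; exact: quotE.
rewrite E {E hc}.
have inner s : CI (fun t => (ind c d t)%:C%C * ee w t *
    ((heaviside (t - s))%:C%C * (phi s * ee lam s))) =
    (phi s * ee lam s) * FT (fun t => (ind s d t)%:C%C) w.
  have [scd|scd] := boolP (c <= s <= d); last first.
    rewrite sphi// mul0r mul0r; under [X in CI X]eq_fun do rewrite !mulr0.
    by rewrite CI0.
  rewrite /FT -CIZ; last by apply: (@sq_ci _ s d); [exact: sq_en|exact: supp_en].
  congr CI; apply/funext => t; case/andP: scd => cs sd.
  suff -> : ind s d t = ind c d t * heaviside (t - s) by rewrite rmorphM; ring.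
  rewrite /ind /heaviside subr_ge0; have [st|st] := leP s t.
    by rewrite (le_trans cs st)/= mulr1.
  by rewrite mulr0.
under [X in CI X]eq_fun do rewrite inner.
have [w0|w0] := eqVneq w 0.
  by rewrite w0 mul0r; have := subr0_eq w0 => ->; rewrite h0.
have box s : s <= d -> FT (fun t => (ind s d t)%:C%C) w = ('i%C * w)^-1 * (ee w d - ee w s).
  move=> sd; rewrite -FT_box// mulKf// mulf_neq0//.
  by rewrite -nc_eq0 nci oner_eq0.
have -> : CI (fun s => phi s * ee lam s * FT (fun t => (ind s d t)%:C%C) w) =
    CI (fun s => (('i%C * w)^-1 * ee w d) * (phi s * ee lam s) -
                  ('i%C * w)^-1 * (phi s * ee z s)).
  congr CI; apply/funext => s; have [scd|scd] := boolP (c <= s <= d).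
    case/andP: scd => cs sd; rewrite box//.
    have -> : ee z s = ee w s * ee lam s by rewrite -eeD /w subrK.
    ring.
  by rewrite sphi//; ring.
rewrite CIB; [|exact/ciZ/(FT_ci lam hphi sphi)|exact/ciZ/(FT_ci z hphi sphi)].
rewrite CIZ ?CIZ; [|exact: FT_ci sphi|exact: FT_ci sphi].
rewrite -/(FT phi lam) -/(FT phi z) h0 mulr0 sub0r.
have i0 : ('i%C : R[i]) != 0 by rewrite -nc_eq0 nci oner_eq0.
by field; rewrite w0 i0.
Qed.

End quot.

Lemma ri_ind_expR (c d k : R) : ri (fun t => ind c d t * expR (k * t)).
Proof.
apply: (ri_dom _ (riZ (expR (`|k| * (`|c| + `|d|))) (ri_ind c d))).
  by apply: mfM; [exact: mf_ind|apply: mf_expR; apply: mfM; [exact: mf_cst|exact: mf_id]].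
move=> t; rewrite ger0_norm ?mulr_ge0 ?ind_ge0 ?expR_ge0//.
have [tcd|tcd] := boolP (c <= t <= d); last by rewrite ind_0// mul0r mulr0.
by rewrite (ind1 tcd) mul1r mulr1; exact: expR_bnd.
Qed.

Lemma RI_expR (c d k : R) : c <= d -> k * RI (fun t => ind c d t * expR (k * t)) = expR (k * d) - expR (k * c).
Proof.
move=> cd; have hd (x : R) : is_derive x (1 : R) (fun t => expR (k * t)) (k * expR (k * x)).
  by apply: is_derive_eq; rewrite /GRing.scale/= ?mulr0 ?addr0 ?mulr1 mulrC.
have cf : continuous (fun x : R => expR (k * x)).
  by move=> x; apply: differentiable_continuous; apply/derivable1_diffP; have [] := hd x.
rewrite -(FTC_RI cd hd); last by move=> x; apply: cvgM; [exact: cvg_cst|exact: cf].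
have i := ri_ind_expR c d k.
by rewrite -RIZ//; congr RI; apply/funext => t; ring.
Qed.

Lemma meas_swap (K : R -> R -> R) :
  measurable_fun [set: T * T] (fun p : T * T => K p.1 p.2) ->
  measurable_fun [set: T * T] (fun p : T * T => K p.2 p.1).
Proof.
by move=> mK; have := measurableT_comp mK (@measurable_swap _ _ T T); apply.
Qed.

(** Schur's test: Cauchy-Schwarz with [K] split into two square roots, one of them paired with
    [phi], and then Fubini. The bound by [M] on a square provides integrability. *)
Lemma schur (L M A : R) (K : R -> R -> R) phi psi : 0 <= A ->
  measurable_fun [set: T * T] (fun p : T * T => K p.1 p.2) ->
  (forall t s, 0 <= K t s) -> (forall t s, K t s <= M * ind 0 L t * ind 0 L s) ->
  (forall t, RI (K t) <= A) -> (forall s, RI (K^~ s) <= A) ->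
  sq phi -> mcf psi -> (forall t, nc (psi t) <= RI (fun s => K t s * nc (phi s))) ->
  sq psi -> nL psi <= A * nL phi.
Proof.
move=> A0 mK K0 KM h1 h2 sphi mpsi hpsi spsi.
have [i1 _ _] := @Fubini_dom _ K _ _ mK (riZ M (ri_ind 0 L)) (ri_ind 0 L)
  ltac:(by move=> x y; rewrite ger0_norm).
have mT : measurable_fun [set: T * T] (fun p : T * T => K p.2 p.1).
  exact: meas_swap mK.
have [i2 _ _] := @Fubini_dom _ (fun x y => K y x) _ _ mT (riZ M (ri_ind 0 L)) (ri_ind 0 L)
  ltac:(by move=> x y; rewrite ger0_norm ?(le_trans (KM y x))// mulrAC).
pose F t s := K t s * nc (phi s) ^+ 2.
have mF : measurable_fun [set: T * T] (fun p : T * T => F p.1 p.2).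
  apply: measurable_funM => //.
  by apply: (measurableT_comp (f := fun s : T => nc (phi s) ^+ 2));
    [exact: mf_nc2 (sq_mcf sphi)|exact: measurable_snd].
have KM1 x y : K x y <= M * ind 0 L x.
  have k1 := KM x y; have [y0|y0] := boolP (0 <= y <= L).
    by move: k1; rewrite (ind1 y0) mulr1.
  move: k1; rewrite (ind_0 y0) mulr0 => k1.
  have -> : K x y = 0 by apply/le_anti; rewrite K0 k1.
  have [x0|x0] := boolP (0 <= x <= L); last by rewrite ind_0// mulr0.
  have := KM x x; have := K0 x x; rewrite !(ind1 x0); lra.
have FM x y : `|F x y| <= M * ind 0 L x * nc (phi y) ^+ 2.
  by rewrite /F ger0_norm ?mulr_ge0 ?sqr_ge0 ?nc_ge0 ?K0//; apply: ler_wpM2r => //; exact: sqr_ge0.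
have [j1 j2 j3] := Fubini_dom mF (riZ M (ri_ind 0 L)) (sq_ri sphi) FM.
have k1 t : ri (fun s => K t s * nc (phi s)).
  apply: (ri_dom _ (riD (i1 t) (j1 t))).
    by apply: mfM; [exact: ri_mf (i1 t)|exact: mf_nc (sq_mcf sphi)].
  move=> s; rewrite ger0_norm; last exact: (mulr_ge0 (K0 t s) (nc_ge0 _)).
  exact: le_k_sq (K0 t s).
have pt t : nc (psi t) ^+ 2 <= A * RI (F t).
  have F0 : 0 <= RI (F t) by apply: RI_ge0 => s; rewrite mulr_ge0 ?sqr_ge0 ?nc_ge0 ?K0.
  have I0 : 0 <= RI (fun s => K t s * nc (phi s)).
    by apply: RI_ge0 => s; rewrite mulr_ge0 ?nc_ge0.
  apply: (@le_trans _ _ (RI (fun s => K t s * nc (phi s)) ^+ 2)).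
    by rewrite lerXn2r ?nnegrE ?nc_ge0.
  apply: (@le_trans _ _ (RI (K t) * RI (F t))); last by rewrite ler_wpM2r.
  apply: (le_of_amgm (RI_ge0 (K0 t)) F0 I0) => e e0.
  rewrite -(RIZ e (i1 t)) -(RIZ e^-1 (j1 t)) -(RIZ 2 (k1 t)).
  rewrite -(RID (riZ e (i1 t)) (riZ e^-1 (j1 t))).
  apply: (RI_le (riZ 2 (k1 t)) (riD (riZ e (i1 t)) (riZ e^-1 (j1 t)))) => s.
  exact: amgm_weight (K0 t s).
apply: le_of_sqr; first by rewrite mulr_ge0 ?nL_ge0.
rewrite exprMn !nL_sq.
apply: (@le_trans _ _ (RI (fun t => A * RI (F t)))).
  exact: (RI_le (sq_ri spsi) (riZ A j2) pt).
rewrite (RIZ _ j2) expr2 -mulrA; apply: (ler_wpM2l A0).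
rewrite j3 -(RIZ A (sq_ri sphi)).
have i3 s : RI (fun x => F x s) = nc (phi s) ^+ 2 * RI (K^~ s).
  by rewrite -(RIZ _ (i2 s)); congr RI; apply/funext => t; rewrite /F mulrC.
apply: RI_le.
- have FM' y x : `|F x y| <= nc (phi y) ^+ 2 * (M * ind 0 L x).
    by rewrite mulrC; exact: FM.
  by have [_ + _] := Fubini_dom (meas_swap mF) (sq_ri sphi) (riZ M (ri_ind 0 L)) FM'.
- exact/riZ/sq_ri.
by move=> s; rewrite i3 mulrC ler_wpM2r ?sqr_ge0.
Qed.

(* Up to a constant, the norm of [FT phi] on the line [Im z = r]. *)
Definition wn (r : R) phi := nL (fun t => (expR (- r * t))%:C%C * phi t).

Lemma mcf_expR (r : R) : mcf (fun t => (expR (- r * t))%:C%C).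
Proof. exact: (mcf_real (mf_expR (mfM (mf_cst _) (@mf_id R)))). Qed.

Lemma sq_wn c d r phi : sq phi -> supp c d phi -> sq (fun t => (expR (- r * t))%:C%C * phi t).
Proof.
move=> h s; apply: (@sqM_bnd _ (expR (`|- r| * (`|c| + `|d|)))) => //.
  exact: mcf_expR.
by move=> t /(suppP s) ?; rewrite nc_real ger0_norm ?expR_ge0// expR_bnd.
Qed.

(** The modulus of the kernel of [quot] relative to the weight [expR (- r * t)], with [k] the
    distance from [r] to [Im lam]; its integral in either variable is at most [k^-1]. *)
Definition dker (L k t s : R) : R :=
  ind 0 L t * ind 0 L s * heaviside (t - s) * expR (- k * (t - s)).

Lemma dker_ge0 L k t s : 0 <= dker L k t s.
Proof. by rewrite !mulr_ge0 ?ind_ge0 ?heaviside_ge0 ?expR_ge0. Qed.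

Lemma dker_le L k t s : 0 < k -> dker L k t s <= 1 * ind 0 L t * ind 0 L s.
Proof.
move=> k0; rewrite mul1r /dker -mulrA; apply: ler_piMr.
  exact: (mulr_ge0 (ind_ge0 _ _ _) (ind_ge0 _ _ _)).
rewrite /heaviside; case: (boolP (0 <= t - s)) => h; last by rewrite mul0r.
by rewrite mul1r -expR0 ler_expR; nra.
Qed.

Lemma dker_meas L k : measurable_fun [set: T * T] (fun p : T * T => dker L k p.1 p.2).
Proof.
have ms : measurable_fun [set: T * T] (fun p : T * T => p.1 - p.2).
  by apply: measurable_funB; [exact: measurable_fst|exact: measurable_snd].
apply: measurable_funM; last first.
  apply: (measurableT_comp (f := fun u : T => expR (- k * u)) _ ms).
  by apply: mf_expR; apply: mfM; [exact: mf_cst|exact: mf_id].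
apply: measurable_funM; last exact: (measurableT_comp mf_heaviside ms).
apply: measurable_funM.
  exact: (measurableT_comp (mf_ind 0 L) measurable_fst).
exact: (measurableT_comp (mf_ind 0 L) measurable_snd).
Qed.

Lemma dker_ri L k : 0 < k ->
  (forall t, ri (dker L k t)) /\ (forall s, ri ((dker L k)^~ s)).
Proof.
move=> k0; have [i1 _ _] := @Fubini_dom _ (dker L k) _ _ (dker_meas L k) (riZ 1 (ri_ind 0 L)) (ri_ind 0 L)
  ltac:(by move=> x y; rewrite ger0_norm ?dker_ge0 ?dker_le).
have mT : measurable_fun [set: T * T] (fun p : T * T => dker L k p.2 p.1).
  exact: (meas_swap (dker_meas L k)).
have [i2 _ _] := @Fubini_dom _ (fun x y => dker L k y x) _ _ mT (riZ 1 (ri_ind 0 L)) (ri_ind 0 L)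
  ltac:(by move=> x y; rewrite ger0_norm ?dker_ge0 ?(le_trans (dker_le L y x k0))// mulrAC).
by [].
Qed.

Lemma dker_int1 L k t : 0 < k -> RI (dker L k t) <= k^-1.
Proof.
move=> k0; have [i1 _] := dker_ri L k0.
have k1 : 0 < k^-1 by rewrite invr_gt0.
have [t0|t0] := boolP (0 <= t <= L); last first.
  have -> : dker L k t = fun=> 0 by apply/funext => s; rewrite /dker ind_0// !mul0r.
  by rewrite RI0 ltW.
case/andP: (t0) => t1 t2.
have E := RI_expR k t1.
apply: (@le_trans _ _ (RI (fun s => expR (- k * t) * (ind 0 t s * expR (k * s))))).
  apply: RI_le => // [|s]; first exact/riZ/ri_ind_expR.
  rewrite /dker (ind1 t0) mul1r mulrCA -expRD.
  have -> : - k * t + k * s = - k * (t - s) by ring.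
  rewrite ler_wpM2r ?expR_ge0// /ind /heaviside subr_ge0.
  by case: (0 <= s) => //=; case: (s <= t); rewrite ?mulr1 ?mulr0//; case: (s <= L).
rewrite RIZ; last exact: ri_ind_expR.
rewrite -(ler_pM2l k0) mulrCA E mulr0 expR0 mulfV ?gt_eqF// mulrBr -expRD mulNr addNr expR0 mulr1.
by rewrite gerBl expR_ge0.
Qed.

Lemma dker_int2 L k s : 0 < k -> RI ((dker L k)^~ s) <= k^-1.
Proof.
move=> k0; have [_ i1] := dker_ri L k0.
have k1 : 0 < k^-1 by rewrite invr_gt0.
have [s0|s0] := boolP (0 <= s <= L); last first.
  have -> : (dker L k)^~ s = fun=> 0 by apply/funext => t; rewrite /dker (ind_0 s0) mulr0 !mul0r.
  by rewrite RI0 ltW.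
case/andP: (s0) => s1 s2.
have E := RI_expR (- k) s2.
apply: (@le_trans _ _ (RI (fun t => expR (k * s) * (ind s L t * expR (- k * t))))).
  apply: RI_le => // [|t]; first exact/riZ/ri_ind_expR.
  rewrite /dker (ind1 s0) mulr1 mulrCA -expRD.
  have -> : k * s + - k * t = - k * (t - s) by ring.
  rewrite ler_wpM2r ?expR_ge0// /ind /heaviside subr_ge0.
  by case: (boolP (s <= t)) => st; rewrite ?mulr0 ?ler0n// (le_trans s1 st)/= mulr1.
rewrite RIZ; last exact: ri_ind_expR.
rewrite -(ler_pM2l k0) mulrCA mulfV ?gt_eqF//.
have -> : k * RI (fun t => ind s L t * expR (- k * t)) = expR (- k * s) - expR (- k * L) by lra.
rewrite mulrBr -expRD mulNr addrN expR0.
by rewrite gerBl mulr_ge0 ?expR_ge0.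
Qed.

(** On the line [Im z = r] the divisor [z - lam] has modulus at least [|r - Im lam|]. Schur's test
    gives the corresponding bound on the spectral side: above [Im lam] the kernel of [quot] decays
    exponentially, and below it the integral over [s <= t] is traded for the one over [s > t]. *)
Lemma wn_quot L lam r phi : 0 <= L -> sq phi -> supp 0 L phi -> FT phi lam = 0 ->
  r != Im lam -> wn r (quot 0 L lam phi) <= `|r - Im lam|^-1 * wn r phi.
Proof.
move=> L0 h s h0 rl; set y := Im lam in rl *; set k := `|r - y|.
have k0 : 0 < k by rewrite normr_gt0 subr_eq0.
have sw := sq_wn r h s.
have sdv := sq_quot lam h s; have spdv : supp 0 L (quot 0 L lam phi) by exact: supp_quot.
have mw := sq_mcf (sq_wn r sdv spdv).
have cih t := @ci_heaviside 0 L lam phi h s t.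
have ndv t : nc ((expR (- r * t))%:C%C * quot 0 L lam phi t) = ind 0 L t * expR ((y - r) * t) *
    nc (CI (fun s0 => (heaviside (t - s0))%:C%C * (phi s0 * ee lam s0))).
  rewrite /quot !ncM !nc_real ncN nci mul1r nc_ee !ger0_norm ?expR_ge0 ?ind_ge0//.
  rewrite ImN opprK -/y mulrBl expRD !mulrA mulNr; ring.
have [d1 d2] := dker_ri L k0.
have kinv : 0 <= k^-1 by rewrite invr_ge0 ltW.
(* The pointwise bound for both cases; [g] is the cut-off under the integral, [heaviside] or its
   complement. *)
have npt (K : R -> R -> R) (g : R -> R -> R) : (forall t, ci (fun s0 => (g t s0)%:C%C * (phi s0 * ee lam s0))) ->
   (forall t s0, 0 <= g t s0) ->
   (forall t, nc (CI (fun s0 => (heaviside (t - s0))%:C%C * (phi s0 * ee lam s0))) =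
      nc (CI (fun s0 => (g t s0)%:C%C * (phi s0 * ee lam s0)))) ->
   (forall t s0, 0 <= t <= L -> 0 <= s0 <= L -> K t s0 = g t s0 * expR ((y - r) * (t - s0))) ->
   (forall t s0, ind 0 L t = 0 -> K t s0 = 0) ->
   forall t, nc ((expR (- r * t))%:C%C * quot 0 L lam phi t) <=
     RI (fun s0 => K t s0 * nc ((expR (- r * s0))%:C%C * phi s0)).
  move=> hci g0 hE hK hK0 t; rewrite ndv.
  have [t0|t0] := boolP (0 <= t <= L); last first.
    rewrite ind_0// !mul0r; apply: RI_ge0 => s0.
    by rewrite hK0 ?mul0r// ind_0.
  rewrite ind1// mul1r hE.
  have nci_ := ci_nc (hci t).
  apply: (@le_trans _ _ (RI (fun s0 => expR ((y - r) * t) * nc ((g t s0)%:C%C * (phi s0 * ee lam s0))))).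
    by rewrite RIZ// ler_wpM2l ?expR_ge0// nc_CI_le.
  have E : (fun s0 => K t s0 * nc ((expR (- r * s0))%:C%C * phi s0)) =
      (fun s0 => expR ((y - r) * t) * nc ((g t s0)%:C%C * (phi s0 * ee lam s0))).
    apply/funext => s0; rewrite !ncM !nc_real !ger0_norm ?expR_ge0//.
    have [s1|s1] := boolP (0 <= s0 <= L); last by rewrite s// nc0 !(mulr0, mul0r).
    rewrite hK// nc_ee -/y.
    have -> : expR ((y - r) * (t - s0)) = expR ((y - r) * t) * expR (- y * s0) * expR (r * s0).
      by rewrite -!expRD; congr expR; ring.
    have e1 : expR (r * s0) * expR (- r * s0) = 1 by rewrite -expRD mulNr addrN expR0.
    transitivity (expR ((y - r) * t) * (g t s0 * (nc (phi s0) * expR (- y * s0))) *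
       (expR (r * s0) * expR (- r * s0))); first by ring.
    by rewrite e1 mulr1.
  by rewrite E.
have [ry|ry] := ltP y r.
  have kE : k = r - y by rewrite /k gtr0_norm// subr_gt0.
  apply: (@schur L 1 k^-1 (dker L k)) => //.
  - exact: dker_meas.
  - exact: dker_ge0.
  - by move=> t s0; exact: dker_le.
  - by move=> t; exact: dker_int1.
  - by move=> t; exact: dker_int2.
  - apply: (npt (dker L k) (fun t s0 => heaviside (t - s0))) => //.
    + by move=> t s0 t0 s1; rewrite /dker !ind1// !mul1r kE; congr (_ * expR _); ring.
    + by move=> t s0 it; rewrite /dker it !mul0r.
  - exact: sq_wn sdv spdv.
have {ry rl}ry : r < y by rewrite lt_neqAle rl.
have kE : k = y - r by rewrite /k ltr0_norm ?subr_lt0// opprB.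
have mT : measurable_fun [set: T * T] (fun p : T * T => dker L k p.2 p.1).
  exact: (meas_swap (dker_meas L k)).
have ci1 t : ci (fun s0 => (1 - heaviside (t - s0))%:C%C * (phi s0 * ee lam s0)).
  have -> : (fun s0 => (1 - heaviside (t - s0))%:C%C * (phi s0 * ee lam s0)) =
     (fun s0 => (phi s0 * ee lam s0) - (heaviside (t - s0))%:C%C * (phi s0 * ee lam s0)).
    by apply/funext => s0; rewrite rmorphB rmorph1; ring.
  by apply: ciB => //; exact: FT_ci s.
(* As [FT phi lam = 0], the two parts of the full integral differ only in sign. *)
have nCI t : nc (CI (fun s0 => (heaviside (t - s0))%:C%C * (phi s0 * ee lam s0))) =
      nc (CI (fun s0 => (1 - heaviside (t - s0))%:C%C * (phi s0 * ee lam s0))).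
  have -> : (fun s0 => (1 - heaviside (t - s0))%:C%C * (phi s0 * ee lam s0)) =
     (fun s0 => (phi s0 * ee lam s0) - (heaviside (t - s0))%:C%C * (phi s0 * ee lam s0)).
    by apply/funext => s0; rewrite rmorphB rmorph1; ring.
  rewrite CIB//; last exact: FT_ci s.
  by rewrite -/(FT phi lam) h0 sub0r ncN.
have h1 u : 0 <= 1 - heaviside u by rewrite subr_ge0 heaviside_le1.
(* The transposed [dker], except on the diagonal, where [K] is 0; hence the inequality [KD] instead
   of an equality. *)
pose K t s0 := ind 0 L t * ind 0 L s0 * (1 - heaviside (t - s0)) * expR (- k * (s0 - t)).
have KD t s0 : K t s0 <= dker L k s0 t.
  rewrite /K /dker mulrAC [ind 0 L s0 * _]mulrC [in leRHS]mulrAC ler_wpM2l//.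
    by rewrite !mulr_ge0 ?ind_ge0 ?expR_ge0.
  rewrite /heaviside !subr_ge0; case: (leP s0 t) => st; first by rewrite subrr ler0n.
  by rewrite subr0 (ltW st).
have K0 t s0 : 0 <= K t s0 by rewrite !mulr_ge0 ?ind_ge0 ?expR_ge0.
have mK : measurable_fun [set: T * T] (fun p : T * T => K p.1 p.2).
  have ms : measurable_fun [set: T * T] (fun p : T * T => p.1 - p.2).
    by apply: measurable_funB; [exact: measurable_fst|exact: measurable_snd].
  have ms' : measurable_fun [set: T * T] (fun p : T * T => p.2 - p.1).
    by apply: measurable_funB; [exact: measurable_snd|exact: measurable_fst].
  apply: measurable_funM; last first.
    apply: (measurableT_comp (f := fun u : T => expR (- k * u)) _ ms').
    by apply: mf_expR; apply: mfM; [exact: mf_cst|exact: mf_id].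
  apply: measurable_funM; last first.
    by apply: (measurableT_comp (f := fun u : T => 1 - heaviside u) _ ms); apply: mfB;
      [exact: mf_cst|exact: mf_heaviside].
  apply: measurable_funM.
    exact: (measurableT_comp (mf_ind 0 L) measurable_fst).
  exact: (measurableT_comp (mf_ind 0 L) measurable_snd).
have KM t s0 : K t s0 <= 1 * ind 0 L t * ind 0 L s0.
  by apply: le_trans (KD _ _) _; apply: le_trans (dker_le L s0 t k0) _; rewrite mulrAC.
have [i1 _ _] := @Fubini_dom _ K _ _ mK (riZ 1 (ri_ind 0 L)) (ri_ind 0 L)
  ltac:(by move=> x x'; rewrite ger0_norm).
have mKT : measurable_fun [set: T * T] (fun p : T * T => K p.2 p.1).
  exact: meas_swap mK.
have [i2 _ _] := @Fubini_dom _ (fun x y => K y x) _ _ mKT (riZ 1 (ri_ind 0 L)) (ri_ind 0 L)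
  ltac:(by move=> x x'; rewrite ger0_norm// (le_trans (KM x' x))// mulrAC).
apply: (@schur L 1 k^-1 K) => //.
- by move=> t; apply: le_trans (dker_int2 L t k0); apply: RI_le.
- by move=> s0; apply: le_trans (dker_int1 L s0 k0); apply: RI_le.
- apply: (npt K (fun t s0 => 1 - heaviside (t - s0))) => //.
  + by move=> t s0 t0 s1; rewrite /K !ind1// !mul1r kE; congr (_ * expR _); ring.
  + by move=> t s0 t0; rewrite /K t0 !mul0r.
- exact: sq_wn sdv spdv.
Qed.

(** Monotone because the spectrum lies in [t >= 0]; this is why spectra are translated to start at
    0. *)
Lemma wn_le L r r' phi : 0 <= L -> r' <= r -> sq phi -> supp 0 L phi -> wn r phi <= wn r' phi.
Proof.
move=> L0 rr h s; apply: nL_le.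
- exact: sq_mcf (sq_wn r h s).
- exact: sq_wn h s.
move=> t; rewrite !ncM !nc_real !ger0_norm ?expR_ge0//.
have [t0|t0] := boolP (0 <= t <= L); last by rewrite s// nc0 !mulr0.
rewrite ler_wpM2r ?nc_ge0// ler_expR; case/andP: t0 => t0 _; nra.
Qed.

Lemma wn0 phi : wn 0 phi = nL phi.
Proof. by apply: nL_eq => t; rewrite oppr0 mul0r expR0 mul1r. Qed.

End Division.

(** * The integral of (1 - cos ux) / x^2 *)

Section Plancherel.
Variable R : realType.
Local Notation mu := (@lebesgue_measure R).
Local Notation T := (measurableTypeR R).
Implicit Types (f g h : R -> R) (phi psi : R -> R[i]) (z w : R[i]).

(** The inverse is the limit of the continuous functions [x / (x ^+ 2 + 1 / n)], which also give the
    value 0 at 0. *)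
Lemma mf_inv f : mf f -> mf (fun t => (f t)^-1).
Proof.
move=> mf_; suff H : mf (fun x : R => x^-1) by exact: (measurableT_comp H mf_).
apply: (@measurable_fun_cvg _ T R setT (fun n x => x / (x ^+ 2 + n.+1%:R^-1))).
  move=> n; apply: mf_cont => x.
  have p : x ^+ 2 + n.+1%:R^-1 != 0 :> R by rewrite gt_eqF// ltr_wpDl ?sqr_ge0.
  apply: cvgM; first exact: cvg_id.
  apply: cvgV => //; apply: cvgD; last exact: cvg_cst.
  exact: exprn_continuous.
move=> x _; have [->|x0] := eqVneq x 0.
  by rewrite invr0; under eq_fun do rewrite mul0r; exact: cvg_cst.
have -> : x^-1 = x / (x ^+ 2 + 0) by rewrite addr0 expr2 invfM mulrA mulfV// mul1r.
apply: cvgM; first exact: cvg_cst.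
apply: cvgV; first by rewrite addr0 expf_neq0.
apply: cvgD; first exact: cvg_cst.
exact: cvg_harmonic.
Qed.

Lemma ri_oneDsqrV : ri (fun x : R => (1 + x ^+ 2)^-1).
Proof.
have c : continuous (fun x : R => (1 + x ^+ 2)^-1).
  exact: continuous_oneDsqrV.
apply: ri_lty; first exact: mf_cont.
have p (x : R) : 0 <= (1 + x ^+ 2)^-1.
  by rewrite invr_ge0 addr_ge0 ?sqr_ge0.
under eq_integral do rewrite ger0_norm//.
rewrite (@ge0_symfun_integralT R (fun x : R => (1 + x ^+ 2)^-1))//; last first.
  by move=> x /=; rewrite sqrrN.
rewrite -set_itvcy; have := @integral0y_oneDsqr R; rewrite /oneDsqr /= => ->.
by rewrite -EFinM ltry.
Qed.

(* [RI (q u)] is proportional to [|u|] by scaling; the value of [kq] is never needed. *)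
Definition q (u x : R) : R := (1 - cos (u * x)) / x ^+ 2.
Definition kq : R := RI (q 1).

Lemma q_ge0 u x : 0 <= q u x.
Proof. by rewrite divr_ge0 ?sqr_ge0// subr_ge0 cos_le1. Qed.

Lemma mf_q u : mf (q u).
Proof.
apply: mfM; last first.
  by apply: mf_inv; under eq_fun do rewrite expr2; apply: mfM; exact: mf_id.
apply: mfB; first exact: mf_cst.
by apply: mf_cos; apply: mfM; [exact: mf_cst|exact: mf_id].
Qed.

Lemma ri_q1 : ri (q 1).
Proof.
apply: (ri_dom (mf_q 1) (riZ 3 ri_oneDsqrV)) => x.
rewrite ger0_norm ?q_ge0// /q mul1r.
have p : 0 < 1 + x ^+ 2 by rewrite ltr_pwDl// sqr_ge0.
have [->|x0] := eqVneq x 0; first by rewrite expr0n/= invr0 mulr0 addr0 invr1 mulr1.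
have x2 : 0 < x ^+ 2 by rewrite lt_def sqrf_eq0 x0 sqr_ge0.
rewrite ler_pdivrMr// mulrAC ler_pdivlMr//.
(* The constant 3 exceeds 1/2 + 2: [(1 - cos x) * (1 + x ^+ 2)] is at most
   [x ^+ 2 / 2 + 2 * x ^+ 2]. *)
have := one_sub_cos_le x; have := cos_geN1 x; have := cos_le1 x; nra.
Qed.

Lemma qE u x : u != 0 -> q u x = u ^+ 2 * q 1 (u * x).
Proof.
move=> u0; rewrite /q mul1r exprMn.
have [->|x0] := eqVneq x 0; first by rewrite expr0n/= !mulr0 invr0 !mulr0.
by field; rewrite u0 x0.
Qed.

Lemma q0 x : q 0 x = 0.
Proof. by rewrite /q mul0r cos0 subrr mul0r. Qed.

Lemma ri_q u : ri (q u).
Proof.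
have [->|u0] := eqVneq u 0.
  have -> : q 0 = (fun=> 0) by apply/funext => x; rewrite q0.
  exact: ri0.
have -> : q u = (fun x => u ^+ 2 * q 1 (u * x + 0)).
  by apply/funext => x; rewrite addr0 qE.
by apply: riZ; have [] := affine_integral 0 u0 ri_q1.
Qed.

Lemma RI_q u : RI (q u) = `|u| * kq.
Proof.
have [->|u0] := eqVneq u 0.
  have -> : q 0 = (fun=> 0) by apply/funext => x; rewrite q0.
  by rewrite RI0 normr0 mul0r.
have [h1 h2] := affine_integral 0 u0 ri_q1.
have -> : q u = (fun x => u ^+ 2 * q 1 (u * x + 0)).
  by apply/funext => x; rewrite addr0 qE.
rewrite RIZ// /kq h2 -sqr_absr expr2 -mulrA; congr (_ * _).
Qed.

Lemma kq_gt0 : 0 < kq.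
Proof.
have c1 : cos 1 < 1 :> R.
  have := one_sub_cos (1 : R); have : 0 < sin (1 / 2 : R).
    by apply: sin_gt0_pihalf; have := @pi_ge2 R; lra.
  nra.
(* A lower bound for [q 1] on [[1, 2]]: there [cos x <= cos 1] and [x ^+ 2 <= 4]. *)
pose k : R := (1 - cos 1) / 4.
have k0 : 0 < k by rewrite /k; lra.
have E : RI (fun t => k * ind 1 2 t) = k.
  by rewrite RIZ ?RI_ind; [lra|lra|exact: ri_ind].
rewrite -E in k0; apply: (lt_le_trans k0); apply: RI_le.
- exact/riZ/ri_ind.
- exact: ri_q1.
move=> x; have [x1|x1] := boolP (1 <= x <= 2); last by rewrite ind_0// mulr0 q_ge0.
rewrite ind1// mulr1 /q mul1r /k; case/andP: x1 => x1 x2.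
have xs : 0 < x ^+ 2 by rewrite exprn_gt0; lra.
have hp := @pi_ge2 R.
have cx : cos x <= cos 1.
  have [->//|x3] := eqVneq x 1.
  by rewrite ltW// ltr_cos ?in_itv/=; [rewrite lt_neqAle eq_sym x3| |]; apply/andP; split; lra.
rewrite ler_pdivlMr//.
have : x ^+ 2 <= 4 by nra.
nra.
Qed.

(** The overlap of two intervals written with the four distances of endpoints, the shape in which
    [RI_q] produces it from [Re_bx2]. *)
Lemma RI_ind2_le (c d c' d' : R) : c <= d -> c' <= d' -> c <= c' ->
  ri (fun t => ind c d t * ind c' d' t) /\
  2 * RI (fun t => ind c d t * ind c' d' t) =
    `|d - c'| + `|c - d'| - `|d - d'| - `|c - c'|.
Proof.
move=> cd cd' cc'.
have E : (fun t => ind c d t * ind c' d' t) = ind c' (Num.min d d').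
  apply/funext => t; rewrite /ind -natrM mulnb le_min; congr (nat_of_bool _)%:R.
  have : (c' <= t) ==> (c <= t) by apply/implyP; exact: le_trans.
  by case: (c <= t); case: (t <= d); case: (c' <= t); case: (t <= d').
rewrite E; split; first exact: ri_ind.
rewrite (ler0_norm (x := c - c')) ?subr_le0//.
rewrite (ler0_norm (x := c - d')) ?subr_le0 ?(le_trans cc')//.
have [dd'|dd'] := leP d d'.
  rewrite (ler0_norm (x := d - d')) ?subr_le0//.
  have [h|h] := leP c' d.
    by rewrite RI_ind// ger0_norm ?subr_ge0//; ring.
  have -> : ind c' d = fun=> 0.
    apply/funext => t; rewrite /ind; case: (boolP (_ <= t <= _)) => // /andP[h1 h2].
    by have := le_lt_trans (le_trans h1 h2) h; rewrite ltxx.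
  by rewrite RI0 mulr0 ltr0_norm ?subr_lt0//; ring.
rewrite (gtr0_norm (x := d - d')) ?subr_gt0// RI_ind//.
by rewrite ger0_norm ?subr_ge0 ?(le_trans cd' (ltW dd'))//; ring.
Qed.

Lemma RI_ind2 (c d c' d' : R) : c <= d -> c' <= d' ->
  ri (fun t => ind c d t * ind c' d' t) /\
  2 * RI (fun t => ind c d t * ind c' d' t) =
    `|d - c'| + `|c - d'| - `|d - d'| - `|c - c'|.
Proof.
move=> cd cd'; have [h|h] := leP c c'; first exact: RI_ind2_le.
have [] := RI_ind2_le cd' cd (ltW h).
under eq_fun do rewrite mulrC; move=> h1 h2; split => //.
move: h2; under [X in 2 * RI X]eq_fun do rewrite mulrC; move=> ->.
by rewrite (distrC d' c) (distrC c' d) (distrC d' d) (distrC c' c); ring.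
Qed.

End Plancherel.

(** * Plancherel's formula, up to a constant *)

Section Plancherel2.
Variable R : realType.
Local Notation mu := (@lebesgue_measure R).
Local Notation T := (measurableTypeR R).
Implicit Types (f g h : R -> R) (phi psi : R -> R[i]) (z w : R[i]).

Lemma ae_except (a : R) (P : R -> Prop) : (forall t, t != a -> P t) -> {ae mu, forall t, P t}.
Proof.
move=> h; exists [set a]; split; [exact: measurable_set1|exact: lebesgue_measure_set1|].
by move=> t nt /=; apply: contra_notP nt => /eqP; exact: h.
Qed.

Lemma ri_ae f g : mf f -> ri g -> {ae mu, forall t, f t = g t} -> ri f.
Proof.
move=> mf_ gi h; apply: ri_lty => //.
have -> : (\int[mu]_t (`|f t|)%:E = \int[mu]_t (`|g t|)%:E)%E.
  apply: ae_eq_integral => //.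
  - exact: (mf_EFin (mf_norm mf_)).
  - exact: (mf_EFin (mf_norm (ri_mf gi))).
  case: h => N [mN N0 sub]; exists N; split => // t nt; apply: sub => ft; apply: nt.
  by move=> _; rewrite /= ft.
by rewrite -RI_EFin ?ltry//; exact: ri_norm.
Qed.

Lemma mcf2_ee : mcf2 (fun x t : R => ee x%:C%C t).
Proof.
have m : measurable_fun [set: T * T] (fun p : T * T => p.1 * p.2).
  by apply: measurable_funM; [exact: measurable_fst|exact: measurable_snd].
split.
  have -> : (fun p : T * T => Re (ee p.1%:C%C p.2)) = (fun p : T * T => cos (p.1 * p.2)).
    apply/funext => p; rewrite /ee ?cE.
    by rewrite !(mul0r, mulr0, mul1r, subr0, sub0r, oppr0, addr0, add0r, expR0).
  exact: (measurableT_comp (mf_cos (@mf_id R)) m).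
have -> : (fun p : T * T => Im (ee p.1%:C%C p.2)) = (fun p : T * T => sin (p.1 * p.2)).
  apply/funext => p; rewrite /ee ?cE.
  by rewrite !(mul0r, mulr0, mul1r, subr0, sub0r, oppr0, addr0, add0r, expR0).
exact: (measurableT_comp (mf_sin (@mf_id R)) m).
Qed.

Lemma ee_real (x t : R) : ee x%:C%C t = Complex (cos (x * t)) (sin (x * t)).
Proof.
apply: ceq; by rewrite /ee ?cE !(mul0r, mulr0, mul1r, subr0, sub0r, oppr0, addr0, add0r, expR0).
Qed.

Lemma nc_ee_real (x t : R) : nc (ee x%:C%C t) = 1.
Proof. by rewrite nc_ee ImC oppr0 mul0r expR0. Qed.

(** Fubini gives measurability after truncation to [[-n, n]], where a product dominates; at each
    point the truncations are eventually constant. *)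
Lemma mcf_FT c d phi : sq phi -> supp c d phi -> mcf (fun x : R => FT phi x%:C%C).
Proof.
move=> h s; have ci_phi := sq_ci h s.
have tr (n : nat) : mcf (fun x => (ind (- n%:R) n%:R x)%:C%C * FT phi x%:C%C).
  have [_ h2 _] : [/\ (forall x, ci (fun t => (ind (- n%:R) n%:R x)%:C%C * (phi t * ee x%:C%C t))),
     ci (fun x => CI (fun t => (ind (- n%:R) n%:R x)%:C%C * (phi t * ee x%:C%C t))) &
     CI (fun x => CI (fun t => (ind (- n%:R) n%:R x)%:C%C * (phi t * ee x%:C%C t))) =
     CI (fun t => CI (fun x => (ind (- n%:R) n%:R x)%:C%C * (phi t * ee x%:C%C t)))].
    apply: (CFubini_dom (g := ind (- n%:R) n%:R) (h := fun t => nc (phi t))).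
    - apply: mcf2M; first exact: (mcf2_fst (mcf_ind _ _)).
      by apply: mcf2M; [exact: (mcf2_snd (sq_mcf h))|exact: mcf2_ee].
    - exact: ri_ind.
    - exact: ci_nc.
    - move=> x t; rewrite !ncM nc_ee_real mulr1 nc_real ger0_norm ?ind_ge0//.
  have -> : (fun x => (ind (- n%:R) n%:R x)%:C%C * FT phi x%:C%C) =
      (fun x => CI (fun t => (ind (- n%:R) n%:R x)%:C%C * (phi t * ee x%:C%C t))).
    by apply/funext => x; rewrite CIZ//; exact: FT_ci s.
  exact: ci_mcf.
have cv (P : R[i] -> R) : P 0 = 0 -> (forall (n : nat), mf (fun x => P ((ind (- n%:R) n%:R x)%:C%C * FT phi x%:C%C))) ->
    mf (fun x => P (FT phi x%:C%C)).
  move=> P0 hP; apply: (@measurable_fun_cvg _ T R setT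
    (fun (n : nat) x => P ((ind (- n%:R) n%:R x)%:C%C * FT phi x%:C%C))) => // x _.
  apply: cvg_near_cst; exists (Num.truncn `|x|).+1 => //= n /= hn.
  rewrite ind1 ?mul1r//.
  have hx : `|x| <= n%:R.
    apply: le_trans (ltW (truncnS_gt _)) _; by rewrite ler_nat.
  by move: hx; rewrite ler_norml.
split; apply: (cv) => // n; [exact: (tr n).1|exact: (tr n).2].
Qed.

Lemma CI_sesq (I : Type) (s : seq I) (A : I -> R[i]) (F : I -> R -> R[i]) :
  (forall i, sq (F i)) ->
  CI (fun t => (\sum_(i <- s) A i * F i t) * (\sum_(i <- s) A i * F i t)^*%C) =
  \sum_(i <- s) \sum_(j <- s) A i * (A j)^*%C * CI (fun t => F i t * (F j t)^*%C).
Proof.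
move=> h.
have c1 i j : ci (fun t => F i t * (F j t)^*%C) by exact: (sqM_ci (h i) (sqJ (h j))).
transitivity (CI (fun t => \sum_(i <- s) \sum_(j <- s) A i * (A j)^*%C * (F i t * (F j t)^*%C))).
  congr CI; apply/funext => t; rewrite mulr_suml; apply: eq_bigr => i _.
  rewrite rmorph_sum mulr_sumr; apply: eq_bigr => j _.
  by rewrite rmorphM/=; ring.
rewrite CI_sum; last by move=> i; apply: ci_sum => j; exact: (ciZ _ (c1 i j)).
apply: eq_bigr => i _; rewrite CI_sum; last by move=> j; exact: (ciZ _ (c1 i j)).
by apply: eq_bigr => j _; rewrite (CIZ _ (c1 i j)).
Qed.

Lemma nL_CI phi : sq phi -> (nL phi ^+ 2)%:C%C = CI (fun t => phi t * (phi t)^*%C).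
Proof.
move=> h; rewrite nL_sq; under [X in CI X]eq_fun do rewrite mulJc.
apply: ceq; rewrite ?Re_CI ?Im_CI ?cE//.
by under eq_fun do rewrite ImC; rewrite RI0.
Qed.

Definition bx (c d x : R) : R[i] := FT (fun t => (ind c d t)%:C%C) x%:C%C.

Lemma sq_ind c d : sq (fun t : R => (ind c d t)%:C%C : R[i]).
Proof.
apply: (sq_bnd (M := 1) (c := c) (d := d) (mcf_ind c d)) => t h.
  by rewrite ind1// nc1.
by rewrite ind_0.
Qed.

Lemma supp_indc c d : supp c d (fun t : R => (ind c d t)%:C%C : R[i]).
Proof. by move=> t h; rewrite ind_0. Qed.

Lemma mcf_bx c d : mcf (bx c d).
Proof. exact: (mcf_FT (@sq_ind c d) (@supp_indc c d)). Qed.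

Lemma bxE c d x : c <= d -> x != 0 ->
  bx c d x = Complex ((sin (x * d) - sin (x * c)) / x) ((cos (x * c) - cos (x * d)) / x).
Proof.
move=> cd x0; have := FT_box x%:C%C cd; rewrite -/(bx c d x) !ee_real => h.
have hr := congr1 (fun w => Re w) h; have hi := congr1 (fun w => Im w) h.
move: hr hi => /=; rewrite ?cE !(mul0r, mulr0, mul1r, subr0, addr0, add0r, sub0r) => hr hi.
apply: ceq; rewrite ?cE; apply: (mulfI x0); rewrite mulrCA divff// mulr1//.
  by move: hi; rewrite oppr0 mul0r add0r.
by move: hr; rewrite oppr0 mul0r sub0r => hr; apply: oppr_inj; rewrite hr opprB.
Qed.

Lemma bx_nc2 c d x : c <= d -> x != 0 -> nc (bx c d x) ^+ 2 = 2 * q (d - c) x.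
Proof.
move=> cd x0; rewrite bxE// nc_sq ?cE /q [(d - c) * x]mulrBl cosB (mulrC d) (mulrC c).
have h1 := cos2Dsin2 (x * c); have h2 := cos2Dsin2 (x * d).
rewrite !expr_div_n -!mulrDl mulrA; congr (_ / _).
move: h1 h2; set C1 := cos _; set S1 := sin _; set C2 := cos _; set S2 := sin _ => h1 h2.
have -> : 2 * (1 - (C2 * C1 + S2 * S1)) = (C1 ^+ 2 + S1 ^+ 2) + (C2 ^+ 2 + S2 ^+ 2) - 2 * (C2 * C1 + S2 * S1).
  by rewrite h1 h2; ring.
ring.
Qed.

Lemma sq_bx c d : c <= d -> sq (bx c d).
Proof.
move=> cd; split; first exact: mcf_bx.
apply: (ri_ae (mf_nc2 (mcf_bx _ _)) (riZ 2 (ri_q (d - c)))).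
by apply: (@ae_except 0) => x x0; exact: bx_nc2.
Qed.

Lemma bxN c d x : bx c d (- x) = (bx c d x)^*%C.
Proof.
rewrite /bx /FT rmorphN; apply: ceq; rewrite ?cE ?Re_CI ?Im_CI.
  by congr RI; apply/funext => t; rewrite -rmorphN !ee_real ?cE [(- x) * t]mulNr sinN cosN; ring.
transitivity (RI (fun t => -1 * Im ((ind c d t)%:C%C * ee x%:C%C t))).
  by congr RI; apply/funext => t; rewrite -rmorphN !ee_real ?cE [(- x) * t]mulNr sinN cosN; ring.
rewrite (RIZ _ (FT_ci _ (@sq_ind c d) (@supp_indc c d)).2) mulN1r -Im_CI//.
Qed.

Lemma Re_bx2 c d c' d' x : c <= d -> c' <= d' -> x != 0 ->
  Re (bx c d x * (bx c' d' x)^*%C) = q (d - c') x + q (c - d') x - q (d - d') x - q (c - c') x.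
Proof.
move=> cd cd' x0; rewrite !bxE// ?cE /q [(d - c') * x]mulrBl [(c - d') * x]mulrBl [(d - d') * x]mulrBl [(c - c') * x]mulrBl.
rewrite !cosB (mulrC d) (mulrC c) (mulrC d') (mulrC c').
by field.
Qed.

(** Polarised Plancherel for two intervals. The real part is a combination of four functions [q],
    whose integrals are proportional to the distances of endpoints; the imaginary part is odd. *)
Lemma CI_bx2 c d c' d' : c <= d -> c' <= d' ->
  CI (fun x => bx c d x * (bx c' d' x)^*%C) =
  (2 * kq R)%:C%C * CI (fun t => (ind c d t)%:C%C * ((ind c' d' t)%:C%C)^*%C).
Proof.
move=> cd cd'; have [i1 i2] := RI_ind2 cd cd'.
have cG : ci (fun x => bx c d x * (bx c' d' x)^*%C).
  exact: (sqM_ci (sq_bx cd) (sqJ (sq_bx cd'))).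
have e1 : CI (fun t => (ind c d t)%:C%C * ((ind c' d' t)%:C%C)^*%C) =
    (RI (fun t => ind c d t * ind c' d' t))%:C%C.
  apply: ceq; rewrite ?Re_CI ?Im_CI ?cE.
    by congr RI; apply/funext => t; rewrite ?cE oppr0 mulr0 subr0.
  rewrite -(RI0 R); congr RI; apply/funext => t; rewrite ?cE; ring.
rewrite e1 -rmorphM/=; apply: ceq; rewrite ?Re_CI ?Im_CI ?cE.
  transitivity (RI (fun x => q (d - c') x + q (c - d') x - q (d - d') x - q (c - c') x)).
    apply: RI_ae; [exact: (ri_mf cG.1)| |].
      by do !apply: mfB; try apply: mfD; exact: mf_q.
    by apply: (@ae_except 0) => x x0; exact: Re_bx2.
  have h1 := riD (ri_q (d - c')) (ri_q (c - d')).
  have h2 := riB h1 (ri_q (d - d')).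
  rewrite (RIB h2 (ri_q (c - c'))) (RIB h1 (ri_q (d - d'))) (RID (ri_q (d - c')) (ri_q (c - d'))).
  rewrite !RI_q -!mulrDl -!mulrBl -i2; ring.
apply: RI_odd; first exact: cG.2.
by move=> x; rewrite !bxN ?cE; ring.
Qed.

End Plancherel2.

(** * Step functions and their limits *)

Section Plancherel3.
Variable R : realType.
Local Notation mu := (@lebesgue_measure R).
Local Notation T := (measurableTypeR R).
Implicit Types (f g h : R -> R) (phi psi : R -> R[i]) (z w : R[i]).

(** The inequalities are bundled with the interval, so that lists of boxes need no side
    conditions. *)
Record box (c d : R) := Box { bl : R; br : R; bP : [/\ c <= bl, bl <= br & br <= d] }.

Definition step_fun c d (s : seq (R[i] * box c d)) (t : R) : R[i] :=
  \sum_(p <- s) p.1 * (ind (bl p.2) (br p.2) t)%:C%C.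

(* Limits in L2 of step functions.  Every square-integrable function is one, but this is easier to
   check by hand for the few functions that matter. *)
Definition step_limit c d phi := [/\ sq phi, supp c d phi &
  forall e, 0 < e -> exists s : seq (R[i] * box c d), nL (fun t => phi t - step_fun s t) <= e].

Lemma supp_box c d (p : box c d) : supp c d (fun t => (ind (bl p) (br p) t)%:C%C : R[i]).
Proof. by have [h1 _ h3] := bP p; exact: (supp_sub h1 h3 (@supp_indc _ _ _)). Qed.

Lemma sq_step_fun c d (s : seq (R[i] * box c d)) : sq (step_fun s).
Proof. by apply: sq_sum => p; exact: (sqZ p.1 (@sq_ind _ _ _)). Qed.

Lemma supp_step_fun c d (s : seq (R[i] * box c d)) : supp c d (step_fun s).
Proof. by apply: supp_sum => p; exact: (suppZ p.1 (supp_box p.2)). Qed.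

Lemma FT_step_fun c d (s : seq (R[i] * box c d)) (x : R) :
  FT (step_fun s) x%:C%C = \sum_(p <- s) p.1 * bx (bl p.2) (br p.2) x.
Proof.
rewrite /step_fun (FT_sum (c := c) (d := d) s x%:C%C (fun p => sqZ p.1 (@sq_ind _ _ _)) (fun p => suppZ p.1 (supp_box p.2))).
by apply: eq_bigr => p _; rewrite (FTZ p.1 x%:C%C (@sq_ind _ _ _) (@supp_indc _ _ _)).
Qed.

(** Both squared norms expand into the same double sum, and [CI_bx2] compares them term by term. *)
Lemma Plancherel_step_fun c d (s : seq (R[i] * box c d)) :
  sq (fun x => FT (step_fun s) x%:C%C) /\
  nL (fun x => FT (step_fun s) x%:C%C) = Num.sqrt (2 * kq R) * nL (step_fun s).
Proof.
have e1 : (fun x : R => FT (step_fun s) x%:C%C) = (fun x => \sum_(p <- s) p.1 * bx (bl p.2) (br p.2) x).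
  by apply/funext => x; exact: FT_step_fun.
have hb (p : R[i] * box c d) : sq (bx (bl p.2) (br p.2)).
  by have [_ h _] := bP p.2; exact: sq_bx.
have h1 : sq (fun x : R => FT (step_fun s) x%:C%C).
  by rewrite e1; apply: sq_sum => p; exact: (sqZ p.1 (hb p)).
have k0 : 0 <= 2 * kq R by rewrite mulr_ge0// ltW// kq_gt0.
split => //; apply/eqP; rewrite -(@eqrXn2 _ 2)//; last 2 first.
- exact: nL_ge0.
- by rewrite mulr_ge0 ?nL_ge0 ?sqrtr_ge0.
rewrite exprMn (sqr_sqrtr k0); apply/eqP.
suff : (nL (fun x : R => FT (step_fun s) x%:C%C) ^+ 2)%:C%C = (2 * kq R * nL (step_fun s) ^+ 2)%:C%C :> R[i].
  by move/complexI.
have cM (x y : R) : (x * y)%:C%C = x%:C%C * y%:C%C :> R[i] by rewrite -rmorphM.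
rewrite (nL_CI h1) (cM (2 * kq R)) (nL_CI (sq_step_fun s)).
under [X in CI X = _]eq_fun do rewrite FT_step_fun.
rewrite (CI_sesq s (fun p => p.1) hb) (CI_sesq s (fun p => p.1) (fun p => @sq_ind _ (bl p.2) (br p.2))).
rewrite mulr_sumr; apply: eq_bigr => p _; rewrite mulr_sumr; apply: eq_bigr => p' _.
have [_ h _] := bP p.2; have [_ h' _] := bP p'.2.
by rewrite CI_bx2//; ring.
Qed.

Lemma step_limitD c d phi psi : step_limit c d phi -> step_limit c d psi -> step_limit c d (fun t => phi t + psi t).
Proof.
move=> [h1 h2 h3] [k1 k2 k3]; split; [exact: sqD|exact: suppD|] => e e0.
have e2 : 0 < e / 2 by rewrite divr_gt0.
have [s hs] := h3 _ e2; have [s' hs'] := k3 _ e2; exists (s ++ s').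
have -> : (fun t => phi t + psi t - step_fun (s ++ s') t) =
    (fun t => (phi t - step_fun s t) + (psi t - step_fun s' t)).
  by apply/funext => t; rewrite /step_fun big_cat/=; ring.
apply: le_trans (nLD (sqB h1 (sq_step_fun s)) (sqB k1 (sq_step_fun s'))) _; lra.
Qed.

Lemma step_limit_step_fun c d (s : seq (R[i] * box c d)) : step_limit c d (step_fun s).
Proof.
split; [exact: sq_step_fun|exact: supp_step_fun|] => e e0; exists s.
by under [X in nL X]eq_fun do rewrite subrr; rewrite nL0 ltW.
Qed.

Lemma step_limitZ c d (k : R[i]) phi : step_limit c d phi -> step_limit c d (fun t => k * phi t).
Proof.
move=> [h1 h2 h3]; split; [exact: sqZ|exact: suppZ|] => e e0.
have n0 : 0 < nc k + 1 by rewrite ltr_wpDl ?nc_ge0.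
have [s hs] := h3 (e / (nc k + 1)) (divr_gt0 e0 n0).
exists [seq (k * p.1, p.2) | p <- s].
have -> : (fun t => k * phi t - step_fun [seq (k * p.1, p.2) | p <- s] t) =
    (fun t => k * (phi t - step_fun s t)).
  apply/funext => t; rewrite /step_fun big_map mulrBr mulr_sumr; congr (_ - _).
  by apply: eq_bigr => p _ /=; rewrite mulrA.
rewrite (nLZ _ (sqB h1 (sq_step_fun s))).
apply: (@le_trans _ _ ((nc k + 1) * (e / (nc k + 1)))).
  by apply: ler_pM; rewrite ?nc_ge0 ?nL_ge0 ?lerDl.
by rewrite mulrC divfK ?gt_eqF.
Qed.

Lemma step_limitB c d phi psi : step_limit c d phi -> step_limit c d psi -> step_limit c d (fun t => phi t - psi t).
Proof.
by move=> h k; under eq_fun do rewrite -mulN1r; exact: (step_limitD h (step_limitZ (-1) k)).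
Qed.

Lemma step_limit_sum c d (I : Type) (s : seq I) (F : I -> R -> R[i]) :
  (forall i, step_limit c d (F i)) -> step_limit c d (fun t => \sum_(i <- s) F i t).
Proof.
move=> h; elim: s => [|i s IH].
  have -> : (fun t => \sum_(i <- [::]) F i t) = step_fun ([::] : seq (R[i] * box c d)).
    by apply/funext => t; rewrite /step_fun !big_nil.
  exact: step_limit_step_fun.
by under eq_fun do rewrite big_cons; exact: step_limitD.
Qed.

Lemma step_limit_sub c d c' d' phi : c' <= c -> d <= d' -> step_limit c d phi -> step_limit c' d' phi.
Proof.
move=> hc hd [h1 h2 h3]; split; [done|exact: (supp_sub hc hd h2)|] => e e0.
have [s hs] := h3 _ e0.
pose wb (p : box c d) : box c' d' :=
  Box (match bP p with And3 a1 a2 a3 => And3 (le_trans hc a1) a2 (le_trans a3 hd) end).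
exists [seq (p.1, wb p.2) | p <- s].
by under [X in nL X]eq_fun do rewrite /step_fun big_map.
Qed.

Lemma cvg_of_dist (u : nat -> R) (l C : R) : (forall n, `|u n - l| <= C * n.+1%:R^-1) ->
  u n @[n --> \oo] --> l.
Proof.
move=> h.
have h0 : C * n.+1%:R^-1 @[n --> \oo] --> (0 : R).
  by rewrite -(mulr0 C); apply: cvgM; [exact: cvg_cst|exact: cvg_harmonic].
have h1 : l - C * n.+1%:R^-1 @[n --> \oo] --> l.
  by rewrite -[X in _ --> X]subr0; apply: cvgB => //; exact: cvg_cst.
have h2 : l + C * n.+1%:R^-1 @[n --> \oo] --> l.
  by rewrite -[X in _ --> X]addr0; apply: cvgD => //; exact: cvg_cst.
apply: squeeze_cvgr h1 h2; near=> n; rewrite -ler_distl; exact: h.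
Unshelve. all: by end_near.
Qed.

Lemma nc_sqr_cvg (u : nat -> R[i]) w (C : R) : (forall n, nc (w - u n) <= C * n.+1%:R^-1) ->
  nc (u n) ^+ 2 @[n --> \oo] --> nc w ^+ 2.
Proof.
move=> h; have : nc (u n) @[n --> \oo] --> nc w.
  apply: (@cvg_of_dist _ _ C) => n; apply: le_trans (h n).
  rewrite ler_norml; have := ncB_ge (u n) w; have := ncB_ge w (u n); rewrite (ncB (u n) w); lra.
by move=> k; rewrite expr2; under eq_fun do rewrite expr2; exact: cvgM.
Qed.

Lemma FT_nL c d phi (x : R) : sq phi -> supp c d phi -> nc (FT phi x%:C%C) <= nL phi * nL (en c d 0).
Proof.
move=> h s; apply: le_trans (FT_bound _ h s) _; apply: ler_wpM2l; first exact: nL_ge0.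
by rewrite (@nL_eq _ (en c d x%:C%C) (en c d 0))// => t; rewrite /en !ncM !nc_ee ImC Im0.
Qed.

(** As spectra are bounded, the transforms of the approximating step functions converge at every
    point, and Fatou's lemma bounds the limit. *)
Lemma Plancherel_le c d phi : step_limit c d phi ->
  sq (fun x => FT phi x%:C%C) /\
  nL (fun x => FT phi x%:C%C) <= Num.sqrt (2 * kq R) * nL phi.
Proof.
move=> [h1 h2 h3]; set K := Num.sqrt _.
have K0 : 0 <= K by exact: sqrtr_ge0.
have main e : 0 < e -> ri (fun x => nc (FT phi x%:C%C) ^+ 2) /\
    RI (fun x => nc (FT phi x%:C%C) ^+ 2) <= (K * (nL phi + e)) ^+ 2.
  move=> e0.
  have ex n : exists s : seq (R[i] * box c d), nL (fun t => phi t - step_fun s t) <= e * n.+1%:R^-1.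
    by apply: h3; rewrite mulr_gt0// invr_gt0.
  have [s hs] := choice ex.
  apply: (Fatou_bound (F := fun n x => nc (FT (step_fun (s n)) x%:C%C) ^+ 2)).
  - move=> n; exact: (sq_ri (Plancherel_step_fun (s n)).1).
  - by move=> n t; exact: sqr_ge0.
  - move=> x; apply: (@nc_sqr_cvg _ _ (e * nL (en c d 0))) => n.
    rewrite -(FTB _ h1 h2 (sq_step_fun (s n)) (@supp_step_fun _ _ (s n))).
    apply: le_trans (FT_nL _ (sqB h1 (sq_step_fun _)) (suppB h2 (@supp_step_fun _ _ _))) _.
    by rewrite mulrAC; apply: ler_wpM2r; [exact: nL_ge0|exact: hs].
  - move=> n; rewrite -nL_sq (Plancherel_step_fun (s n)).2 -/K.
    rewrite !exprMn; apply: ler_wpM2l; first exact: sqr_ge0.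
    rewrite lerXn2r ?nnegrE ?addr_ge0 ?nL_ge0 ?(ltW e0)//.
    have := nLB h1 (sqB h1 (sq_step_fun (s n))).
    have -> : (fun t => phi t - (phi t - step_fun (s n) t)) = step_fun (s n) by apply/funext => t; ring.
    move=> /le_trans; apply; rewrite lerD2l; apply: le_trans (hs n) _.
    by rewrite ler_piMr ?(ltW e0)// invf_le1 ?ler1n.
have [r1 _] := main 1 ltr01.
split; first by split => //; exact: (mcf_FT h1 h2).
apply/ler_addgt0Pr => e e0.
have d0 : 0 < e / (K + 1) by rewrite divr_gt0// ltr_wpDl.
have [_ hm] := main _ d0.
apply: (@le_trans _ _ (K * (nL phi + e / (K + 1)))).
  apply: le_of_sqr; last by rewrite nL_sq.
  by rewrite mulr_ge0// addr_ge0 ?nL_ge0 ?ltW.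
rewrite mulrDr lerD2l mulrCA ler_piMr ?ltW//.
by rewrite ltr_pdivrMr ?mul1r ?ltrDl// ltr_wpDl.
Qed.

Lemma Plancherel_arith (KS F D KP KQ Kw e : R) : KS <= F + D -> KP <= KQ + KS -> KQ <= Kw ->
  2 * Kw <= e -> D <= KQ -> KP <= F + e.
Proof. lra. Qed.

(** The reverse inequality comes from a single step function: [Plancherel_le] controls the transform
    of the error, and the triangle inequality is used on both sides. *)
Lemma Plancherel c d phi : step_limit c d phi ->
  sq (fun x => FT phi x%:C%C) /\
  nL (fun x => FT phi x%:C%C) = Num.sqrt (2 * kq R) * nL phi.
Proof.
move=> h; have [s1 le1] := Plancherel_le h; split => //.
apply/eqP; rewrite eq_le le1 /=; have [h1 h2 h3] := h.
set K := Num.sqrt _ in le1 *.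
have K0 : 0 <= K by exact: sqrtr_ge0.
apply/ler_addgt0Pr => e e0.
have d0 : 0 < e / (2 * K + 1) by rewrite divr_gt0// ltr_wpDl// mulr_ge0.
have [s hs] := h3 _ d0.
have hd := step_limitB h (step_limit_step_fun s); have [s2 le2] := Plancherel_le hd.
have [s3 e3] := Plancherel_step_fun s.
have a1 : nL phi <= nL (fun t => phi t - step_fun s t) + nL (step_fun s).
  have := nLD (sqB h1 (sq_step_fun s)) (sq_step_fun s); by under [X in nL X]eq_fun do rewrite subrK.
have a2 : nL (fun x => FT (step_fun s) x%:C%C) <= nL (fun x => FT phi x%:C%C) +
    nL (fun x => FT (fun t => phi t - step_fun s t) x%:C%C).
  apply: le_trans (nLB s1 s2); under [X in _ <= nL X]eq_fun do
    rewrite (FTB _ h1 h2 (sq_step_fun s) (@supp_step_fun _ _ s)) subKr.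
  exact: lexx.
have a3 : K * nL phi <= K * (nL (fun t => phi t - step_fun s t) + nL (step_fun s)) by exact: ler_wpM2l.
have a4 : K * nL (fun t => phi t - step_fun s t) <= K * (e / (2 * K + 1)) by exact: ler_wpM2l.
have a5 : 2 * (K * (e / (2 * K + 1))) <= e.
  rewrite mulrA mulrCA ler_piMr ?(ltW e0)// ler_pdivrMr ?mul1r ?lerDl//.
  by rewrite ltr_wpDl// mulr_ge0.
by move: a2 a3; rewrite -/K e3 mulrDr => a2 a3; exact: (Plancherel_arith a2 a3 a4 a5 le2).
Qed.

(** The hypothesis is uniform continuity on [[c, d]]; jumps to 0 at the two ends are allowed. *)
Lemma step_limit_cont c d phi : c < d -> sq phi -> supp c d phi ->
  (forall e, 0 < e -> exists2 r, 0 < r & forall s t, c <= s <= t -> t <= d -> t - s <= r ->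
    nc (phi t - phi s) <= e) -> step_limit c d phi.
Proof.
move=> cd h1 h2 h3; split => // e e0.
have sd : 0 < Num.sqrt (d - c) by rewrite sqrtr_gt0 subr_gt0.
have [r r0 hr] := h3 (e / Num.sqrt (d - c)) (divr_gt0 e0 sd).
set N := (Num.truncn ((d - c) / r)).+1.
have N0 : (0 : R) < N%:R by rewrite ltr0n.
pose k := (d - c) / N%:R.
have k0 : 0 < k by rewrite divr_gt0// subr_gt0.
have kr : k <= r.
  rewrite ler_pdivrMr// mulrC -ler_pdivrMr//; exact: (ltW (truncnS_gt _)).
have Nk : N%:R * k = d - c by rewrite mulrC divfK// gt_eqF.
pose tj (j : nat) := c + j%:R * k.
have tjP (j : nat) : (j <= N)%N -> [/\ c <= tj j, tj j <= d & d <= d].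
  move=> jN; split => //; first by rewrite lerDl mulr_ge0// ltW.
  by rewrite -lerBrDl -Nk; apply: ler_wpM2r; [exact: ltW|rewrite ler_nat].
pose b0 : box c d := Box (And3 (lexx c) (ltW cd) (lexx d)).
(* All boxes extend to [d] and carry the increments of [phi]; at [t] the sum telescopes to the value
   of [phi] at the last grid point before [t]. *)
pose bj (j : 'I_N) : box c d := Box (tjP j.+1 (ltn_ord j)).
pose s := (phi c, b0) :: [seq (phi (tj j.+1) - phi (tj j), bj j) | j : 'I_N].
exists s.
have sE t : c <= t <= d -> exists2 u, c <= u <= t /\ t - u <= k & step_fun s t = phi u.
  move=> ctd; have /andP[ct td] := ctd.
  have tk0 : 0 <= (t - c) / k by rewrite divr_ge0 ?subr_ge0// ltW.
  pose J := Num.truncn ((t - c) / k).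
  have JN : (J <= N)%N.
    rewrite -(ler_nat R); apply: (@le_trans _ _ ((t - c) / k)); first by rewrite truncn_le.
    by rewrite ler_pdivrMr// Nk lerD2r.
  have J1 : tj J <= t.
    by rewrite -lerBrDl -ler_pdivlMr// truncn_le.
  have J2 : t < tj J.+1.
    by rewrite -ltrBlDl -ltr_pdivrMr//; exact: truncnS_gt.
  exists (tj J).
    split; first by rewrite J1 lerDl mulr_ge0// ltW.
    by move: J2; rewrite /tj -(natr1 J); lra.
  rewrite /step_fun big_cons /= (ind1 ctd) mulr1 big_map big_enum /=.
  rewrite (eq_bigr (fun j : 'I_N => if (j < J)%N then phi (tj j.+1) - phi (tj j) else 0)); last first.
    move=> j _; case: (ltnP j J) => hj.
      rewrite ind1 ?mulr1// td andbT; apply: le_trans J1.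
      by rewrite lerD2l; apply: ler_wpM2r; [exact: ltW|rewrite ler_nat].
    rewrite ind_0 ?mulr0// negb_and -ltNge; apply/orP; left.
    apply: lt_le_trans J2 _; rewrite lerD2l; apply: ler_wpM2r; [exact: ltW|by rewrite ler_nat].
  rewrite -big_mkcond /= -(big_mkord (fun j => j < J)%N (fun j => phi (tj j.+1) - phi (tj j))).
  rewrite -(big_nat_widen 0 J N xpredT (fun j => phi (tj j.+1) - phi (tj j)) JN).
  by rewrite telescope_sumr// /tj mul0r addr0 addrC subrK.
have hb t : c <= t <= d -> nc (phi t - step_fun s t) <= e / Num.sqrt (d - c).
  move=> ctd; have [u [cu uk] ->] := sE _ ctd; have /andP[_ td] := ctd.
  exact: (hr _ _ cu td (le_trans uk kr)).
have := nL_bnd (ltW cd) (mcfB (sq_mcf h1) (sq_mcf (sq_step_fun s))) hb.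
have dc : 0 < d - c by rewrite subr_gt0.
rewrite expr_div_n (sqr_sqrtr (ltW dc)) divfK ?gt_eqF// => hh.
apply: le_of_sqr; first exact: ltW.
by apply: hh => t ht; rewrite h2// (@supp_step_fun _ _ s)// subrr.
Qed.

End Plancherel3.

(** * Injectivity of the Fourier transform *)

Section Injectivity.
Variable R : realType.
Local Notation mu := (@lebesgue_measure R).
Local Notation T := (measurableTypeR R).
Implicit Types (f g h : R -> R) (phi psi : R -> R[i]) (z w : R[i]).

(* By Lebesgue's differentiation theorem. *)
Lemma prim_ae f : ri f -> (forall t, RI (fun s => heaviside (t - s) * f s) = 0) ->
  {ae mu, forall t, f t = 0}.
Proof.
move=> fi h0.
have E x : \int[mu]_(t in [set` `]-oo, x]]) f t = 0.
  rewrite -(h0 x) Rintegral_mkcond; congr RI; apply/funext => s; rewrite patchE /heaviside subr_ge0.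
  case: ifPn; first by rewrite inE /= in_itv /= => ->; rewrite mul1r.
  by rewrite notin_setE /= in_itv /= => /negP/negbTE ->; rewrite mul0r.
have i1 y : mu.-integrable `]-oo, y] (EFin \o f).
  by apply: (integrableS measurableT _ _ fi) => //; exact: measurable_itv.
have i2 : locally_integrable [set: R] f.
  by apply: open_integrable_locally => //; exact: openT.
have [N [mN N0 sub]] := FTC1Ny i1 i2.
exists N; split => // t nt; apply: sub => /= -[_ hd]; apply: nt.
apply: etrans (esym hd) _.
have -> : (fun x => \int[mu]_(t in [set` `]-oo, x]]) f t) = cst 0 by apply/funext => x; exact: E.
exact: derive1_cst.
Qed.

Section prim.
Variables (c d : R) (phi : R -> R[i]).
Hypotheses (hphi : sq phi) (sphi : supp c d phi).

(** The factor [ee 0 s] is 1; it keeps the shape of [quot] at [lam = 0]. *)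
Definition prim phi (t : R) : R[i] := CI (fun s => (heaviside (t - s))%:C%C * (phi s * ee 0 s)).

Lemma quot_prim t : quot c d 0 phi t = (ind c d t)%:C%C * (- 'i%C * prim phi t).
Proof. by rewrite /quot oppr0 ee0 mulr1. Qed.

Lemma heaviside_sub (s t u : R) : s <= t -> nc ((heaviside (t - u))%:C%C - (heaviside (s - u))%:C%C : R[i]) <= ind s t u.
Proof.
move=> st; rewrite -rmorphB nc_real /heaviside /ind !subr_ge0.
case: (leP u s) => h1.
  by rewrite (le_trans h1 st) subrr normr0.
rewrite (ltW h1) /= subr0; case: (u <= t) => /=; by rewrite ?normr1 ?normr0.
Qed.

Lemma prim_holder (s t : R) : s <= t ->
  nc (prim phi t - prim phi s) <= Num.sqrt (t - s) * nL phi.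
Proof.
move=> st; have c1 := @ci_heaviside _ c d 0 phi hphi sphi.
rewrite /prim -(CIB (c1 t) (c1 s)); apply: le_trans (nc_CI_le (ciB (c1 t) (c1 s))) _.
have i1 := ci_nc (sqM_ci (@sq_ind _ s t) hphi).
apply: (@le_trans _ _ (RI (fun u => nc ((ind s t u)%:C%C * phi u)))).
  apply: RI_le => //; first exact: (ci_nc (ciB (c1 t) (c1 s))).
  move=> u; rewrite ee0 mulr1 -mulrBl !ncM; apply: ler_wpM2r; first exact: nc_ge0.
  by rewrite nc_real ger0_norm ?ind_ge0//; exact: heaviside_sub.
apply: le_trans (CS_nc (@sq_ind _ s t) hphi) _; apply: ler_wpM2r; first exact: nL_ge0.
apply: le_of_sqr; first exact: sqrtr_ge0.
rewrite nL_sq; under [X in RI X]eq_fun do rewrite nc_real ger0_norm ?ind_ge0//.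
have -> : (fun u : R => ind s t u ^+ 2) = ind s t.
  by apply/funext => u; rewrite /ind; case: (_ <= _ <= _); rewrite ?expr1n ?expr0n.
by rewrite RI_ind// (@sqr_sqrtr _ (t - s)) ?subr_ge0.
Qed.

Lemma step_limit_quot : c < d -> step_limit c d (quot c d 0 phi).
Proof.
move=> cd; apply: step_limit_cont => //; [exact: sq_quot|exact: supp_quot|] => e e0.
have n1 : 0 < nL phi + 1 by rewrite ltr_wpDl ?nL_ge0.
exists ((e / (nL phi + 1)) ^+ 2); first by rewrite exprn_gt0// divr_gt0.
move=> s t /andP[cs st] td hst; rewrite !quot_prim !ind1 ?cs ?td ?(le_trans cs st) ?(le_trans st td)//.
rewrite !mul1r -mulrBr ncM ncN nci mul1r; apply: le_trans (prim_holder st) _.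
apply: (@le_trans _ _ (e / (nL phi + 1) * (nL phi + 1))); last by rewrite divfK ?gt_eqF.
apply: ler_pM; rewrite ?sqrtr_ge0 ?nL_ge0 ?lerDl//.
apply: le_of_sqr; first by rewrite divr_ge0 ?ltW.
by rewrite (@sqr_sqrtr _ (t - s)) ?subr_ge0.
Qed.

Lemma nL_ae0 psi : mcf psi -> {ae mu, forall t, psi t = 0} -> nL psi = 0.
Proof.
move=> m [N [mN N0 sub]]; rewrite /nL (@RI_ae _ _ (fun _ => 0)) ?RI0 ?sqrtr0//.
- exact: mf_nc2.
- exact: mf_cst.
exists N; split => // t nt; apply: sub => /= h; apply: nt; by rewrite /= h nc0 expr0n.
Qed.

(* The quotient of the transform by [z] is the transform of the primitive, which is continuous, so that
   [Plancherel] applies to it. *)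
Lemma FT_inj : c < d -> (forall z, FT phi z = 0) -> nL phi = 0.
Proof.
move=> cd h0.
have ct : ci phi by exact: (sq_ci hphi sphi).
have hs := step_limit_quot cd; have [s1 e1] := Plancherel hs.
(* The transform of the quotient vanishes at every real [x] other than 0, hence almost everywhere,
   and [Plancherel] applies. *)
have n0 : nL (quot c d 0 phi) = 0.
  have : Num.sqrt (2 * kq R) * nL (quot c d 0 phi) = 0.
    rewrite -e1; apply: nL_ae0; first exact: sq_mcf s1.
    apply: (@ae_except _ 0) => x x0.
    have := @FT_quot _ c d 0 phi hphi sphi x%:C%C (h0 0); rewrite h0 subr0 => /eqP.
    by rewrite mulf_eq0 (inj_eq (@complexI R)) (negbTE x0) => /eqP.
  move/eqP; rewrite mulf_eq0 sqrtr_eq0 leNgt mulr_gt0 ?kq_gt0//= => /eqP//.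
(* To the right of [d] the primitive is the full integral, which is [FT phi 0 = 0]. *)
have pout t : ~~ (c <= t <= d) -> prim phi t = 0.
  rewrite negb_and -!ltNge => /orP[tc|dt].
    rewrite /prim -(CI0 R); congr CI; apply/funext => s; rewrite /heaviside subr_ge0.
    case: leP => st; rewrite ?mul0r// sphi ?mul0r ?mulr0//.
    by rewrite negb_and -ltNge (le_lt_trans st tc).
  rewrite -(h0 0) /prim; congr CI; apply/funext => s; rewrite /heaviside subr_ge0.
  case: leP => st; rewrite ?mul1r// sphi ?mul0r ?mulr0//.
  by rewrite negb_and -!ltNge (lt_trans dt st) orbT.
have p0 t : prim phi t = 0.
  case: (boolP (c <= t <= d)) => [ctd|]; last exact: pout.
  (* If the primitive had modulus [eta] at [t], Hölder continuity would keep it above [eta / 2]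
     within distance [r], and a piece of that neighbourhood inside [[c, d]] would give the quotient
     a positive norm. *)
  apply/eqP; rewrite -nc_eq0; apply: contraT => eta0.
  set eta := nc _ in eta0; have e0 : 0 < eta by rewrite lt_def eta0 nc_ge0.
  pose K := nL phi + 1; have K0 : 0 < K by rewrite ltr_wpDl ?nL_ge0.
  pose r := (eta / (2 * K)) ^+ 2; have r0 : 0 < r by rewrite exprn_gt0// divr_gt0// mulr_gt0.
  have near u : `|u - t| <= r -> eta / 2 <= nc (prim phi u).
    move=> hu.
    have hd : nc (prim phi u - prim phi t) <= eta / 2.
      apply: (@le_trans _ _ (Num.sqrt `|u - t| * nL phi)).
        case: (leP u t) => ut.
          by rewrite ncB ler0_norm ?subr_le0// opprB; exact: prim_holder.
        by rewrite gtr0_norm ?subr_gt0//; apply: prim_holder; exact: ltW.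
      apply: (@le_trans _ _ (eta / (2 * K) * K)); last first.
        by rewrite invfM mulrA divfK ?gt_eqF.
      apply: ler_pM; rewrite ?sqrtr_ge0 ?nL_ge0 ?lerDl//.
      apply: le_of_sqr; first by rewrite divr_ge0 ?mulr_ge0 ?ltW.
      by rewrite (@sqr_sqrtr _ `|u - t|).
    have := ncB_ge (prim phi t) (prim phi u); rewrite ncB -/eta; lra.
  have [/andP[ct1 td1]] := (conj ctd I) => _.
  pose lo := Num.max c (t - r); pose hi := Num.min d (t + r).
  have lohi : lo < hi by rewrite gt_max !lt_min; apply/and3P; split; lra.
  have : RI (fun u => (eta / 2) ^+ 2 * ind lo hi u) <= nL (quot c d 0 phi) ^+ 2.
    rewrite nL_sq; apply: RI_le; first exact: (riZ _ (ri_ind _ _)).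
      by have [[]] := hs.
    move=> u; rewrite /ind; case: (boolP (lo <= u <= hi)) => hu; last by rewrite mulr0 sqr_ge0.
    move: hu; rewrite ge_max le_min => /andP[/andP[cu ru] /andP[ud ur]].
    rewrite mulr1 quot_prim ind1 ?cu ?ud// mul1r ncM ncN nci mul1r.
    rewrite lerXn2r ?nnegrE ?nc_ge0 ?divr_ge0 ?(ltW e0)//.
    by apply: near; rewrite ler_norml; apply/andP; split; lra.
  rewrite n0 expr0n (RIZ _ (ri_ind _ _)) RI_ind ?(ltW lohi)// leNgt mulr_gt0//.
    by rewrite exprn_gt0// divr_gt0.
  by rewrite subr_gt0.
have ez (P : R[i] -> R) : (forall t, RI (fun s => heaviside (t - s) * P (phi s)) = P (prim phi t)) ->
    P 0 = 0 -> ri (fun s => P (phi s)) -> {ae mu, forall t, P (phi t) = 0}.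
  by move=> h1 h2 h3; apply: prim_ae => // t; rewrite h1 p0 h2.
have a1 := ez (fun w => Re w) _ erefl ct.1; have a2 := ez (fun w => Im w) _ erefl ct.2.
have [|N1 [mN1 N10 sub1]] := a1.
  move=> t; rewrite /prim Re_CI; congr RI; apply/funext => s; rewrite ee0 mulr1 ?cE; ring.
have [|N2 [mN2 N20 sub2]] := a2.
  move=> t; rewrite /prim Im_CI; congr RI; apply/funext => s; rewrite ee0 mulr1 ?cE; ring.
apply: nL_ae0; first exact: sq_mcf.
exists (N1 `|` N2); split; [exact: measurableU|by rewrite measureU0|].
move=> t nt; apply: contrapT => h; apply: nt => /=; apply: ceq; rewrite ?cE.
  by apply: contrapT => h'; apply: h; left; apply: sub1.
by apply: contrapT => h'; apply: h; right; apply: sub2.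
Qed.

End prim.
End Injectivity.

(** * Interpolation and density in a Hilbert space *)

Section Hilbert.
Variable R : realType.
Local Notation mu := (@lebesgue_measure R).
Implicit Types (phi psi : R -> R[i]) (z w : R[i]).

Lemma nLD_sq phi psi : sq phi -> sq psi ->
  nL (fun t => phi t + psi t) ^+ 2 =
  nL phi ^+ 2 + nL psi ^+ 2 + 2 * Re (CI (fun t => phi t * (psi t)^*%C)).
Proof.
move=> h k; rewrite !nL_sq Re_CI.
have i1 := (sqM_ci h (sqJ k)).1.
rewrite -(RID (sq_ri h) (sq_ri k)) -(RIZ 2 i1) -(RID (riD (sq_ri h) (sq_ri k)) (riZ 2 i1)).
by congr RI; apply/funext => t; rewrite !nc_sq ?cE; ring.
Qed.

Lemma parallelogram phi psi : sq phi -> sq psi ->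
  nL (fun t => phi t + psi t) ^+ 2 + nL (fun t => phi t - psi t) ^+ 2 =
  2 * nL phi ^+ 2 + 2 * nL psi ^+ 2.
Proof.
move=> h k; rewrite (nLD_sq h k) (nLD_sq h (sqN k)) nLN.
have -> : CI (fun t => phi t * (- psi t)^*%C) = - CI (fun t => phi t * (psi t)^*%C).
  by rewrite -(CIN (sqM_ci h (sqJ k))); congr CI; apply/funext => t; rewrite rmorphN mulrN.
by rewrite ReN; ring.
Qed.

Lemma CI_J phi : ci phi -> CI (fun t => (phi t)^*%C) = (CI phi)^*%C.
Proof.
move=> h; apply: ceq; rewrite ?cE ?Re_CI ?Im_CI.
  by congr RI; apply/funext => t; rewrite ?cE.
by rewrite -mulN1r -(RIZ (-1) h.2); congr RI; apply/funext => t; rewrite ?cE mulN1r.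
Qed.

Variables (I : choiceType) (Lam : set I) (v : I -> R -> R[i]) (Z : set R).
Hypotheses (hv : forall i, sq (v i)) (hvZ : forall i t, Z t -> v i t = 0).

Definition inL (s : seq I) := uniq s /\ forall i, i \in s -> Lam i.
(** Summability of a nonnegative family is expressed by its finite partial sums, so that [Lam] is
    never enumerated. *)
Definition bsum (w : I -> R) (B : R) := forall s, inL s -> \sum_(i <- s) w i <= B.
Definition gz phi := sq phi /\ forall t, Z t -> phi t = 0.
Definition lc (s : seq I) (k : I -> R[i]) (t : R) : R[i] := \sum_(i <- s) k i * v i t.

Lemma sq_lc s k : sq (lc s k).
Proof. by apply: sq_sum => i; exact: sqZ. Qed.

Lemma CI_lc phi s k : sq phi ->
  CI (fun t => phi t * lc s k t) = \sum_(i <- s) k i * CI (fun t => phi t * v i t).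
Proof.
move=> h; rewrite /lc.
transitivity (CI (fun t => \sum_(i <- s) k i * (phi t * v i t))).
  by congr CI; apply/funext => t; rewrite mulr_sumr; apply: eq_bigr => i _; ring.
rewrite CI_sum; last by move=> i; exact: (ciZ (k i) (sqM_ci h (hv i))).
by apply: eq_bigr => i _; rewrite (CIZ _ (sqM_ci h (hv i))).
Qed.

(** No bound for [phi] is supplied; obtaining one is the purpose of [riesz_lower_bound] and
    [sampling_bound]. *)
Hypothesis hX : forall (a : I -> R[i]) B, bsum (fun i => nc (a i) ^+ 2) B ->
  exists2 phi, gz phi & forall i, Lam i -> CI (fun t => phi t * v i t) = a i.

Lemma biorth i : Lam i -> exists2 g, gz g & forall j, Lam j -> CI (fun t => g t * v j t) = (j == i)%:R.
Proof.
move=> hi; apply: (hX (a := fun j => (j == i)%:R) (B := 1)) => s [us _].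
rewrite (eq_bigr (fun j => if j == i then 1 else 0)).
  rewrite -big_mkcond /= big_const_seq iter_addr_0 -mulr_natl mulr1 -/(count_mem i s).
  by rewrite (count_uniq_mem _ us); case: (i \in s); rewrite ?ler01.
by move=> j _; case: (j == i); rewrite ?nc1 ?nc0 ?expr1n ?expr0n.
Qed.

Lemma coef_bound i : Lam i -> exists2 B, 0 <= B & forall s k, inL s -> i \in s ->
  nc (k i) <= B * nL (lc s k).
Proof.
move=> hi; have [g [sg _] hg] := biorth hi; exists (nL g); first exact: nL_ge0.
move=> s k [us hs] si; have := CS sg (sq_lc s k); rewrite CI_lc//.
rewrite (bigD1_seq i)//= hg// eqxx mulr1 big1_seq ?addr0//.
by move=> j /andP[/negbTE ji js]; rewrite hg ?ji ?mulr0//; exact: hs.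
Qed.

Definition riesz_lower_on (F : seq I) := exists C, forall s k, inL s -> (forall i, i \in s -> i \notin F) ->
  \sum_(i <- s) nc (k i) ^+ 2 <= C * nL (lc s k) ^+ 2.

(** The coefficient at [i] is controlled by the norm of the whole combination, through the
    biorthogonal vector. Removing that term thus enlarges the norm by a bounded factor only, and the
    bound for combinations avoiding [i] applies to the rest. *)
Lemma riesz_lower_on_cons i F : riesz_lower_on (i :: F) -> riesz_lower_on F.
Proof.
move=> [C hC].
case: (pselect (Lam i)) => [hi|ni]; last first.
  exists C => s k hs hF; apply: hC => // j js; rewrite inE negb_or hF// andbT.
  by apply: contra_notN ni => /eqP <-; exact: hs.2.
have [B B0 hB] := coef_bound hi.
exists (`|C| * (1 + B * nL (v i)) ^+ 2 + B ^+ 2) => s k hs hF; have [us hs2] := hs.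
set N := nL (lc s k); have N0 : 0 <= N by exact: nL_ge0.
have V0 : 0 <= nL (v i) by exact: nL_ge0.
have K1 : C * N ^+ 2 <= (`|C| * (1 + B * nL (v i)) ^+ 2 + B ^+ 2) * N ^+ 2.
  apply: ler_wpM2r; first exact: sqr_ge0.
  apply: (@le_trans _ _ `|C|); first exact: ler_norm.
  rewrite -[leLHS]addr0; apply: lerD; last exact: sqr_ge0.
  rewrite -[leLHS]mulr1; apply: ler_wpM2l; first exact: normr_ge0.
  by rewrite -[leLHS](expr1n _ 2) lerXn2r ?nnegrE ?lerDl ?addr_ge0 ?mulr_ge0.
case: (boolP (i \in s)) => is_; last first.
  apply: le_trans K1; apply: hC => // j js; rewrite inE negb_or hF// andbT.
  by apply: contraNN is_ => /eqP <-.
have inr : inL (rem i s).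
  by split; [exact: rem_uniq|move=> j /mem_rem; exact: hs2].
have h1 := hB _ k hs is_; rewrite -/N in h1.
have eL : lc (rem i s) k = (fun t => lc s k t - k i * v i t).
  by apply/funext => t; rewrite /lc [in RHS](big_rem i is_)/= addrC addrK.
have h2 : nL (lc (rem i s) k) <= N * (1 + B * nL (v i)).
  rewrite eL; apply: le_trans (nLB (sq_lc s k) (sqZ (k i) (hv i))) _.
  rewrite (nLZ _ (hv i)) mulrDr mulr1 lerD2l mulrCA mulrA; exact: ler_wpM2r.
have h3 : \sum_(j <- rem i s) nc (k j) ^+ 2 <= C * nL (lc (rem i s) k) ^+ 2.
  apply: hC => // j; rewrite mem_rem_uniq// !inE => /andP[ji js].
  by rewrite negb_or ji hF.
rewrite (big_rem i is_)/= mulrDl addrC; apply: lerD; last first.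
  by rewrite -exprMn lerXn2r ?nnegrE ?nc_ge0 ?mulr_ge0.
apply: le_trans h3 _; rewrite -mulrA -exprMn mulrC [leRHS]mulrC.
apply: (@le_trans _ _ (nL (lc (rem i s) k) ^+ 2 * `|C|)).
  by apply: ler_wpM2l; [exact: sqr_ge0|exact: ler_norm].
apply: ler_wpM2r; first exact: normr_ge0.
by rewrite lerXn2r ?nnegrE ?nL_ge0 ?mulr_ge0 ?addr_ge0 ?mulr_ge0// (mulrC _ N).
Qed.

(* Gliding hump.  Finite combinations violating the bound can be found with disjoint supports, since the
   bound passes from [i :: F] to [F]; their coefficients, suitably scaled, are data that no vector interpolates. *)
Lemma riesz_lower_bound : riesz_lower_on [::].
Proof.
apply: contrapT => nRF.
have nR F : ~ riesz_lower_on F by elim: F => // i F IH /riesz_lower_on_cons.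
(* A block away from [F] with unit coefficients in the square norm but a vector of norm at most
   [4^-n]; the factor [16 ^+ n] below is the square of this rate. *)
have step (F : seq I) (n : nat) : exists p : seq I * (I -> R[i]),
   [/\ inL p.1, (forall i, i \in p.1 -> i \notin F),
     \sum_(i <- p.1) nc (p.2 i) ^+ 2 = 1 & nL (lc p.1 p.2) <= (1 / 4) ^+ n].
  have [s [k [hs hF hlt]]] : exists s k, [/\ inL s, (forall i, i \in s -> i \notin F) &
     16 ^+ n * nL (lc s k) ^+ 2 < \sum_(i <- s) nc (k i) ^+ 2].
    apply: contrapT => h; apply: (nR F); exists (16 ^+ n) => s k hs hF.
    by rewrite leNgt; apply/negP => hh; apply: h; exists s, k.
  set S := \sum_(i <- s) _ in hlt.
  have S0 : 0 < S by apply: le_lt_trans hlt; rewrite mulr_ge0 ?exprn_ge0 ?nL_ge0//.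
  have q0 : 0 < Num.sqrt S by rewrite sqrtr_gt0.
  have q2 : Num.sqrt S ^+ 2 = S by apply: sqr_sqrtr; exact: ltW.
  exists (s, fun i => (Num.sqrt S)^-1%:C%C * k i); split => //=.
    transitivity (\sum_(i <- s) S^-1 * nc (k i) ^+ 2).
      apply: eq_bigr => i _; rewrite ncM exprMn nc_real sqr_absr exprVn q2//.
    by rewrite -mulr_sumr -/S mulVf ?gt_eqF.
  have -> : lc s (fun i => (Num.sqrt S)^-1%:C%C * k i) = (fun t => (Num.sqrt S)^-1%:C%C * lc s k t).
    by apply/funext => t; rewrite /lc mulr_sumr; apply: eq_bigr => i _; rewrite mulrA.
  rewrite (nLZ _ (sq_lc s k)) nc_real ger0_norm ?invr_ge0 ?(ltW q0)//.
  rewrite mulrC ler_pdivrMr//; apply: le_of_sqr; first by rewrite mulr_ge0 ?exprn_ge0 ?(ltW q0).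
  rewrite exprMn q2 -exprM mulnC exprM expr_div_n expr1n.
  have -> : (4 : R) ^+ 2 = 16 by ring.
  by rewrite expr_div_n expr1n mul1r ler_pdivlMl ?exprn_gt0// ltW.
have [pk hpk] := choice (fun Fn : seq I * nat => step Fn.1 Fn.2).
pose Fs := fix Fs n := if n is m.+1 then Fs m ++ (pk (Fs m, m)).1 else [::].
pose S n := (pk (Fs n, n)).1; pose k n := (pk (Fs n, n)).2.
have hS n : [/\ inL (S n), (forall i, i \in S n -> i \notin Fs n),
     \sum_(i <- S n) nc (k n i) ^+ 2 = 1 & nL (lc (S n) (k n)) <= (1 / 4) ^+ n] := hpk (Fs n, n).
have sub n m i : (n < m)%N -> i \in S n -> i \in Fs m.
  elim: m => // m IH; rewrite ltnS leq_eqVlt /= mem_cat => /predU1P[<- ->|nm si]; first by rewrite orbT.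
  by rewrite IH.
have dis n m i : i \in S n -> i \in S m -> n = m.
  move=> h1 h2; case: (ltngtP n m) => // nm.
    by have [_ /(_ _ h2)] := hS m; rewrite (sub _ _ _ nm h1).
  by have [_ /(_ _ h1)] := hS n; rewrite (sub _ _ _ nm h2).
(* An index in no block gets the default 0; [a] therefore tests membership once more. *)
pose n0 i : nat := xget 0%N [set n | i \in S n].
have n0P n i : i \in S n -> n0 i = n.
  by move=> h; apply: (dis _ _ i) => //; rewrite /n0; case: xgetP => [m _ //|/(_ n)].
(* On block [n] the data are [2^-n] times the conjugate coefficients. They are square-summable, yet
   an interpolating [phi] pairs to [2^-n] with a vector of norm [4^-n], so its norm is at least
   [2^n] for every [n]. *)
pose a i : R[i] := if i \in S (n0 i) then ((1 / 2) ^+ n0 i)%:C%C * (k (n0 i) i)^*%C else 0.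
have h20 n : (0 : R) <= (1 / 2) ^+ n by rewrite exprn_ge0.
have ha : bsum (fun i => nc (a i) ^+ 2) 2.
  move=> s [us _].
  pose N := \max_(i <- s) (n0 i).+1.
  have hN i : i \in s -> (n0 i < N)%N by move=> is_; rewrite /N (big_rem i is_) /= leq_max leqnn.
  apply: (@le_trans _ _ (\sum_(i <- s) \sum_(n < N) (1 / 2) ^+ n * (if i \in S n then nc (k n i) ^+ 2 else 0))).
    rewrite big_seq [leRHS]big_seq; apply: ler_sum => i is_.
    rewrite /a; case: ifPn => ih; last first.
      rewrite nc0 expr0n; apply: sumr_ge0 => n _; apply: mulr_ge0 => //.
      by case: ifP => // _; exact: sqr_ge0.
    rewrite (bigD1 (Ordinal (hN i is_)))//= ih -[leLHS]addr0; apply: lerD; last first.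
      apply: sumr_ge0 => n _; apply: mulr_ge0 => //.
      by case: ifP => // _; exact: sqr_ge0.
    rewrite ncM ncJ exprMn; apply: ler_wpM2r; first exact: sqr_ge0.
    rewrite nc_real ger0_norm// expr2 -[leRHS]mulr1; apply: ler_wpM2l => //.
    by apply: exprn_ile1; lra.
  rewrite exchange_big /=; apply: le_trans (half_pow_sum R N).
  apply: ler_sum => n _; rewrite -mulr_sumr -[leRHS]mulr1; apply: ler_wpM2l => //.
  have [[uS _] _ <- _] := hS n.
  rewrite -big_mkcond /= -big_filter [leRHS](bigID (mem s)) /= -[leLHS]addr0.
  apply: lerD; last by apply: sumr_ge0 => j _; exact: sqr_ge0.
  rewrite -[leRHS]big_filter (perm_big [seq j <- S n | j \in s]) ?lexx//.
  apply: uniq_perm; rewrite ?filter_uniq// => j.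
  by rewrite !mem_filter andbC.
have [phi [sphi _] hphi] := hX ha.
have key n : (1 / 2) ^+ n <= nL phi * (1 / 4) ^+ n.
  have [[uS hL] _ e1 hn] := hS n.
  apply: (@le_trans _ _ (nL phi * nL (lc (S n) (k n)))); last by apply: ler_wpM2l; first exact: nL_ge0.
  have := CS sphi (sq_lc (S n) (k n)); rewrite CI_lc//.
  have -> : \sum_(i <- S n) k n i * CI (fun t => phi t * v i t) = ((1 / 2) ^+ n)%:C%C.
    transitivity (((1 / 2) ^+ n)%:C%C * (\sum_(i <- S n) nc (k n i) ^+ 2)%:C%C : R[i]).
      rewrite rmorph_sum mulr_sumr.
      rewrite big_seq [RHS]big_seq; apply: eq_bigr => i iS.
      by rewrite (hphi _ (hL _ iS)) /a (n0P _ _ iS) iS mulrCA mulJc.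
    by rewrite e1 mulr1.
  by rewrite nc_real ger0_norm.
have h4 n : (2 : R) ^+ n <= nL phi.
  have p0 : (0 : R) < (1 / 2) ^+ n by rewrite exprn_gt0.
  have e4 : (1 / 4 : R) ^+ n = (1 / 2) ^+ n * (1 / 2) ^+ n by rewrite -exprMn; congr (_ ^+ _); field.
  have e2 : (1 / 2 : R) ^+ n = (2 ^+ n)^-1 by rewrite div1r exprVn.
  have := key n; rewrite e4 mulrA => h.
  have : 1 <= nL phi * (1 / 2) ^+ n by rewrite -(ler_pM2r p0) (mul1r ((1 / 2) ^+ n)).
  by rewrite e2 ler_pdivlMr ?exprn_gt0// mul1r.
have := h4 (Num.truncn (nL phi)).+1; apply/negP; rewrite -ltNge.
apply: lt_le_trans (truncnS_gt _) _; rewrite -natrX ler_nat.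
by apply: ltnW; apply: ltn_expl.
Qed.

(** * Density of the span and the sampling inequality *)

Hypothesis hU : forall phi, gz phi -> (forall i, Lam i -> CI (fun t => phi t * v i t) = 0) ->
  nL phi = 0.

Definition sp (l : seq (R[i] * I)) (t : R) : R[i] := \sum_(p <- l) p.1 * v p.2 t.
Definition inS (l : seq (R[i] * I)) := forall p, p \in l -> Lam p.2.

Lemma sq_sp l : sq (sp l).
Proof. by apply: sq_sum => p; exact: sqZ. Qed.

Lemma gz_sp l : gz (sp l).
Proof.
split; first exact: sq_sp.
by move=> t Zt; apply: big1 => p _; rewrite hvZ ?mulr0.
Qed.

Lemma gzB phi psi : gz phi -> gz psi -> gz (fun t => phi t - psi t).
Proof.
by move=> [h1 h2] [k1 k2]; split; [exact: sqB|move=> t Zt; rewrite h2// k2// subrr].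
Qed.

Lemma sp_lc l : inS l -> exists s k, inL s /\ sp l = lc s k.
Proof.
move=> hl; exists (undup (map snd l)), (fun i => \sum_(p <- l | p.2 == i) p.1); split.
  split; first exact: undup_uniq.
  by move=> i; rewrite mem_undup => /mapP[p pl ->]; exact: hl.
apply/funext => t; rewrite /lc /sp.
under [RHS]eq_bigr do rewrite big_mkcond mulr_suml.
rewrite exchange_big /= big_seq [RHS]big_seq; apply: eq_bigr => p pl.
rewrite (bigD1_seq p.2) ?undup_uniq ?mem_undup ?map_f//= eqxx big1 ?addr0// => i ip.
by rewrite eq_sym (negbTE ip) mul0r.
Qed.

Lemma sp_cat l l' t : sp (l ++ l') t = sp l t + sp l' t.
Proof. by rewrite /sp big_cat. Qed.

Definition scl (c : R[i]) (l : seq (R[i] * I)) := [seq (c * p.1, p.2) | p <- l].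

Lemma sp_scl c l t : sp (scl c l) t = c * sp l t.
Proof.
by rewrite /sp /scl big_map mulr_sumr; apply: eq_bigr => p _; rewrite mulrA.
Qed.

Lemma inS_scl c l : inS l -> inS (scl c l).
Proof. by move=> h p /mapP[p' pl ->]; exact: (h p'). Qed.

Lemma inS_cat l l' : inS l -> inS l' -> inS (l ++ l').
Proof. by move=> h h' p; rewrite mem_cat => /orP[]; [exact: h|exact: h']. Qed.

Lemma small_pow (x y C : R) : (forall n : nat, x <= y + C * (1 / 2) ^+ n) -> x <= y.
Proof.
move=> h; apply/ler_addgt0Pr => e e0.
have [C0|C0] := leP C 0.
  apply: le_trans (h 0%N) _; rewrite expr0 mulr1; lra.
apply: le_trans (h (Num.truncn (C / e)).+1) _; rewrite lerD2l.
rewrite expr_div_n expr1n div1r ler_pdivrMr ?exprn_gt0// mulrC -ler_pdivrMr//.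
apply: ltW; apply: lt_le_trans (truncnS_gt _) _; rewrite -natrX ler_nat.
by apply: ltnW; apply: ltn_expl.
Qed.

(** The parallelogram law for two nearly minimal vectors: their midpoint has norm [m] at least [d],
    which forces the squared norm [D] of their difference to be small. *)
Lemma mid_arith (x y m d p D : R) : 0 <= d -> x <= d + p -> y <= d + p -> d <= m -> 0 <= x -> 0 <= y ->
  0 <= p -> p <= 1 -> (2 * m) ^+ 2 + D = 2 * x ^+ 2 + 2 * y ^+ 2 -> D <= 4 * (2 * d + 1) * p.
Proof.
move=> d0 hx hy hm x0 y0 p0 p1 e.
have a1 : x ^+ 2 <= (d + p) ^+ 2 by rewrite lerXn2r ?nnegrE ?addr_ge0.
have a2 : y ^+ 2 <= (d + p) ^+ 2 by rewrite lerXn2r ?nnegrE ?addr_ge0.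
have a3 : d ^+ 2 <= m ^+ 2 by rewrite lerXn2r ?nnegrE// (le_trans d0).
have a4 : p ^+ 2 <= p by rewrite expr2 -[leRHS]mulr1 ler_wpM2l.
have e' : D = 2 * x ^+ 2 + 2 * y ^+ 2 - 4 * m ^+ 2 by rewrite -e; ring.
have : (d + p) ^+ 2 = d ^+ 2 + 2 * d * p + p ^+ 2 by ring.
rewrite e'; lra.
Qed.

(* The orthogonal projection of [chi] is built from a minimising sequence; what remains is orthogonal to
   all [v i], hence [0] by [hU]. *)
Lemma density chi : gz chi -> forall e, 0 < e -> exists2 l, inS l & nL (fun t => chi t - sp l t) <= e.
Proof.
move=> hchi; have [schi _] := hchi.
pose N l := nL (fun t => chi t - sp l t).
pose A : set R := [set x | exists2 l, inS l & x = N l].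
have A0 : has_inf A.
  split; first by exists (N [::]), [::].
  by exists 0 => _ [l _ ->]; exact: nL_ge0.
set d := inf A.
have dl l : inS l -> d <= N l by move=> hl; apply: (ge_inf A0.2); exists l.
have d0 : 0 <= d by apply: lb_le_inf A0.1 _ => _ [l _ ->]; exact: nL_ge0.
(* The rate [4^-n] makes the squared differences of consecutive approximants [O(4^-n)], hence their
   norms [O(2^-n)], as [L2_complete] requires. *)
have mn (n : nat) : exists2 l, inS l & N l <= d + (1 / 4) ^+ n.
  have q0 : 0 < (1 / 4 : R) ^+ n by rewrite exprn_gt0.
  by have [_ [l hl ->] /ltW h] := inf_adherent q0 A0; exists l.
have mn' (n : nat) : exists l, inS l /\ N l <= d + (1 / 4) ^+ n.
  by have [l h1 h2] := mn n; exists l.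
have [l hl] := choice mn'.
pose C := 2 * (2 * d + 1).
have C0 : 0 <= C by rewrite /C; lra.
have sB l1 : sq (fun t => chi t - sp l1 t) := sqB schi (sq_sp l1).
have cau n : nL (fun t => sp (l n.+1) t - sp (l n) t) <= C * (1 / 2) ^+ n.
  have [i1 h1] := hl n; have [i2 h2] := hl n.+1.
  have q0 : 0 <= (1 / 4 : R) ^+ n by rewrite exprn_ge0.
  have q1 : (1 / 4 : R) ^+ n <= 1 by apply: exprn_ile1; lra.
  have h2' : N (l n.+1) <= d + (1 / 4) ^+ n.
    by apply: le_trans h2 _; rewrite lerD2l exprS ler_piMl//; lra.
  pose m := scl (1 / 2)%:C%C (l n ++ l n.+1).
  have hm : inS m by apply: inS_scl; exact: (inS_cat i1 i2).
  have := parallelogram (sB (l n)) (sB (l n.+1)).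
  have -> : (fun t => chi t - sp (l n) t + (chi t - sp (l n.+1) t)) =
     (fun t => (2 : R)%:C%C * (chi t - sp m t)).
    apply/funext => t; rewrite /m sp_scl sp_cat mulrBr mulrA -rmorphM/=.
    have -> : (2 : R) * (1 / 2) = 1 by field.
    by rewrite mul1r (_ : (2%:C)%C = 1 + 1 :> R[i]) ?rmorphD//; ring.
  rewrite (nLZ _ (sB m)) nc_real ger0_norm//.
  have -> : (fun t => chi t - sp (l n) t - (chi t - sp (l n.+1) t)) =
     (fun t => sp (l n.+1) t - sp (l n) t) by apply/funext => t; ring.
  move=> /(mid_arith d0 h1 h2' (dl _ hm) (nL_ge0 _) (nL_ge0 _) q0 q1) hD.
  apply: le_of_sqr; first by rewrite mulr_ge0 ?exprn_ge0.
  have e2 : ((1 / 2 : R) ^+ n) ^+ 2 = (1 / 4) ^+ n.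
    by rewrite -exprM mulnC exprM; congr (_ ^+ _); field.
  apply: le_trans hD _; rewrite [leRHS]exprMn e2.
  apply: ler_wpM2r => //; rewrite /C; have : 0 <= d * d by exact: mulr_ge0.
  by lra.
have [y [sy hy hyZ]] := L2_complete C0 (fun n => sq_sp (l n)) cau.
have gy : gz y by split => // t Zt; apply: hyZ => n; exact: (gz_sp _).2.
pose r t := chi t - y t.
have gr : gz r := gzB hchi gy; have [sr rZ] := gr.
(* [r] is shortest among its translates by the span: its norm is at most [d] and that of every
   translate at least [d], up to errors that vanish with [n]. *)
have rmin l1 : inS l1 -> nL r <= nL (fun t => r t - sp l1 t).
  move=> h1; apply: (@small_pow _ _ (4 * C + 1)) => n.
  have [i1 hn] := hl n.
  have b1 : nL r <= N (l n) + 2 * C * (1 / 2) ^+ n.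
    apply: le_trans (lerD (lexx _) (hy n)).
    have -> : r = (fun t => (chi t - sp (l n) t) - (y t - sp (l n) t)).
      by apply/funext => t; rewrite /r; ring.
    exact: (nLB (sB _) (sqB sy (sq_sp _))).
  have b2 : d <= nL (fun t => r t - sp l1 t) + 2 * C * (1 / 2) ^+ n.
    apply: le_trans (dl _ (inS_cat i1 h1)) _.
    apply: le_trans (lerD (lexx _) (hy n)).
    rewrite /N; have -> : (fun t => chi t - sp (l n ++ l1) t) =
       (fun t => (r t - sp l1 t) + (y t - sp (l n) t)).
      by apply/funext => t; rewrite /r sp_cat; ring.
    exact: (nLD (sqB sr (sq_sp _)) (sqB sy (sq_sp _))).
  have b3 : (1 / 4 : R) ^+ n <= (1 / 2) ^+ n.
    by rewrite lerXn2r ?nnegrE; lra.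
  move: b1 b2 b3 hn; rewrite !mulrDl mul1r; move: (nL r) (nL _) (N _) (_ ^+ _) (_ ^+ _) => x1 x2 x3 x4 x5.
  lra.
have orth i : Lam i -> CI (fun t => (r t)^*%C * v i t) = 0.
  move=> hi; set w := CI _.
  have sw : CI (fun t => r t * (v i t)^*%C) = w^*%C.
    rewrite /w -(CI_J (sqM_ci (sqJ sr) (hv i))); congr CI; apply/funext => t.
    by rewrite rmorphM/= conjcK.
  clearbody w.
  apply/eqP; rewrite -nc_eq0; apply: contraT => w0.
  have w1 : 0 < nc w by rewrite lt_def w0 nc_ge0.
  (* Subtracting [c * v i] would shorten [r] if [w] were nonzero. The added 1 avoids a division by
     the norm of [v i], which could be 0. *)
  pose V := nL (v i) ^+ 2 + 1; have V0 : 0 < V by rewrite ltr_wpDl ?sqr_ge0.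
  pose c := (V^-1)%:C%C * w^*%C.
  have hin : inS [:: (c, i)] by move=> p; rewrite inE => /eqP ->.
  have hm := rmin _ hin.
  have e : (fun t => r t - sp [:: (c, i)] t) = (fun t => r t + (- c) * v i t).
    by apply/funext => t; rewrite /sp big_cons big_nil addr0 mulNr.
  rewrite e in hm.
  have : nL r ^+ 2 <= nL (fun t => r t + - c * v i t) ^+ 2.
    by rewrite lerXn2r ?nnegrE ?nL_ge0.
  rewrite (nLD_sq sr (sqZ (- c) (hv i))) (nLZ _ (hv i)) ncN exprMn.
  have -> : CI (fun t => r t * (- c * v i t)^*%C) = - c^*%C * w^*%C.
    rewrite -sw -(CIZ _ (sqM_ci sr (sqJ (hv i)))); congr CI; apply/funext => t.
    by rewrite rmorphM rmorphN/=; ring.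
  have -> : - c^*%C * w^*%C = - ((V^-1)%:C%C * (nc w ^+ 2)%:C%C).
    by apply: ceq; rewrite /c ?cE ?nc_sq; ring.
  rewrite -rmorphM ReN ReC /c ncM ncJ nc_real exprMn sqr_absr.
  move=> hh.
  have : V^-1 * nc w ^+ 2 * (2 - V^-1 * nL (v i) ^+ 2) <= 0.
    by rewrite expr2 in hh; lra.
  rewrite leNgt mulr_gt0 ?mulr_gt0 ?invr_gt0 ?exprn_gt0// subr_gt0.
  apply: (@le_lt_trans _ _ 1); last by lra.
  by rewrite mulrC ler_pdivrMr// mul1r /V lerDl.
(* The pairing in [hU] is bilinear, so orthogonality to the [v i] speaks of the conjugate of [r]. *)
have grJ : gz (fun t => (r t)^*%C).
  by split; [exact: sqJ|move=> t Zt; rewrite rZ// conjc0].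
have r0 : nL r = 0 by rewrite -(nLJ r); exact: hU.
move=> e e0.
have [n hn] : exists n : nat, 2 * C * (1 / 2) ^+ n <= e.
  apply: contrapT => h; suff : e <= 0 by rewrite leNgt e0.
  apply: (@small_pow _ _ (2 * C)) => n; rewrite add0r leNgt; apply/negP => /ltW h'.
  by apply: h; exists n.
have [i1 _] := hl n; exists (l n) => //.
have -> : (fun t => chi t - sp (l n) t) = (fun t => r t + (y t - sp (l n) t)).
  by apply/funext => t; rewrite /r; ring.
apply: le_trans (nLD sr (sqB sy (sq_sp _))) _; rewrite r0 add0r.
exact: le_trans (hy n) hn.
Qed.

Lemma CS_seq (s : seq I) (x y : I -> R) : (forall i, 0 <= x i) -> (forall i, 0 <= y i) ->
  (\sum_(i <- s) x i * y i) ^+ 2 <= (\sum_(i <- s) x i ^+ 2) * (\sum_(i <- s) y i ^+ 2).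
Proof.
move=> x0 y0; apply: le_of_amgm.
- by apply: sumr_ge0 => i _; exact: sqr_ge0.
- by apply: sumr_ge0 => i _; exact: sqr_ge0.
- by apply: sumr_ge0 => i _; exact: mulr_ge0.
move=> u u0; rewrite !mulr_sumr -big_split; apply: ler_sum => i _ /=.
have k := sqr_ge0 (Num.sqrt u * x i - (Num.sqrt u)^-1 * y i).
have e : (Num.sqrt u * x i - (Num.sqrt u)^-1 * y i) ^+ 2 =
   Num.sqrt u ^+ 2 * x i ^+ 2 + (Num.sqrt u ^+ 2)^-1 * y i ^+ 2 - 2 * (x i * y i).
  by field; rewrite gt_eqF// sqrtr_gt0.
by move: k; rewrite e (@sqr_sqrtr _ u) ?(ltW u0)// subr_ge0.
Qed.

(** The squared norm of [phi] is its pairing with its conjugate. By [density] the conjugate may be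
    replaced by a finite combination of the [v i]; the pairing is then a finite sum of sample
    values, bounded by Cauchy-Schwarz and the lower Riesz bound. *)
Lemma sampling_bound : exists2 C, 0 < C & forall phi B, gz phi ->
  bsum (fun i => nc (CI (fun t => phi t * v i t)) ^+ 2) B -> nL phi <= C * Num.sqrt B.
Proof.
have [C hC] := riesz_lower_bound.
exists (Num.sqrt `|C| + 1); first by rewrite ltr_wpDl ?sqrtr_ge0.
move=> phi B hphi hB; have [sphi pZ] := hphi.
have B0 : 0 <= B by have := hB [::]; rewrite big_nil; apply.
have N0 := nL_ge0 phi.
set K := _ + 1; have K0 : 0 <= K by rewrite addr_ge0 ?sqrtr_ge0.
have main e : 0 < e -> nL phi ^+ 2 <= K * Num.sqrt B * (nL phi + e) + nL phi * e.
  move=> e0; have gJ : gz (fun t => (phi t)^*%C).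
    by split; [exact: sqJ|move=> t Zt; rewrite pZ// conjc0].
  have [l hl hle] := density gJ e0.
  have [s [k [hs es]]] := sp_lc hl.
  have sl := sq_lc s k.
  have a1 : (nL phi ^+ 2)%:C%C = CI (fun t => phi t * lc s k t) +
      CI (fun t => phi t * ((phi t)^*%C - lc s k t)).
    rewrite -(CID (sqM_ci sphi sl) (sqM_ci sphi (sqB (sqJ sphi) sl))) nL_CI//.
    by congr CI; apply/funext => t; ring.
  have a2 : nc (CI (fun t => phi t * ((phi t)^*%C - lc s k t))) <= nL phi * e.
    apply: le_trans (CS sphi (sqB (sqJ sphi) sl)) _; apply: ler_wpM2l => //.
    by rewrite -es.
  have a3 : nL (lc s k) <= nL phi + e.
    have -> : lc s k = (fun t => (phi t)^*%C - ((phi t)^*%C - sp l t)).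
      by rewrite es; apply/funext => t; ring.
    apply: le_trans (nLB (sqJ sphi) (sqB (sqJ sphi) (sq_sp l))) _.
    by rewrite nLJ lerD2l.
  have a4 : nc (CI (fun t => phi t * lc s k t)) <= K * Num.sqrt B * nL (lc s k).
    rewrite CI_lc//; apply: le_trans (nc_sum _ _ _) _.
    under eq_bigr do rewrite ncM.
    apply: le_of_sqr; first by rewrite !mulr_ge0 ?sqrtr_ge0 ?nL_ge0.
    apply: le_trans (CS_seq s (fun i => nc_ge0 (k i)) (fun i => nc_ge0 _)) _.
    rewrite !exprMn (@sqr_sqrtr _ B)// mulrAC.
    apply: ler_pM.
    - by apply: sumr_ge0 => i _; exact: sqr_ge0.
    - by apply: sumr_ge0 => i _; exact: sqr_ge0.
    - apply: le_trans (hC s k hs _) _ => //; apply: ler_wpM2r; first exact: sqr_ge0.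
      apply: (@le_trans _ _ (Num.sqrt `|C| ^+ 2)).
        by rewrite (@sqr_sqrtr _ `|C|)// ler_norm.
      by rewrite lerXn2r ?nnegrE ?sqrtr_ge0 ?lerDl.
    - exact: hB.
  have : nc (nL phi ^+ 2)%:C%C <= K * Num.sqrt B * (nL phi + e) + nL phi * e.
    rewrite a1; apply: le_trans (ncD _ _) _; apply: lerD => //.
    apply: le_trans a4 _; apply: ler_wpM2l => //; by rewrite mulr_ge0 ?sqrtr_ge0.
  by rewrite nc_real ger0_norm ?sqr_ge0.
have h2 : nL phi ^+ 2 <= K * Num.sqrt B * nL phi.
  apply: (@small_pow _ _ (K * Num.sqrt B + nL phi)) => n.
  have q0 : 0 < (1 / 2 : R) ^+ n by rewrite exprn_gt0.
  by apply: le_trans (main _ q0) _; rewrite le_eqVlt; apply/orP; left; apply/eqP; ring.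
have [->|p0] := eqVneq (nL phi) 0; first by rewrite mulr_ge0 ?sqrtr_ge0.
have p1 : 0 < nL phi by rewrite lt_def p0.
by move: h2; rewrite expr2 ler_pM2r.
Qed.

End Hilbert.

(** * Complete interpolating sequences for two intervals *)

Section CIS.
Variable R : realType.
Local Notation mu := (@lebesgue_measure R).
Implicit Types (phi psi : R -> R[i]) (z w : R[i]).

Definition Zg (c a b d : R) : set R := [set t | ~~ (c <= t <= a) && ~~ (b <= t <= d)].
Definition expE (c a b d : R) z (t : R) : R[i] := en c a z t + en b d z t.
Definition nrmE (c a b d : R) z : R := nL (expE c a b d z).

(* By [PWnorm_kappa], [nrmE c a b d z] is a constant multiple of the norm of the kernel at [z]. *)
Definition CIS (c a b d : R) (Lam : set R[i]) :=
  (forall (f : R[i] -> R[i]) B, bsum Lam (fun z => nc (f z) ^+ 2) B ->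
    exists2 phi, gz (Zg c a b d) phi & forall z, Lam z -> FT phi z = f z * (nrmE c a b d z)%:C%C) /\
  (forall phi, gz (Zg c a b d) phi -> (forall z, Lam z -> FT phi z = 0) -> nL phi = 0).

Variables (c a b d : R) (Lam : set R[i]).
Hypotheses (hca : c < a) (hab : a < b) (hbd : b < d).
Local Notation Z := (Zg c a b d).
Local Notation eE := (expE c a b d).
Local Notation nE := (nrmE c a b d).

Lemma gz_supp phi : gz Z phi -> supp c d phi.
Proof.
move=> [_ h] t ht; apply: h; rewrite /Zg /=; apply/andP; split.
  by apply: contraNN ht => /andP[-> h2] /=; apply: ltW (le_lt_trans h2 _); exact: lt_trans hbd.
by apply: contraNN ht => /andP[h1 ->]; rewrite (ltW (lt_le_trans _ h1))//; exact: lt_trans hab.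
Qed.

Lemma eE_in z t : c <= t <= a -> eE z t = ee z t.
Proof.
move=> h; rewrite /expE /en ind1// mul1r ind_0 ?mul0r ?addr0// negb_and -ltNge.
by move: h => /andP[_ h]; rewrite (le_lt_trans h hab).
Qed.

Lemma eE_in' z t : b <= t <= d -> eE z t = ee z t.
Proof.
move=> h; rewrite /expE /en (ind1 h) mul1r ind_0 ?mul0r ?add0r// negb_and -!ltNge.
by move: h => /andP[h _]; rewrite (lt_le_trans hab h) orbT.
Qed.

Lemma eE_out z t : Z t -> eE z t = 0.
Proof. by move=> /andP[h1 h2]; rewrite /expE /en !ind_0// !mul0r addr0. Qed.

Lemma sq_eE z : sq (eE z). Proof. exact: (sqD (@sq_en _ _ _ _) (@sq_en _ _ _ _)). Qed.

Lemma nc_eE z t : nc (eE z t) <= ind c d t * expR (- Im z * t).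
Proof.
have ad : a < d by exact: lt_trans hbd.
have cb : c < b by exact: lt_trans hab.
case: (boolP (c <= t <= a)) => h.
  rewrite eE_in// nc_ee ind1 ?mul1r//.
  by move: h => /andP[-> h]; rewrite (le_trans h (ltW ad)).
case: (boolP (b <= t <= d)) => h'.
  rewrite eE_in'// nc_ee ind1 ?mul1r//.
  by move: h' => /andP[h1 ->]; rewrite (le_trans (ltW cb) h1).
by rewrite eE_out ?nc0 ?mulr_ge0 ?ind_ge0 ?expR_ge0//; apply/andP.
Qed.

Lemma FT_eE phi z : gz Z phi -> FT phi z = CI (fun t => phi t * eE z t).
Proof.
move=> [_ h]; congr CI; apply/funext => t.
case: (boolP (c <= t <= a)) => h1; first by rewrite eE_in.
case: (boolP (b <= t <= d)) => h2; first by rewrite eE_in'.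
by rewrite h ?mul0r//; apply/andP.
Qed.

Lemma FT_le phi z : gz Z phi -> nc (FT phi z) <= nL phi * nE z.
Proof. by move=> h; rewrite FT_eE//; exact: (CS h.1 (sq_eE z)). Qed.

(** [tau] is the end of the spectrum where [expR (- y * t)] is largest: [c] for [y >= 0], [d]
    otherwise. From there the exponential decays at rate [|y|]. *)
Lemma anchor (y : R) : exists tau, [/\ c <= tau <= d,
  (forall t, c <= t <= d -> expR (- y * t) = expR (- y * tau) * expR (- `|y| * `|t - tau|)) &
  (forall Y, 0 < Y -> ri (fun t => ind c d t * expR (- Y * `|t - tau|)) /\
     RI (fun t => ind c d t * expR (- Y * `|t - tau|)) <= Y^-1)].
Proof.
have cd : c < d by apply: lt_trans hbd; exact: lt_trans hab.
have [y0|y0] := leP 0 y.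
  exists c; split; first by rewrite lexx ltW.
    move=> t /andP[ct _]; rewrite -expRD !ger0_norm ?subr_ge0//; congr expR; ring.
  move=> Y Y0.
  have e : (fun t => ind c d t * expR (- Y * `|t - c|)) =
     (fun t => expR (Y * c) * (ind c d t * expR (- Y * t))).
    apply/funext => t; rewrite /ind; case: (boolP (c <= t <= d)) => [/andP[ct _]|_]; last by rewrite !mul0r mulr0.
    rewrite !mul1r -expRD ger0_norm ?subr_ge0//; congr expR; ring.
  rewrite e; split; first exact: (riZ _ (ri_ind_expR _ _ _)).
  rewrite (RIZ _ (ri_ind_expR _ _ _)) -(ler_pM2l Y0) mulfV ?gt_eqF//.
  have := RI_expR (- Y) (ltW cd) => h.
  have -> : Y * (expR (Y * c) * RI (fun t => ind c d t * expR (- Y * t))) =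
     expR (Y * c) * (expR (- Y * c) - expR (- Y * d)).
    by rewrite -opprB -h; ring.
  by rewrite mulrBr -!expRD -mulrDl subrr mul0r expR0 lerBlDr lerDl expR_ge0.
exists d; split; first by rewrite lexx ltW.
  move=> t /andP[_ td]; rewrite -expRD !ler0_norm ?subr_le0 ?(ltW y0)//; congr expR; ring.
move=> Y Y0.
have e : (fun t => ind c d t * expR (- Y * `|t - d|)) =
   (fun t => expR (- Y * d) * (ind c d t * expR (Y * t))).
  apply/funext => t; rewrite /ind; case: (boolP (c <= t <= d)) => [/andP[_ td]|_]; last by rewrite !mul0r mulr0.
  rewrite !mul1r -expRD ler0_norm ?subr_le0//; congr expR; ring.
rewrite e; split; first exact: (riZ _ (ri_ind_expR _ _ _)).
rewrite (RIZ _ (ri_ind_expR _ _ _)) -(ler_pM2l Y0) mulfV ?gt_eqF//.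
have := RI_expR Y (ltW cd) => h.
rewrite mulrCA h mulrBr -!expRD -mulrDl addNr mul0r expR0 lerBlDr lerDl; exact: expR_ge0.
Qed.

Lemma low_piece (lo hi m : R) z : lo <= hi -> 0 <= m ->
  (forall t, lo <= t <= hi -> m <= nc (eE z t)) -> m ^+ 2 * (hi - lo) <= nE z ^+ 2.
Proof.
move=> lh m0 h; rewrite nL_sq -(RI_ind lh) -(RIZ _ (ri_ind _ _)).
apply: RI_le; [exact: (riZ _ (ri_ind _ _))|exact: (sq_ri (sq_eE z))|move=> t].
rewrite /ind; case: (boolP (lo <= t <= hi)) => ht; last by rewrite mulr0 sqr_ge0.
by rewrite mulr1 lerXn2r ?nnegrE ?nc_ge0 ?h.
Qed.

(** Exponentials at any [t] between [c] and [d], the gap included, are dominated by the kernel norm: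
    the largest value is taken at an end, and both ends belong to the spectrum. *)
Lemma nE_low : exists2 K, 0 < K & forall z t, c <= t <= d ->
  expR (- Im z * t) ^+ 2 <= K * (1 + `|Im z|) * nE z ^+ 2.
Proof.
pose m := Num.min (Num.min (a - c) (d - b)) 1.
have m0 : 0 < m by rewrite !lt_min !subr_gt0 hca hbd ltr01.
have [ma mb m1] : [/\ m <= a - c, m <= d - b & m <= 1].
  by rewrite /m !ge_min !lexx ?orbT.
exists (expR 1 ^+ 2 / m); first by rewrite divr_gt0// exprn_gt0 ?expR_gt0.
move=> z t /andP[ct td]; set y := Im z.
pose Y := 1 + `|y|; have Y0 : 0 < Y by rewrite ltr_wpDr.
(* An interval of length [m / Y] at either end stays inside its piece, and over it the exponential
   changes by a factor of at most [expR 1]. *)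
have mY0 : 0 <= m / Y by rewrite divr_ge0 ?ltW.
have mYm : m / Y <= m by rewrite ler_pdivrMr// ler_peMr ?lerDl// ltW.
have yY : `|y| * (m / Y) <= 1.
  rewrite mulrA ler_pdivrMr// mul1r /Y.
  apply: (@le_trans _ _ `|y|); first by rewrite ler_piMr.
  by rewrite lerDr.
have fin lo : (forall s, lo <= s <= lo + m / Y -> expR (- y * t) / expR 1 <= nc (eE z s)) ->
    expR (- y * t) ^+ 2 <= expR 1 ^+ 2 / m * Y * nE z ^+ 2.
  move=> h; have := @low_piece lo (lo + m / Y) _ z _ _ h.
  rewrite lerDl mY0 divr_ge0 ?expR_ge0// => /(_ isT isT).
  rewrite addrAC subrr add0r expr_div_n => hh.
  have e1 : 0 < expR 1 ^+ 2 :> R by rewrite exprn_gt0 ?expR_gt0.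
  have -> : expR (- y * t) ^+ 2 = (expR 1 ^+ 2 / m * Y) * (expR (- y * t) ^+ 2 / expR 1 ^+ 2 * (m / Y)).
    by field; rewrite !gt_eqF ?expR_gt0.
  by apply: ler_wpM2l => //; rewrite !mulr_ge0 ?invr_ge0 ?(ltW e1) ?(ltW m0) ?(ltW Y0).
have [y0|y0] := leP 0 y.
  apply: (fin c) => s /andP[cs sm]; rewrite eE_in; last by rewrite cs/=; lra.
  rewrite nc_ee -/y -expRN -expRD ler_expR.
  have h1 : y * (s - c) <= 1.
    apply: le_trans yY; rewrite ger0_norm//; apply: ler_wpM2l => //; lra.
  have h2 : 0 <= y * (t - c) by rewrite mulr_ge0 ?subr_ge0.
  by move: h1 h2; rewrite !mulrBr !mulNr; lra.
apply: (fin (d - m / Y)) => s /andP[ds sd]; rewrite eE_in'; last by apply/andP; split; lra.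
rewrite nc_ee -/y -expRN -expRD ler_expR.
have h1 : (- y) * (d - s) <= 1.
  apply: le_trans yY; rewrite ltr0_norm//; apply: ler_wpM2l; lra.
have h2 : 0 <= (- y) * (d - t) by rewrite mulr_ge0 ?subr_ge0//; lra.
by move: h1 h2; rewrite !mulrBr !mulNr; lra.
Qed.

Lemma nE_gt0 z : 0 < nE z.
Proof.
have [K K0 h] := nE_low; have := h z c; rewrite lexx => /(_ _)/=.
have cd : c < d by apply: lt_trans hbd; exact: lt_trans hab.
move=> /(_ (ltW cd)) hh; rewrite lt_def nL_ge0 andbT; apply/eqP => e0.
by move: hh; rewrite e0 expr0n mulr0 leNgt exprn_gt0 ?expR_gt0.
Qed.

Definition vE z (t : R) : R[i] := ((nE z)^-1)%:C%C * eE z t.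

Lemma sq_vE z : sq (vE z). Proof. exact: (sqZ _ (sq_eE z)). Qed.

Lemma CI_vE phi z : gz Z phi -> CI (fun t => phi t * vE z t) = FT phi z / (nE z)%:C%C.
Proof.
move=> h; rewrite FT_eE// mulrC -fmorphV -(CIZ _ (sqM_ci h.1 (sq_eE z))).
by congr CI; apply/funext => t; rewrite /vE mulrCA.
Qed.

Hypothesis hCIS : CIS c a b d Lam.

Lemma nEC_neq0 z : (nE z)%:C%C != 0 :> R[i].
Proof. by rewrite -nc_gt0 nc_real normr_gt0 gt_eqF ?nE_gt0. Qed.

Lemma sampling_bound_E : exists2 C, 0 < C & forall phi B, gz Z phi ->
  bsum Lam (fun z => (nc (FT phi z) / nE z) ^+ 2) B -> nL phi <= C * Num.sqrt B.
Proof.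
have [hX hU] := hCIS.
have [C C0 hC] : exists2 C, 0 < C & forall phi B, gz Z phi ->
  bsum Lam (fun i => nc (CI (fun t => phi t * vE i t)) ^+ 2) B -> nL phi <= C * Num.sqrt B.
  apply: sampling_bound; first exact: sq_vE.
  - by move=> z t Zt; rewrite /vE eE_out// mulr0.
  - move=> f B hB; have [phi gphi h] := hX f B hB; exists phi => // z hz.
    by rewrite CI_vE// h// mulfK// nEC_neq0.
  - move=> phi gphi h; apply: hU => // z hz; have := h _ hz; rewrite CI_vE// => /eqP.
    by rewrite mulf_eq0 invr_eq0 (negbTE (nEC_neq0 z)) orbF => /eqP.
exists C => // phi B gphi hB; apply: hC => // s hs; apply: le_trans (hB s hs).
apply: ler_sum => z _; rewrite CI_vE// ncM ncV nc_real ger0_norm ?lexx//.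
exact: ltW (nE_gt0 _).
Qed.

Lemma delta_sum w (B : R) (f : R[i] -> R) : 0 <= B -> f w <= B -> (forall z, z != w -> f z = 0) -> bsum Lam f B.
Proof.
move=> B0 fw fz s [us _].
case: (boolP (w \in s)) => ws.
  rewrite (bigD1_seq w)//= big1_seq ?addr0// => z /andP[zw _]; exact: fz.
rewrite big1_seq// => z /andP[_ zs]; apply: fz; apply: contraNneq ws => <-//.
Qed.

(** The normalised samples of the dual function at [w] are 1 at [w] and 0 elsewhere, so the sampling
    inequality bounds its norm uniformly in [w]. *)
Lemma dual_E : exists2 C, 0 < C & forall w, Lam w -> exists g,
  [/\ gz Z g, nL g <= C & forall z, Lam z -> FT g z = (z == w)%:R * (nE w)%:C%C].
Proof.
have [C C0 hC] := sampling_bound_E; have [hX _] := hCIS.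
exists C => // w hw.
have [|g gg hg] := hX (fun z => (z == w)%:R) 1.
  apply: (@delta_sum w) => //; first by rewrite eqxx nc1 expr1n.
  by move=> z /negbTE ->; rewrite nc0 expr0n.
have hg' z : Lam z -> FT g z = (z == w)%:R * (nE w)%:C%C.
  by move=> hz; rewrite (hg z hz); case: (z =P w) => [->|_]; rewrite ?mul0r.
exists g; split => //; rewrite -[leRHS]mulr1 -(sqrtr1 R); apply: hC => // s hs.
have := @delta_sum w 1 (fun z => (z == w)%:R) ler01 _ _ s hs; rewrite eqxx => /(_ (lexx _)) h1.
apply: le_trans (h1 _); last by move=> z /negbTE ->.
rewrite big_seq [leRHS]big_seq; apply: ler_sum => z zs; rewrite hg'; last exact: hs.2.
case: eqP => [->|_]; last by rewrite mul0r nc0 mul0r expr0n.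
by rewrite mul1r nc_real ger0_norm ?divff ?expr1n ?gt_eqF ?nE_gt0// ltW// nE_gt0.
Qed.

Lemma nc_ee_sub1 z (u : R) : nc (1 - ee z u) <= 2 * (nc z * `|u|) * expR (nc z * `|u|).
Proof.
rewrite ncB /ee; apply: le_trans (nc_cexp_sub1 _) _.
have e1 : nc ('i%C * z * u%:C%C) = nc z * `|u| by rewrite !ncM nci mul1r nc_real.
rewrite e1; apply: ler_wpM2l; first by rewrite !mulr_ge0 ?nc_ge0.
rewrite ge_max; apply/andP; split.
  by rewrite -[leLHS]expR0 ler_expR mulr_ge0 ?nc_ge0.
by rewrite ler_expR -e1; apply: le_trans (Re_le_nc _); exact: ler_norm.
Qed.

(** For [dl <= 1 / 4] the growth of the perturbation uses up half of the decay rate [Y] and leaves a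
    factor [dl]; [expR L] pays for replacing [|y|] by [Y = 1 + |y|] on a range of length [L]. *)
Lemma sep_pt (y Y L u dl h : R) : 0 <= u -> u <= L -> Y = 1 + `|y| -> 0 < dl -> dl <= 1 / 4 -> 0 <= h -> h <= dl * Y ->
  expR (- `|y| * u) * (2 * (h * u) * expR (h * u)) <= expR L * (8 * dl) * expR (- (Y / 2) * u).
Proof.
move=> u0 uL eY d0 d4 h0 hd.
have Y0 : 0 < Y by rewrite eY ltr_wpDr.
have a1 : h * u <= dl * (Y * u) by rewrite mulrA ler_wpM2r.
have a2 : h * u <= Y * u / 4.
  apply: le_trans a1 _; rewrite mulrC; apply: ler_wpM2l; rewrite ?mulr_ge0 ?(ltW Y0)//; lra.
have a3 : Y * u / 4 <= expR (Y * u / 4) by have := expR_sub1_ge (Y * u / 4); lra.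
have a4 : 2 * (h * u) <= 8 * dl * expR (Y * u / 4).
  apply: (@le_trans _ _ (8 * dl * (Y * u / 4))); first by lra.
  by apply: ler_wpM2l => //; lra.
apply: (@le_trans _ _ (expR (- `|y| * u) * (8 * dl * expR (Y * u / 4) * expR (Y * u / 4)))).
  apply: ler_wpM2l; first exact: expR_ge0.
  apply: ler_pM => //; rewrite ?mulr_ge0 ?expR_ge0//.
  by rewrite ler_expR.
have -> : expR (- `|y| * u) * (8 * dl * expR (Y * u / 4) * expR (Y * u / 4)) =
  8 * dl * expR (- `|y| * u + Y * u / 4 + Y * u / 4) by rewrite !expRD; ring.
have -> : expR L * (8 * dl) * expR (- (Y / 2) * u) = 8 * dl * expR (L + - (Y / 2) * u).
  by rewrite expRD; ring.
apply: ler_wpM2l; first lra.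
rewrite ler_expR eY; lra.
Qed.

(* The dual function at [z] is [nE z] at [z] and [0] at [w], whereas transforms vary slowly: after a
   translation by the end [tau] of the spectrum where the exponential is largest, [1 - ee (w - z)] is small
   where [ee z] is large. *)
Lemma separation : exists2 dl, 0 < dl <= 1 & forall z w, Lam z -> Lam w -> z != w ->
  dl * (1 + `|Im z|) <= nc (z - w).
Proof.
have [C C0 hC] := dual_E; have [K K0 hK] := nE_low.
have cd : c < d by apply: lt_trans hbd; exact: lt_trans hab.
pose L := d - c.
pose M := C * expR L * 8 * Num.sqrt K.
have M0 : 0 < M by rewrite !mulr_gt0 ?expR_gt0 ?sqrtr_gt0.
(* The value 1/4 is what [sep_pt] requires, and [dl * M <= 1 / 2] yields the contradiction
   [nE z <= nE z / 2]. *)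
pose dl := Num.min (1 / 4) (1 / (2 * M)).
have M2 : 0 < 2 * M by rewrite pmulr_rgt0.
have d0 : 0 < dl by rewrite lt_min !divr_gt0.
have d4 : dl <= 1 / 4 by rewrite ge_min lexx.
have dM : dl * M <= 1 / 2.
  apply: (@le_trans _ _ (1 / (2 * M) * M)); first by rewrite ler_pM2r// ge_min lexx orbT.
  by rewrite invfM mul1r divfK ?gt_eqF// div1r.
exists dl; first by apply/andP; split=> //; apply: (le_trans d4); lra.
move=> z w hz hw zw; rewrite leNgt; apply/negP => hlt.
have [g [gg nLg hg]] := hC z hz.
have [tau [htau ha hint]] := anchor (Im z).
set Y := 1 + `|Im z| in hlt; have Y0 : 0 < Y by rewrite ltr_wpDr.
pose h := w - z; have hh : nc h <= dl * Y by rewrite /h ncB ltW.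
have ew t : ee w t = ee z t * ee h t by rewrite -eeD /h addrC subrK.
(* Pairing [g] with [F] gives [FT g z - ee h (- tau) * FT g w], in which the second term is 0. *)
pose F t := eE z t * (1 - ee h (t - tau)).
have e1 : (nE z)%:C%C = CI (fun t => g t * F t).
  have c1 := FT_ci z gg.1 (gz_supp gg); have c2 := FT_ci w gg.1 (gz_supp gg).
  have e2 : FT g z - ee h (- tau) * FT g w = (nE z)%:C%C.
    by rewrite (hg _ hz) (hg _ hw) eqxx mul1r eq_sym (negbTE zw) mul0r mulr0 subr0.
  rewrite -e2 /FT -(CIZ _ c2) -(CIB c1 (ciZ (ee h (- tau)) c2)); congr CI; apply/funext => t.
  case: (boolP (c <= t <= a)) => h1.
    by rewrite /F eE_in// eeDt ew; ring.
  case: (boolP (b <= t <= d)) => h2.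
    by rewrite /F eE_in'// eeDt ew; ring.
  by rewrite (gg.2 t) ?mul0r ?mulr0 ?subr0//; apply/andP.
have mF : mcf F.
  apply: mcfM; first exact: (sq_mcf (sq_eE z)).
  apply: mcfB; first exact: mcf_cst.
  by split; [exact: (mf_shift (- tau) (mcf_ee h).1)|exact: (mf_shift (- tau) (mcf_ee h).2)].
pose A := expR (- Im z * tau) * (expR L * (8 * dl)).
have A0 : 0 <= A by rewrite !mulr_ge0 ?expR_ge0//; lra.
have bF t : nc (F t) <= A * (ind c d t * expR (- (Y / 2) * `|t - tau|)).
  rewrite /F ncM; case: (boolP (c <= t <= d)) => ht; last first.
    rewrite (ind_0 ht) mul0r mulr0; have := nc_eE z t; rewrite (ind_0 ht) mul0r => h1.
    by rewrite (le_anti (introT andP (conj h1 (nc_ge0 _)))) mul0r.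
  rewrite (ind1 ht) mul1r; have := nc_eE z t; rewrite (ind1 ht) mul1r ha// => h1.
  apply: le_trans (ler_pM (nc_ge0 _) (nc_ge0 _) h1 (nc_ee_sub1 _ _)) _.
  rewrite -[leLHS]mulrA /A -[leRHS]mulrA; apply: ler_wpM2l; first exact: expR_ge0.
  apply: sep_pt => //; rewrite ?nc_ge0//.
  rewrite /L ler_norml; move: ht htau => /andP[? ?] /andP[? ?]; apply/andP; split; lra.
have [ri1 RI1] := hint Y Y0.
have bF2 t : nc (F t) ^+ 2 <= A ^+ 2 * (ind c d t * expR (- Y * `|t - tau|)).
  apply: (@le_trans _ _ ((A * (ind c d t * expR (- (Y / 2) * `|t - tau|))) ^+ 2)).
    by rewrite lerXn2r ?nnegrE ?nc_ge0// (mulr_ge0 A0 (mulr_ge0 (ind_ge0 _ _ _) (expR_ge0 _))).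
  have e2 : expR (- (Y / 2) * `|t - tau|) ^+ 2 = expR (- Y * `|t - tau|).
    rewrite expr2 -expRD; congr expR; lra.
  rewrite [leLHS]exprMn [X in _ * X <= _]exprMn e2 /ind.
  by case: (_ <= _ <= _); rewrite ?expr0n ?expr1n !(mul0r, mul1r).
have sF : sq F by apply: (sq_dom mF (riZ (A ^+ 2) ri1)).
have nF : nL F ^+ 2 <= A ^+ 2 * Y^-1.
  rewrite nL_sq; apply: (@le_trans _ _ (RI (fun t => A ^+ 2 * (ind c d t * expR (- Y * `|t - tau|))))).
    by apply: RI_le => //; [exact: sq_ri|exact: riZ].
  by rewrite (RIZ _ ri1); apply: ler_wpM2l => //; exact: sqr_ge0.
have nF2 : nL F <= expR L * (8 * dl) * Num.sqrt K * nE z.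
  apply: le_of_sqr; first by rewrite !mulr_ge0 ?expR_ge0 ?sqrtr_ge0 ?nL_ge0//; lra.
  apply: le_trans nF _; rewrite [leRHS]exprMn [X in _ <= X * _]exprMn (@sqr_sqrtr _ K) ?(ltW K0)//.
  rewrite /A exprMn mulrC mulrA [leRHS](_ : _ = Y^-1 * (K * Y * nE z ^+ 2) * (expR L * (8 * dl)) ^+ 2); last first.
    by field; rewrite gt_eqF.
  apply: ler_wpM2r; first exact: sqr_ge0.
  by apply: ler_wpM2l; [rewrite invr_ge0 ltW|exact: hK].
have : nE z <= C * (expR L * (8 * dl) * Num.sqrt K * nE z).
  rewrite -[leLHS]ger0_norm ?nL_ge0// -nc_real e1; apply: le_trans (CS gg.1 sF) _.
  by apply: ler_pM; rewrite ?nL_ge0.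
have -> : C * (expR L * (8 * dl) * Num.sqrt K * nE z) = dl * M * nE z by rewrite /M; ring.
move=> h1; have : nE z <= 1 / 2 * nE z by apply: le_trans h1 _; apply: ler_wpM2r; rewrite ?nL_ge0.
by have := nE_gt0 z; lra.
Qed.

End CIS.

(** * Sparseness of the sequence *)

Section Cells.
Variable R : realType.
Implicit Types (x y : R) (z w : R[i]).

(** The fourth root, from which the powers with exponent 5/4 are built. *)
Definition q4 x : R := Num.sqrt (Num.sqrt x).

Lemma q4_ge0 x : 0 <= q4 x. Proof. exact: sqrtr_ge0. Qed.
Lemma q4_gt0 x : 0 < x -> 0 < q4 x. Proof. by move=> h; rewrite !sqrtr_gt0. Qed.
Lemma q4M x y : 0 <= x -> q4 (x * y) = q4 x * q4 y.
Proof. by move=> h; rewrite /q4 !sqrtrM ?sqrtr_ge0. Qed.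
Lemma q4_4 x : 0 <= x -> q4 x ^+ 4 = x.
Proof. by move=> h; rewrite (exprM _ 2 2) !sqr_sqrtr ?sqrtr_ge0. Qed.
Lemma q4_le x y : x <= y -> q4 x <= q4 y.
Proof. by move=> h; rewrite /q4 !ler_wsqrtr. Qed.
Lemma q4_1 : q4 1 = 1 :> R. Proof. by rewrite /q4 !sqrtr1. Qed.
Lemma q4_ge1 x : 1 <= x -> 1 <= q4 x.
Proof. by move=> h; rewrite -q4_1 q4_le. Qed.
Lemma q4_le_id x : 1 <= x -> q4 x <= x.
Proof.
move=> h; have h1 := q4_ge1 h; rewrite -[leRHS](q4_4 (le_trans ler01 h)).
by rewrite -[leLHS]expr1; exact: ler_weXn2l.
Qed.

(** Separated points are spaced like squares of side [1 + |Im z|]. Summing [wt] thus resembles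
    integrating [1 / ((1 + |y|) (1 + |z|)^(5/4))] over the plane, and this integral converges. *)
Definition wt z : R := (1 + `|Im z|) / ((1 + nc z) * q4 (1 + nc z)).

Lemma nc1_gt0 z : 0 < 1 + nc z. Proof. by rewrite ltr_wpDr ?nc_ge0. Qed.

Lemma wt_ge0 z : 0 <= wt z.
Proof. by rewrite divr_ge0 ?addr_ge0// mulr_ge0 ?q4_ge0 ?addr_ge0 ?nc_ge0. Qed.

Lemma wt_sq z : (1 + nc z) ^- 2 <= wt z.
Proof.
have h0 := nc1_gt0 z; have h1 : 1 <= 1 + nc z by rewrite lerDl nc_ge0.
rewrite -[leLHS]mul1r /wt; apply: ler_pM => //; first by rewrite invr_ge0 exprn_ge0 ?ltW.
  by rewrite lerDl.
rewrite lef_pV2 ?posrE ?exprn_gt0 ?mulr_gt0 ?q4_gt0// expr2.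
by apply: ler_wpM2l; [exact: ltW|exact: q4_le_id].
Qed.

Lemma inj_sum_le (I : eqType) (P : finType) (s : seq I) (key : I -> P) (F : P -> R) :
  uniq s -> {in s &, injective key} -> (forall p, 0 <= F p) ->
  \sum_(i <- s) F (key i) <= \sum_p F p.
Proof.
move=> us inj F0; rewrite -(big_map key xpredT F).
have um : uniq [seq key i | i <- s] by rewrite map_inj_in_uniq.
rewrite (big_uniq _ um)/= [leRHS](bigID (mem [seq key i | i <- s]))/= lerDl.
exact: sumr_ge0.
Qed.

Definition alj (j : nat) : R := (j.+1%:R * q4 j.+1%:R)^-1.

Lemma alj_ge0 j : 0 <= alj j.
Proof. by rewrite invr_ge0 mulr_ge0 ?q4_ge0. Qed.

(** With [u] and [v] the fourth roots of consecutive integers this compares [n^(-5/4)] with an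
    increment of [-4 n^(-1/4)], so that [alj_sum] telescopes. *)
Lemma alj_step (u v : R) : 0 < u -> 0 < v -> v ^+ 4 = u ^+ 4 + 1 ->
  (v ^+ 4 * v)^-1 <= 4 / u - 4 / v.
Proof.
move=> u0 v0 h.
have uv : u <= v by rewrite -(@ler_pXn2r _ 4) ?nnegrE ?ltW// h; lra.
have h3 : (v - u) * (4 * v ^+ 3) >= 1.
  have e : (v - u) * (v ^+ 3 + v ^+ 2 * u + v * u ^+ 2 + u ^+ 3) = 1.
    have -> : (v - u) * (v ^+ 3 + v ^+ 2 * u + v * u ^+ 2 + u ^+ 3) = v ^+ 4 - u ^+ 4 by ring.
    by rewrite h addrAC subrr add0r.
  apply: (@le_trans _ _ ((v - u) * (v ^+ 3 + v ^+ 2 * u + v * u ^+ 2 + u ^+ 3))); first by rewrite e.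
  apply: ler_wpM2l; first by rewrite subr_ge0.
  have a1 : v ^+ 2 * u <= v ^+ 3 by rewrite (exprSr v 2) ler_wpM2l ?exprn_ge0 ?(ltW v0).
  have a2 : u ^+ 2 <= v ^+ 2 by rewrite lerXn2r ?nnegrE ?(ltW u0) ?(ltW v0).
  have a3 : v * u ^+ 2 <= v ^+ 3 by rewrite (exprS v 2) ler_wpM2l ?(ltW v0).
  have a4 : u ^+ 3 <= v ^+ 3 by rewrite lerXn2r ?nnegrE ?(ltW u0) ?(ltW v0).
  have -> : 4 * v ^+ 3 = v ^+ 3 + v ^+ 3 + v ^+ 3 + v ^+ 3 by ring.
  by apply: lerD a4; apply: lerD a3; apply: lerD a1.
have -> : 4 / u - 4 / v = (v - u) * (4 * v ^+ 3) * (v ^+ 4 * u)^-1 by field; rewrite !gt_eqF.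
apply: (@le_trans _ _ (v ^+ 4 * u)^-1).
  by rewrite lef_pV2 ?posrE ?mulr_gt0 ?exprn_gt0// ler_wpM2l ?exprn_ge0 ?(ltW v0).
by rewrite -[leLHS]mul1r; apply: ler_wpM2r => //; rewrite invr_ge0 mulr_ge0 ?exprn_ge0 ?ltW.
Qed.

Lemma alj_sum J : \sum_(j < J) alj j <= 5.
Proof.
suff h n : \sum_(j < n.+1) alj j <= 5 - 4 / q4 n.+1%:R.
  case: J => [|J]; first by rewrite big_ord0.
  by apply: le_trans (h J) _; rewrite lerBlDr lerDl divr_ge0 ?q4_ge0.
elim: n => [|n IH]; first by rewrite big_ord1 /alj q4_1 mulr1 invr1; lra.
rewrite big_ord_recr /=; have := @alj_step (q4 n.+1%:R) (q4 n.+2%:R).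
rewrite !q4_gt0 ?ltr0n// => /(_ isT isT); rewrite !q4_4 ?ler0n//.
rewrite -[n.+2]addn1 natrD => /(_ erefl); rewrite /alj -[n.+2]addn1 natrD; lra.
Qed.

(** [2^(-1/4)], the ratio of the sums over consecutive dyadic strips. *)
Definition gam : R := (q4 2)^-1.

Lemma gam_lt1 : 0 < gam < 1.
Proof.
have q0 : 0 < q4 2 :> R by rewrite q4_gt0.
rewrite invr_gt0 q0 /= invf_lt1//; rewrite ltNge; apply/negP => h.
have := lerXn2r 4 (ltW q0 : _ \in Num.nneg) (ler01 : _ \in Num.nneg) h; rewrite q4_4// expr1n; lra.
Qed.

Lemma gam_sum K : \sum_(k < K) gam ^+ k <= (1 - gam)^-1.
Proof.
have /andP[g0 g1] := gam_lt1.
rewrite -div1r ler_pdivlMr ?subr_gt0//.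
have := subrX1 gam K; rewrite -opprB -[X in _ = X * _]opprB mulNr => /oppr_inj e.
by rewrite mulrC -e lerBlDr lerDl exprn_ge0 ?(ltW g0).
Qed.

Lemma q4_pow2 k : q4 (2 ^+ k) = (gam ^+ k)^-1.
Proof.
elim: k => [|k IH]; first by rewrite !expr0 q4_1 invr1.
by rewrite !exprS q4M// IH invfM /gam invrK.
Qed.

(* Cells of side comparable to [2 ^ k] in the strips where [1 + |Im z|] is between [2 ^ k] and [2 ^ k.+1]
   contain at most one point each. *)
Lemma cells (Lam : set R[i]) (dl : R) : 0 < dl <= 1 ->
  (forall z w, Lam z -> Lam w -> z != w -> dl * (1 + `|Im z|) <= nc (z - w)) ->
  exists B, bsum Lam wt B.
Proof.
move=> /andP[d0 d1] sep.
pose k z : nat := trunc_log 2 (Num.truncn (1 + `|Im z|)).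
have kP z : 2 ^+ k z <= 1 + `|Im z| < 2 ^+ (k z).+1.
  have y1 : 1 <= 1 + `|Im z| by rewrite lerDl.
  have y0 : 0 <= 1 + `|Im z| by rewrite addr_ge0.
  have t0 : (0 < Num.truncn (1 + `|Im z|))%N by rewrite truncn_gt0.
  have /andP[h1 h2] := trunc_log_bounds (isT : (1 < 2)%N) t0; apply/andP; split.
    apply: (@le_trans _ _ (Num.truncn (1 + `|Im z|))%:R); last by rewrite truncn_le.
    by rewrite -natrX ler_nat.
  apply: (lt_le_trans (truncnS_gt _)); by rewrite -natrX ler_nat.
(* Two points of one cell are closer than [2 * S z], which is at most [dl * (1 + |Im z|)]. Cells are
   indexed through absolute values, so the key also records both signs. *)
pose S z : R := dl * 2 ^+ k z / 2.
have S0 z : 0 < S z by rewrite divr_gt0// mulr_gt0// exprn_gt0.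
pose j z : nat := Num.truncn (`|Re z| / S z).
pose r z : nat := Num.truncn (`|Im z| / S z).
have tr (x y : R) (n : nat) : 0 <= x -> 0 < y -> Num.truncn (x / y) = n -> n%:R * y <= x < (n%:R + 1) * y.
  move=> x0 y0 e; rewrite -ler_pdivlMr// -ltr_pdivrMr//.
  have xy : 0 <= x / y by rewrite divr_ge0// ltW.
  by have := trunc_itv xy; rewrite e natr1.
have same (x x' s : R) : (0 <= x) = (0 <= x') -> `| `|x| - `|x'| | = `|x - x'|.
  have [x0|x0] := leP 0 x => [|].
    by move=> /esym x'0; rewrite (ger0_norm x0) (ger0_norm x'0).
  move=> /esym /negbT; rewrite -ltNge => x'0; rewrite !(ltr0_norm x0) (ltr0_norm x'0).
  by rewrite opprK addrC distrC.
(* A strip has height at most [2 ^+ (k z).+1], that is [4 / dl] cells. *)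
pose M := (Num.truncn (4 / dl)).+1.
have rM z : (r z < M)%N.
  rewrite /M ltnS; apply: le_truncn.
  rewrite ler_pdivrMr// /S.
  have /andP[_ h] := kP z.
  have -> : 4 / dl * (dl * 2 ^+ k z / 2) = 2 ^+ (k z).+1 by rewrite exprS; field; rewrite gt_eqF.
  by apply: le_trans (ltW h); rewrite lerDr.
have key_inj z w : Lam z -> Lam w -> k z = k w -> j z = j w -> r z = r w ->
   (0 <= Re z) = (0 <= Re w) -> (0 <= Im z) = (0 <= Im w) -> z = w.
  move=> hz hw ek ej er sx sy; apply/eqP; apply: contraT => zw.
  have := sep _ _ hz hw zw; rewrite leNgt => /negP[].
  have eS : S z = S w by rewrite /S ek.
  have cell (x x' : R) (n : nat) : (0 <= x) = (0 <= x') -> Num.truncn (`|x| / S z) = n ->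
      Num.truncn (`|x'| / S z) = n -> `|x - x'| < S z.
    move=> e h1 h2; rewrite -(same _ _ 0 e).
    have /andP[a1 a2] := tr _ _ _ (normr_ge0 x) (S0 z) h1.
    have /andP[b1 b2] := tr _ _ _ (normr_ge0 x') (S0 z) h2.
    by rewrite ltr_norml; apply/andP; split; lra.
  have c1 := cell (Re z) (Re w) (j z) sx erefl _; have c2 := cell (Im z) (Im w) (r z) sy erefl _.
  apply: (@le_lt_trans _ _ (`|Re (z - w)| + `|Im (z - w)|)); first exact: nc_le.
  rewrite ?cE; apply: (@lt_le_trans _ _ (S z + S z)).
    apply: ltrD; [apply: c1; rewrite ej /j eS//|apply: c2; rewrite er /r eS//].
  have /andP[h _] := kP z; rewrite /S -splitr; apply: ler_wpM2l => //; exact: ltW.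
pose d' := dl / 4; have d'0 : 0 < d' by rewrite divr_gt0.
pose A := 2 / (d' * q4 d').
have A0 : 0 < A by rewrite divr_gt0// mulr_gt0// q4_gt0.
have wb z : wt z <= A * alj (j z) * gam ^+ k z.
  have /andP[k1 k2] := kP z.
  have p0 : 0 < 2 ^+ k z :> R by rewrite exprn_gt0.
  (* A lower bound for [1 + nc z] that uses the strip and the column together: half of the column's
     distance [j z * S z], and a part of [2 ^+ k z] for the [+ 1] in [(j z).+1]. *)
  pose T := 2 ^+ k z * ((j z).+1%:R * d').
  have j0 : 0 < (j z).+1%:R :> R by rewrite ltr0n.
  have T0 : 0 < T by rewrite !mulr_gt0.
  have T1 : T <= 1 + nc z.
    have /andP[h1 _] := tr _ _ _ (normr_ge0 (Re z)) (S0 z) (erefl (j z)).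
    have h2 : `|Re z| <= nc z by exact: Re_le_nc.
    have h3 : `|Im z| <= nc z by exact: Im_le_nc.
    have -> : T = (j z)%:R * S z / 2 + 2 ^+ k z * dl / 4 by rewrite /T /S /d' -(natr1 (j z)); field.
    have : 2 ^+ k z * dl <= 2 ^+ k z by rewrite ler_piMr// ltW.
    have := nc_ge0 z; lra.
  have q0 : 0 < q4 T by exact: q4_gt0.
  apply: (@le_trans _ _ (2 ^+ (k z).+1 / (T * q4 T))).
    apply: ler_pM; rewrite ?addr_ge0// ?invr_ge0 ?mulr_ge0 ?q4_ge0 ?addr_ge0 ?nc_ge0//; first exact: ltW.
    rewrite lef_pV2 ?posrE ?mulr_gt0 ?q4_gt0 ?nc1_gt0//.
    by apply: ler_pM => //; [exact: ltW|exact: ltW|exact: q4_le].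
  have eT : q4 T = (gam ^+ k z)^-1 * (q4 (j z).+1%:R * q4 d').
    by rewrite /T (@q4M (2 ^+ k z) _ (ltW p0)) (@q4M (j z).+1%:R _ (ltW j0)) q4_pow2.
  rewrite eT /T /alj /A exprS le_eqVlt; apply/orP; left; apply/eqP.
  have g0 : 0 < gam ^+ k z by rewrite exprn_gt0//; have /andP[] := gam_lt1.
  by field; rewrite !gt_eqF ?q4_gt0.
(* The sum over the columns is at most 5, the one over the strips is geometric, and there are [M]
   rows and 4 pairs of signs. *)
exists (A * 5 * (1 - gam)^-1 * (M * 4)%:R) => s [us hs].
pose K := (\max_(z <- s) k z).+1; pose J := (\max_(z <- s) j z).+1.
have kK z : z \in s -> (k z < K)%N by move=> zs; rewrite /K ltnS (big_rem z zs) /= leq_maxl.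
have jJ z : z \in s -> (j z < J)%N by move=> zs; rewrite /J ltnS (big_rem z zs) /= leq_maxl.
pose key z : ('I_K * 'I_J) * ('I_M * (bool * bool)) :=
  ((inord (k z), inord (j z)), (inord (r z), (0 <= Re z, 0 <= Im z))).
pose F (p : ('I_K * 'I_J) * ('I_M * (bool * bool))) := A * alj p.1.2 * gam ^+ p.1.1.
have gam0 n : 0 <= gam ^+ n by rewrite exprn_ge0//; have /andP[/ltW] := gam_lt1.
apply: (@le_trans _ _ (\sum_(z <- s) F (key z))).
  rewrite big_seq [leRHS]big_seq; apply: ler_sum => z zs.
  by rewrite /F /= !inordK ?kK ?jJ.
apply: le_trans (inj_sum_le us _ _) _.
- move=> z w zs ws; rewrite /key => -[/(congr1 val)/= e1 /(congr1 val)/= e2 /(congr1 val)/= e3 e4 e5].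
  rewrite !inordK ?kK in e1; rewrite ?kK//.
  rewrite !inordK ?jJ in e2; rewrite ?jJ//.
  rewrite !inordK ?rM in e3; rewrite ?rM//.
  by apply: key_inj => //; exact: hs.
- by move=> p; exact: (mulr_ge0 (mulr_ge0 (ltW A0) (alj_ge0 _)) (gam0 _)).
rewrite -(pair_bigA _ (fun (p : 'I_K * 'I_J) (q : 'I_M * (bool * bool)) => A * alj p.2 * gam ^+ p.1))/=.
under eq_bigr do rewrite sumr_const !card_prod !card_bool card_ord -mulr_natr.
rewrite -mulr_suml -(pair_bigA _ (fun (k : 'I_K) (j : 'I_J) => A * alj j * gam ^+ k))/=.
apply: ler_wpM2r; first exact: ler0n.
under eq_bigr do rewrite -mulr_suml -mulr_sumr.
rewrite -mulr_sumr; apply: ler_pM.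
- by rewrite mulr_ge0 ?(ltW A0)// sumr_ge0// => i _; exact: alj_ge0.
- by apply: sumr_ge0 => i _; exact: gam0.
- by apply: ler_wpM2l; [exact: ltW|exact: alj_sum].
- exact: gam_sum.
Qed.

End Cells.

(** * Interpolating data divided by [z - w] *)

Section Multiples.
Variable R : realType.
Implicit Types (phi psi : R -> R[i]) (z w : R[i]).
Variables (c a b d : R) (Lam : set R[i]).
Hypotheses (hca : c < a) (hab : a < b) (hbd : b < d).
Local Notation Z := (Zg c a b d).
Local Notation nE := (nrmE c a b d).
Hypothesis hCIS : CIS c a b d Lam.

Lemma weight_summable : exists2 B, 0 <= B & bsum Lam (@wt R) B.
Proof.
have [dl hdl sep] := separation hca hab hbd hCIS.
have [B hB] := cells hdl sep; exists B => //.
by have := hB [::]; rewrite big_nil; apply.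
Qed.

(** By separation at most one point of [Lam] is very close to [w], so the distance is bounded below;
    the triangle inequality turns this into linear growth. *)
Lemma dist_pt w : exists2 k, 0 < k & forall z, Lam z -> z != w -> k * (1 + nc z) <= nc (z - w).
Proof.
have [dl /andP[d0 d1] sep] := separation hca hab hbd hCIS.
have [rho r0 hr] : exists2 rho, 0 < rho & forall z, Lam z -> z != w -> rho <= nc (z - w).
  case: (pselect (exists z, [/\ Lam z, z != w & nc (z - w) < dl / 2])) => [[z1 [hz1 zw1 h1]]|nex]; last first.
    exists (dl / 2); first by rewrite divr_gt0.
    by move=> z hz zw; rewrite leNgt; apply/negP => h; apply: nex; exists z.
  have n1 : 0 < nc (z1 - w) by rewrite nc_gt0 subr_eq0.
  exists (nc (z1 - w)) => // z hz zw; have [->//|zz] := eqVneq z z1.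
  have h2 := sep _ _ hz hz1 zz; have h3 : dl <= dl * (1 + `|Im z|) by rewrite ler_peMr ?lerDl// ltW.
  have : nc (z - z1) <= nc (z - w) + nc (z1 - w).
    by rewrite -(ncB w z1) (_ : z - z1 = (z - w) + (w - z1)) ?ncD//; ring.
  lra.
have w0 := nc_ge0 w.
exists (rho / (rho + 1 + nc w)); first by rewrite divr_gt0//; lra.
move=> z hz zw; have h := hr z hz zw.
have hn : nc z <= nc (z - w) + nc w by rewrite -[X in nc X <= _](subrK w); exact: ncD.
rewrite mulrAC ler_pdivrMr; last by lra.
have h5 : rho * (1 + nc w) <= nc (z - w) * (1 + nc w) by apply: ler_wpM2r => //; lra.
have h6 : rho * nc z <= rho * (nc (z - w) + nc w) by apply: ler_wpM2l => //; exact: ltW.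
move: h5 h6; rewrite !mulrDr !mulr1; lra.
Qed.

(** The normalised samples of a transform are bounded, and division by [z - w] makes them
    [O(1 / (1 + |z|))]. By [wt_sq] these are square-summable, so they can be interpolated. *)
Lemma multiplier_exists phi w : gz Z phi -> (Lam w -> FT phi w = 0) ->
  exists2 k, gz Z k & forall z, Lam z -> (z - w) * FT k z + FT phi z = 0.
Proof.
move=> gp hw; have [B B0 hB] := weight_summable; have [kp k0 hk] := dist_pt w.
have [hX _] := hCIS; have n0 := nE_gt0 hca hab hbd.
have nn0 z : (nE z)%:C%C != 0 :> R[i] := nEC_neq0 hca hab hbd z.
have [|k gk hk2] := hX (fun z => - FT phi z / ((z - w) * (nE z)%:C%C)) ((nL phi / kp) ^+ 2 * B).
  move=> s hs; apply: le_trans (ler_wpM2l _ (hB s hs)); last exact: sqr_ge0.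
  rewrite mulr_sumr big_seq [leRHS]big_seq; apply: ler_sum => z zs.
  (* At [z = w] the division by 0 makes the datum 0, and the required equation reduces to
     [FT phi w = 0]. *)
  have [->|zw] := eqVneq z w.
    by rewrite subrr mul0r invr0 mulr0 nc0 expr0n mulr_ge0 ?sqr_ge0 ?wt_ge0.
  apply: (@le_trans _ _ ((nL phi / kp) ^+ 2 * (1 + nc z) ^- 2)); last first.
    by apply: ler_wpM2l; [exact: sqr_ge0|exact: wt_sq].
  rewrite -exprVn -exprMn lerXn2r ?nnegrE ?nc_ge0//.
    by rewrite !mulr_ge0 ?invr_ge0 ?nL_ge0 ?(ltW k0) ?addr_ge0 ?nc_ge0.
  have e1 : nc (- FT phi z / ((z - w) * (nE z)%:C%C)) = ((nE z)^-1 * nc (FT phi z)) * (nc (z - w))^-1.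
    by rewrite ncM ncN ncV ncM nc_real (ger0_norm (ltW (n0 z))) invfM; ring.
  have a1 : (nE z)^-1 * nc (FT phi z) <= nL phi.
    by rewrite mulrC ler_pdivrMr//; exact: (FT_le hab z gp).
  rewrite e1 -[leRHS]mulrA -invfM.
  apply: ler_pM => //; rewrite ?mulr_ge0 ?invr_ge0 ?nc_ge0 ?(ltW (n0 z))//.
  have zw0 : 0 < nc (z - w) by rewrite nc_gt0 subr_eq0.
  by rewrite lef_pV2 ?posrE ?mulr_gt0 ?nc1_gt0//; apply: hk => //; exact: hs.2.
exists k => // z hz; have [e|zw] := eqVneq z w.
  by rewrite e subrr mul0r add0r; apply: hw; rewrite -e.
rewrite hk2// mulrA; have zw0 : z - w != 0 by rewrite subr_eq0.
by rewrite invfM; field; rewrite nn0 zw0.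
Qed.

End Multiples.

(** * Minimality *)

Section Rows.
Variable R : realType.
Implicit Types (phi psi : R -> R[i]) (z w : R[i]).

Definition restr (lo hi : R) phi (t : R) : R[i] := (ind lo hi t)%:C%C * phi t.

Lemma sq_restr lo hi phi : sq phi -> sq (restr lo hi phi).
Proof.
move=> h; apply: (sqM_bnd (M := 1) h (mcf_ind lo hi)) => t _.
by rewrite nc_real ger0_norm ?ind_ge0 ?ind_le1.
Qed.

Lemma supp_restr lo hi phi : supp lo hi (restr lo hi phi).
Proof. by move=> t h; rewrite /restr ind_0 ?mul0r. Qed.

Lemma nL_restr lo hi phi : sq phi -> nL (restr lo hi phi) <= nL phi.
Proof.
move=> h; rewrite -[leRHS]mul1r; apply: (nLM_bnd ler01 h (mcf_ind lo hi)) => t _.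
by rewrite nc_real ger0_norm ?ind_ge0 ?ind_le1.
Qed.

Lemma FT_split (c a b d : R) phi z : c < a -> a < b -> b < d -> gz (Zg c a b d) phi ->
  FT phi z = FT (restr b d phi) z + FT (restr c a phi) z.
Proof.
move=> hca hab hbd gp.
have c1 := FT_ci z (sq_restr b d gp.1) (@supp_restr b d phi).
have c2 := FT_ci z (sq_restr c a gp.1) (@supp_restr c a phi).
rewrite /FT -(CID c1 c2); congr CI; apply/funext => t; rewrite /restr.
case: (boolP (c <= t <= a)) => h1.
  rewrite (ind1 h1) ind_0; first by rewrite !mul0r add0r mul1r.
  by rewrite negb_and -ltNge; move: h1 => /andP[_ h]; rewrite (le_lt_trans h hab).
case: (boolP (b <= t <= d)) => h2.
  by rewrite (ind1 h2) (ind_0 h1) !mul0r addr0 mul1r.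
by rewrite (gp.2 t) ?mulr0 ?mul0r ?addr0//; apply/andP.
Qed.

(** A list of coefficients and frequencies. The same list acts on any function [F] by
    [\sum_(p <- s) p.1 * F p.2], even if [F] is not a transform. *)
Definition Ye (s : seq (R[i] * R[i])) (t : R) : R[i] := \sum_(p <- s) p.1 * ee p.2 t.

Lemma Ye_en lo hi s t : (ind lo hi t)%:C%C * Ye s t = \sum_(p <- s) p.1 * en lo hi p.2 t.
Proof. by rewrite /Ye mulr_sumr; apply: eq_bigr => p _; rewrite /en; ring. Qed.

Lemma sq_Ye lo hi s : sq (fun t => (ind lo hi t)%:C%C * Ye s t).
Proof.
under eq_fun do rewrite Ye_en.
by apply: sq_sum => p; exact: (sqZ _ (@sq_en _ _ _ _)).
Qed.

Definition nY (lo hi : R) s := nL (fun t => (ind lo hi t)%:C%C * Ye s t).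

Lemma CI_Ye c d phi s : sq phi -> supp c d phi ->
  \sum_(p <- s) p.1 * FT phi p.2 = CI (fun t => phi t * Ye s t).
Proof.
move=> h k; transitivity (CI (fun t => \sum_(p <- s) p.1 * (phi t * ee p.2 t))).
  rewrite CI_sum; last by move=> p; exact: (ciZ _ (FT_ci p.2 h k)).
  by apply: eq_bigr => p _; rewrite -(CIZ _ (FT_ci p.2 h k)).
by congr CI; apply/funext => t; rewrite /Ye mulr_sumr; apply: eq_bigr => p _; ring.
Qed.

Variables (c a b d : R).
Hypotheses (hca : c < a) (hab : a < b) (hbd : b < d).
Local Notation al := (c + b).
Local Notation be := (a + d).

(** A product of transforms has its spectrum in the sum of the two intervals. Cauchy-Schwarz is
    applied in one variable after the other, without forming the convolution. *)
Lemma bilinear_bound (f1 f2 : R -> R[i]) s : sq f1 -> supp b d f1 -> sq f2 -> supp c a f2 ->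
  nc (\sum_(p <- s) p.1 * (FT f1 p.2 * FT f2 p.2)) <=
  nL f1 * nL (fun t : R => (ind b d t)%:C%C : R[i]) * nL f2 * nY al be s.
Proof.
move=> q1 s1 q2 s2.
pose s' (t : R) := [seq (p.1 * ee p.2 t, p.2) | p <- s].
pose H t := \sum_(p <- s) p.1 * FT f2 p.2 * ee p.2 t.
have HE t : H t = CI (fun u => f2 u * Ye s (t + u)).
  transitivity (CI (fun u => f2 u * Ye (s' t) u)).
    by rewrite -(CI_Ye _ q2 s2) /H big_map; apply: eq_bigr => p _ /=; ring.
  congr CI; apply/funext => u; congr (_ * _).
  by rewrite /Ye big_map; apply: eq_bigr => p _ /=; rewrite eeDt mulrA.
have M0 : 0 <= nL f2 * nY al be s by rewrite mulr_ge0 ?nL_ge0.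
have Hb t : b <= t <= d -> nc (H t) <= nL f2 * nY al be s.
  move=> /andP[bt td]; rewrite HE.
  have -> : (fun u => f2 u * Ye s (t + u)) =
     (fun u => f2 u * ((ind al be (u + t))%:C%C * Ye s (u + t))).
    apply/funext => u; case: (boolP (c <= u <= a)) => [/andP[cu ua]|hu]; last by rewrite s2 ?mul0r.
    by rewrite ind1 ?mul1r 1?addrC//; apply/andP; split; lra.
  apply: le_trans (CS q2 (sq_shift t (@sq_Ye al be s))) _.
  by rewrite (nL_shift t (@sq_Ye al be s)).
have -> : \sum_(p <- s) p.1 * (FT f1 p.2 * FT f2 p.2) = \sum_(p <- [seq (p.1 * FT f2 p.2, p.2) | p <- s]) p.1 * FT f1 p.2.
  by rewrite big_map; apply: eq_bigr => p _ /=; ring.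
rewrite (CI_Ye _ q1 s1).
have -> : Ye [seq (p.1 * FT f2 p.2, p.2) | p <- s] = H.
  by apply/funext => t; rewrite /Ye big_map; apply: eq_bigr.
have mH : mcf H.
  by apply: mcf_sum => p; apply: mcfM; [exact: mcf_cst|exact: mcf_ee].
have -> : (fun t => f1 t * H t) = (fun t => f1 t * ((ind b d t)%:C%C * H t)).
  apply/funext => t; case: (boolP (b <= t <= d)) => h; last by rewrite s1 ?mul0r.
  by rewrite ind1// mul1r.
pose M : R[i] := (nL f2 * nY al be s)%:C%C.
have sM : sq (fun t => M * (ind b d t)%:C%C) := sqZ M (@sq_ind _ b d).
have mI : mcf (fun t => (ind b d t)%:C%C * H t) by exact: (mcfM (mcf_ind b d) mH).
have lM t : nc ((ind b d t)%:C%C * H t) <= nc (M * (ind b d t)%:C%C).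
  rewrite !ncM mulrC; case: (boolP (b <= t <= d)) => h; last by rewrite ind_0// nc0 !mulr0.
  by apply: ler_wpM2r; [exact: nc_ge0|rewrite /M nc_real ger0_norm// Hb].
apply: le_trans (CS q1 (sq_le mI sM lM)) _.
rewrite -!mulrA; apply: ler_wpM2l; first exact: nL_ge0.
apply: le_trans (nL_le mI sM lM) _.
by rewrite (nLZ M (@sq_ind _ b d)) /M nc_real ger0_norm// mulrC mulrA.
Qed.

Lemma det_bound (g h : R -> R[i]) : gz (Zg c a b d) g -> gz (Zg c a b d) h ->
  exists2 C, 0 <= C & forall s,
    nc (\sum_(p <- s) p.1 * (FT (restr b d g) p.2 * FT (restr c a h) p.2 -
                              FT (restr b d h) p.2 * FT (restr c a g) p.2)) <= C * nY al be s.
Proof.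
move=> [gg _] [gh _].
pose C1 := nL (restr b d g) * nL (fun t : R => (ind b d t)%:C%C : R[i]) * nL (restr c a h).
pose C2 := nL (restr b d h) * nL (fun t : R => (ind b d t)%:C%C : R[i]) * nL (restr c a g).
exists (C1 + C2); first by rewrite addr_ge0// !mulr_ge0 ?nL_ge0.
move=> s; under eq_bigr do rewrite mulrBr; rewrite sumrB.
apply: le_trans (ncD _ _) _; rewrite ncN mulrDl; apply: lerD; apply: bilinear_bound;
  by [exact: sq_restr|exact: supp_restr].
Qed.

(* Replaces the coefficients of an exponential sum so that applying [F] with [F l0 = 0] to the new sum is
   the same as applying [F z / (z - l0)] to the old one. *)
Definition sdiv (l0 : R[i]) (s : seq (R[i] * R[i])) :=
  [seq (p.1 / (p.2 - l0), p.2) | p <- s] ++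
  [seq (- (p.1 / (p.2 - l0) * ee (p.2 - l0) al), l0) | p <- s].

Lemma sdiv_sum l0 s (F : R[i] -> R[i]) : F l0 = 0 ->
  \sum_(p <- sdiv l0 s) p.1 * F p.2 = \sum_(p <- s) p.1 * (F p.2 / (p.2 - l0)).
Proof.
move=> h; rewrite /sdiv big_cat !big_map /= [X in _ + X]big1 ?addr0; last first.
  by move=> p _; rewrite h mulr0.
by apply: eq_bigr => p _; ring.
Qed.

(** Up to the factor [i * ee l0 t], the new sum is the primitive of [ee (- l0) * Ye s] that vanishes
    at the left end [al]; the extra terms of frequency [l0] are its constant of integration. A
    primitive on a bounded interval is bounded by the norm. *)
Lemma sdiv_nY l0 : exists2 C, 0 <= C & forall s, (forall p, p \in s -> p.2 != l0) ->
  nY al be (sdiv l0 s) <= C * nY al be s.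
Proof.
have ab : al <= be by rewrite lerD ?ltW.
pose k := `|Im l0| * (`|al| + `|be|).
pose E0 := nL (en al be (- l0)).
exists (expR k * E0 * Num.sqrt (be - al)); first by rewrite !mulr_ge0 ?expR_ge0 ?nL_ge0 ?sqrtr_ge0.
move=> s hs; set N := nY al be s; have N0 : 0 <= N by exact: nL_ge0.
have YE t : al <= t <= be -> Ye (sdiv l0 s) t =
    'i%C * ee l0 t * CI (fun u => ((ind al t u)%:C%C * ee (- l0) u) * ((ind al be u)%:C%C * Ye s u)).
  move=> /andP[h1 h2].
  pose f u : R[i] := (ind al t u)%:C%C * ee (- l0) u.
  have qf : sq f by exact: sq_en.
  have sf : supp al t f by exact: supp_en.
  have -> : (fun u => f u * ((ind al be u)%:C%C * Ye s u)) = (fun u => f u * Ye s u).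
    apply/funext => u; case: (boolP (al <= u <= t)) => hu; last by rewrite sf ?mul0r.
    by rewrite (@ind1 _ al be) ?mul1r//; move: hu => /andP[-> h3]; exact: le_trans h2.
  rewrite -(CI_Ye s qf sf) /Ye /sdiv big_cat !big_map /= -big_split /= mulr_sumr.
  rewrite big_seq [RHS]big_seq; apply: eq_bigr => p ps.
  have e1 : FT f p.2 = FT (fun u => (ind al t u)%:C%C) (p.2 - l0).
    by rewrite /f -FT_mulee; congr CI; apply/funext => u; rewrite mulrC [in RHS]mulrC; ring.
  have p0 : p.2 - l0 != 0 by rewrite subr_eq0 hs.
  have := FT_box (p.2 - l0) h1; rewrite -e1 => e2.
  have -> : ee p.2 t = ee l0 t * ee (p.2 - l0) t by rewrite -eeD addrC subrK.
  have -> : 'i%C * ee l0 t * (p.1 * FT f p.2) = ee l0 t * p.1 * ('i%C * (p.2 - l0) * FT f p.2) / (p.2 - l0) by field.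
  by rewrite e2; field.
have Yb t : al <= t <= be -> nc (Ye (sdiv l0 s) t) <= expR k * E0 * N.
  move=> ht; rewrite YE// !ncM nci mul1r nc_ee -mulrA; apply: ler_pM; rewrite ?expR_ge0 ?nc_ge0//.
    by rewrite /k -normrN; exact: (expR_bnd (- Im l0) ht).
  have qf : sq (fun u => (ind al t u)%:C%C * ee (- l0) u) by exact: sq_en.
  apply: le_trans (CS qf (@sq_Ye al be s)) _; apply: ler_wpM2r => //.
  apply: nL_le; [exact: sq_mcf qf|exact: sq_en|move=> u].
  rewrite /en !ncM; apply: ler_wpM2r; first exact: nc_ge0.
  rewrite !nc_real !ger0_norm ?ind_ge0// /ind ler_nat.
  by case: (boolP (al <= u <= t)) => // /andP[-> h3]; move: ht => /andP[_ h4]; rewrite (le_trans h3 h4).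
apply: le_of_sqr; first by rewrite !mulr_ge0 ?expR_ge0 ?nL_ge0 ?sqrtr_ge0.
have -> : (expR k * E0 * Num.sqrt (be - al) * N) ^+ 2 = (expR k * E0 * N) ^+ 2 * (be - al).
  have e : Num.sqrt (be - al) ^+ 2 = be - al by apply: sqr_sqrtr; rewrite subr_ge0.
  by rewrite -[in RHS]e; ring.
apply: (nL_bnd ab (sq_mcf (@sq_Ye al be _))) => t ht; last by rewrite ind_0 ?mul0r.
by rewrite ind1// mul1r; exact: Yb.
Qed.

(** Evaluating the conjugate of an exponential at its own frequency gives a squared norm, so any
    interval carries a function with a prescribed value at [l]. *)
Lemma FT_enJ (lo hi : R) l : lo < hi ->
  exists2 m : R, 0 < m & FT (fun t => (en lo hi l t)^*%C) l = m%:C%C.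
Proof.
move=> lh; exists (nL (en lo hi l) ^+ 2).
  have m0 : 0 < expR (- (`|- Im l| * (`|lo| + `|hi|))) by exact: expR_gt0.
  have : expR (- (`|- Im l| * (`|lo| + `|hi|))) ^+ 2 * (hi - lo) <= nL (en lo hi l) ^+ 2.
    rewrite nL_sq -(RI_ind (ltW lh)) -(RIZ _ (ri_ind _ _)).
    apply: RI_le; [exact: (riZ _ (ri_ind _ _))|exact: (sq_ri (@sq_en _ lo hi l))|move=> t].
    rewrite /en ncM nc_real (ger0_norm (ind_ge0 lo hi t)); case: (boolP (lo <= t <= hi)) => ht.
      rewrite (ind1 ht) mulr1 mul1r lerXn2r ?nnegrE ?nc_ge0 ?expR_ge0// nc_ee.
      have := expR_bnd (Im l) ht; rewrite mulNr !expRN normrN => h.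
      by rewrite lef_pV2 ?posrE ?expR_gt0.
    by rewrite (ind_0 ht) mulr0 mul0r expr0n.
  by apply: lt_le_trans; rewrite mulr_gt0 ?exprn_gt0// subr_gt0.
rewrite nL_CI; last exact: sq_en.
congr CI; apply/funext => t; rewrite /en; move: (ee l t) => w.
by apply: ceq; rewrite /ind; case: (lo <= t <= hi) => /=; rewrite ?cE; ring.
Qed.

Definition row (P Q : R -> R[i]) (t : R) : R[i] := restr b d P t + restr c a Q t.

Lemma gz_row P Q : sq P -> sq Q -> gz (Zg c a b d) (row P Q).
Proof.
move=> hP hQ; split; first exact: (sqD (sq_restr _ _ hP) (sq_restr _ _ hQ)).
by move=> t /andP[h1 h2]; rewrite /row /restr !ind_0// !mul0r addr0.
Qed.

Lemma row_p P Q : restr b d (row P Q) = restr b d P.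
Proof.
apply/funext => t; rewrite /row /restr; case: (boolP (b <= t <= d)) => h; last by rewrite (ind_0 h) !mul0r.
rewrite (ind1 h) ind_0 ?mul0r ?addr0 ?mul1r// negb_and -!ltNge.
by move: h => /andP[h _]; rewrite (lt_le_trans hab h) orbT.
Qed.

Lemma row_m P Q : restr c a (row P Q) = restr c a Q.
Proof.
apply/funext => t; rewrite /row /restr; case: (boolP (c <= t <= a)) => h; last by rewrite (ind_0 h) !mul0r.
rewrite (ind1 h) ind_0 ?mul0r ?add0r ?mul1r// negb_and -!ltNge.
by move: h => /andP[_ h]; rewrite (le_lt_trans h hab).
Qed.

Variable Lam : set R[i].
Hypothesis hCIS : CIS c a b d Lam.
Local Notation Z := (Zg c a b d).

(** [C] is independent of [s], so the bound survives the passage to the closed span. *)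
Lemma minimal_bound (l l0 : R[i]) : Lam l -> Lam l0 -> l != l0 ->
  exists C : R, forall s : seq (R[i] * R[i]),
    (forall p, p \in s -> [/\ Lam p.2, p.2 != l & p.2 != l0]) ->
    1 <= C * nL (fun t => en al be l t + \sum_(p <- s) p.1 * en al be p.2 t).
Proof.
move=> hl hl0 ll0.
have fs := FT_split _ hca hab hbd.
have [C0 C00 hdual] := dual_E hca hab hbd hCIS.
have [g [gg _ hg]] := hdual _ hl.
have [m1 m10 e1] := FT_enJ l hbd; have [m2 m20 e2] := FT_enJ l hca.
(* The row [h] has parts 1 and -1 at [l]: it vanishes there as a whole but its parts do not. *)
pose P t := m1^-1%:C%C * (en b d l t)^*%C; pose Q t := - m2^-1%:C%C * (en c a l t)^*%C.
have sP : sq P by exact: (sqZ _ (sqJ (@sq_en _ _ _ _))).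
have sQ : sq Q by exact: (sqZ _ (sqJ (@sq_en _ _ _ _))).
have suJ (lo hi : R) : supp lo hi (fun t => (en lo hi l t)^*%C).
  by move=> t ht; rewrite (@supp_en _ lo hi) ?conjc0.
have rP : restr b d P = P.
  apply/funext => t; rewrite /restr; case: (boolP (b <= t <= d)) => ht; first by rewrite ind1 ?mul1r.
  by rewrite /P suJ ?mulr0.
have rQ : restr c a Q = Q.
  apply/funext => t; rewrite /restr; case: (boolP (c <= t <= a)) => ht; first by rewrite ind1 ?mul1r.
  by rewrite /Q suJ ?mulr0.
have rk (m : R) : 0 < m -> m^-1%:C%C * m%:C%C = 1 :> R[i].
  by move=> m0; rewrite -rmorphM mulVf ?gt_eqF.
pose h := row P Q.
have gh : gz Z h := gz_row sP sQ.
have hp : FT (restr b d h) l = 1.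
  by rewrite row_p rP (FTZ _ l (sqJ (@sq_en _ _ _ _)) (suJ b d)) e1 rk.
have hm : FT (restr c a h) l = -1.
  by rewrite row_m rQ (FTZ _ l (sqJ (@sq_en _ _ _ _)) (suJ c a)) e2 mulNr rk.
have hl_0 : FT h l = 0 by rewrite (fs h l gh) hp hm subrr.
have [k gk hk] := multiplier_exists hca hab hbd hCIS gh (fun _ => hl_0).
pose dt (f1 f2 : R -> R[i]) z := FT (restr b d f1) z * FT (restr c a f2) z - FT (restr b d f2) z * FT (restr c a f1) z.
pose D z := (z - l) * dt g k z + dt g h z.
(* Since [z - l = (z - l0) + (l0 - l)], [D z / (z - l0)] is [dt g k z + U z / (z - l0)] with
   [U l0 = D l0 = 0]. The first term is bounded by [det_bound], the second by [sdiv_nY] and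
   [det_bound]. *)
pose U z := (l0 - l) * dt g k z + dt g h z.
have D0 z : Lam z -> z != l -> D z = 0.
  move=> hz zl; have := hg z hz; rewrite (negbTE zl) mul0r (fs g z gg) => /eqP.
  rewrite addr_eq0 => /eqP eg; have := hk z hz; rewrite (fs k z gk) (fs h z gh) => eh.
  rewrite /D /dt eg.
  rewrite (_ : forall x y u v G : R[i], (z - l) * (- G * u - x * G) + (- G * v - y * G) = - G * ((z - l) * (x + u) + (y + v))); last by move=> *; ring.
  by rewrite eh mulr0.
have Dl : D l != 0.
  have := hg l hl; rewrite eqxx mul1r (fs g l gg) => eg.
  rewrite /D /dt subrr mul0r add0r hp hm mulrN1 mul1r -opprD eg oppr_eq0.
  exact: nEC_neq0.
have [C1 C10 h1] := det_bound gg gk; have [C2 C20 h2] := det_bound gg gh.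
have [C3 C30 h3] := sdiv_nY l0.
pose Ct := C1 + (nc (l0 - l) * C1 + C2) * C3.
have main s : (forall p, p \in s -> p.2 != l0) ->
    nc (\sum_(p <- s) p.1 * (D p.2 / (p.2 - l0))) <= Ct * nY al be s.
  move=> hs.
  have -> : \sum_(p <- s) p.1 * (D p.2 / (p.2 - l0)) =
     \sum_(p <- s) p.1 * dt g k p.2 + \sum_(p <- s) p.1 * (U p.2 / (p.2 - l0)).
    rewrite -big_split /= big_seq [RHS]big_seq; apply: eq_bigr => p ps.
    by rewrite /D /U; field; rewrite subr_eq0 hs.
  have U0 : U l0 = 0 by rewrite -(D0 l0)// eq_sym.
  rewrite -(sdiv_sum _ U0); apply: le_trans (ncD _ _) _; rewrite mulrDl; apply: lerD; first exact: h1.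
  rewrite /U; under eq_bigr do rewrite mulrDr mulrCA.
  rewrite big_split /= -mulr_sumr; apply: le_trans (ncD _ _) _; rewrite ncM.
  rewrite -mulrA mulrDl; apply: lerD.
    rewrite -mulrA; apply: ler_wpM2l; first exact: nc_ge0.
    apply: le_trans (h1 _) _; apply: ler_wpM2l => //; exact: h3.
  by apply: le_trans (h2 _) _; apply: ler_wpM2l => //; exact: h3.
pose kap := D l / (l - l0).
have k0 : 0 < nc kap by rewrite nc_gt0 mulf_eq0 negb_or Dl invr_eq0 subr_eq0.
exists (Ct / nc kap) => s hs.
have hs' p : p \in (1, l) :: s -> p.2 != l0.
  by rewrite inE => /predU1P[->//|/hs[]].
have := main _ hs'; rewrite big_cons /= mul1r big_seq big1 ?addr0; last first.
  by move=> p /hs[q1 q2 _]; rewrite D0// mul0r mulr0.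
rewrite -/kap => hh.
have -> : (fun t => en al be l t + \sum_(p <- s) p.1 * en al be p.2 t) =
   (fun t => (ind al be t)%:C%C * Ye ((1, l) :: s) t).
  by apply/funext => t; rewrite Ye_en big_cons /= mul1r.
by rewrite mulrAC ler_pdivlMr// mul1r.
Qed.

End Rows.

(** * Tools for uniqueness *)

Section Tools.
Variable R : realType.
Implicit Types (phi psi : R -> R[i]) (z w : R[i]).

(** [J] almost attains the supremum of the partial sums, so a finite set disjoint from it cannot add
    more than [e]. *)
Lemma tail_ex (I : choiceType) (Lam : set I) (W : I -> R) B : bsum Lam W B ->
  forall e, 0 < e -> exists2 J, inL Lam J & forall s, inL Lam s -> (forall i, i \in s -> i \notin J) ->
    \sum_(i <- s) W i <= e.
Proof.
move=> hB e e0.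
pose A : set R := [set x | exists2 s, inL Lam s & x = \sum_(i <- s) W i].
have hA : has_sup A.
  split; first by exists 0, [::]; rewrite ?big_nil.
  by exists B => _ [s hs ->]; exact: hB.
have [_ [J hJ ->] hlt] := sup_adherent e0 hA.
exists J => // s hs dis.
have hcat : inL Lam (J ++ s).
  split.
    rewrite cat_uniq hJ.1 hs.1 andbT /= -all_predC; apply/allP => i si /=; exact: dis.
  by move=> i; rewrite mem_cat => /orP[]; [exact: hJ.2|exact: hs.2].
have : \sum_(i <- J ++ s) W i <= sup A by apply: (ub_le_sup hA.2); exists (J ++ s).
rewrite big_cat /=; lra.
Qed.

Lemma nL_wn L r phi : 0 <= L -> 0 <= r -> sq phi -> supp 0 L phi -> nL phi <= expR (r * L) * wn r phi.
Proof.
move=> L0 r0 h s; rewrite /wn -(ger0_norm (expR_ge0 (r * L))) -nc_real.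
rewrite -(nLZ _ (sq_wn r h s)); apply: nL_le; first exact: sq_mcf.
  exact: (sqZ _ (sq_wn r h s)).
move=> t; case: (boolP (0 <= t <= L)) => ht; last by rewrite s// nc0 nc_ge0.
rewrite mulrA -rmorphM -expRD ncM nc_real ger0_norm ?expR_ge0// ler_peMl ?nc_ge0//.
rewrite -[leLHS]expR0 ler_expR; have /andP[_ h'] := ht.
by have := ler_wpM2l r0 h'; lra.
Qed.

Lemma nL_le_wn L r phi : 0 <= L -> 0 <= r -> sq phi -> supp 0 L phi -> wn r phi <= nL phi.
Proof. by move=> L0 r0 h s; rewrite -[leRHS]wn0; exact: (wn_le L0 r0 h s). Qed.

Lemma wnD L r phi psi : sq phi -> supp 0 L phi -> sq psi -> supp 0 L psi ->
  wn r (fun t => phi t + psi t) <= wn r phi + wn r psi.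
Proof.
move=> h1 h2 k1 k2; rewrite /wn; under [X in nL X]eq_fun do rewrite mulrDr.
exact: (nLD (sq_wn r h1 h2) (sq_wn r k1 k2)).
Qed.

Lemma wnZ L r (k : R[i]) phi : sq phi -> supp 0 L phi -> wn r (fun t => k * phi t) = nc k * wn r phi.
Proof.
move=> h1 h2; rewrite /wn -(nLZ k (sq_wn r h1 h2)); congr nL; apply/funext => t; ring.
Qed.

Lemma wn_sum L r (I : Type) (s : seq I) (F : I -> R -> R[i]) :
  (forall i, sq (F i)) -> (forall i, supp 0 L (F i)) ->
  wn r (fun t => \sum_(i <- s) F i t) <= \sum_(i <- s) wn r (F i).
Proof.
move=> h1 h2; rewrite /wn; under [X in nL X]eq_fun do rewrite mulr_sumr.
exact: (nL_sum s (fun i => sq_wn r (h1 i) (h2 i))).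
Qed.

Lemma ee_diff z w (t : R) : 0 <= t ->
  nc (ee w t - ee z t) <= 2 * nc (w - z) * t * expR (nc (w - z) * t) * expR (nc z * t).
Proof.
move=> t0; have -> : ee w t - ee z t = - ((1 - ee (w - z) t) * ee z t).
  by rewrite mulrBl mul1r -eeD subrK opprB.
rewrite ncN ncM; apply: ler_pM; rewrite ?nc_ge0//.
  by apply: le_trans (nc_ee_sub1 _ _) _; rewrite ger0_norm// !mulrA.
rewrite nc_ee ler_expR; apply: ler_wpM2r => //.
by apply: le_trans (Im_le_nc z); rewrite -normrN ler_norm.
Qed.

Lemma FT_near L phi z w : 0 <= L -> sq phi -> supp 0 L phi ->
  nc (FT phi w - FT phi z) <=
  (2 * nc (w - z) * L * expR (nc (w - z) * L) * expR (nc z * L)) * Num.sqrt L * nL phi.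
Proof.
move=> L0 h s.
have M0 : 0 <= 2 * nc (w - z) * L * expR (nc (w - z) * L) * expR (nc z * L).
  by rewrite !mulr_ge0 ?nc_ge0 ?expR_ge0.
have := FT_diff (z := z) (w := w) L0 M0 h s; rewrite subr0; apply => t /andP[t0 tL].
apply: le_trans (ee_diff z w t0) _.
by rewrite !ler_pM ?mulr_ge0 ?nc_ge0 ?expR_ge0// ?ler_expR ler_wpM2l ?nc_ge0.
Qed.

Lemma FT_cont L phi z1 eta : 0 <= L -> sq phi -> supp 0 L phi -> 0 < eta ->
  (forall z, z != z1 -> nc (z - z1) < eta -> FT phi z = 0) -> FT phi z1 = 0.
Proof.
move=> L0 h s e0 h0; apply/eqP; rewrite -nc_eq0 eq_le nc_ge0 andbT.
apply: (@small_pow _ _ _ (2 * L * expR (Num.min (eta / 2) 1 * L) * expR (nc z1 * L) * Num.sqrt L * nL phi)) => n.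
pose del := Num.min (eta / 2) 1 * (1 / 2) ^+ n.
have m0 : 0 < Num.min (eta / 2) 1 by rewrite lt_min divr_gt0/=.
have p0 : 0 < (1 / 2 : R) ^+ n by rewrite exprn_gt0.
have p1 : (1 / 2 : R) ^+ n <= 1 by apply: exprn_ile1; lra.
have d0 : 0 < del by rewrite mulr_gt0.
have d1 : del <= Num.min (eta / 2) 1 by rewrite ler_piMr// ltW.
have d2 : del <= (1 / 2) ^+ n by rewrite ler_piMl ?(ltW p0)// ge_min lexx orbT.
have de : del < eta by apply: (le_lt_trans d1); rewrite gt_min; apply/orP; left; lra.
pose z := z1 + del%:C%C.
have zd : z - z1 = del%:C%C by rewrite /z addrC addKr.
have nz : nc (z - z1) = del by rewrite zd nc_real gtr0_norm.
have := FT_near z1 z L0 h s; rewrite h0; last 2 first.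
- by rewrite -subr_eq0 -nc_gt0 nz.
- by rewrite nz.
rewrite sub0r ncN nz add0r => hh; apply: le_trans hh _.
have e1 : expR (del * L) <= expR (Num.min (eta / 2) 1 * L) by rewrite ler_expR ler_wpM2r.
have -> : 2 * L * expR (Num.min (eta / 2) 1 * L) * expR (nc z1 * L) * Num.sqrt L * nL phi * (1 / 2) ^+ n =
  (2 * (1 / 2) ^+ n * L * expR (Num.min (eta / 2) 1 * L) * expR (nc z1 * L)) * Num.sqrt L * nL phi by ring.
do 2 (apply: ler_wpM2r; first by rewrite ?nL_ge0 ?sqrtr_ge0).
apply: ler_wpM2r; first exact: expR_ge0.
apply: ler_pM => //; rewrite ?mulr_ge0 ?expR_ge0 ?(ltW m0) ?(ltW p0)//.
by apply: ler_wpM2r => //; apply: ler_wpM2l.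
Qed.

(* Dividing [n] times by [z - z1] gives [FT phi z = (z - z1) ^+ n * FT psi z] with the norm of [psi] bounded by
   [C * rho ^- n], for any [rho], as seen from the line [Im z = Im z1 + rho]. *)
Lemma identity_theorem L phi z1 eta : 0 <= L -> sq phi -> supp 0 L phi -> 0 < eta ->
  (forall z, nc (z - z1) < eta -> FT phi z = 0) -> forall z, FT phi z = 0.
Proof.
move=> L0 h s e0 h0 z.
pose ps := fix ps n := if n is m.+1 then quot 0 L z1 (ps m) else phi.
have qs n : sq (ps n) /\ supp 0 L (ps n).
  elim: n => [//|n [IH1 IH2]] /=; split; [exact: sq_quot|exact: supp_quot].
have zn n : forall w, nc (w - z1) < eta -> FT (ps n) w = 0.
  elim: n => [//|n IH] w hw /=; have [IH1 IH2] := qs n.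
  have f1 : FT (ps n) z1 = 0 by apply: IH; rewrite subrr nc0.
  have gen v : v != z1 -> nc (v - z1) < eta -> FT (quot 0 L z1 (ps n)) v = 0.
    move=> vz hv; have := @FT_quot _ 0 L z1 _ IH1 IH2 v f1; rewrite (IH v hv) => /eqP.
    by rewrite mulf_eq0 subr_eq0 (negbTE vz) => /eqP.
  have [->|wz] := eqVneq w z1; last exact: gen.
  by apply: (FT_cont L0 _ _ e0 gen); [exact: sq_quot|exact: supp_quot].
(* Each division gains [rho^-1] and costs [nc (z - z1)], a ratio of at most 1/2. The line [Im z = r]
   is placed at nonnegative height and at distance at least [rho] from [z1]. *)
pose rho := 2 * (nc (z - z1) + 1).
have r0 : 0 < rho by have := nc_ge0 (z - z1); rewrite /rho; lra.
pose r := `|Im z1| + rho.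
have rge : 0 <= r by rewrite addr_ge0 ?(ltW r0).
have rd : rho <= `|r - Im z1|.
  by apply: (@le_trans _ _ (r - Im z1)); [have := ler_norm (Im z1); rewrite /r; lra|exact: ler_norm].
have rn : r != Im z1 by rewrite -subr_eq0 -normr_gt0 (lt_le_trans r0 rd).
have wb n : wn r (ps n) <= rho^-1 ^+ n * wn r phi.
  elim: n => [|n IH] /=; first by rewrite expr0 mul1r.
  have [IH1 IH2] := qs n.
  have f1 : FT (ps n) z1 = 0 by apply: zn; rewrite subrr nc0.
  apply: le_trans (wn_quot L0 IH1 IH2 f1 rn) _; rewrite exprS -mulrA; apply: ler_pM IH; rewrite ?invr_ge0 ?nL_ge0//.
  by rewrite lef_pV2 ?posrE// (lt_le_trans r0 rd).
have FTn n : FT phi z = (z - z1) ^+ n * FT (ps n) z.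
  elim: n => [|n IH]; first by rewrite expr0 mul1r.
  have [IH1 IH2] := qs n.
  have f1 : FT (ps n) z1 = 0 by apply: zn; rewrite subrr nc0.
  by rewrite IH exprSr -mulrA /= (@FT_quot _ 0 L z1 _ IH1 IH2 z f1).
apply/eqP; rewrite -nc_eq0 eq_le nc_ge0 andbT.
pose E := nL (en 0 L z).
apply: (@small_pow _ _ _ (expR (r * L) * wn r phi * E)) => n; rewrite add0r.
have [q1 q2] := qs n.
rewrite (FTn n) ncM ncX; apply: le_trans (ler_wpM2l _ (FT_bound z q1 q2)) _.
  by rewrite exprn_ge0 ?nc_ge0.
rewrite -/E.
have a1 : nL (ps n) <= expR (r * L) * (rho^-1 ^+ n * wn r phi).
  by apply: le_trans (nL_wn L0 rge q1 q2) _; apply: ler_wpM2l; rewrite ?expR_ge0.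
have a2 : nc (z - z1) ^+ n * rho^-1 ^+ n <= (1 / 2) ^+ n.
  rewrite -exprMn lerXn2r ?nnegrE ?mulr_ge0 ?invr_ge0 ?nc_ge0 ?(ltW r0)//.
  by rewrite ler_pdivrMr// /rho; have := nc_ge0 (z - z1); lra.
apply: (@le_trans _ _ (nc (z - z1) ^+ n * (expR (r * L) * (rho^-1 ^+ n * wn r phi) * E))).
  apply: ler_wpM2l; first by rewrite exprn_ge0 ?nc_ge0.
  by apply: ler_wpM2r; rewrite ?nL_ge0.
have -> : nc (z - z1) ^+ n * (expR (r * L) * (rho^-1 ^+ n * wn r phi) * E) =
  expR (r * L) * wn r phi * E * (nc (z - z1) ^+ n * rho^-1 ^+ n) by ring.
by apply: ler_wpM2l => //; rewrite !mulr_ge0 ?expR_ge0 ?nL_ge0.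
Qed.

(* One of [r / 4], [r / 2] and [3 r / 4] is far from both points. *)
Lemma choose_R (r x y : R) : 0 < r -> exists r1, [/\ 0 <= r1 <= r, r / 8 <= `|r1 - x| & r / 8 <= `|r1 - y|].
Proof.
move=> r0.
have far (u : R) (p p' : R) : r / 4 <= p' - p -> `|p - u| < r / 8 -> r / 8 <= `|p' - u|.
  move=> hp; rewrite ltr_norml => /andP[h1 h2]; apply: le_trans (ler_norm _); lra.
have far' (u : R) (p p' : R) : r / 4 <= p' - p -> `|p' - u| < r / 8 -> r / 8 <= `|p - u|.
  move=> hp; rewrite ltr_norml => /andP[h1 h2]; rewrite -normrN; apply: le_trans (ler_norm _); lra.
pose p1 := r / 4; pose p2 := r / 2; pose p3 := 3 * r / 4.
have d12 : r / 4 <= p2 - p1 by rewrite /p1 /p2; lra.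
have d23 : r / 4 <= p3 - p2 by rewrite /p3 /p2; lra.
have d13 : r / 4 <= p3 - p1 by rewrite /p3 /p1; lra.
have [i1 i2 i3] : [/\ 0 <= p1 <= r, 0 <= p2 <= r & 0 <= p3 <= r].
  by split; apply/andP; split; rewrite /p1 /p2 /p3; lra.
have [x1|x1] := leP (r / 8) `|p1 - x|.
  have [y1|y1] := leP (r / 8) `|p1 - y|; first by exists p1.
  have [x2|x2] := leP (r / 8) `|p2 - x|.
    by exists p2; split => //; exact: far y1.
  by exists p3; split => //; [exact: far x2|exact: far y1].
have [y2|y2] := leP (r / 8) `|p2 - y|.
  by exists p2; split => //; exact: far x1.
by exists p3; split => //; [exact: far x1|exact: far y2].
Qed.

(** The zeros may lie on the line [Im z = r] itself. The divisions are estimated on a lower line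
    away from both zeros, and [wn_le] leads back up. *)
Lemma wn_quot2 L r phi z w : 0 <= L -> 0 < r -> sq phi -> supp 0 L phi -> FT phi z = 0 -> FT phi w = 0 ->
  z != w -> wn r (quot 0 L w (quot 0 L z phi)) <= (8 / r) ^+ 2 * nL phi.
Proof.
move=> L0 r0 h s hz hw zw.
have [r1 [/andP[r10 r1r] h1 h2]] := choose_R (Im z) (Im w) r0.
have r8 : 0 < r / 8 by rewrite divr_gt0.
have q1 := @sq_quot _ 0 L z _ h s; have s1 := @supp_quot _ 0 L z phi.
have f1 : FT (quot 0 L z phi) w = 0.
  have := @FT_quot _ 0 L z _ h s w hz; rewrite hw => /eqP.
  by rewrite mulf_eq0 subr_eq0 eq_sym (negbTE zw) => /eqP.
have n1 : r1 != Im z by rewrite -subr_eq0 -normr_gt0 (lt_le_trans r8 h1).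
have n2 : r1 != Im w by rewrite -subr_eq0 -normr_gt0 (lt_le_trans r8 h2).
have q2 := @sq_quot _ 0 L w _ q1 s1; have s2 := @supp_quot _ 0 L w (quot 0 L z phi).
apply: le_trans (wn_le L0 r1r q2 s2) _.
apply: le_trans (wn_quot L0 q1 s1 f1 n2) _.
have b1 : `|r1 - Im z|^-1 <= 8 / r.
  by rewrite -invf_div lef_pV2 ?posrE// (lt_le_trans r8).
have b2 : `|r1 - Im w|^-1 <= 8 / r.
  by rewrite -invf_div lef_pV2 ?posrE// (lt_le_trans r8).
rewrite expr2 -mulrA; apply: ler_pM; rewrite ?invr_ge0 ?nL_ge0//.
apply: le_trans (wn_quot L0 h s hz n1) _; apply: ler_pM; rewrite ?invr_ge0 ?nL_ge0//.
exact: (nL_le_wn L0 r10 h s).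
Qed.

(** * Bumps whose transforms decay quadratically *)

Definition eta (k t : R) : R[i] := CI (fun s : R => (ind 0 k s)%:C%C * (ind 0 k (t - s))%:C%C).
Definition Bx (k : R) z : R[i] := FT (fun t => (ind 0 k t)%:C%C) z.

Lemma eta_supp k : supp 0 (2 * k) (eta k).
Proof.
move=> t ht; rewrite /eta -(CI0 R); congr CI; apply/funext => s.
case: (boolP (0 <= s <= k)) => [/andP[s0 sk]|hs]; last by rewrite (ind_0 hs) mul0r.
rewrite (@ind_0 _ _ _ (t - s)) ?mulr0//; apply: contraNN ht => /andP[h1 h2].
by apply/andP; split; lra.
Qed.

(** [eta] is the indicator of [[0, k]] convolved with itself: after Fubini the translation by [s]
    factors out one copy of [Bx k z]. *)
Lemma eta_Fubini k z : 0 < k -> [/\ ci (fun t => eta k t * ee z t) & FT (eta k) z = Bx k z ^+ 2].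
Proof.
move=> k0.
pose F (t s : R) : R[i] := ((ind 0 k s)%:C%C * (ind 0 k (t - s))%:C%C) * ee z t.
have mF : mcf2 F.
  apply: mcf2M; last exact: (mcf2_fst (mcf_ee z)).
  apply: mcf2M; first exact: (mcf2_snd (mcf_ind 0 k)).
  exact: (mcf2_sub (mcf_ind 0 k)).
pose M := expR (`|Im z| * (`|0 : R| + `|2 * k|)).
have [c1 c2 c3] : [/\ (forall t, ci (F t)), ci (fun t => CI (F t)) & CI (fun t => CI (F t)) = CI (fun s => CI (fun t => F t s))].
  apply: (CFubini_dom mF (riZ M (ri_ind 0 (2 * k))) (ri_ind 0 k)) => t s.
  rewrite /F !ncM !nc_real !(ger0_norm (ind_ge0 _ _ _)).
  case: (boolP (0 <= s <= k)) => hs; last by rewrite (ind_0 hs) !mul0r mulr0.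
  case: (boolP (0 <= t - s <= k)) => hts; last by rewrite (ind_0 hts) mulr0 mul0r !mulr_ge0 ?ind_ge0 ?expR_ge0.
  have ht : 0 <= t <= 2 * k by move: hs hts => /andP[? ?] /andP[? ?]; apply/andP; split; lra.
  rewrite (ind1 hs) (ind1 hts) (ind1 ht) !mul1r !mulr1 nc_ee /M -normrN; exact: expR_bnd.
have ci0 (t : R) : ci (fun s : R => (ind 0 k s)%:C%C * (ind 0 k (t - s))%:C%C : R[i]).
  apply: (ci_dom (g := ind 0 k)); last 2 first.
  - exact: ri_ind.
  - move=> s; rewrite ncM !nc_real !(ger0_norm (ind_ge0 _ _ _)) ler_piMr ?ind_ge0 ?ind_le1//.
  apply: mcfM; first exact: mcf_ind.
  apply: mcf_real; apply: (measurableT_comp (mf_ind 0 k)).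
  by apply: mfB; [exact: mf_cst|exact: mf_id].
have e1 : (fun t => CI (F t)) = (fun t => eta k t * ee z t).
  apply/funext => t; rewrite /eta mulrC -(CIZ _ (ci0 t)); congr CI; apply/funext => s; rewrite /F mulrC//.
split; first by rewrite -e1.
rewrite /FT -e1 c3.
have qi := @sq_ind _ 0 k; have si := @supp_indc _ 0 k.
have cb := FT_ci z qi si.
have e2 s : CI (fun t => F t s) = Bx k z * ((ind 0 k s)%:C%C * ee z s).
  transitivity (CI (fun t => ((ind 0 k s)%:C%C * ee z s) * ((ind 0 k (t - s))%:C%C * ee z (t - s)))).
    congr CI; apply/funext => t; rewrite /F.
    have -> : ee z t = ee z (t - s) * ee z s by rewrite -eeDt subrK.
    ring.
  have cs := ci_shift (- s) cb.
  by rewrite (CIZ _ cs) (CI_shift (- s) cb) mulrC.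
by under eq_fun do rewrite e2; rewrite (CIZ _ cb) expr2.
Qed.

Lemma eta_sq k : 0 < k -> sq (eta k).
Proof.
move=> k0; have [c1 _] := eta_Fubini 0 k0.
have m : mcf (eta k).
  by have := ci_mcf c1; under eq_fun do rewrite ee0 mulr1.
apply: (sq_bnd (M := k) m) (@eta_supp k) => t _.
rewrite /eta; have ci0 : ci (fun s : R => (ind 0 k s)%:C%C * (ind 0 k (t - s))%:C%C : R[i]).
  apply: (ci_dom (g := ind 0 k)); last 2 first.
  - exact: ri_ind.
  - move=> s; rewrite ncM !nc_real !(ger0_norm (ind_ge0 _ _ _)) ler_piMr ?ind_ge0 ?ind_le1//.
  apply: mcfM; first exact: mcf_ind.
  apply: mcf_real; apply: (measurableT_comp (mf_ind 0 k)).
  by apply: mfB; [exact: mf_cst|exact: mf_id].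
apply: le_trans (nc_CI_le ci0) _.
have e : RI (ind 0 k) = k by rewrite RI_ind ?subr0 ?(ltW k0).
rewrite -[leRHS]e; apply: RI_le; [exact: ci_nc|exact: ri_ind|move=> s].
by rewrite ncM !nc_real !(ger0_norm (ind_ge0 _ _ _)) ler_piMr ?ind_ge0 ?ind_le1.
Qed.

Lemma Bx_le k z : 0 < k -> nc (Bx k z) <= k * Num.max 1 (expR (- Im z * k)).
Proof.
move=> k0; have qi := @sq_ind _ 0 k; have si := @supp_indc _ 0 k; have cb := FT_ci z qi si.
apply: le_trans (nc_CI_le cb) _.
apply: (@le_trans _ _ (RI (fun t => Num.max 1 (expR (- Im z * k)) * ind 0 k t))).
  apply: RI_le; [exact: ci_nc|exact: (riZ _ (ri_ind 0 k))|move=> t].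
  rewrite ncM nc_real (ger0_norm (ind_ge0 _ _ _)) nc_ee mulrC.
  case: (boolP (0 <= t <= k)) => ht; last by rewrite (ind_0 ht) !mulr0.
  rewrite (ind1 ht) !mulr1 le_max; move: ht => /andP[t0 tk].
  have [y0|y0] := leP 0 (Im z).
    by apply/orP; left; rewrite -[leRHS]expR0 ler_expR mulNr oppr_le0 mulr_ge0.
  by apply/orP; right; rewrite ler_expR; apply: ler_wpM2l => //; lra.
by rewrite (RIZ _ (ri_ind 0 k)) RI_ind ?(ltW k0)// subr0 mulrC.
Qed.

Lemma Bx_le2 k z : 0 < k -> nc z * nc (Bx k z) <= 2 * Num.max 1 (expR (- Im z * k)).
Proof.
move=> k0; have := FT_box z (ltW k0); rewrite -/(Bx k z) ee00 => e.
have -> : nc z * nc (Bx k z) = nc (ee z k - 1) by rewrite -e !ncM nci mul1r.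
apply: le_trans (ncD _ _) _; rewrite ncN nc1 nc_ee.
have h1 : expR (- Im z * k) <= Num.max 1 (expR (- Im z * k)) by rewrite le_max lexx orbT.
have h2 : 1 <= Num.max 1 (expR (- Im z * k)) by rewrite le_max lexx.
lra.
Qed.

Lemma Bx_sub k z : 0 < k -> nc (k%:C%C - Bx k z) <= k * (2 * (nc z * k) * expR (nc z * k)).
Proof.
move=> k0; have qi := @sq_ind _ 0 k; have si := @supp_indc _ 0 k; have cb := FT_ci z qi si.
have c0 := FT_ci 0 qi si.
have e : k%:C%C = CI (fun t => (ind 0 k t)%:C%C * ee 0 t) :> R[i].
  apply: ceq; rewrite ?Re_CI ?Im_CI.
    under eq_fun do rewrite ee0 mulr1 ReC; rewrite RI_ind ?(ltW k0)// ReC subr0//.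
  under eq_fun do rewrite ee0 mulr1 ImC; by rewrite RI0 ImC.
rewrite e -(CIB c0 cb); apply: le_trans (nc_CI_le (ciB c0 cb)) _.
apply: (@le_trans _ _ (RI (fun t => (2 * (nc z * k) * expR (nc z * k)) * ind 0 k t))).
  apply: RI_le; [exact: (ci_nc (ciB c0 cb))|exact: (riZ _ (ri_ind 0 k))|move=> t].
  rewrite ee0 -mulrBr ncM nc_real (ger0_norm (ind_ge0 _ _ _)) mulrC.
  case: (boolP (0 <= t <= k)) => ht; last by rewrite (ind_0 ht) !mulr0.
  rewrite (ind1 ht) !mulr1; move: ht => /andP[t0 tk].
  apply: le_trans (nc_ee_sub1 _ _) _; rewrite (ger0_norm t0).
  have h1 : nc z * t <= nc z * k by apply: ler_wpM2l; rewrite ?nc_ge0.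
  apply: ler_pM; rewrite ?mulr_ge0 ?nc_ge0 ?expR_ge0 ?ler_expR//.
  by apply: ler_wpM2l.
by rewrite (RIZ _ (ri_ind 0 k)) RI_ind ?(ltW k0)// subr0 mulrC.
Qed.

(** A bump of width [2 * k] starting at [lo], modulated and scaled so that its transform is centred
    at [lam1] with value 1 there. *)
Definition hat (lam1 : R[i]) (k lo t : R) : R[i] :=
  (ee (- lam1) lo * (k ^- 2)%:C%C) * (ee (- lam1) (t - lo) * eta k (t - lo)).

Lemma hat_spec lam1 k lo : 0 < k -> [/\ sq (hat lam1 k lo), supp lo (lo + 2 * k) (hat lam1 k lo) &
  forall z, FT (hat lam1 k lo) z = ee (z - lam1) lo * (Bx k (z - lam1) / k%:C%C) ^+ 2].
Proof.
move=> k0; have q0 := sq_ee (- lam1) (eta_sq k0) (@eta_supp k).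
have s0 : supp 0 (2 * k) (fun t => ee (- lam1) t * eta k t).
  by move=> t ht; rewrite eta_supp// mulr0.
have q1 := sq_shift (- lo) q0.
have s1 : supp lo (lo + 2 * k) (fun t => ee (- lam1) (t + - lo) * eta k (t + - lo)).
  move=> t ht; rewrite (@eta_supp k) ?mulr0//.
  by apply: contraNN ht => /andP[h1 h2]; apply/andP; split; lra.
split; [exact: (sqZ _ q1)|exact: (suppZ _ s1)|move=> z].
rewrite /hat (FTZ _ z q1 s1) (FT_shift z (- lo) q0 s0) opprK FT_mulee.
have [_ ->] := eta_Fubini (z - lam1) k0.
rewrite eeD; have -> : (k ^- 2)%:C%C = (k%:C%C ^+ 2)^-1 :> R[i] by rewrite fmorphV rmorphXn.
by rewrite expr_div_n; ring.
Qed.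

End Tools.

(** * Quotients *)

Lemma quarter_half (R : realType) n : (1 / 4 : R) ^+ n <= (1 / 2) ^+ n.
Proof. by apply: lerXn2r; rewrite ?nnegrE; lra. Qed.

Lemma half_le1 (R : realType) n : (1 / 2 : R) ^+ n <= 1.
Proof. by apply: exprn_ile1; lra. Qed.

Section Quotients.
Variable R : realType.
Implicit Types (phi psi : R -> R[i]) (z w : R[i]).
Variables (c a b d : R) (Lam : set R[i]).
Hypotheses (hca : c < a) (hab : a < b) (hbd : b < d).
Local Notation Z := (Zg c a b d).
Local Notation nE := (nrmE c a b d).
Hypothesis hCIS : CIS c a b d Lam.
Variable lam1 : R[i].
Hypothesis hl1 : ~ Lam lam1.

Local Notation rp := (fun phi => FT (restr b d phi)).
Local Notation rm := (fun phi => FT (restr c a phi)).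

Lemma FT_restr_lin lo hi phi psi k z : sq phi -> sq psi ->
  FT (restr lo hi (fun t => phi t + k * psi t)) z = FT (restr lo hi phi) z + k * FT (restr lo hi psi) z.
Proof.
move=> h1 h2; have q1 := sq_restr lo hi h1; have q2 := sq_restr lo hi h2.
rewrite -(FTZ k z q2 (@supp_restr _ lo hi psi)).
rewrite -(FTD z q1 (@supp_restr _ lo hi phi) (sqZ k q2) (suppZ k (@supp_restr _ lo hi psi))).
by congr FT; apply/funext => t; rewrite /restr mulrDr mulrCA.
Qed.

Lemma FT_restr_le lo hi phi z : sq phi -> nc (FT (restr lo hi phi) z) <= nL phi * nL (en lo hi z).
Proof.
move=> h; apply: le_trans (FT_bound z (sq_restr lo hi h) (@supp_restr _ lo hi phi)) _.
by apply: ler_wpM2r; [exact: nL_ge0|exact: nL_restr].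
Qed.

Lemma FT_restr_sum lo hi (I : Type) (s : seq I) (F : I -> R -> R[i]) (k : I -> R[i]) z :
  (forall i, sq (F i)) ->
  FT (restr lo hi (fun t => \sum_(i <- s) k i * F i t)) z = \sum_(i <- s) k i * FT (restr lo hi (F i)) z.
Proof.
move=> h; have q i := sq_restr lo hi (h i).
transitivity (FT (fun t => \sum_(i <- s) k i * restr lo hi (F i) t) z).
  congr FT; apply/funext => t; rewrite /restr mulr_sumr; apply: eq_bigr => i _; exact: mulrCA.
rewrite (FT_sum s z (fun i => sqZ (k i) (q i)) (fun i => suppZ (k i) (@supp_restr _ lo hi (F i)))).
by apply: eq_bigr => i _; rewrite (FTZ _ z (q i) (@supp_restr _ lo hi (F i))).
Qed.

Lemma gzD_lin phi psi k : gz Z phi -> gz Z psi -> gz Z (fun t => phi t + k * psi t).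
Proof.
move=> [h1 h2] [k1 k2]; split; first exact: (sqD h1 (sqZ k k1)).
by move=> t Zt; rewrite h2// k2// mulr0 addr0.
Qed.

Lemma unit_rows : exists h1 h2, [/\ gz Z h1, gz Z h2,
  rp h1 lam1 = 1 /\ rm h1 lam1 = 0 & rp h2 lam1 = 0 /\ rm h2 lam1 = 1].
Proof.
have su (lo hi : R) (m : R) : supp lo hi (fun t => m^-1%:C%C * (en lo hi lam1 t)^*%C).
  by move=> t ht; rewrite (@supp_en _ lo hi) ?conjc0 ?mulr0.
have re lo hi psi : supp lo hi psi -> restr lo hi psi = psi.
  move=> h; apply/funext => t; rewrite /restr; case: (boolP (lo <= t <= hi)) => ht; first by rewrite ind1 ?mul1r.
  by rewrite h ?mulr0.
have r0 lo hi : restr lo hi (fun _ => 0 : R[i]) = (fun _ => 0).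
  by apply/funext => t; rewrite /restr mulr0.
have un (lo hi : R) : lo < hi -> exists P, [/\ sq P, supp lo hi P & FT P lam1 = 1].
  move=> lh; have [m m0 e] := FT_enJ lam1 lh.
  have sJ (lo' hi' : R) : supp lo' hi' (fun t => (en lo' hi' lam1 t)^*%C).
    by move=> t ht; rewrite (@supp_en _ lo' hi') ?conjc0.
  exists (fun t => m^-1%:C%C * (en lo hi lam1 t)^*%C); split => //.
    exact: (sqZ _ (sqJ (@sq_en _ _ _ _))).
  rewrite (FTZ _ lam1 (sqJ (@sq_en _ _ _ _)) (sJ lo hi)) e -rmorphM mulVf ?gt_eqF//.
have [P [qP sP fP]] := un b d hbd; have [Q [qQ sQ fQ]] := un c a hca.
have q0 := @sq0 R.
exists (row c a b d P (fun _ => 0)), (row c a b d (fun _ => 0) Q).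
split; [exact: gz_row|exact: gz_row| |].
  by rewrite row_p// row_m// (re _ _ _ sP) r0 FT0.
by rewrite row_p// row_m// (re _ _ _ sQ) r0 FT0.
Qed.

(** Lipschitz at [lam1], which keeps a function with value 1 there away from 0 nearby. *)
Definition loc (F : R[i] -> R[i]) := exists2 M, 0 <= M &
  forall z, nc (z - lam1) <= 1 -> nc (F z - F lam1) <= M * nc (z - lam1).

Lemma locD F G : loc F -> loc G -> loc (fun z => F z + G z).
Proof.
move=> [M M0 hM] [N N0 hN]; exists (M + N); first exact: addr_ge0.
move=> z hz; have -> : F z + G z - (F lam1 + G lam1) = (F z - F lam1) + (G z - G lam1) by ring.
by apply: le_trans (ncD _ _) _; rewrite mulrDl; apply: lerD; [exact: hM|exact: hN].
Qed.

Lemma locM F G : loc F -> loc G -> loc (fun z => F z * G z).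
Proof.
move=> [M M0 hM] [N N0 hN]; exists (M * (nc (G lam1) + N) + nc (F lam1) * N).
  by rewrite addr_ge0// mulr_ge0 ?addr_ge0 ?nc_ge0.
move=> z hz; have -> : F z * G z - F lam1 * G lam1 = (F z - F lam1) * G z + F lam1 * (G z - G lam1) by ring.
apply: le_trans (ncD _ _) _; rewrite !ncM mulrDl; apply: lerD.
  rewrite mulrAC; apply: ler_pM; rewrite ?nc_ge0 ?hM//.
  have -> : G z = G lam1 + (G z - G lam1) by ring.
  apply: le_trans (ncD _ _) _; rewrite lerD2l; apply: le_trans (hN _ hz) _.
  by rewrite ler_piMr.
by rewrite -mulrA; apply: ler_wpM2l; rewrite ?nc_ge0 ?hN.
Qed.

Lemma locN F : loc F -> loc (fun z => - F z).
Proof.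
move=> [M M0 hM]; exists M => // z hz.
have -> : - F z - - F lam1 = - (F z - F lam1) by ring.
by rewrite ncN; exact: hM.
Qed.

Lemma loc_id : loc (fun z => z - lam1).
Proof. by exists 1 => // z _; rewrite subrr subr0 mul1r. Qed.

Lemma loc_FT lo hi phi : lo <= hi -> sq phi -> supp lo hi phi -> loc (FT phi).
Proof.
move=> lh h s; pose T := `|lo| + `|hi|; have T0 : 0 <= T by exact: addr_ge0.
pose M := 2 * T * expR T * expR (nc lam1 * T).
have M0 : 0 <= M by rewrite !mulr_ge0 ?expR_ge0.
exists (M * Num.sqrt (hi - lo) * nL phi).
  exact: (mulr_ge0 (mulr_ge0 M0 (sqrtr_ge0 _)) (nL_ge0 _)).
move=> z hz.
have B0 : 0 <= M * nc (z - lam1) by rewrite mulr_ge0 ?nc_ge0.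
have := FT_diff (z := lam1) (w := z) lh B0 h s.
have -> : M * Num.sqrt (hi - lo) * nL phi * nc (z - lam1) = M * nc (z - lam1) * Num.sqrt (hi - lo) * nL phi by ring.
apply => t /andP[t1 t2].
have tT : `|t| <= T.
  have := ler_norm hi; have := ler_norm (- lo); rewrite normrN => h1 h2.
  have := normr_ge0 lo; have := normr_ge0 hi => h3 h4.
  by rewrite ler_norml /T; apply/andP; split; lra.
have -> : ee z t - ee lam1 t = - ((1 - ee (z - lam1) t) * ee lam1 t).
  by rewrite mulrBl mul1r -eeD subrK opprB.
rewrite ncN ncM; apply: le_trans (ler_wpM2r (nc_ge0 _) (nc_ee_sub1 _ _)) _.
have -> : M * nc (z - lam1) = 2 * (nc (z - lam1) * T) * expR T * expR (nc lam1 * T) by rewrite /M; ring.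
have x0 := nc_ge0 (z - lam1).
apply: ler_pM; rewrite ?mulr_ge0 ?expR_ge0 ?nc_ge0//.
  apply: ler_pM; rewrite ?mulr_ge0 ?expR_ge0 ?nc_ge0//.
    by apply: ler_wpM2l => //; apply: ler_wpM2l.
  by rewrite ler_expR; apply: le_trans tT; rewrite ler_piMl.
rewrite nc_ee ler_expR; apply: le_trans (ler_norm _) _; rewrite normrM normrN.
by apply: ler_pM => //; exact: Im_le_nc.
Qed.

(* The difference of the two sides is [(z - lam1)] times a row that vanishes on [Lam]. *)
Lemma frame : exists Fp Fm Gp Gm : R[i] -> R[i],
  [/\ Fp lam1 = 1 /\ Fm lam1 = 0, Gp lam1 = 0 /\ Gm lam1 = 1,
  [/\ loc Fp, loc Fm, loc Gp & loc Gm] &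
  forall g nu, gz Z g -> (forall z, Lam z -> z != nu -> FT g z = 0) -> forall z,
    (z - nu) * rp g z = (lam1 - nu) * (rp g lam1 * Fp z + rm g lam1 * Gp z) /\
    (z - nu) * rm g z = (lam1 - nu) * (rp g lam1 * Fm z + rm g lam1 * Gm z)].
Proof.
have [h1 [h2 [gh1 gh2 [h1p h1m] [h2p h2m]]]] := unit_rows.
have [k1 gk1 hk1] := multiplier_exists hca hab hbd hCIS gh1 (fun h => False_ind _ (hl1 h)).
have [k2 gk2 hk2] := multiplier_exists hca hab hbd hCIS gh2 (fun h => False_ind _ (hl1 h)).
exists (fun z => (z - lam1) * rp k1 z + rp h1 z), (fun z => (z - lam1) * rm k1 z + rm h1 z),
  (fun z => (z - lam1) * rp k2 z + rp h2 z), (fun z => (z - lam1) * rm k2 z + rm h2 z).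
have lp phi : gz Z phi -> loc (rp phi).
  by move=> g0; apply: (loc_FT (ltW hbd)); [exact: (sq_restr _ _ g0.1)|exact: supp_restr].
have lm phi : gz Z phi -> loc (rm phi).
  by move=> g0; apply: (loc_FT (ltW hca)); [exact: (sq_restr _ _ g0.1)|exact: supp_restr].
split; rewrite ?subrr ?mul0r ?add0r//.
  by split; apply: locD; try (apply: locM; first exact: loc_id); [exact: lp|exact: lp|exact: lm|exact: lm|exact: lp|exact: lp|exact: lm|exact: lm].
move=> g nu gg hg; set A := rp g lam1; set B := rm g lam1.
(* [r] is [g] corrected so that both of its parts vanish at [lam1]; each part can then be divided by
   [z - lam1] separately, which gives the row [v]. *)
pose r0 t := g t + (- A) * h1 t; pose r t := r0 t + (- B) * h2 t.
have gr0 : gz Z r0 := gzD_lin (- A) gg gh1.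
have gr : gz Z r := gzD_lin (- B) gr0 gh2.
have rE lo hi z : FT (restr lo hi r) z = FT (restr lo hi g) z - A * FT (restr lo hi h1) z - B * FT (restr lo hi h2) z.
  by rewrite (FT_restr_lin lo hi (- B) z gr0.1 gh2.1) (FT_restr_lin lo hi (- A) z gg.1 gh1.1) !mulNr.
have rp0 : FT (restr b d r) lam1 = 0 by rewrite rE h1p h2p -/A; ring.
have rm0 : FT (restr c a r) lam1 = 0 by rewrite rE h1m h2m -/B; ring.
have qp := sq_restr b d gr.1; have qm := sq_restr c a gr.1.
have sp_ := @supp_restr _ b d r; have sm_ := @supp_restr _ c a r.
pose v := row c a b d (quot b d lam1 (restr b d r)) (quot c a lam1 (restr c a r)).
have gv : gz Z v by apply: gz_row; exact: sq_quot.
have re lo hi psi : supp lo hi psi -> restr lo hi psi = psi.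
  move=> h; apply/funext => t; rewrite /restr; case: (boolP (lo <= t <= hi)) => ht; first by rewrite ind1 ?mul1r.
  by rewrite h ?mulr0.
have vp z : (z - lam1) * rp v z = rp r z.
  rewrite row_p// (re _ _ _ (@supp_quot _ _ _ _ _)).
  exact: (@FT_quot _ b d lam1 _ qp sp_ z rp0).
have vm z : (z - lam1) * rm v z = rm r z.
  rewrite row_m// (re _ _ _ (@supp_quot _ _ _ _ _)).
  exact: (@FT_quot _ c a lam1 _ qm sm_ z rm0).
pose m := lam1 - nu.
(* From [z - nu = (z - lam1) + m], the row [e] times [z - lam1] is the difference of the two sides
   of the claim. It vanishes on [Lam], so [e] is 0. *)
pose e1 t := g t + (- (m * A)) * k1 t; pose e2 t := e1 t + (- (m * B)) * k2 t; pose e t := e2 t + m * v t.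
have g1 : gz Z e1 := gzD_lin _ gg gk1.
have g2 : gz Z e2 := gzD_lin _ g1 gk2.
have ge : gz Z e := gzD_lin m g2 gv.
have eE lo hi z : FT (restr lo hi e) z = FT (restr lo hi g) z - m * A * FT (restr lo hi k1) z -
    m * B * FT (restr lo hi k2) z + m * FT (restr lo hi v) z.
  rewrite (FT_restr_lin lo hi m z g2.1 gv.1) (FT_restr_lin lo hi _ z g1.1 gk2.1) (FT_restr_lin lo hi _ z gg.1 gk1.1).
  by rewrite !mulNr.
have ep z : (z - lam1) * rp e z = (z - nu) * rp g z -
    m * (A * ((z - lam1) * rp k1 z + rp h1 z) + B * ((z - lam1) * rp k2 z + rp h2 z)).
  have := vp z; rewrite eE rE => h.
  transitivity ((z - lam1) * (rp g z - m * A * rp k1 z - m * B * rp k2 z) + m * ((z - lam1) * rp v z)); first by ring.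
  by rewrite h /m; ring.
have em z : (z - lam1) * rm e z = (z - nu) * rm g z -
    m * (A * ((z - lam1) * rm k1 z + rm h1 z) + B * ((z - lam1) * rm k2 z + rm h2 z)).
  have := vm z; rewrite eE rE => h.
  transitivity ((z - lam1) * (rm g z - m * A * rm k1 z - m * B * rm k2 z) + m * ((z - lam1) * rm v z)); first by ring.
  by rewrite h /m; ring.
have [_ hU] := hCIS.
have e0 : nL e = 0.
  apply: hU => // z hz.
  have zl : z - lam1 != 0 by rewrite subr_eq0; apply: contra_notN hl1 => /eqP <-.
  apply: (mulfI zl); rewrite mulr0 (FT_split z hca hab hbd ge) mulrDr ep em.
  have a1 := hk1 z hz; have a2 := hk2 z hz.
  rewrite (FT_split z hca hab hbd gk1) (FT_split z hca hab hbd gh1) in a1.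
  rewrite (FT_split z hca hab hbd gk2) (FT_split z hca hab hbd gh2) in a2.
  have a3 : (z - nu) * (rp g z + rm g z) = 0.
    rewrite -(FT_split z hca hab hbd gg); have [->|zn] := eqVneq z nu; first by rewrite subrr mul0r.
    by rewrite hg ?mulr0.
  transitivity ((z - nu) * (rp g z + rm g z) - m * (A * ((z - lam1) * (rp k1 z + rm k1 z) + (rp h1 z + rm h1 z)) +
    B * ((z - lam1) * (rp k2 z + rm k2 z) + (rp h2 z + rm h2 z)))); first by ring.
  by rewrite a1 a2 a3; ring.
have z0 lo hi z : FT (restr lo hi e) z = 0.
  apply/eqP; rewrite -nc_eq0 eq_le nc_ge0 andbT.
  by apply: le_trans (FT_restr_le lo hi z ge.1) _; rewrite e0 mul0r.
by move=> z; split; apply/eqP; rewrite -subr_eq0; [rewrite -ep|rewrite -em]; rewrite z0 mulr0.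
Qed.

Lemma dual_ex : exists g : R[i] -> R -> R[i], (forall w, gz Z (g w)) /\
  forall w, Lam w -> forall z, Lam z -> FT (g w) z = (z == w)%:R * (nE w)%:C%C.
Proof.
have [C _ hC] := dual_E hca hab hbd hCIS.
have ex w : exists g, gz Z g /\ (Lam w -> forall z, Lam z -> FT g z = (z == w)%:R * (nE w)%:C%C).
  have [hw|nw] := pselect (Lam w); last by exists (fun _ => 0); split; [split; [exact: sq0|]|].
  by have [g [g1 _ g2]] := hC w hw; exists g.
have [g hg] := choice ex; exists g; split => [w|w hw]; first by have [] := hg w.
by have [_] := hg w; apply.
Qed.

(** Duality: take the [g w] with the conjugates of their values at [lam1] as coefficients. The value
    of this combination at [lam1] is the sum [S] in question, while its norm is [O(sqrt S)] by the
    sampling inequality; hence [S] is bounded. *)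
Lemma dual_values_sum g lo hi : (forall w, gz Z (g w)) ->
  (forall w, Lam w -> forall z, Lam z -> FT (g w) z = (z == w)%:R * (nE w)%:C%C) ->
  exists2 X, 0 <= X & bsum Lam (fun w => nc (FT (restr lo hi (g w)) lam1) ^+ 2) X.
Proof.
move=> gg hg; have [C C0 hC] := sampling_bound_E hca hab hbd hCIS.
pose E1 := nL (en lo hi lam1).
exists ((C * E1) ^+ 2); first exact: sqr_ge0.
move=> s [us hs]; set S := \sum_(w <- s) _.
have S0 : 0 <= S by apply: sumr_ge0 => w _; exact: sqr_ge0.
pose k w := (FT (restr lo hi (g w)) lam1)^*%C.
pose psi t := \sum_(w <- s) k w * g w t.
have qpsi : sq psi by apply: sq_sum => w; exact: (sqZ _ (gg w).1).
have gpsi : gz Z psi.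
  by split => // t Zt; apply: big1 => w _; rewrite (gg w).2// mulr0.
have FTpsi z : Lam z -> FT psi z = (if z \in s then k z else 0) * (nE z)%:C%C.
  move=> hz; rewrite (FT_sum s z (fun w => sqZ (k w) (gg w).1) (fun w => suppZ (k w) (gz_supp hca hab hbd (gg w)))).
  transitivity (\sum_(w <- s) (if w == z then k z * (nE z)%:C%C else 0)).
    rewrite big_seq [RHS]big_seq; apply: eq_bigr => w ws.
    rewrite (FTZ _ z (gg w).1 (gz_supp hca hab hbd (gg w))) hg//; last exact: hs.
    by rewrite eq_sym; case: eqP => [->|_]; rewrite ?mul1r ?mul0r ?mulr0.
  case: ifPn => zs.
    by rewrite (bigD1_seq z)//= eqxx big1 ?addr0// => w /negbTE ->.
  rewrite mul0r big1_seq// => w /andP[_ ws]; case: eqP => // e; by rewrite -e ws in zs.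
have nS : nL psi <= C * Num.sqrt S.
  apply: hC => // s' [us' hs'].
  apply: (@le_trans _ _ (\sum_(w <- s' | w \in s) nc (k w) ^+ 2)).
    rewrite [leRHS]big_mkcond big_seq [leRHS]big_seq; apply: ler_sum => w ws.
    rewrite FTpsi; last exact: hs'.
    case: ifPn => _; last by rewrite mul0r nc0 mul0r expr0n.
    by rewrite ncM nc_real ger0_norm ?nL_ge0// mulfK ?lexx// gt_eqF// nE_gt0.
  rewrite /S [leRHS](bigID (mem s')) /= -[leLHS]addr0; apply: lerD; last by apply: sumr_ge0 => w _; exact: sqr_ge0.
  rewrite -big_filter -[leRHS]big_filter (perm_big [seq w <- s | w \in s']).
    by apply: ler_sum => w _; rewrite /k ncJ.
  by apply: uniq_perm; rewrite ?filter_uniq// => w; rewrite !mem_filter andbC.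
have e1 : FT (restr lo hi psi) lam1 = S%:C%C.
  rewrite (FT_restr_sum lo hi s k lam1 (fun w => (gg w).1)) /S rmorph_sum.
  by apply: eq_bigr => w _; rewrite /k mulrC mulJc.
have : S <= C * Num.sqrt S * E1.
  rewrite -{1}(ger0_norm S0) -nc_real -e1; apply: le_trans (FT_restr_le lo hi lam1 qpsi) _.
  by apply: ler_wpM2r; rewrite ?nL_ge0.
have s2 : Num.sqrt S ^+ 2 = S by apply: sqr_sqrtr.
have q0 : 0 <= Num.sqrt S by exact: sqrtr_ge0.
move=> h; rewrite -s2.
have [->|sn] := eqVneq (Num.sqrt S) 0; first by rewrite expr0n; exact: sqr_ge0.
have sp0 : 0 < Num.sqrt S by rewrite lt_def sn.
have h1 : Num.sqrt S <= C * E1 by rewrite -(ler_pM2r sp0) -expr2 s2 mulrAC.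
by rewrite lerXn2r ?nnegrE ?(le_trans q0 h1).
Qed.

Lemma det_lim (p q p' q' pn qn pn' qn' : R[i]) (K e : R) : 0 <= e -> e <= 1 -> 0 <= K ->
  nc (p - pn) <= K * e -> nc (q - qn) <= K * e -> nc (p' - pn') <= K * e -> nc (q' - qn') <= K * e ->
  nc ((p * q - p' * q') - (pn * qn - pn' * qn')) <=
  (K * nc q + (nc p + K) * K + (K * nc q' + (nc p' + K) * K)) * e.
Proof.
move=> e0 e1 K0.
have one x y xn yn : nc (x - xn) <= K * e -> nc (y - yn) <= K * e ->
    nc (x * y - xn * yn) <= (K * nc y + (nc x + K) * K) * e.
  move=> hx hy; have -> : x * y - xn * yn = (x - xn) * y + xn * (y - yn) by ring.
  have xb : nc xn <= nc x + K.
    have -> : xn = x - (x - xn) by ring.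
    apply: le_trans (ncD _ _) _; rewrite ncN lerD2l; apply: le_trans hx _.
    by rewrite ler_piMr.
  apply: le_trans (ncD _ _) _; rewrite !ncM mulrDl; apply: lerD.
    by rewrite mulrAC; apply: ler_wpM2r; rewrite ?nc_ge0.
  by rewrite -mulrA; apply: ler_pM; rewrite ?nc_ge0.
move=> h1 h2 h3 h4.
have -> : (p * q - p' * q') - (pn * qn - pn' * qn') = (p * q - pn * qn) - (p' * q' - pn' * qn') by ring.
by apply: le_trans (ncD _ _) _; rewrite ncN [leRHS]mulrDl; apply: lerD; exact: one.
Qed.

Lemma sum_sub_split (J J' : seq R[i]) (V : zmodType) (F : R[i] -> V) : uniq J -> uniq J' -> {subset J <= J'} ->
  \sum_(i <- J') F i = \sum_(i <- [seq i <- J' | i \notin J]) F i + \sum_(i <- J) F i.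
Proof.
move=> uJ uJ' sub; rewrite (bigID (fun i => i \notin J)) /= big_filter; congr (_ + _).
rewrite -big_filter; apply: perm_big; apply: uniq_perm; rewrite ?filter_uniq// => i.
by rewrite mem_filter negbK; case: (boolP (i \in J)) => // /sub ->.
Qed.

Lemma sqr_add2 (x y : R) : (x + y) ^+ 2 <= 2 * x ^+ 2 + 2 * y ^+ 2.
Proof. by have := sqr_ge0 (x - y); rewrite sqrrB sqrrD; lra. Qed.

Lemma nc_cf (p q x y v : R[i]) : nc (p * q * (x * y) * v) = (nc p * nc x) * (nc q * nc y) * nc v.
Proof. by rewrite !ncM; ring. Qed.

(** Both rows are combinations of the rows [F] and [G], so their determinant is that of the
    coefficients times that of [F] and [G]. *)
Lemma det_quot (zx zy W cx cy px mx py my lx ly Px Mx Py My F1 F2 G1 G2 : R[i]) :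
  zx * px = lx * (Px * F1 + Mx * G1) -> zx * mx = lx * (Px * F2 + Mx * G2) ->
  zy * py = ly * (Py * F1 + My * G1) -> zy * my = ly * (Py * F2 + My * G2) ->
  zx * (zy * W) * (cx * px * (cy * my) - cx * mx * (cy * py)) =
  (F1 * G2 - F2 * G1) * (cx * cy * (lx * ly) * (Px * My - Mx * Py) * W).
Proof.
move=> h1 h2 h3 h4.
transitivity (cx * cy * W * ((zx * px) * (zy * my) - (zx * mx) * (zy * py))); first by ring.
by rewrite h1 h2 h3 h4; ring.
Qed.

Lemma weight_le (x x' y y' v : R) : 0 <= x -> 0 <= y -> v <= x' * y' -> x * y * v <= (x * x') * (y * y').
Proof. by move=> x0 y0 h; rewrite mulrACA; apply: ler_wpM2l => //; exact: mulr_ge0. Qed.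

Lemma Wt_le (x y u v : R) : 0 <= u -> 0 <= v ->
  [/\ x ^+ 2 <= x ^+ 2 + y ^+ 2 + (u + v), y ^+ 2 <= x ^+ 2 + y ^+ 2 + (u + v),
    u <= x ^+ 2 + y ^+ 2 + (u + v) & v <= x ^+ 2 + y ^+ 2 + (u + v)].
Proof. by move=> u0 v0; have := sqr_ge0 x; have := sqr_ge0 y; split; lra. Qed.

Lemma cross_le (x y x' y' : R) : 0 <= x -> 0 <= y -> 0 <= x' -> 0 <= y' ->
  x * y' + y * x' <= (x + y) * (x' + y').
Proof.
move=> h1 h2 h3 h4; have := mulr_ge0 h1 h3; have := mulr_ge0 h2 h4.
by rewrite mulrDl !mulrDr; lra.
Qed.

(** The size of the normalised sample times the factor [lam1 - z] that [frame] attaches to the dual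
    function at [z]. *)
Definition aw phi z : R := nc (FT phi z) * nc (z - lam1) / nE z.

Variables (L : R) (phi : R -> R[i]).
Hypotheses (L0 : 0 <= L) (qphi : sq phi) (sphi : supp 0 L phi) (fphi : forall z, Lam z -> FT phi z = 0).

(* [FT psi] is the sum of the [h(nu) k(mu) (lam1 - nu) (lam1 - mu) det(g_nu, g_mu)(lam1) f / ((z - nu) (z - mu))],
   where [f = FT phi] and the [g_nu] are the dual functions. *)
Lemma quotient_exists : exists (Dl : R[i] -> R[i]) (C : R), [/\ Dl lam1 = 1, loc Dl, 0 <= C &
  forall h k A r, gz Z h -> gz Z k -> 0 < r -> 0 <= A ->
    bsum Lam (fun z => aw h z ^+ 2) (A ^+ 2) -> bsum Lam (fun z => aw k z ^+ 2) (A ^+ 2) ->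
    exists psi, [/\ sq psi, supp 0 L psi,
      forall z, FT phi z * (rp h z * rm k z - rm h z * rp k z) = Dl z * FT psi z &
      wn r psi <= C / r ^+ 2 * A ^+ 2]].
Proof.
have [Fp [Fm [Gp [Gm [[F1 F2] [G1 G2] [l1 l2 l3 l4] hfr]]]]] := frame.
have [g [gg hg]] := dual_ex.
have [X1 X10 hX1] := dual_values_sum b d gg hg; have [X2 X20 hX2] := dual_values_sum c a gg hg.
pose Xv z := nc (rp (g z) lam1) + nc (rm (g z) lam1).
pose X := Num.sqrt (2 * X1 + 2 * X2).
have XX0 : 0 <= 2 * X1 + 2 * X2 by rewrite addr_ge0 ?mulr_ge0.
have X2E : X ^+ 2 = 2 * X1 + 2 * X2 by apply: sqr_sqrtr.
have X0 : 0 <= X by exact: sqrtr_ge0.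
have Xv0 z : 0 <= Xv z by rewrite addr_ge0 ?nc_ge0.
have hX s : inL Lam s -> \sum_(z <- s) Xv z ^+ 2 <= X ^+ 2.
  move=> hs; rewrite X2E.
  apply: (@le_trans _ _ (2 * \sum_(z <- s) nc (rp (g z) lam1) ^+ 2 + 2 * \sum_(z <- s) nc (rm (g z) lam1) ^+ 2)); last first.
    by apply: lerD; apply: ler_wpM2l => //; [exact: hX1|exact: hX2].
  rewrite !mulr_sumr -big_split; apply: ler_sum => z _ /=; rewrite /Xv.
  exact: sqr_add2.
pose Dl z := Fp z * Gm z - Fm z * Gp z.
exists Dl, (64 * nL phi * X ^+ 2); split.
- by rewrite /Dl F1 F2 G1 G2; ring.
- exact: (locD (locM l1 l4) (locN (locM l2 l3))).
- by rewrite !mulr_ge0 ?nL_ge0.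
move=> h k A r gh gk r0 A0 hA hB.
have n0 := nE_gt0 hca hab hbd.
have aw0 psi z : 0 <= aw psi z by rewrite /aw divr_ge0 ?mulr_ge0 ?nc_ge0 ?nL_ge0.
pose u z := aw h z * Xv z; pose v z := aw k z * Xv z.
have u0 z : 0 <= u z by exact: mulr_ge0.
have v0 z : 0 <= v z by exact: mulr_ge0.
have AX0 : 0 <= A * X by exact: mulr_ge0.
have su psi : bsum Lam (fun z => aw psi z ^+ 2) (A ^+ 2) -> bsum Lam (fun z => aw psi z * Xv z) (A * X).
  move=> hh s hs; apply: le_of_sqr => //; apply: le_trans (CS_seq s (aw0 psi) Xv0) _.
  rewrite exprMn; apply: ler_pM; [| |exact: hh|exact: hX].
    by apply: sumr_ge0 => z _; exact: sqr_ge0.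
  by apply: sumr_ge0 => z _; exact: sqr_ge0.
have su1 := su h hA; have su2 := su k hB.
(* One weight dominates all four families, so a single exhaustion [J] of [Lam] makes all tails
   small. *)
pose Wt z := aw h z ^+ 2 + aw k z ^+ 2 + (u z + v z).
have hW : bsum Lam Wt (A ^+ 2 + A ^+ 2 + (A * X + A * X)).
  by move=> s hs; rewrite /Wt !big_split /=; apply: lerD; apply: lerD; [exact: hA|exact: hB|exact: su1|exact: su2].
have Wt4 z : [/\ aw h z ^+ 2 <= Wt z, aw k z ^+ 2 <= Wt z, u z <= Wt z & v z <= Wt z].
  exact: Wt_le.
have tl (n : nat) : exists J, inL Lam J /\ forall s, inL Lam s -> (forall i, i \in s -> i \notin J) ->
    \sum_(i <- s) Wt i <= (1 / 4) ^+ n.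
  have q0 : 0 < (1 / 4 : R) ^+ n by rewrite exprn_gt0.
  by have [J h1 h2] := tail_ex hW q0; exists J.
have [Tl hT] := choice tl.
pose J := fix J n := if n is m.+1 then undup (J m ++ Tl m.+1) else Tl 0%N.
have inJ n : inL Lam (J n).
  elim: n => [|n [IH1 IH2]] /=; first by have [] := hT 0%N.
  split; first exact: undup_uniq.
  move=> i; rewrite mem_undup mem_cat => /orP[/IH2//|]; exact: (hT n.+1).1.2.
have subJ n : {subset J n <= J n.+1} by move=> i hi /=; rewrite mem_undup mem_cat hi.
have TJ n : {subset Tl n <= J n}.
  by case: n => [|n] i hi //=; rewrite mem_undup mem_cat hi orbT.
have tlJ n s : inL Lam s -> (forall i, i \in s -> i \notin J n) -> \sum_(i <- s) Wt i <= (1 / 4) ^+ n.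
  move=> hs dis; apply: (hT n).2 => // i si; apply: contraNN (dis i si); exact: TJ.
have half4 n := quarter_half R n.
have h20 n : 0 <= (1 / 2 : R) ^+ n by rewrite exprn_ge0.
have h21 n := half_le1 R n.
pose co psi z := FT psi z / (nE z)%:C%C.
pose dd z w := rp (g z) lam1 * rm (g w) lam1 - rm (g z) lam1 * rp (g w) lam1.
pose cf z w := co h z * co k w * ((lam1 - z) * (lam1 - w)) * dd z w.
pose Tm z w t := cf z w * quot 0 L w (quot 0 L z phi) t.
have qT z w : sq (Tm z w).
  by apply: sqZ; apply: (@sq_quot _ 0 L w _ (@sq_quot _ 0 L z _ qphi sphi) (@supp_quot _ 0 L z phi)).
have sT z w : supp 0 L (Tm z w) by apply: suppZ; exact: supp_quot.
pose D := (8 / r) ^+ 2 * nL phi.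
have D0 : 0 <= D by rewrite mulr_ge0 ?sqr_ge0 ?nL_ge0.
have nco psi z : nc (co psi z) * nc (lam1 - z) = aw psi z.
  by rewrite /co ncM ncV nc_real (ger0_norm (nL_ge0 _)) /aw (ncB lam1 z); ring.
have cfb z w : nc (cf z w) <= u z * v w.
  have -> : nc (cf z w) = (nc (co h z) * nc (lam1 - z)) * (nc (co k w) * nc (lam1 - w)) * nc (dd z w).
    exact: nc_cf.
  rewrite (nco h z) (nco k w); apply: (weight_le (aw0 h z) (aw0 k w)).
  apply: le_trans (ncD _ _) _; rewrite ncN !ncM /Xv.
  by apply: cross_le; exact: nc_ge0.
have wnT z w : Lam z -> Lam w -> wn r (Tm z w) <= u z * v w * D.
  move=> hz hw; have uvD : 0 <= u z * v w * D by rewrite mulr_ge0// mulr_ge0.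
  have q1 := @sq_quot _ 0 L z _ qphi sphi; have s1 := @supp_quot _ 0 L z phi.
  rewrite /Tm (wnZ r (cf z w) (@sq_quot _ 0 L w _ q1 s1) (@supp_quot _ 0 L w _)).
  (* On the diagonal the determinant is 0, so only pairs of distinct zeros are divided out. *)
  have [e|zw] := eqVneq z w.
    have -> : cf z w = 0 by rewrite /cf /dd e; ring.
    by rewrite nc0 mul0r.
  apply: ler_pM; rewrite ?nc_ge0 ?nL_ge0//.
  exact: (wn_quot2 L0 r0 qphi sphi (fphi hz) (fphi hw) zw).
pose Ws s1 s2 t := \sum_(z <- s1) \sum_(w <- s2) Tm z w t.
have qW s1 s2 : sq (Ws s1 s2) by apply: sq_sum => z; apply: sq_sum => w; exact: qT.
have sW s1 s2 : supp 0 L (Ws s1 s2) by apply: supp_sum => z; apply: supp_sum => w; exact: sT.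
have wnW s1 s2 : (forall z, z \in s1 -> Lam z) -> (forall z, z \in s2 -> Lam z) ->
    wn r (Ws s1 s2) <= (\sum_(z <- s1) u z) * (\sum_(z <- s2) v z) * D.
  move=> h1 h2.
  apply: le_trans (wn_sum r s1 (fun z => sq_sum s2 (qT z)) (fun z => supp_sum s2 (sT z))) _.
  rewrite mulr_suml mulr_suml big_seq [leRHS]big_seq; apply: ler_sum => z zs.
  apply: le_trans (wn_sum r s2 (qT z) (sT z)) _.
  rewrite mulr_sumr mulr_suml big_seq [leRHS]big_seq; apply: ler_sum => w ws.
  by apply: wnT; [exact: h1|exact: h2].
pose wJ n := Ws (J n) (J n).
pose C2 := expR (r * L) * (2 * (A * X) * D).
have C20 : 0 <= C2 by rewrite mulr_ge0 ?expR_ge0// mulr_ge0// mulr_ge0.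
(* The new pairs have at least one entry in [E], and the tail over [E] makes their sum small while
   the other sum stays bounded. *)
have cau n : nL (fun t => wJ n.+1 t - wJ n t) <= C2 * (1 / 2) ^+ n.
  pose E := [seq i <- J n.+1 | i \notin J n].
  have EL : inL Lam E.
    split; first exact: (filter_uniq _ (inJ n.+1).1).
    by move=> i; rewrite mem_filter => /andP[_]; exact: (inJ n.+1).2.
  have Edis i : i \in E -> i \notin J n by rewrite mem_filter => /andP[].
  have tE : \sum_(z <- E) Wt z <= (1 / 4) ^+ n by exact: tlJ.
  have tu : \sum_(z <- E) u z <= (1 / 4) ^+ n by apply: le_trans tE; apply: ler_sum => z _; have [] := Wt4 z.
  have tv : \sum_(z <- E) v z <= (1 / 4) ^+ n by apply: le_trans tE; apply: ler_sum => z _; have [] := Wt4 z.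
  have eW : (fun t => wJ n.+1 t - wJ n t) = (fun t => Ws E (J n.+1) t + Ws (J n) E t).
    apply/funext => t; rewrite /wJ /Ws (sum_sub_split _ (inJ n).1 (inJ n.+1).1 (@subJ n)) -/E -addrA; congr (_ + _).
    rewrite -sumrB; apply: eq_bigr => z _.
    by rewrite (sum_sub_split _ (inJ n).1 (inJ n.+1).1 (@subJ n)) -/E addrK.
  rewrite eW; apply: le_trans (nL_wn L0 (ltW r0) (sqD (qW _ _) (qW _ _)) (suppD (sW _ _) (sW _ _))) _.
  rewrite /C2 -mulrA; apply: ler_wpM2l; first exact: expR_ge0.
  apply: le_trans (wnD r (qW _ _) (sW _ _) (qW _ _) (sW _ _)) _.
  have b1 : wn r (Ws E (J n.+1)) <= (1 / 4) ^+ n * (A * X) * D.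
    apply: le_trans (wnW _ _ EL.2 (inJ n.+1).2) _; apply: ler_wpM2r => //.
    by apply: ler_pM => //; [apply: sumr_ge0|apply: sumr_ge0|exact: su2].
  have b2 : wn r (Ws (J n) E) <= (A * X) * (1 / 4) ^+ n * D.
    apply: le_trans (wnW _ _ (inJ n).2 EL.2) _; apply: ler_wpM2r => //.
    by apply: ler_pM => //; [apply: sumr_ge0|apply: sumr_ge0|exact: su1].
  apply: le_trans (lerD b1 b2) _.
  have -> : (1 / 4) ^+ n * (A * X) * D + A * X * (1 / 4) ^+ n * D = 2 * (A * X) * D * (1 / 4) ^+ n by ring.
  by apply: ler_wpM2l (half4 n); exact: (mulr_ge0 (mulr_ge0 (ler0n R 2) AX0) D0).
have [w [qw hw hwZ]] := L2_complete C20 (fun n => qW (J n) (J n)) cau.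
have sw : supp 0 L w by move=> t ht; apply: hwZ => n; exact: sW.
exists w; split => //; last first.
  apply: (@small_pow _ _ _ (2 * C2)) => n.
  have -> : w = (fun t => (w t - wJ n t) + wJ n t) by apply/funext => t; rewrite subrK.
  apply: le_trans (wnD r (sqB qw (qW _ _)) (suppB sw (sW _ _)) (qW _ _) (sW _ _)) _.
  rewrite addrC; apply: lerD.
    apply: le_trans (wnW _ _ (inJ n).2 (inJ n).2) _.
    apply: (@le_trans _ _ ((A * X) * (A * X) * D)).
      by apply: ler_wpM2r => //; apply: ler_pM; [apply: sumr_ge0|apply: sumr_ge0|exact: su1|exact: su2].
    by rewrite /D le_eqVlt; apply/orP; left; apply/eqP; field; rewrite gt_eqF.
  exact: le_trans (nL_le_wn L0 (ltW r0) (sqB qw (qW _ _)) (suppB sw (sW _ _))) (hw n).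
have [Cs Cs0 hCs] := sampling_bound_E hca hab hbd hCIS.
have [kp kp0 hkp] := dist_pt hca hab hbd hCIS lam1.
(* Partial sums of the dual expansion. On [Lam] they take the values of [psi] cut to [J n], so the
   sampling inequality gives their convergence to [psi]. *)
pose hJ psi n t := \sum_(z <- J n) co psi z * g z t.
have qJ psi n : sq (hJ psi n) by apply: sq_sum => z; exact: (sqZ _ (gg z).1).
have gJ psi n : gz Z (hJ psi n).
  by split => // t Zt; apply: big1 => z _; rewrite (gg z).2// mulr0.
have nn0 z : (nE z)%:C%C != 0 :> R[i] := nEC_neq0 hca hab hbd z.
have FTJ psi n z : Lam z -> FT (hJ psi n) z = if z \in J n then FT psi z else 0.
  move=> hz; rewrite (FT_sum (J n) z (fun w => sqZ (co psi w) (gg w).1) (fun w => suppZ (co psi w) (gz_supp hca hab hbd (gg w)))).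
  transitivity (\sum_(i <- J n) (if i == z then FT psi z else 0)).
    rewrite big_seq [RHS]big_seq; apply: eq_bigr => i iJ.
    rewrite (FTZ _ z (gg i).1 (gz_supp hca hab hbd (gg i))) hg//; last exact: (inJ n).2.
    rewrite eq_sym; case: eqP => [->|_]; last by rewrite mul0r mulr0.
    by rewrite mul1r /co mulfVK.
  case: ifPn => zs.
    by rewrite (bigD1_seq z)//= ?(inJ n).1// eqxx big1 ?addr0// => i /negbTE ->.
  by rewrite big1_seq// => i /andP[_ ws]; case: eqP => // e; rewrite -e ws in zs.
have cvJ psi n : gz Z psi -> (forall z, aw psi z ^+ 2 <= Wt z) ->
    nL (fun t => psi t - hJ psi n t) <= Cs / kp * (1 / 2) ^+ n.
  move=> gp hp.
  have gB : gz Z (fun t => psi t - hJ psi n t).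
    by split; [exact: (sqB gp.1 (qJ psi n))|move=> t Zt; rewrite gp.2// (gJ psi n).2// subrr].
  have -> : Cs / kp * (1 / 2) ^+ n = Cs * Num.sqrt ((kp^-1 * (1 / 2) ^+ n) ^+ 2).
    by rewrite sqrtr_sqr ger0_norm ?mulr_ge0 ?invr_ge0 ?(ltW kp0)// mulrA.
  apply: hCs => // s hs.
  have e2 : ((1 / 2 : R) ^+ n) ^+ 2 = (1 / 4) ^+ n.
    by rewrite -exprM mulnC exprM; congr (_ ^+ _); field.
  rewrite exprMn e2.
  pose s' := [seq z <- s | z \notin J n].
  have hs' : inL Lam s'.
    split; first exact: (filter_uniq _ hs.1).
    by move=> i; rewrite mem_filter => /andP[_]; exact: hs.2.
  have ts : \sum_(z <- s') Wt z <= (1 / 4) ^+ n.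
    by apply: tlJ => // i; rewrite mem_filter => /andP[].
  apply: (@le_trans _ _ (kp^-1 ^+ 2 * \sum_(z <- s') Wt z)); last by apply: ler_wpM2l; rewrite ?sqr_ge0.
  rewrite /s' big_filter [X in _ <= _ * X]big_mkcond mulr_sumr big_seq [leRHS]big_seq; apply: ler_sum => z zs.
  have hz := hs.2 _ zs.
  rewrite (FTB z gp.1 (gz_supp hca hab hbd gp) (qJ psi n) (gz_supp hca hab hbd (gJ psi n))) FTJ//.
  case: (boolP (z \in J n)) => zJ /=; first by rewrite subrr nc0 mul0r expr0n mulr0.
  rewrite subr0; apply: (@le_trans _ _ (kp^-1 ^+ 2 * aw psi z ^+ 2)); last by apply: ler_wpM2l; rewrite ?sqr_ge0.
  rewrite -exprMn lerXn2r ?nnegrE ?divr_ge0 ?mulr_ge0 ?invr_ge0 ?nc_ge0 ?nL_ge0 ?(ltW kp0)//.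
  have zl : z != lam1 by apply: contra_notN hl1 => /eqP <-.
  have h3 : kp <= nc (z - lam1).
    by apply: le_trans (hkp z hz zl); rewrite ler_peMr ?(ltW kp0)// lerDl nc_ge0.
  rewrite /aw mulrA; apply: ler_wpM2r; first by rewrite invr_ge0 nL_ge0.
  rewrite mulrCA ler_peMr ?nc_ge0//.
  by rewrite mulrC ler_pdivlMr// mul1r.
move=> z.
(* For the partial sums the identity is finite and holds term by term, by [frame] and [det_quot]. *)
have id n : FT phi z * (rp (hJ h n) z * rm (hJ k n) z - rm (hJ h n) z * rp (hJ k n) z) = Dl z * FT (wJ n) z.
  have qg i : sq (g i) := (gg i).1.
  rewrite !(FT_restr_sum _ _ (J n) _ z qg).
  have -> : FT (wJ n) z = \sum_(x <- J n) \sum_(y <- J n) FT (Tm x y) z.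
    rewrite /wJ /Ws (FT_sum (J n) z (fun x => sq_sum (J n) (qT x)) (fun x => supp_sum (J n) (sT x))).
    by apply: eq_bigr => x _; rewrite (FT_sum (J n) z (qT x) (sT x)).
  rewrite !big_distrlr /= -sumrB !mulr_sumr big_seq [RHS]big_seq; apply: eq_bigr => x xJ.
  rewrite -sumrB !mulr_sumr big_seq [RHS]big_seq; apply: eq_bigr => y yJ.
  have hx := (inJ n).2 _ xJ; have hy := (inJ n).2 _ yJ.
  have [e|xy] := eqVneq x y.
    have c0 : cf x y = 0 by rewrite /cf /dd e; ring.
    have q1 := @sq_quot _ 0 L x _ qphi sphi; have s1 := @supp_quot _ 0 L x phi.
    rewrite /Tm (FTZ (cf x y) z (@sq_quot _ 0 L y _ q1 s1) (@supp_quot _ 0 L y _)) c0 mul0r mulr0 e; ring.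
  have q1 := @sq_quot _ 0 L x _ qphi sphi; have s1 := @supp_quot _ 0 L x phi.
  have d1 := @FT_quot _ 0 L x _ qphi sphi.
  have f1 : FT (quot 0 L x phi) y = 0.
    have := d1 y (fphi hx); rewrite (fphi hy) => /eqP.
    by rewrite mulf_eq0 subr_eq0 eq_sym (negbTE xy) => /eqP.
  have d2 := @FT_quot _ 0 L y _ q1 s1 z f1; have d3 := d1 z (fphi hx).
  rewrite /Tm (FTZ (cf x y) z (@sq_quot _ 0 L y _ q1 s1) (@supp_quot _ 0 L y _)).
  set W := FT (quot 0 L y _) z in d2 *.
  have gx : forall w, Lam w -> w != x -> FT (g x) w = 0 by move=> w' h1 h2; rewrite hg// (negbTE h2) mul0r.
  have gy : forall w, Lam w -> w != y -> FT (g y) w = 0 by move=> w' h1 h2; rewrite hg// (negbTE h2) mul0r.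
  have [x1 x2] := hfr _ _ (gg x) gx z; have [y1 y2] := hfr _ _ (gg y) gy z.
  rewrite -d3 -d2; exact: (det_quot W (co h x) (co k y) x1 x2 y1 y2).
pose K1 := Cs / kp * nL (en b d z) + Cs / kp * nL (en c a z).
have Ck0 : 0 <= Cs / kp by rewrite divr_ge0 ?ltW.
have K10 : 0 <= K1 by exact: (addr_ge0 (mulr_ge0 Ck0 (nL_ge0 _)) (mulr_ge0 Ck0 (nL_ge0 _))).
have cvr psi n lo hi : gz Z psi -> (forall y, aw psi y ^+ 2 <= Wt y) ->
    nc (FT (restr lo hi psi) z - FT (restr lo hi (hJ psi n)) z) <= (Cs / kp * nL (en lo hi z)) * (1 / 2) ^+ n.
  move=> gp hp; have := FT_restr_lin lo hi (-1) z gp.1 (qJ psi n); rewrite mulN1r => <-.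
  apply: le_trans (FT_restr_le lo hi z (sqD gp.1 (sqZ (-1) (qJ psi n)))) _.
  rewrite mulrAC; apply: ler_wpM2r; first exact: nL_ge0.
  by under [X in nL X]eq_fun do rewrite mulN1r; exact: cvJ.
have Kb : forall psi n, gz Z psi -> (forall y, aw psi y ^+ 2 <= Wt y) ->
   nc (rp psi z - rp (hJ psi n) z) <= K1 * (1 / 2) ^+ n /\ nc (rm psi z - rm (hJ psi n) z) <= K1 * (1 / 2) ^+ n.
  move=> psi n gp hp; split; apply: le_trans (cvr _ _ _ _ gp hp) _; apply: ler_wpM2r => //; rewrite /K1.
    by rewrite lerDl; exact: (mulr_ge0 Ck0 (nL_ge0 _)).
  by rewrite lerDr; exact: (mulr_ge0 Ck0 (nL_ge0 _)).
have hpA y : aw h y ^+ 2 <= Wt y by have [] := Wt4 y.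
have hpB y : aw k y ^+ 2 <= Wt y by have [] := Wt4 y.
apply/eqP; rewrite -subr_eq0 -nc_eq0 eq_le nc_ge0 andbT.
pose M1 := K1 * nc (rm k z) + (nc (rp h z) + K1) * K1 + (K1 * nc (rp k z) + (nc (rm h z) + K1) * K1).
pose M2 := 2 * C2 * nL (en 0 L z).
apply: (@small_pow _ _ _ (nc (FT phi z) * M1 + nc (Dl z) * M2)) => n; rewrite add0r.
have [a1 a2] := Kb h n gh hpA; have [b1 b2] := Kb k n gk hpB.
have dl := det_lim (h20 n) (h21 n) K10 a1 b2 a2 b1; rewrite -/M1 in dl.
have wl : nc (FT w z - FT (wJ n) z) <= M2 * (1 / 2) ^+ n.
  rewrite -(FTB z qw sw (qW _ _) (sW (J n) (J n))).
  apply: le_trans (FT_bound z (sqB qw (qW _ _)) (suppB sw (sW _ _))) _.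
  by rewrite /M2 mulrAC; apply: ler_wpM2r; [exact: nL_ge0|exact: hw].
set d0 := rp h z * rm k z - rm h z * rp k z in dl *.
have idn := id n.
set dn := rp (hJ h n) z * _ - _ in dl idn *.
have -> : FT phi z * d0 - Dl z * FT w z = FT phi z * (d0 - dn) - Dl z * (FT w z - FT (wJ n) z).
  transitivity (FT phi z * d0 - FT phi z * dn - (Dl z * FT w z - Dl z * FT (wJ n) z)); last by ring.
  by rewrite idn; ring.
apply: le_trans (ncD _ _) _; rewrite ncN !ncM mulrDl; apply: lerD; rewrite -mulrA; apply: ler_wpM2l;
  by rewrite ?nc_ge0.
Qed.

End Quotients.

(** * Uniqueness *)

Section Uniqueness.
Variable R : realType.
Implicit Types (phi psi : R -> R[i]) (z w : R[i]).

Lemma q4V (x : R) : 0 < x -> q4 x^-1 = (q4 x)^-1.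
Proof. by move=> x0; rewrite /q4 !sqrtrV ?sqrtr_ge0 ?ltW. Qed.

Lemma sqrt_q4 (x : R) : 0 <= x -> Num.sqrt x = q4 x ^+ 2.
Proof. by move=> x0; rewrite /q4 sqr_sqrtr ?sqrtr_ge0. Qed.

(** For [x <= rho] the bound [H <= G] is the better one, for [x > rho] the quadratic decay; both
    lead to the same power [x^(-5/4)]. *)
Lemma hat_pt (H G x rho : R) : 0 <= H -> 0 <= G -> 0 < x -> 0 < rho -> H <= G -> x ^+ 2 * H <= 4 * rho ^+ 2 * G ->
  (H * x) ^+ 2 <= 16 * G ^+ 2 * (rho ^+ 3 * q4 rho) / (x * q4 x).
Proof.
move=> H0 G0 x0 r0 h1 h2.
have qx := q4_gt0 x0; have qr := q4_gt0 r0.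
have G2 : 0 <= G ^+ 2 by exact: sqr_ge0.
have xq : 0 < x * q4 x by exact: mulr_gt0.
rewrite ler_pdivlMr//.
have [xr|rx] := leP x rho.
  have a1 : (H * x) ^+ 2 <= G ^+ 2 * rho ^+ 2.
    by rewrite -exprMn lerXn2r ?nnegrE ?mulr_ge0 ?(ltW x0) ?(ltW r0)//; apply: ler_pM => //; exact: ltW.
  have a2 : x * q4 x <= rho * q4 rho by apply: ler_pM => //; [exact: ltW|exact: q4_ge0|exact: q4_le].
  apply: (@le_trans _ _ (G ^+ 2 * rho ^+ 2 * (rho * q4 rho))).
    by apply: ler_pM => //; [exact: sqr_ge0|exact: ltW].
  have -> : 16 * G ^+ 2 * (rho ^+ 3 * q4 rho) = 16 * (G ^+ 2 * rho ^+ 2 * (rho * q4 rho)) by ring.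
  apply: ler_peMl; last by rewrite ler1n.
  exact: (mulr_ge0 (mulr_ge0 G2 (sqr_ge0 _)) (mulr_ge0 (ltW r0) (q4_ge0 _))).
have a1 : (x ^+ 2 * H) ^+ 2 <= (4 * rho ^+ 2 * G) ^+ 2.
  apply: lerXn2r => //; rewrite nnegrE; first exact: (mulr_ge0 (sqr_ge0 _) H0).
  exact: (mulr_ge0 (mulr_ge0 (ler0n R 4) (sqr_ge0 _)) G0).
have a2 : rho * q4 x <= x * q4 rho.
  have e1 : rho = q4 rho ^+ 4 by rewrite q4_4// ltW.
  have e2 : x = q4 x ^+ 4 by rewrite q4_4// ltW.
  have -> : rho * q4 x = (q4 rho * q4 x) * q4 rho ^+ 3 by rewrite {1}e1; ring.
  have -> : x * q4 rho = (q4 rho * q4 x) * q4 x ^+ 3 by rewrite {1}e2; ring.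
  apply: ler_wpM2l; first by rewrite mulr_ge0 ?q4_ge0.
  by rewrite lerXn2r ?nnegrE ?q4_ge0// q4_le// ltW.
have x2 : 0 < x ^+ 2 by rewrite exprn_gt0.
rewrite -(ler_pM2l x2).
have -> : x ^+ 2 * ((H * x) ^+ 2 * (x * q4 x)) = (x ^+ 2 * H) ^+ 2 * (x * q4 x) by ring.
apply: (@le_trans _ _ ((4 * rho ^+ 2 * G) ^+ 2 * (x * q4 x))).
  by apply: ler_wpM2r => //; exact: ltW.
have -> : (4 * rho ^+ 2 * G) ^+ 2 * (x * q4 x) = 16 * G ^+ 2 * rho ^+ 3 * x * (rho * q4 x) by ring.
have -> : x ^+ 2 * (16 * G ^+ 2 * (rho ^+ 3 * q4 rho)) = 16 * G ^+ 2 * rho ^+ 3 * x * (x * q4 rho) by ring.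
apply: ler_wpM2l a2.
by rewrite !mulr_ge0 ?exprn_ge0 ?(ltW r0) ?(ltW x0).
Qed.

Variables (c a b d : R) (Lam : set R[i]).
Hypotheses (hca : c < a) (hab : a < b) (hbd : b < d).
Local Notation Z := (Zg c a b d).
Local Notation nE := (nrmE c a b d).
Hypothesis hCIS : CIS c a b d Lam.
Variable lam1 : R[i].
Hypothesis hl1 : ~ Lam lam1.

(** [hat_pt] produces [wt z] once the square of [G] is compared with [(1 + |Im z|) * nE z ^+ 2].
    This works for bumps anywhere in [[c, d]], since [nE_low] does. *)
Lemma hat_weight_sum : exists2 C, 0 <= C & forall k lo, 0 < k -> c <= lo -> lo + 2 * k <= d ->
  bsum Lam (fun z => (nc (FT (hat lam1 k lo) z) * nc (z - lam1) / nE z) ^+ 2) (C * (k^-1 ^+ 3 * q4 k^-1)).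
Proof.
have n0 := nE_gt0 hca hab hbd.
have [K K0 hK] := nE_low hca hab hbd.
have [B B0 hB] := weight_summable hca hab hbd hCIS.
have [kp kp0 hkp] := dist_pt hca hab hbd hCIS lam1.
pose E := expR (`|Im lam1| * (`|c| + `|d|)).
have E0 : 0 < E by exact: expR_gt0.
have qk : 0 < kp * q4 kp by rewrite mulr_gt0 ?q4_gt0.
pose C1 := 16 * (E ^+ 2 * K) / (kp * q4 kp).
have C10 : 0 <= C1 by rewrite /C1 divr_ge0 ?(ltW qk)// mulr_ge0// mulr_ge0 ?sqr_ge0 ?ltW.
exists (C1 * B); first exact: mulr_ge0.
move=> k lo k0 clo lod s hs; set rho := k^-1.
have r0 : 0 < rho by rewrite invr_gt0.
have rr0 : 0 <= rho ^+ 3 * q4 rho by rewrite mulr_ge0 ?q4_ge0 ?exprn_ge0 ?ltW.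
apply: (@le_trans _ _ (C1 * (rho ^+ 3 * q4 rho) * \sum_(z <- s) wt z)); last first.
  have -> : C1 * B * (rho ^+ 3 * q4 rho) = C1 * (rho ^+ 3 * q4 rho) * B by ring.
  by apply: ler_wpM2l (hB s hs); exact: mulr_ge0.
rewrite mulr_sumr big_seq [leRHS]big_seq; apply: ler_sum => z zs.
have hz := hs.2 _ zs.
have zl : z != lam1 by apply: contra_notN hl1 => /eqP <-.
set x := nc (z - lam1); have x0 : 0 < x by rewrite nc_gt0 subr_eq0.
have hx : kp * (1 + nc z) <= x := hkp z hz zl.
have [_ _ ->] := hat_spec lam1 lo k0.
set u := z - lam1 in x x0 hx *.
pose m := Num.max 1 (expR (- Im u * k)).
have m1 : 1 <= m by rewrite le_max lexx.
have m0 : 0 <= m by exact: le_trans m1.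
pose G := nc (ee u lo) * m ^+ 2.
have G0 : 0 <= G by rewrite mulr_ge0 ?nc_ge0 ?sqr_ge0.
pose Y := 1 + `|Im z|.
have Y0 : 0 <= Y by exact: addr_ge0.
have GE t : c <= t <= d -> expR (- Im u * t) ^+ 2 <= E ^+ 2 * (K * Y * nE z ^+ 2).
  move=> ht; apply: (@le_trans _ _ (E ^+ 2 * expR (- Im z * t) ^+ 2)); last first.
    by apply: ler_wpM2l; [exact: sqr_ge0|exact: hK].
  rewrite -exprMn lerXn2r ?nnegrE ?mulr_ge0 ?expR_ge0//.
  have -> : expR (- Im u * t) = expR (Im lam1 * t) * expR (- Im z * t).
    by rewrite -expRD /u ?cE; congr expR; ring.
  by apply: ler_wpM2r; [exact: expR_ge0|exact: expR_bnd].
have G2 : G ^+ 2 <= E ^+ 2 * (K * Y * nE z ^+ 2).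
  (* [G] is the exponential at one end of the support of the bump, whichever gives the larger
     value. *)
  rewrite /G nc_ee /m; have [h|h] := leP 1 (expR (- Im u * k)).
    have -> : expR (- Im u * lo) * expR (- Im u * k) ^+ 2 = expR (- Im u * (lo + 2 * k)).
      by rewrite expr2 -!expRD; congr expR; ring.
    by apply: GE; apply/andP; split => //; lra.
  by rewrite expr1n mulr1; apply: GE; apply/andP; split => //; lra.
have n2 : 0 < nE z ^+ 2 by rewrite exprn_gt0.
set Bv := nc (Bx k u).
have hn : nc (ee u lo * (Bx k u / k%:C%C) ^+ 2) = nc (ee u lo) * (Bv * rho) ^+ 2.
  by rewrite ncM ncX ncM ncV nc_real (gtr0_norm k0).
rewrite hn; set H := _ * (Bv * rho) ^+ 2.
have H0 : 0 <= H by rewrite mulr_ge0 ?nc_ge0 ?sqr_ge0.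
have Bv0 : 0 <= Bv by exact: nc_ge0.
have HG : H <= G.
  apply: ler_wpM2l; first exact: nc_ge0.
  rewrite lerXn2r ?nnegrE ?mulr_ge0 ?(ltW r0)//.
  by rewrite ler_pdivrMr// mulrC; exact: Bx_le.
have HG2 : x ^+ 2 * H <= 4 * rho ^+ 2 * G.
  have h := Bx_le2 u k0; rewrite -/x -/Bv -/m in h.
  have -> : x ^+ 2 * H = nc (ee u lo) * rho ^+ 2 * (x * Bv) ^+ 2 by rewrite /H; ring.
  have -> : 4 * rho ^+ 2 * G = nc (ee u lo) * rho ^+ 2 * (2 * m) ^+ 2 by rewrite /G; ring.
  apply: ler_wpM2l; first by rewrite mulr_ge0 ?nc_ge0 ?sqr_ge0.
  by rewrite lerXn2r ?nnegrE ?mulr_ge0 ?(ltW x0).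
have hp := hat_pt H0 G0 x0 r0 HG HG2.
have xq : 0 < x * q4 x by rewrite mulr_gt0 ?q4_gt0.
rewrite expr_div_n ler_pdivrMr//; apply: le_trans hp _.
have q1 : 0 < (1 + nc z) * q4 (1 + nc z) by rewrite mulr_gt0 ?q4_gt0 ?nc1_gt0.
have xi : (x * q4 x)^-1 <= (kp * q4 kp)^-1 * ((1 + nc z) * q4 (1 + nc z))^-1.
  rewrite -invfM lef_pV2 ?posrE ?mulr_gt0// ?q4_gt0 ?nc1_gt0//.
  have -> : kp * q4 kp * ((1 + nc z) * q4 (1 + nc z)) = (kp * (1 + nc z)) * q4 (kp * (1 + nc z)).
    by rewrite q4M ?(ltW kp0)//; ring.
  apply: ler_pM => //; rewrite ?q4_ge0 ?mulr_ge0 ?(ltW kp0) ?(ltW (nc1_gt0 z))//.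
  exact: q4_le.
apply: (@le_trans _ _ (16 * (E ^+ 2 * (K * Y * nE z ^+ 2)) * (rho ^+ 3 * q4 rho) *
   ((kp * q4 kp)^-1 * ((1 + nc z) * q4 (1 + nc z))^-1))).
  apply: ler_pM => //.
  - by rewrite mulr_ge0// mulr_ge0 ?sqr_ge0.
  - by rewrite invr_ge0 ltW.
  - by apply: ler_wpM2r => //; apply: ler_wpM2l.
rewrite /C1 /wt -/Y le_eqVlt; apply/orP; left; apply/eqP; field.
by rewrite !gt_eqF ?q4_gt0 ?nc1_gt0.
Qed.

Variables (phi : R -> R[i]).
Local Notation L := ((a + d) - (c + b)).
Hypotheses (qphi : sq phi) (sphi : supp 0 L phi) (fphi : forall z, Lam z -> FT phi z = 0) (f1 : FT phi lam1 = 0).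

Lemma restr_id lo hi psi : supp lo hi psi -> restr lo hi psi = psi.
Proof.
move=> h; apply/funext => t; rewrite /restr; case: (boolP (lo <= t <= hi)) => ht; first by rewrite ind1 ?mul1r.
by rewrite h ?mulr0.
Qed.

Lemma restr_0 (lo hi : R) : restr lo hi (fun _ => 0 : R[i]) = (fun _ => 0).
Proof. by apply/funext => t; rewrite /restr mulr0. Qed.

(** Each row lives on one piece only, so the determinant is a product. The positions of the bumps
    enter it through an exponential alone, which makes different positions comparable. *)
Lemma hat_rows k lo lo' : 0 < k -> b <= lo -> lo + 2 * k <= d -> c <= lo' -> lo' + 2 * k <= a ->
  exists h k' : R -> R[i], [/\ gz Z h, gz Z k',
    forall z, FT (restr b d h) z * FT (restr c a k') z - FT (restr c a h) z * FT (restr b d k') z =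
      ee (z - lam1) (lo + lo') * (Bx k (z - lam1) / k%:C%C) ^+ 4,
    forall z, FT h z = FT (hat lam1 k lo) z & forall z, FT k' z = FT (hat lam1 k lo') z].
Proof.
move=> k0 h1 h2 h3 h4; have [q1 s1 e1] := hat_spec lam1 lo k0; have [q2 s2 e2] := hat_spec lam1 lo' k0.
have s1' := supp_sub h1 h2 s1; have s2' := supp_sub h3 h4 s2.
have q0 := @sq0 R.
have g1 := gz_row c a b d q1 q0; have g2 := gz_row c a b d q0 q2.
exists (row c a b d (hat lam1 k lo) (fun _ => 0)), (row c a b d (fun _ => 0) (hat lam1 k lo')).
have p1 : restr b d (row c a b d (hat lam1 k lo) (fun _ => 0)) = hat lam1 k lo by rewrite row_p// restr_id.
have p2 : restr c a (row c a b d (hat lam1 k lo) (fun _ => 0)) = (fun _ => 0) by rewrite row_m// restr_0.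
have p3 : restr b d (row c a b d (fun _ => 0) (hat lam1 k lo')) = (fun _ => 0) by rewrite row_p// restr_0.
have p4 : restr c a (row c a b d (fun _ => 0) (hat lam1 k lo')) = hat lam1 k lo' by rewrite row_m// restr_id.
split => //.
- by move=> z; rewrite p1 p2 p3 p4 FT0 e1 e2 eeDt; ring.
- by move=> z; rewrite (FT_split z hca hab hbd g1) p1 p2 FT0 addr0.
- by move=> z; rewrite (FT_split z hca hab hbd g2) p3 p4 FT0 add0r.
Qed.

Lemma Bx_ratio (k : R) (u : R[i]) : 0 < k -> nc u * k <= 1 / 8 -> 1 / 2 <= nc (Bx k u / k%:C%C).
Proof.
move=> k0 h; rewrite ncM ncV nc_real gtr0_norm// ler_pdivlMr//.
have h1 := Bx_sub u k0.
have e8 : expR (1 / 8) <= 8 / 7 :> R by have := expR_sub1_le (1 / 8 : R); lra.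
have h2 : 2 * (nc u * k) * expR (nc u * k) <= 2 * (1 / 8) * (8 / 7).
  apply: ler_pM; rewrite ?expR_ge0 ?mulr_ge0 ?nc_ge0 ?(ltW k0)//.
    by apply: ler_wpM2l.
  by apply: le_trans e8; rewrite ler_expR.
have h3 : k * (2 * (nc u * k) * expR (nc u * k)) <= k * (2 * (1 / 8) * (8 / 7)).
  by apply: ler_wpM2l => //; exact: ltW.
have := ncB_ge k%:C%C (Bx k u); rewrite nc_real gtr0_norm//; lra.
Qed.

(* On a neighbourhood of [lam1], hence everywhere, the transforms of [psi2] and of a translate of [psi1] by
   [L - 4 k] agree up to a constant, and both functions are supported in [[0, L]]. *)
Lemma supp_shrink (k : R) (psi1 psi2 : R -> R[i]) (Dl : R[i] -> R[i]) (F : R[i] -> R[i]) : 0 < k -> 4 * k <= L ->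
  Dl lam1 = 1 -> loc lam1 Dl ->
  sq psi1 -> supp 0 L psi1 -> sq psi2 -> supp 0 L psi2 ->
  (forall z, F z = Dl z * FT psi1 z) -> (forall z, ee (z - lam1) (L - 4 * k) * F z = Dl z * FT psi2 z) ->
  nL (fun t => psi1 t - restr 0 (4 * k) psi1 t) = 0.
Proof.
move=> k0 kL D1 [M M0 hM] q1 s1 q2 s2 F1 F2.
pose sg := L - 4 * k; have sg0 : 0 <= sg by rewrite subr_ge0.
have L0 : 0 < L by apply: lt_le_trans kL; rewrite mulr_gt0.
pose K := ee (- lam1) sg.
have q1' := sq_shift (- sg) q1.
have s1' : supp 0 (L + sg) (fun t => psi1 (t + - sg)).
  move=> t ht; apply: s1; apply: contraNN ht => /andP[h1 h2]; apply/andP; split; lra.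
have s2' : supp 0 (L + sg) psi2 by apply: (supp_sub _ _ s2); rewrite ?lerDl.
pose psi t := psi2 t - K * psi1 (t + - sg).
have qp : sq psi := sqB q2 (sqZ K q1').
have sp_ : supp 0 (L + sg) psi := suppB s2' (suppZ K s1').
have FTp z : FT psi z = FT psi2 z - ee (z - lam1) sg * FT psi1 z.
  rewrite (FTB z q2 s2' (sqZ K q1') (suppZ K s1')) (FTZ K z q1' s1') (FT_shift z (- sg) q1 s1) opprK.
  by rewrite eeD /K; ring.
have Dp z : Dl z * FT psi z = 0.
  by rewrite FTp mulrBr -F2 mulrCA -F1 subrr.
(* [Dl] is 1 at [lam1] and Lipschitz there with constant [M], hence nonzero at distances below
   [(M + 1)^-1]. *)
have near z : nc (z - lam1) < (M + 1)^-1 -> FT psi z = 0.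
  move=> hz; have M1 : 0 < M + 1 by rewrite ltr_wpDl.
  have h1 : nc (z - lam1) <= 1.
    by apply: le_trans (ltW hz) _; rewrite invf_le1// lerDr.
  have h2 := hM z h1; rewrite D1 in h2.
  have h3 : M * nc (z - lam1) < 1.
    have : (M + 1) * nc (z - lam1) < 1 by rewrite mulrC -ltr_pdivlMr// div1r.
    by apply: le_lt_trans; apply: ler_wpM2r; rewrite ?nc_ge0 ?lerDl.
  have Dn : Dl z != 0.
    apply/eqP => e; move: h2; rewrite e sub0r ncN nc1 => h2.
    by have := le_lt_trans h2 h3; rewrite ltxx.
  by have /eqP := Dp z; rewrite mulf_eq0 (negbTE Dn) => /eqP.
have Ls : 0 <= L + sg by rewrite addr_ge0 ?(ltW L0).
have Ls' : 0 < L + sg by rewrite ltr_wpDr.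
have eta0 : 0 < (M + 1)^-1 by rewrite invr_gt0 ltr_wpDl.
have all0 := identity_theorem Ls qp sp_ eta0 near.
have n0 : nL psi = 0 by exact: (FT_inj qp sp_ Ls' all0).
apply/eqP; rewrite eq_le nL_ge0 andbT.
have K0 : K != 0 by exact: ee_neq0.
have qs := sq_shift sg qp.
have : nL (fun t => K^-1 * psi (t + sg)) <= 0.
  by rewrite (nLZ _ qs) (nL_shift _ qp) n0 mulr0.
apply: le_trans; apply: nL_le.
- exact: (mcfB (sq_mcf q1) (sq_mcf (sq_restr _ _ q1))).
- exact: sqZ.
(* For [t] beyond [4 * k] the point [t + sg] is beyond [L], where [psi2] is 0, so that
   [psi (t + sg)] is [- K * psi1 t]. *)
move=> t; case: (boolP (0 <= t <= 4 * k)) => ht.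
  by rewrite /restr ind1// mul1r subrr nc0 nc_ge0.
rewrite /restr ind_0// mul0r subr0.
case: (boolP (0 <= t <= L)) => htL; last by rewrite s1// nc0 nc_ge0.
rewrite /psi s2; last first.
  apply: contraNN ht => /andP[_ h2]; move: htL => /andP[-> _] /=; move: h2; rewrite /sg; lra.
by rewrite sub0r addrK mulrN mulKf// ncN.
Qed.

(** The factor [k * sqrt k] from [FT_near] against a norm of order [k^(-5/4)] leaves [k^(1/4)]. *)
Lemma decay (x l : R) : 0 <= x -> 0 <= l -> exists2 Cx, 0 <= Cx & forall (k N Cw : R), 0 < k -> k <= 1 -> 0 <= N -> 0 <= Cw ->
  N <= expR 4 * (Cw * (k^-1 * q4 k^-1)) ->
  2 * x * (4 * k) * expR (x * (4 * k)) * expR (l * (4 * k)) * Num.sqrt (4 * k) * N <= Cx * Cw / q4 k^-1.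
Proof.
move=> x0 l0; exists (2 * x * 4 * expR (x * 4) * expR (l * 4) * Num.sqrt 4 * expR 4).
  by rewrite !mulr_ge0 ?expR_ge0 ?sqrtr_ge0.
move=> k N Cw k0 k1 N0 Cw0 hN.
have kk : 4 * k <= 4 by lra.
have qk0 : 0 < q4 k by exact: q4_gt0.
have sk : Num.sqrt (4 * k) = Num.sqrt 4 * q4 k ^+ 2 by rewrite sqrtrM// (sqrt_q4 (ltW k0)).
rewrite sk.
apply: (@le_trans _ _ (2 * x * (4 * k) * expR (x * 4) * expR (l * 4) * (Num.sqrt 4 * q4 k ^+ 2) * (expR 4 * (Cw * (k^-1 * q4 k^-1))))).
  apply: ler_pM => //; first by rewrite !mulr_ge0 ?expR_ge0 ?sqrtr_ge0 ?sqr_ge0 ?(ltW k0).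
  apply: ler_wpM2r; first by rewrite mulr_ge0 ?sqrtr_ge0 ?sqr_ge0.
  apply: ler_pM; rewrite ?mulr_ge0 ?expR_ge0 ?(ltW k0)//.
    apply: ler_wpM2l; first by rewrite !mulr_ge0 ?(ltW k0).
    by rewrite ler_expR; apply: ler_wpM2l.
  by rewrite ler_expR; apply: ler_wpM2l.
rewrite q4V// le_eqVlt; apply/orP; left; apply/eqP; field.
by rewrite !gt_eqF.
Qed.

Lemma no_zero_bound (v C : R) : 0 <= C -> 0 <= v -> forall r0 : R, 
  (forall rho, r0 <= rho -> 1 <= rho -> v <= C / q4 rho) -> v = 0.
Proof.
move=> C0 v0 r0 h; apply/eqP; rewrite eq_le v0 andbT leNgt; apply/negP => vp.
pose N := C / v + 1; have N0 : 0 < N by rewrite ltr_wpDl// divr_ge0.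
pose rho := Num.max (Num.max r0 1) (N ^+ 4).
have h1 : r0 <= rho by rewrite !le_max lexx.
have h2 : 1 <= rho by rewrite !le_max lexx orbT.
have h3 : N ^+ 4 <= rho by rewrite le_max lexx orbT.
have rho0 : 0 < rho by exact: lt_le_trans h2.
have q0 := q4_gt0 rho0.
have Nq : N <= q4 rho by rewrite -(@ler_pXn2r _ 4) ?nnegrE ?(ltW N0) ?q4_ge0// q4_4// ltW.
have := h rho h1 h2; rewrite ler_pdivlMr// => h4.
have : v * N <= C by apply: le_trans h4; apply: ler_wpM2l.
by rewrite mulrDr mulr1 mulrCA divff ?gt_eqF// mulr1; lra.
Qed.

Lemma uniqueness_shifted z : FT phi z = 0.
Proof.
have L0 : 0 < L by rewrite subr_gt0 ltrD.
have [Dl [C [D1 Dloc C0 hW]]] := quotient_exists hca hab hbd hCIS hl1 (ltW L0) qphi sphi fphi.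
have [Ch Ch0 hch] := hat_weight_sum.
have [Cx Cx0 hCx] := decay (nc_ge0 (z - lam1)) (nc_ge0 lam1).
pose u := z - lam1.
pose e0 := nc (ee u b) * nc (ee u c); have e00 : 0 < e0 by rewrite mulr_gt0 ?nc_gt0 ?ee_neq0.
pose Cw := C * Ch; have Cw0 : 0 <= Cw by exact: mulr_ge0.
pose m := Num.min (Num.min (a - c) (d - b)) L.
have m0 : 0 < m by rewrite !lt_min !subr_gt0 hca hbd /=; rewrite -subr_gt0.
apply/eqP; rewrite -nc_eq0; apply/eqP.
(* [e0] is the modulus of the exponential for the left ends, and 16 comes from the fourth power of
   [Bx_ratio]. The last argument makes [rho] so large that the bumps fit into both pieces and
   [nc u * k <= 1 / 8]. *)
apply: (@no_zero_bound _ (16 / e0 * (nc (Dl z) * (Cx * Cw))) _ _ (Num.max (4 / m) (8 * nc u))).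
- by rewrite mulr_ge0 ?divr_ge0 ?(ltW e00)// mulr_ge0 ?nc_ge0// mulr_ge0.
- exact: nc_ge0.
move=> rho; rewrite ge_max => /andP[r1 r2] r3.
have r0 : 0 < rho by exact: lt_le_trans r3.
pose k := rho^-1; have k0 : 0 < k by rewrite invr_gt0.
have kV : k^-1 = rho by rewrite invrK.
have k1 : k <= 1 by rewrite invf_le1.
have k4 : 4 * k <= m by rewrite ler_pdivrMr// mulrC -ler_pdivrMr.
have [ka kd kL] : [/\ 4 * k <= a - c, 4 * k <= d - b & 4 * k <= L].
  by move: k4; rewrite !le_min => /andP[/andP[-> ->] ->].
have uk : nc u * k <= 1 / 8 by rewrite ler_pdivrMr// mulrC mulrA mulr1 -div1r; move: r2; lra.
pose A := Num.sqrt (Ch * (rho ^+ 3 * q4 rho)).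
have AA0 : 0 <= Ch * (rho ^+ 3 * q4 rho) by rewrite mulr_ge0// mulr_ge0 ?q4_ge0 ?exprn_ge0 ?ltW.
have A2 : A ^+ 2 = Ch * (rho ^+ 3 * q4 rho) by apply: sqr_sqrtr.
have A0 : 0 <= A by exact: sqrtr_ge0.
have hatb lo : c <= lo -> lo + 2 * k <= d -> forall h, (forall w, FT h w = FT (hat lam1 k lo) w) ->
    bsum Lam (fun w => aw c a b d lam1 h w ^+ 2) (A ^+ 2).
  move=> h1 h2 h eh s hs; rewrite A2 -kV; apply: le_trans (hch k lo k0 h1 h2 s hs).
  by apply: ler_sum => w _; rewrite /aw eh.
have i1 : b + 2 * k <= d by lra.
have i2 : c + 2 * k <= a by lra.
have [h1 [k1' [gh1 gk1 det1 eh1 ek1]]] := hat_rows k0 (lexx b) i1 (lexx c) i2.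
have j1 : b <= d - 2 * k by lra.
have j2 : d - 2 * k + 2 * k <= d by lra.
have j3 : c <= a - 2 * k by lra.
have j4 : a - 2 * k + 2 * k <= a by lra.
have [h2 [k2' [gh2 gk2 det2 eh2 ek2]]] := hat_rows k0 j1 j2 j3 j4.
have cb : c <= b by rewrite ltW// (lt_trans hca hab).
have c2d : c + 2 * k <= d by lra.
have cd2 : c <= d - 2 * k by lra.
have a2d : a - 2 * k + 2 * k <= d by rewrite subrK ltW// (lt_trans hab hbd).
have [w1 [q1 s1 id1 b1]] := hW h1 k1' A rho gh1 gk1 r0 A0 (hatb b cb i1 h1 eh1) (hatb c (lexx c) c2d k1' ek1).
have [w2 [q2 s2 id2 _]] := hW h2 k2' A rho gh2 gk2 r0 A0 (hatb _ cd2 j2 h2 eh2) (hatb _ j3 a2d k2' ek2).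
pose F y := FT phi y * (FT (restr b d h1) y * FT (restr c a k1') y - FT (restr c a h1) y * FT (restr b d k1') y).
(* Moving both bumps from the left to the right ends shifts the sum of their positions by
   [L - 4 * k]. *)
have F2 y : ee (y - lam1) (L - 4 * k) * F y = Dl y * FT w2 y.
  rewrite -id2 /F det1 det2.
  have -> : d - 2 * k + (a - 2 * k) = (b + c) + (L - 4 * k) by ring.
  by rewrite (eeDt _ (b + c)); ring.
have sh := supp_shrink k0 kL D1 Dloc q1 s1 q2 s2 id1 F2.
pose w1' := restr 0 (4 * k) w1.
have q1' : sq w1' by exact: sq_restr.
have s1' : supp 0 (4 * k) w1' by exact: supp_restr.
have k40 : 0 <= 4 * k by rewrite mulr_ge0// ltW.
have s1'' : supp 0 L w1' by exact: (supp_sub (lexx 0) kL s1').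
have FTw y : FT w1 y = FT w1' y.
  apply/eqP; rewrite -subr_eq0 -nc_eq0 eq_le nc_ge0 andbT -(FTB y q1 s1 q1' s1'').
  by apply: le_trans (FT_bound y (sqB q1 q1') (suppB s1 s1'')) _; rewrite sh mul0r.
(* The height [rho = 1 / k] of the line matches the spectrum [[0, 4 * k]]: leaving the weighted norm
   costs only [expR 4]. *)
have nw : nL w1' <= expR 4 * (Cw * (k^-1 * q4 k^-1)).
  apply: le_trans (nL_wn k40 (ltW r0) q1' s1') _.
  have -> : rho * (4 * k) = 4 by rewrite mulrCA mulfV ?mulr1// gt_eqF.
  apply: ler_wpM2l; first exact: expR_ge0.
  apply: (@le_trans _ _ (wn rho w1)).
    rewrite /wn; have -> : (fun t => (expR (- rho * t))%:C%C * w1' t) = restr 0 (4 * k) (fun t => (expR (- rho * t))%:C%C * w1 t).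
      by apply/funext => t; rewrite /w1' /restr; ring.
    exact: (nL_restr _ _ (sq_wn rho q1 s1)).
  apply: le_trans b1 _; rewrite A2 kV /Cw le_eqVlt; apply/orP; left; apply/eqP; field.
  by rewrite gt_eqF.
(* Here the additional zero of [FT phi] enters: as [Dl lam1 = 1], it is passed on to the
   quotient. *)
have w1l : FT w1' lam1 = 0.
  by have := id1 lam1; rewrite f1 mul0r D1 mul1r FTw => <-.
have w1z : nc (FT w1' z) <= Cx * Cw / q4 rho.
  have := FT_near lam1 z k40 q1' s1'; rewrite w1l subr0 => h.
  apply: le_trans h _; rewrite -kV.
  exact: (hCx k (nL w1') Cw k0 k1 (nL_ge0 _) Cw0 nw).
have := congr1 (fun y => nc y) (id1 z); rewrite det1 (ncM (FT phi z)) (ncM (ee _ _)) (ncM (Dl z)) FTw -/u ncX => eq1.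
have hr := Bx_ratio k0 uk.
have h4 : (1 / 2) ^+ 4 <= nc (Bx k u / k%:C%C) ^+ 4.
  by apply: lerXn2r; rewrite ?nnegrE ?nc_ge0//; lra.
have h5 : nc (FT phi z) * (e0 * (1 / 2) ^+ 4) <= nc (Dl z) * (Cx * Cw / q4 rho).
  apply: (@le_trans _ _ (nc (Dl z) * nc (FT w1' z))); last by apply: ler_wpM2l; rewrite ?nc_ge0.
  rewrite -eq1 eeDt ncM -/e0; apply: ler_wpM2l; first exact: nc_ge0.
  by apply: ler_wpM2l => //; exact: ltW.
have -> : 16 / e0 * (nc (Dl z) * (Cx * Cw)) / q4 rho = (nc (Dl z) * (Cx * Cw / q4 rho)) / (e0 * (1 / 2) ^+ 4).
  by field; rewrite !gt_eqF ?q4_gt0.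
by rewrite ler_pdivlMr// mulr_gt0// exprn_gt0.
Qed.

End Uniqueness.

(** * Paley-Wiener spaces *)

Section Bridge.
Variable R : realType.
Local Notation mu := (@lebesgue_measure R).
Local Notation T := (measurableTypeR R).
Implicit Types (phi psi : R -> R[i]) (z w : R[i]).

Lemma integral_zero_off (S : set R) (f : R -> R) : (forall t, ~ S t -> f t = 0) -> \int[mu]_(t in S) f t = RI f.
Proof.
move=> h; rewrite Rintegral_mkcond; congr RI; apply/funext => t; rewrite patchE.
by case: ifPn => // /negP; rewrite inE => /h ->.
Qed.

Lemma cintegral_zero_off (S : set R) phi : (forall t, ~ S t -> phi t = 0) -> cintegral S phi = CI phi.
Proof.
move=> h; apply: ceq; rewrite ?Re_CI ?Im_CI /=; apply: integral_zero_off => t /h ->//.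
Qed.

Lemma cintegral_eq (S : set R) phi psi : (forall t, S t -> phi t = psi t) -> cintegral S phi = cintegral S psi.
Proof.
move=> h; apply: ceq => /=; rewrite [LHS]Rintegral_mkcond [RHS]Rintegral_mkcond; congr RI; apply/funext => t;
  rewrite !patchE; by case: ifPn => // /set_mem /h ->.
Qed.

Lemma PW_FT (S : set R) (f : R[i] -> R[i]) : measurable (S : set T) -> PW S f ->
  exists phi, [/\ sq phi, (forall t, ~ S t -> phi t = 0) & forall z, f z = FT phi z].
Proof.
move=> mS [phi0 [h1 h2 h3] hf].
pose phi t := if t \in S then phi0 t else 0.
have phiE t : S t -> phi t = phi0 t by move=> /mem_set h; rewrite /phi h.
have phi_0 t : ~ S t -> phi t = 0 by move=> h; rewrite /phi memNset.
have m (P : R[i] -> R) : P 0 = 0 -> @measurable_fun _ _ T R S (fun t => P (phi0 t)) -> mf (fun t => P (phi t)).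
  move=> P0 hP; have := (measurable_restrictT (fun t => P (phi0 t)) mS).1 hP.
  congr measurable_fun; apply/funext => t; rewrite patchE /phi.
  by case: (t \in S); rewrite ?P0.
have mphi : mcf phi by split; apply: m.
exists phi; split => //.
  split => //; apply: ri_lty; first exact: mf_nc2.
  apply: le_lt_trans h3; rewrite le_eqVlt; apply/orP; left; apply/eqP.
  rewrite [RHS]integral_mkcond; apply: eq_integral => t _.
  rewrite patchE /phi ger0_norm ?sqr_ge0//; case: (t \in S) => //.
  by rewrite nc0 expr0n.
move=> z; rewrite hf /FT -(@cintegral_zero_off S); last by move=> t /phi_0 ->; rewrite mul0r.
by apply: cintegral_eq => t /phiE ->.
Qed.

Lemma FT_PW (S : set R) phi : sq phi -> (forall t, ~ S t -> phi t = 0) -> PW S (FT phi).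
Proof.
move=> [[m1 m2] h] h0; exists phi.
  split; [exact: measurable_funTS m1|exact: measurable_funTS m2|].
  rewrite integral_mkcond; apply: (@le_lt_trans _ _ (RI (fun t => nc (phi t) ^+ 2))%:E); last exact: ltry.
  rewrite (RI_EFin h) le_eqVlt; apply/orP; left; apply/eqP; apply: eq_integral => t _.
  rewrite patchE; case: ifPn => // /negP; rewrite inE => /h0 ->.
  by rewrite nc0 expr0n.
by move=> z; rewrite /FT cintegral_zero_off// => t /h0 ->; rewrite mul0r.
Qed.

Lemma PWnorm_nL (f : R[i] -> R[i]) : PWnorm f = Num.sqrt (2 * pi)^-1 * nL (fun x : R => f x%:C%C).
Proof.
have p0 : 0 <= (2 * pi)^-1 :> R by rewrite invr_ge0 mulr_ge0 ?pi_ge0.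
rewrite /PWnorm /PWdot /nL -sqrtrM//; congr Num.sqrt.
have ReZ (x : R) w : Re (x%:C%C * w) = x * Re w by rewrite ?cE; ring.
rewrite -/(CI _) ReZ Re_CI; congr (_ * RI _).
by apply/funext => x; rewrite mulJc ?cE.
Qed.

Lemma ee_conj z (t : R) : (ee (- z^*%C) t)^*%C = ee z t.
Proof.
have cJ w : (cexp w)^*%C = cexp (w^*%C).
  by apply: ceq; rewrite ?cE ?cosN ?sinN//; ring.
by rewrite /ee cJ; congr cexp; apply: ceq; rewrite ?cE; ring.
Qed.

Lemma en_conj c d z (t : R) : (en c d (- z^*%C) t)^*%C = en c d z t.
Proof.
rewrite /en rmorphM/= -[in RHS]ee_conj; congr (_ * _).
by apply: ceq; rewrite ?cE ?oppr0.
Qed.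

Lemma step_limit_en c d z : c < d -> step_limit c d (en c d z).
Proof.
move=> cd; apply: step_limit_cont => //; [exact: sq_en|exact: supp_en|] => e e0.
pose M := expR (`|Im z| * (`|c| + `|d|)) * (2 * nc z * expR (nc z * (d - c))).
have M0 : 0 <= M by rewrite !mulr_ge0 ?expR_ge0 ?nc_ge0.
have M1 : 0 < M + 1 by rewrite ltr_wpDl.
exists (e / (M + 1)); first exact: divr_gt0.
move=> s t /andP[cs st] td hst.
have std : t - s <= d - c by lra.
have ts0 : 0 <= t - s by lra.
have cst : c <= s <= d by rewrite cs (le_trans st td).
rewrite /en !ind1 ?td ?(le_trans cs st)// !mul1r.
have -> : ee z t - ee z s = - (ee z s * (1 - ee z (t - s))).
  have -> : ee z t = ee z s * ee z (t - s) by rewrite -eeDt addrCA subrr addr0.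
  ring.
rewrite ncN ncM; apply: (@le_trans _ _ (M * (t - s))).
  rewrite /M -mulrA; apply: ler_pM; rewrite ?nc_ge0//.
    by rewrite nc_ee -normrN; exact: expR_bnd.
  apply: le_trans (nc_ee_sub1 _ _) _; rewrite (ger0_norm ts0).
  have -> : 2 * nc z * expR (nc z * (d - c)) * (t - s) = 2 * (nc z * (t - s)) * expR (nc z * (d - c)) by ring.
  apply: ler_wpM2l; first by rewrite !mulr_ge0 ?nc_ge0.
  by rewrite ler_expR; apply: ler_wpM2l; rewrite ?nc_ge0.
apply: (@le_trans _ _ ((M + 1) * (e / (M + 1)))); last by rewrite mulrC divfK ?gt_eqF.
by apply: ler_pM => //; rewrite lerDl.
Qed.

(** The ratio of the Paley-Wiener norm to the norm of the spectral function; classically 1, as the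
    integral [kq R] is [pi]. *)
Definition kap : R := Num.sqrt (2 * pi)^-1 * Num.sqrt (2 * kq R).

Lemma kap_gt0 : 0 < kap.
Proof. by rewrite mulr_gt0// sqrtr_gt0 ?invr_gt0 mulr_gt0 ?pi_gt0 ?kq_gt0. Qed.

Lemma PWnorm_stl c d phi f : step_limit c d phi -> (forall z, f z = FT phi z) -> PWnorm f = kap * nL phi.
Proof.
move=> h e; rewrite PWnorm_nL /kap -mulrA -(Plancherel h).2; congr (_ * nL _).
by apply/funext => x; exact: e.
Qed.

Lemma esum_bsum (Lam : set R[i]) (f : R[i] -> R) B : (forall z, 0 <= f z) -> bsum Lam f B ->
  (\esum_(z in Lam) (f z)%:E < +oo)%E.
Proof.
move=> f0 hB; apply: (@le_lt_trans _ _ B%:E); last exact: ltry.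
apply: ge_ereal_sup => _ [F [finF FL] <-].
rewrite fsbig_finite//= sumEFin lee_fin; apply: hB; split; first exact: finmap.fset_uniq.
by move=> z; rewrite in_fset_set// => /set_mem; exact: FL.
Qed.

(** * The two intervals, the glued interval and their kernels *)

Section gap.
Variables (a b : R).
Hypotheses (ha : - pi < a) (hab : a < b) (hb : b < pi).
Local Notation S := (gapped a b).
Local Notation nE := (nrmE (- pi) a b pi).

Lemma gappedN t : ~ S t <-> Zg (- pi) a b pi t.
Proof.
rewrite /gapped /Zg /=; split.
  by move=> h; apply/andP; split; apply/negP => h'; apply: h; [left|right]; rewrite /= in_itv.
by move=> /andP[/negP h1 /negP h2] [] /=; rewrite in_itv.
Qed.

Lemma measurable_gapped : measurable (S : set T).
Proof. by apply: measurableU; exact: measurable_itv. Qed.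

Lemma kappa_gapped l z : kappa S l z = FT (expE (- pi) a b pi (- l^*%C)) z.
Proof.
rewrite /kappa /FT -(@cintegral_zero_off S); last first.
  by move=> t /gappedN h; rewrite eE_out ?mul0r.
apply: cintegral_eq => t [] /=; rewrite in_itv /= => h.
  by rewrite (@eE_in R (- pi) a b pi hab _ _ h) -eeD addrC.
by rewrite (@eE_in' R (- pi) a b pi hab _ _ h) -eeD addrC.
Qed.

(** The kernel at [l] has spectral function of frequency [- l^*], which is conjugate to the
    exponential of frequency [l] used in [FT]. *)
Lemma nrmE_conj l : nE (- l^*%C) = nE l.
Proof.
have e t : nc (ee (- l^*%C) t) = nc (ee l t) by rewrite -(ee_conj l t) ncJ.
apply: nL_eq => t; rewrite /expE /en.
by rewrite -(mulrDl _ _ (ee (- l^*%C) t)) -(mulrDl _ _ (ee l t)) !(ncM (_ + _)) e.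
Qed.

Lemma PWnorm_kappa l : PWnorm (kappa S l) = kap * nE l.
Proof.
have ap : a < pi by exact: lt_trans hb.
have pb : - pi < b by exact: lt_trans hab.
rewrite -nrmE_conj; apply: (@PWnorm_stl (- pi) pi _ _ _ (kappa_gapped l)).
exact: (step_limitD (step_limit_sub (lexx _) (ltW ap) (step_limit_en _ ha)) (step_limit_sub (ltW pb) (lexx _) (step_limit_en _ hb))).
Qed.

Lemma CIS_of (Lam : set R[i]) : complete_interpolating S Lam -> CIS (- pi) a b pi Lam.
Proof.
move=> hL; have n0 l : 0 < PWnorm (kappa S l) by rewrite PWnorm_kappa mulr_gt0 ?kap_gt0 ?nE_gt0.
have pn0 l : (PWnorm (kappa S l))%:C%C != 0 :> R[i].
  by rewrite -nc_gt0 nc_real normr_gt0 gt_eqF.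
have kn0 : kap%:C%C != 0 :> R[i] by rewrite -nc_gt0 nc_real normr_gt0 gt_eqF ?kap_gt0.
split.
  move=> f B hB.
  (* The data are divided by [kap] because kernels are normalised here by [kap * nE]. *)
  have [|F [[hF hF2] _]] := hL (fun z => f z / kap%:C%C).
    apply: (@esum_bsum _ _ ((kap^-1) ^+ 2 * B)) => [z|s hs]; first exact: sqr_ge0.
    apply: le_trans (ler_wpM2l (sqr_ge0 _) (hB s hs)); rewrite mulr_sumr; apply: ler_sum => z _.
    by rewrite ncM ncV nc_real (gtr0_norm kap_gt0) exprMn mulrC.
  have [phi [qphi phi0 eF]] := PW_FT measurable_gapped hF.
  exists phi; first by split => // t /gappedN; exact: phi0.
  move=> z hz; have := hF2 z hz; rewrite eF => h.
  rewrite -[LHS](mulfVK (pn0 z)) h PWnorm_kappa.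
  have -> : (kap * nE z)%:C%C = kap%:C%C * (nE z)%:C%C :> R[i] by rewrite rmorphM.
  by rewrite mulrA divfK.
move=> phi [qphi phi0] hz.
have pi0 : - pi < pi :> R by exact: lt_trans (lt_trans ha hab) hb.
have gp : gz (Zg (- pi) a b pi) phi by [].
have s0 := gz_supp ha hab hb gp.
apply: (FT_inj qphi s0 pi0) => z.
(* For zero data both [FT phi] and the zero function interpolate, so uniqueness identifies them. *)
have [|F [_ hu]] := hL (fun _ => 0).
  apply: (@esum_bsum _ _ 0) => [w|s hs]; first exact: sqr_ge0.
  by rewrite big1// => w _; rewrite nc0 expr0n.
have e1 : F = FT phi.
  apply: hu; split; first by apply: FT_PW => // t /gappedN; exact: phi0.
  by move=> l hl; rewrite hz// mul0r.
have e2 : F = FT (fun _ => 0).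
  apply: hu; split; first by apply: FT_PW => //; exact: sq0.
  by move=> l hl; rewrite FT0 mul0r.
by rewrite -e1 e2 FT0.
Qed.

Lemma measurable_swapped : measurable (swapped a b : set T).
Proof. exact: measurable_itv. Qed.

Lemma swappedN t : ~ swapped a b t <-> ~~ (- pi + b <= t <= a + pi).
Proof. by rewrite /swapped /= in_itv /=; split => [/negP|/negP]. Qed.

Lemma kappa_swapped l z : kappa (swapped a b) l z = FT (en (- pi + b) (a + pi) (- l^*%C)) z.
Proof.
rewrite /kappa /FT -(@cintegral_zero_off (swapped a b)); last first.
  by move=> t /swappedN h; rewrite supp_en ?mul0r.
apply: cintegral_eq => t; rewrite /swapped /= in_itv /= => h.
by rewrite /en ind1// mul1r -eeD addrC.
Qed.

Lemma uniqueness_swapped (Lam : set R[i]) : CIS (- pi) a b pi Lam -> forall lam1, ~ Lam lam1 ->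
  uniqueness_set (swapped a b) (Lam `|` [set lam1]).
Proof.
move=> hC lam1 nl f hf hz z.
have [phi [qphi phi0 eF]] := PW_FT measurable_swapped hf.
have sphi : supp (- pi + b) (a + pi) phi by move=> t /swappedN; exact: phi0.
(* Translating the spectrum to start at 0 multiplies the transform by an exponential, which has no
   zeros. *)
pose psi t := phi (t + (- pi + b)).
have qpsi : sq psi by exact: sq_shift.
have spsi : supp 0 ((a + pi) - (- pi + b)) psi.
  move=> t ht; apply: sphi; apply: contraNN ht => /andP[h1 h2]; apply/andP; split; lra.
have e w : FT psi w = ee w (- (- pi + b)) * FT phi w by exact: (FT_shift w _ qphi sphi).
have z0 w : Lam w -> FT psi w = 0 by move=> hw; rewrite e -eF hz ?mulr0//; left.
have z1 : FT psi lam1 = 0 by rewrite e -eF hz ?mulr0//; right.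
have := uniqueness_shifted ha hab hb hC nl qpsi spsi z0 z1 z.
by rewrite e => /eqP; rewrite mulf_eq0 (negbTE (ee_neq0 _ _)) eF => /eqP.
Qed.

Lemma minimal_swapped (Lam : set R[i]) : CIS (- pi) a b pi Lam -> forall l0, Lam l0 ->
  minimal (swapped a b) (Lam `\ l0).
Proof.
move=> hC l0 hl0 m [hm /eqP ml0] [_ hspan].
have [C hCb] := minimal_bound ha hab hb hC hm hl0 ml0.
have k0 := kap_gt0.
have C1 : 0 < `|C| + 1 by rewrite ltr_wpDl.
(* With this tolerance the approximation error [nL u] satisfies [C * nL u < 1], against
   [minimal_bound]. *)
have [n [mj [c [hmj hlt]]]] := hspan (kap / (`|C| + 1)) (divr_gt0 k0 C1).
have ab : - pi + b < a + pi by rewrite ltrD.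
pose al : R := - pi + b; pose be : R := a + pi.
pose u t := en al be (- m^*%C) t + \sum_(j < n) (- c j) * en al be (- (mj j)^*%C) t.
have su : step_limit al be u.
  by apply: step_limitD; [exact: step_limit_en|apply: step_limit_sum => j; apply: step_limitZ; exact: step_limit_en].
have e : PWnorm (fun z => kappa (swapped a b) m z - \sum_(j < n) c j * kappa (swapped a b) (mj j) z) = kap * nL u.
  apply: (PWnorm_stl su) => z.
  have q1 := @sq_en R al be; have s1 := @supp_en R al be.
  rewrite (FTD z (q1 _) (s1 _) (sq_sum (index_enum 'I_n) (fun j => sqZ (- c j) (q1 (- (mj j)^*%C))))
     (supp_sum (index_enum 'I_n) (fun j => suppZ (- c j) (s1 (- (mj j)^*%C))))).
  rewrite kappa_swapped; congr (_ + _).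
  rewrite (FT_sum _ z (fun j => sqZ (- c j) (q1 (- (mj j)^*%C))) (fun j => suppZ (- c j) (s1 (- (mj j)^*%C)))).
  rewrite -sumrN; apply: eq_bigr => j _.
  by rewrite (FTZ _ z (q1 _) (s1 _)) kappa_swapped mulNr.
rewrite e in hlt.
(* Conjugation turns the frequencies [- l^*] of the kernels into [l] and preserves the norm; the
   coefficients are conjugated along with it. *)
pose s := [seq (- (c j)^*%C, mj j) | j <- index_enum 'I_n].
have hs p : p \in s -> [/\ Lam p.2, p.2 != m & p.2 != l0].
  move=> /mapP[j _ ->] /=; have [[h1 h2] h3] := hmj j; split => //; exact/eqP.
have := hCb s hs.
have -> : nL (fun t => en al be m t + \sum_(p <- s) p.1 * en al be p.2 t) = nL u.
  rewrite -[RHS]nLJ; congr nL; apply/funext => t.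
  have cJD (x y : R[i]) : (x + y)^*%C = x^*%C + y^*%C by exact: rmorphD.
  have cJM (x y : R[i]) : (x * y)^*%C = x^*%C * y^*%C by exact: rmorphM.
  have cJN (x : R[i]) : (- x)^*%C = - x^*%C by exact: rmorphN.
  have cJS (F : 'I_n -> R[i]) : (\sum_(j < n) F j)^*%C = \sum_(j < n) (F j)^*%C by exact: rmorph_sum.
  rewrite /u cJD en_conj cJS big_map; congr (_ + _); apply: eq_bigr => j _.
  by rewrite cJM cJN en_conj.
move=> h1; have : kap <= kap * (C * nL u) by rewrite ler_peMr// ltW.
apply/negP; rewrite -ltNge.
apply: (@le_lt_trans _ _ (`|C| * (kap * nL u))).
  rewrite mulrCA; apply: ler_wpM2r; last exact: ler_norm.
  by rewrite mulr_ge0 ?nL_ge0 ?ltW.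
apply: (@le_lt_trans _ _ (`|C| * (kap / (`|C| + 1)))).
  by apply: ler_wpM2l => //; exact: ltW.
by rewrite mulrCA gtr_pMr// ltr_pdivrMr// mul1r ltrDl.
Qed.

End gap.
End Bridge.

Theorem theorem2 (R : realType) (a b : R)
  (ha : - pi < a) (hab : a < b) (hb : b < pi)
  (Lam : set R[i]) (hLam : complete_interpolating (gapped a b) Lam) :
  (forall lam1 : R[i], ~ Lam lam1 ->
     uniqueness_set (swapped a b) (Lam `|` [set lam1])) /\
  (forall l0 : R[i], Lam l0 -> minimal (swapped a b) (Lam `\ l0)).
Proof.
have hC := CIS_of ha hab hb hLam.
split; [exact: uniqueness_swapped|exact: minimal_swapped].
Qed.
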